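(* Let $G$ be a planar graph with terminal set $T$ such that $\kappa'(T) \ge k$. Then there is a polynomial-time algorithm that finds at least $\lceil k/5 \rceil - 1$ element-disjoint Steiner trees in $G$. Moreover, in each of these trees, every non-terminal vertex has degree $2$.
   Context: Vertices not in $T$ are non-terminals. For terminals $u,v$, $\kappa'_G(u,v)$ is the maximum number of $u$-$v$ paths pairwise disjoint in edges and non-terminal vertices (they may share terminals), and $\kappa'(T)=\min_{u,v\in T}\kappa'_G(u,v)$. A Steiner tree is a subtree of $G$ containing all of $T$; Steiner trees are element-disjoint if they share no edges and no non-terminal vertices. *)

(* Defs.v *)
From mathcomp Require Import all_boot all_order all_algebra.
From mathcomp Require Import boolp classical_sets set_interval reals topology normedtype.

Set Implicit Arguments.
Unset Strict Implicit.
Unset Printing Implicit Defensive.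

Import numFieldNormedType.Exports.

Record sgraph (V : finType) := SGraph {
  adj :> rel V;
  adj_sym : symmetric adj;
  adj_irr : irreflexive adj
}.

Definition edges (V : finType) (G : sgraph V) : {set {set V}} :=
  [set [set xy.1; xy.2] | xy : V * V & G xy.1 xy.2].

(** Planarity: [pos] places the vertices and, for each edge [A], [arc A]
    restricted to the unit interval is a simple arc joining the two ends of
    [A]; the interior of an arc meets neither a vertex nor another arc.
    Outside [edges G] and outside the unit interval, [arc] is irrelevant. *)

Definition planar (R : realType) (V : finType) (G : sgraph V) : Prop :=
  exists (pos : V -> R * R) (arc : {set V} -> R -> R * R),
  [/\ injective pos,
      forall A, A \in edges G ->
        [/\ {within `[0%R, 1%R], continuous (arc A)}%classic,
            {in `[0%R, 1%R]%R &, injective (arc A)} &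
            exists x y, [/\ A = [set x; y],
                            arc A 0%R = pos x & arc A 1%R = pos y]],
      forall A s z, A \in edges G -> s \in `]0%R, 1%R[%R ->
        arc A s <> pos z &
      forall A B s t, A \in edges G -> B \in edges G -> A != B ->
        s \in `]0%R, 1%R[%R -> t \in `[0%R, 1%R]%R ->
        arc A s <> arc B t].

Section ElementConnectivity.

Variables (V : finType) (G : sgraph V) (T : {set V}).

(** A path from [u] is given by the sequence [p] of its vertices after [u]. *)

Definition upath (u v : V) (p : seq V) : bool :=
  [&& path G u p, last u p == v & uniq (u :: p)].

Definition path_edges (u : V) (p : seq V) : seq {set V} :=
  pairmap (fun x y => [set x; y]) u p.

Definition path_disjoint (u : V) (p q : seq V) : bool :=
  ~~ has (mem (path_edges u p)) (path_edges u q) &&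
  [forall x, (x \in u :: p) && (x \in u :: q) ==> (x \in T)].

Definition disjoint_paths (u v : V) (P : {set #|V|.-bseq V}) : bool :=
  [forall p in P, upath u v p] &&
  [forall p in P, forall q in P, (p != q) ==> path_disjoint u p q].

Definition kappa (u v : V) : nat :=
  \max_(P : {set #|V|.-bseq V} | disjoint_paths u v P) #|P|.

(** The minimum is over pairs of distinct terminals. Since
    [kappa u v <= #|edges G|] whenever [u != v], the default value of the
    iterated [minn] does not affect the result once [T] has two elements. *)

Definition kappaT : nat :=
  \big[minn/#|edges G|]_(uv : V * V |
     [&& uv.1 \in T, uv.2 \in T & uv.1 != uv.2]) kappa uv.1 uv.2.

End ElementConnectivity.

Definition subgraph (V : finType) : Type := {set V} * {set {set V}}.
Definition sub_verts (V : finType) (H : subgraph V) : {set V} := H.1.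
Definition sub_edges (V : finType) (H : subgraph V) : {set {set V}} := H.2.

Section SteinerTrees.

Variables (V : finType) (G : sgraph V) (T : {set V}).

Definition is_subgraph (H : subgraph V) : bool :=
  (sub_edges H \subset edges G) &&
  [forall A in sub_edges H, A \subset sub_verts H].

Definition sub_adj (H : subgraph V) : rel V :=
  fun x y => (x != y) && ([set x; y] \in sub_edges H).

Definition is_connected (H : subgraph V) : Prop :=
  sub_verts H != finset.set0 /\
  {in sub_verts H &, forall x y, connect (sub_adj H) x y}.

Definition is_acyclic (H : subgraph V) : Prop :=
  forall c : seq V, 2 < size c -> ~ ucycle (sub_adj H) c.

Definition steiner_tree (H : subgraph V) : Prop :=
  [/\ is_subgraph H, is_connected H, is_acyclic H & T \subset sub_verts H].

Definition element_disjoint (H K : subgraph V) : bool :=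
  [disjoint sub_edges H & sub_edges K] &&
  (sub_verts H :&: sub_verts K \subset T).

Definition sub_degree (H : subgraph V) (x : V) : nat :=
  #|[set A in sub_edges H | x \in A]|.

End SteinerTrees.

(** Algorithms are random access machines in the sense of Cook and Reckhow
    (Time bounded random access machines, 1973), on natural numbers with
    truncated subtraction. Every instruction takes one step. There is no
    multiplication, so a register after [t] steps holds at most [t] more bits
    than the largest constant or input number, and polynomial time here agrees with
    polynomial time under logarithmic cost or on Turing machines. *)

Inductive instr :=
  | IConst of nat & nat         (* IConst i c : X_i <- c                  *)
  | IAdd of nat & nat & nat     (* IAdd i j l : X_i <- X_j + X_l          *)
  | ISub of nat & nat & nat     (* ISub i j l : X_i <- X_j - X_l          *)
  | ILoad of nat & nat          (* ILoad i j  : X_i <- X_(X_j)            *)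
  | IStore of nat & nat         (* IStore i j : X_(X_i) <- X_j            *)
  | IJump of nat & nat          (* IJump j m  : if X_j > 0 then go to m   *)
  | IRead of nat                (* IRead i    : X_i <- next input number  *)
  | IPrint of nat.              (* IPrint j   : append X_j to the output  *)

Definition program := seq instr.

Record config := Config {
  pc : nat;
  regs : nat -> nat;
  input : seq nat;
  output : seq nat
}.

Definition upd (m : nat -> nat) (i v : nat) : nat -> nat :=
  fun j => if j == i then v else m j.

(** [IRead] yields 0 on an exhausted input. *)

Definition exec_instr (a : instr) (c : config) : config :=
  let: Config l m x y := c in
  match a with
  | IConst i v => Config l.+1 (upd m i v) x y
  | IAdd i j h => Config l.+1 (upd m i (m j + m h)) x y
  | ISub i j h => Config l.+1 (upd m i (m j - m h)) x y
  | ILoad i j => Config l.+1 (upd m i (m (m j))) x y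
  | IStore i j => Config l.+1 (upd m (m i) (m j)) x y
  | IJump j t => Config (if 0 < m j then t else l.+1) m x y
  | IRead i => Config l.+1 (upd m i (head 0 x)) (behead x) y
  | IPrint j => Config l.+1 m x (rcons y (m j))
  end.

(** The machine halts when the program counter leaves the program. *)

Definition step (p : program) (c : config) : option config :=
  omap (exec_instr^~ c) (onth p (pc c)).

Definition init (x : seq nat) : config := Config 0 (fun=> 0) x [::].

Definition computes_in (p : program) (x : seq nat) (t : nat) (y : seq nat) :
    Prop :=
  exists c, [/\ iter t (obind (step p)) (Some (init x)) = Some c,
                step p c = None & output c = y].

Definition encode_set n (S : {set 'I_n}) : seq nat :=
  [seq nat_of_bool (i \in S) | i <- enum 'I_n].

Definition encode_rel n (e : rel 'I_n) : seq nat :=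
  [seq nat_of_bool (e i j) | i <- enum 'I_n, j <- enum 'I_n].

Definition encode_instance n (G : sgraph 'I_n) (T : {set 'I_n}) : seq nat :=
  n :: encode_rel G ++ encode_set T.

Definition encode_subgraph n (H : subgraph 'I_n) : seq nat :=
  encode_set (sub_verts H) ++ encode_rel (sub_adj H).

Definition encode_subgraphs n (F : seq (subgraph 'I_n)) : seq nat :=
  size F :: flatten [seq encode_subgraph H | H <- F].

(* Main.v *)
Require Import Defs.
From mathcomp Require Import all_boot zify.

(** An edge between two non-terminals can be deleted or contracted without
    lowering the element connectivity [k] of [T]. Once there is none left,
    every element (a non-terminal with its incident edges, or an edge between
    two terminals) acts as a hyperedge on [T], and [j] element-disjoint Steiner
    trees amount to a spanning forest of [j] copies of [T] in which every
    element provides at most one edge. This is a matroid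
    intersection problem, and a maximum forest is found by augmenting along
    shortest exchange paths. When no path is left, the labels reached by the
    search split [T] into parts; if the forest does not span, contracting the
    parts yields a minor of the incidence graph of [G] in which few elements
    join parts each of which meets at least [k = 5 * j + 1] of them, so that it
    has a [K5] minor by Mader's bound and [G] is not planar. Planar graphs
    have no [K5] minor by a parity argument on crossings of polygons.

    As every element provides at most one edge, a non-terminal of a tree is an
    inner vertex of a single path, hence has degree 2.

    The algorithm is written in a small language of first-order definable
    updates of relations on the vertices, which compiles to the random access
    machine with a polynomial bound on the running time. *)

Set Implicit Arguments.
Unset Strict Implicit.
Unset Printing Implicit Defensive.

(** Planarity enters only as the absence of a [K5_model] in the incidence graph, the subdivision of
    [G]. There an edge between two terminals is a vertex and can be a branch set of its own. Each
    edge of the subdivision is half an arc, and halves at distinct vertices on distinct edges have a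
    positive distance, so a model yields a polygonal drawing.

    Element connectivity is handled through cuts ([elt_connected]), because cuts can be uncrossed
    and survive deletion and contraction in a controlled way. The given paths serve once, as each of
    them meets every cut; the algorithm tests cuts by maximum flows.

    The algorithm is not given [k]. It tries every [j < n] at connectivity [5 * j + 1] and keeps the
    last success; for [0 < k], the ceiling of [k / 5] minus one is the largest [j] with
    [5 * j + 1 <= k]. If the forest does not span and there are [r] parts, fewer than [j * (r - 1)]
    elements are unreached, while at least [r * (5 * j + 1)] adjacencies join them to the parts: too
    many for a graph without a five-clique minor.

    Shortest exchange paths matter because they have no shortcuts, which is what keeps the exchanged
    edges a forest. *)

Definition connected_in (N : finType) (e : rel N) (B : {set N}) : Prop :=
  B != set0 /\
  {in B &, forall x y, connect [rel u v | [&& u \in B, v \in B & e u v]] x y}.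

Definition K5_model (N : finType) (e : rel N) (B : nat -> {set N}) : Prop :=
  [/\ forall i, i < 5 -> connected_in e (B i),
      forall i j, i < j < 5 -> [disjoint B i & B j] &
      forall i j, i < j < 5 -> exists x y, [/\ x \in B i, y \in B j & e x y]].

Definition incidence (V : finType) (G : sgraph V) : rel (V + {set V})%type := fun u v =>
  match u, v with
  | inl x, inr A | inr A, inl x => (A \in edges G) && (x \in A)
  | _, _ => false
  end.

Lemma incidence_sym (V : finType) (G : sgraph V) : symmetric (incidence G).
Proof. by move=> [x|A] [y|B]. Qed.

Lemma connect_homo (N1 N2 : finType) (e1 : rel N1) (e2 : rel N2) (f : N1 -> N2) x y :
  (forall u v, e1 u v -> connect e2 (f u) (f v)) ->
  connect e1 x y -> connect e2 (f x) (f y).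
Proof.
move=> h /connectP[p + ->]; elim: p x => [|z p IH] x /=; first by rewrite connect0.
by move=> /andP[/h h1 /IH]; exact: connect_trans.
Qed.

(** All truth tables of length [n]: the finite case analyses on five-vertex graphs and on
    orientations of five points are computations over these lists. *)
Fixpoint bitseqs (n : nat) : seq (seq bool) :=
  if n is n'.+1 then map (cons true) (bitseqs n') ++ map (cons false) (bitseqs n')
  else [:: [::]].

Lemma mem_bitseqs (s : seq bool) : s \in bitseqs (size s).
Proof.
elim: s => //= b s IH; rewrite mem_cat; apply/orP.
by case: b; [left|right]; rewrite map_f.
Qed.

(** * Dense graphs have a five-clique minor *)

Section Mader.
Variables (N I : finType) (e : rel N).

Definition minor_model (W : {set I}) (adj : rel I) (beta : I -> {set N}) : Prop :=
  [/\ {in W, forall w, connected_in e (beta w)},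
      {in W &, forall w w', w != w' -> [disjoint beta w & beta w']} &
      {in W &, forall w w', w != w' -> adj w w' ->
         exists x y, [/\ x \in beta w, y \in beta w' & e x y]}].

Lemma connected_in_bigcup (W X : {set I}) adj beta : irreflexive adj -> X \subset W ->
  minor_model W adj beta -> connected_in adj X ->
  connected_in e (\bigcup_(w in X) beta w).
Proof.
move=> irr /subsetP XW [bc bd ba] [/set0Pn[w0 w0X] Xc].
have sub w : w \in X -> beta w \subset \bigcup_(w in X) beta w.
  by move=> wX; apply: bigcup_sup.
split.
  have [/set0Pn[x xw] _] := bc w0 (XW _ w0X).
  by apply/set0Pn; exists x; apply: (subsetP (sub w0 w0X)).
move=> u v /bigcupP[w wX uw] /bigcupP[w' w'X vw'].
set B := \bigcup_(w in X) beta w.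
have lift w1 x y : w1 \in X -> x \in beta w1 -> y \in beta w1 ->
    connect [rel u v | [&& u \in B, v \in B & e u v]] x y.
  move=> w1X xw yw; have [_ /(_ x y xw yw)] := bc w1 (XW _ w1X).
  apply: connect_sub => a b /= /and3P[ha hb hab]; apply: connect1.
  by rewrite /= !(subsetP (sub w1 w1X)).
have /connectP[p pp pl] := Xc w w' wX w'X.
elim: p w u wX uw pp pl => [|z p IH] w u wX uw /=.
  by move=> _ w'w; apply: (lift w) => //; rewrite -w'w.
move=> /andP[/and3P[_ zX wz] pp] pl.
have nwz : w != z by apply: contraTneq wz => ->; rewrite irr.
have [x [y [xw yz xy]]] := ba w z (XW _ wX) (XW _ zX) nwz wz.
apply: (connect_trans (lift w _ _ wX uw xw)).
apply: (connect_trans _ (IH z y zX yz pp pl)).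
by apply: connect1; rewrite /= xy (subsetP (sub w wX))// (subsetP (sub z zX)).
Qed.

(** Minors compose: each vertex of a branch set is blown up to its own branch set. *)
Lemma K5_model_lift (W : {set I}) adj beta (X : nat -> {set I}) :
  irreflexive adj -> minor_model W adj beta -> (forall i, i < 5 -> X i \subset W) ->
  K5_model adj X -> exists B, K5_model e B.
Proof.
move=> irr mm XW [Xc Xd Xa]; exists (fun i => \bigcup_(w in X i) beta w); split.
- by move=> i i5; apply: (connected_in_bigcup irr (XW i i5) mm); apply: Xc.
- case: mm => _ bd _ i j /[dup] ij' /andP[ij j5]; have i5 := ltn_trans ij j5.
  rewrite -setI_eq0; apply/eqP/setP => x; rewrite !inE; apply/negbTE/negP.
  case/andP => /bigcupP[w wi xw] /bigcupP[w' wj xw'].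
  have ww' : w != w'.
    apply/eqP => ww; have := Xd i j ij' => /disjoint_setI0/setP/(_ w).
    by rewrite !inE wi ww wj.
  have := bd w w' (subsetP (XW i i5) _ wi) (subsetP (XW j j5) _ wj) ww'.
  by move=> /disjoint_setI0/setP/(_ x); rewrite !inE xw xw'.
- case: mm => _ _ ba i j /[dup] ij' /andP[ij j5]; have i5 := ltn_trans ij j5.
  have [w [w' [wi wj ww']]] := Xa i j ij'.
  have nww' : w != w' by apply: contraTneq ww' => ->; rewrite irr.
  have [x [y [xw yw xy]]] := ba _ _ (subsetP (XW i i5) _ wi) (subsetP (XW j j5) _ wj) nww' ww'.
  by exists x, y; split=> //; apply/bigcupP; [exists w|exists w'].
Qed.

Definition degree_in (W : {set I}) (adj : rel I) x : nat := \sum_(v in W) adj x v.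
(** For a symmetric relation every edge counts twice, so [6 * #|W| < arcs_in W adj + 6] below means
    more than [3 * (#|W| - 1)] edges. *)
Definition arcs_in (W : {set I}) (adj : rel I) : nat := \sum_(x in W) degree_in W adj x.

Lemma arcs_in_del (W : {set I}) (adj : rel I) x : symmetric adj -> irreflexive adj ->
  x \in W -> arcs_in W adj = arcs_in (W :\ x) adj + 2 * degree_in (W :\ x) adj x.
Proof.
move=> sym irr xW; rewrite /arcs_in (big_setD1 x xW) /=.
have -> : degree_in W adj x = degree_in (W :\ x) adj x.
  by rewrite /degree_in (big_setD1 x xW) /= irr.
have -> : \sum_(u in W :\ x) degree_in W adj u =
    degree_in (W :\ x) adj x + arcs_in (W :\ x) adj.
  rewrite -big_split; apply: eq_bigr => u _; rewrite /degree_in (big_setD1 x xW) /=.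
  by rewrite sym.
by rewrite mul2n -addnn addnA [RHS]addnC.
Qed.

Lemma degree_in_del (W : {set I}) (adj : rel I) x : irreflexive adj ->
  degree_in (W :\ x) adj x = degree_in W adj x.
Proof.
move=> irr; case: (boolP (x \in W)) => xW.
  by rewrite /degree_in [RHS](big_setD1 x xW) /= irr.
by congr degree_in; apply/setP => y; rewrite !inE; case: eqVneq => // ->; rewrite (negPf xW).
Qed.

Lemma arcs_in_eq (W : {set I}) (adj adj' : rel I) :
  {in W &, adj =2 adj'} -> arcs_in W adj = arcs_in W adj'.
Proof.
by move=> h; apply: eq_bigr => x xW; apply: eq_bigr => y yW; rewrite h.
Qed.

Lemma degree_in_card (W : {set I}) (adj : rel I) x :
  degree_in W adj x = #|[set v in W | adj x v]|.
Proof.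
rewrite /degree_in -sum1_card big_mkcond /= [RHS]big_mkcond /=; apply: eq_bigr => v _.
by rewrite inE; case: (v \in W); case: (adj x v).
Qed.

(** Position of the pair [ij] among the ten pairs of five vertices, so that a graph on five vertices
    becomes a truth table of length ten. *)
Definition K4_pos (i j : nat) : nat :=
  index (minn i j, maxn i j) [:: (0, 1); (0, 2); (0, 3); (0, 4); (1, 2); (1, 3); (1, 4); (2, 3); (2, 4); (3, 4)].

(** The complement has maximum degree one, so some [h] sees all the others, and these contain
    disjoint edges [pq] and [rt] such that [r] and [t] each see [p] or [q]. Contracting [pq] then
    leaves a complete graph on four vertices. The existence is checked over all graphs. *)
Lemma dense_five_wheel (a : nat -> nat -> bool) : (forall i j, a i j = a j i) ->
  (forall i, i < 5 -> 2 < \sum_(j <- iota 0 5 | j != i) a i j) ->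
  exists s, [/\ perm_eq s (iota 0 5) & if s is [:: h; p; q; r; t] then
    [&& a h p, a h q, a h r, a h t, a p q, a r t, a p r || a q r & a p t || a q t] else false].
Proof.
move=> asym H.
pose bits := [seq a ij.1 ij.2 | ij <- [:: (0, 1); (0, 2); (0, 3); (0, 4); (1, 2); (1, 3); (1, 4); (2, 3); (2, 4); (3, 4)]].
pose A (b : bitseq) i j := nth false b (K4_pos i j).
pose deg b i := foldr (fun j n => (if j != i then nat_of_bool (A b i j) else 0) + n) 0 (iota 0 5).
pose ok b s := if s is [:: h; p; q; r; t] then
    [&& A b h p, A b h q, A b h r, A b h t, A b p q, A b r t, A b p r || A b q r & A b p t || A b q t] else false.
have tab : all (fun b => all (fun i => 2 < deg b i) (iota 0 5) ==> has (ok b) (permutations (iota 0 5))) (bitseqs 10).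
  by vm_compute.
have AE i j : i < 5 -> j < 5 -> i != j -> A bits i j = a i j.
  have T : all (fun i => all (fun j => (i == j) || (K4_pos i j < 10) && (nth (0, 0)
     [:: (0, 1); (0, 2); (0, 3); (0, 4); (1, 2); (1, 3); (1, 4); (2, 3); (2, 4); (3, 4)] (K4_pos i j)
     \in [:: (i, j); (j, i)])) (iota 0 5)) (iota 0 5) by [].
  move=> i5 j5 ij; have := allP (allP T i _) j; rewrite !mem_iota i5 j5 (negPf ij) orFb.
  move=> /(_ isT isT) /andP[k10 hk]; rewrite /A /bits (nth_map (0, 0))//.
  by move: hk; rewrite !inE => /orP[/eqP->//|/eqP-> /=]; rewrite asym.
have /implyP tb := allP tab bits (mem_bitseqs bits).
have /hasP[s] : has (ok bits) (permutations (iota 0 5)).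
  apply: tb; apply/allP => i; rewrite mem_iota /= add0n => i5; have := H i i5.
  rewrite /deg /= !big_cons big_nil.
  have /orP[/eqP->|] : (i == 0) || (i \in [:: 1; 2; 3; 4]) by move: i5; do 5!case: i => // i.
    by rewrite /= !AE.
  by rewrite !inE => /or4P[]/eqP->; rewrite /= !AE.
rewrite mem_permutations => ps ok_s; exists s; split=> //.
case: s ps ok_s => [|h [|p [|q [|r [|t [|? ?]]]]]] // ps; rewrite /ok.
have us : uniq [:: h; p; q; r; t] by rewrite (perm_uniq ps).
have ms i : i \in [:: h; p; q; r; t] -> i < 5 by rewrite (perm_mem ps) mem_iota.
move: us; rewrite /= !inE !negb_or => /and5P[/and4P[? ? ? ?] /and3P[? ? ?] /andP[? ?] ? _].
by rewrite !AE// ms// !inE eqxx ?orbT.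
Qed.

Lemma connected_in1 (adj : rel I) x : connected_in adj [set x].
Proof.
split; first by apply/set0Pn; exists x; rewrite inE.
by move=> u v; rewrite !inE => /eqP-> /eqP->.
Qed.

Lemma K5_model_sets (adj : rel I) (X : seq {set I}) : symmetric adj -> size X = 5 ->
  {in X, forall S, connected_in adj S} ->
  pairwise (fun S S' : {set I} => [disjoint S & S'] &&
    [exists x in S, exists y in S', adj x y]) X ->
  K5_model adj (nth set0 X).
Proof.
move=> sym sX Xc /(pairwiseP set0) Xp; split.
- by move=> i i5; apply: Xc; rewrite mem_nth// sX.
- move=> i j /andP[ij j5]; have := Xp i j _ _ ij; rewrite !inE sX j5 (ltn_trans ij j5).
  by move=> /(_ isT isT)/andP[].
- move=> i j /andP[ij j5]; have := Xp i j _ _ ij; rewrite !inE sX j5 (ltn_trans ij j5).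
  move=> /(_ isT isT) /andP[_ /existsP[x /andP[xi /existsP[y /andP[yj xy]]]]].
  by exists x, y.
Qed.

(** The vertex [x] is one branch set. Its four or five neighbours induce a graph of minimum degree
    at least three, which is complete or contracts to a complete graph on four vertices by
    [dense_five_wheel]. *)
Lemma dense_neighbourhood_K5 (W : {set I}) (adj : rel I) x :
  symmetric adj -> irreflexive adj -> x \in W -> 3 < degree_in W adj x < 6 ->
  {in W, forall y, adj x y -> 2 < \sum_(v in W) (adj x v && adj y v)} ->
  exists X, K5_model adj X /\ forall i, i < 5 -> X i \subset W.
Proof.
move=> sym irr xW dx common.
pose Nx := [set v in W | adj x v].
have cN : degree_in W adj x = #|Nx| by rewrite degree_in_card.
have memN y : y \in Nx -> [/\ y \in W, adj x y & x != y].
  by rewrite inE => /andP[yW xy]; split=> //; apply: contraTneq xy => ->; rewrite irr.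
have cm y : y \in Nx -> 2 < \sum_(v in Nx) adj y v.
  move=> /memN[yW xy _]; apply: leq_trans (common y yW xy) _.
  rewrite [leqRHS]big_mkcond /= big_mkcond /=; apply: leq_sum => v _; rewrite inE.
  by case: (v \in W); case: (adj x v).
pose s := enum Nx.
have us : uniq s := enum_uniq _.
have sW : {in s, forall y, [/\ y \in W, adj x y & x != y]} by move=> y; rewrite mem_enum; exact: memN.
have cs y : y \in s -> 2 < \sum_(v <- s) adj y v by rewrite mem_enum => /cm; rewrite -big_enum.
have ss : size s = degree_in W adj x by rewrite cN -cardE.
have fin (X : seq {set I}) : size X = 5 -> {in X, forall S, connected_in adj S} ->
  pairwise (fun S S' : {set I} => [disjoint S & S'] &&
    [exists x in S, exists y in S', adj x y]) X -> {in X, forall S : {set I}, S \subset W} ->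
  exists X, K5_model adj X /\ forall i, i < 5 -> X i \subset W.
  move=> sX h1 h2 h3; exists (nth set0 X); split; first exact: K5_model_sets.
  by move=> i i5; apply: h3; rewrite mem_nth ?sX.
have pr (S S' : {set I}) : (exists u v, [/\ u \in S, v \in S' & adj u v]) ->
    [disjoint S & S'] -> [disjoint S & S'] && [exists x in S, exists y in S', adj x y].
  move=> [u [v [uS vS uv]]] ->; apply/existsP; exists u; rewrite uS /=.
  by apply/existsP; exists v; rewrite vS.
have pr1 u v : u != v -> adj u v -> [disjoint [set u] & [set v]] &&
    [exists x in [set u], exists y in [set v], adj x y].
  by move=> uv auv; apply: pr; [exists u, v; rewrite !inE|rewrite disjoints1 inE].
have [s4|s5] : size s = 4 \/ size s = 5 by rewrite ss; lia.
  case: s us sW cs s4 {ss} => [|a [|b [|c [|d [|? ?]]]]] // us sW cs _.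
  have [[aW xa nxa] [bW xb nxb]] : [/\ a \in W, adj x a & x != a] /\ [/\ b \in W, adj x b & x != b].
    by split; apply: sW; rewrite !inE eqxx ?orbT.
  have [[cW xc nxc] [dW xd nxd]] : [/\ c \in W, adj x c & x != c] /\ [/\ d \in W, adj x d & x != d].
    by split; apply: sW; rewrite !inE eqxx ?orbT.
  move: us; rewrite /= !inE !negb_or => /and4P[/and3P[ab ac ad] /andP[bc bd] cd _].
  have [ea eb ec] : [/\ adj a b && adj a c && adj a d, adj b c && adj b d & adj c d].
    have := cs a; have := cs b; have := cs c; rewrite !inE !eqxx ?orbT !big_cons !big_nil !irr.
    move=> /(_ isT) h1 /(_ isT) h2 /(_ isT) h3; move: h1 h2 h3.
    rewrite [adj b a]sym [adj c a]sym [adj c b]sym.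
    by case: (adj a b); case: (adj a c); case: (adj a d); case: (adj b c); case: (adj b d); case: (adj c d).
  case/andP: ea => /andP[eab eac] ead; case/andP: eb => ebc ebd.
  apply: (fin [:: [set x]; [set a]; [set b]; [set c]; [set d]]) => //.
  - by move=> S; rewrite !inE => /orP[|/or4P[]] /eqP->; exact: connected_in1.
  - by rewrite /= !pr1.
  - by move=> S; rewrite !inE => /orP[|/or4P[]] /eqP->; rewrite sub1set.
pose nt := nth x s.
have [] := @dense_five_wheel (fun i j => adj (nt i) (nt j)).
- by move=> i j; rewrite sym.
- move=> i i5; have := cs (nt i); rewrite mem_nth ?s5// => /(_ isT).
  rewrite (big_nth x) s5 /index_iota subn0 (bigID (fun j => j == i)) /=.
  by rewrite big1 ?add0n// => j /eqP->; rewrite -/(nt i) irr.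
move=> q [ps hq]; case: q ps hq => [|h [|p [|q [|r [|t [|? ?]]]]]] // ps.
have uq : uniq [:: h; p; q; r; t] by rewrite (perm_uniq ps).
have ms i : i \in [:: h; p; q; r; t] -> nt i \in s.
  by rewrite (perm_mem ps) mem_iota => i5; rewrite mem_nth ?s5.
have mW i : i \in [:: h; p; q; r; t] -> [/\ nt i \in W, adj x (nt i) & x != nt i].
  by move=> /ms; exact: sW.
have nneq i j : i \in [:: h; p; q; r; t] -> j \in [:: h; p; q; r; t] -> i != j -> nt i != nt j.
  by rewrite !(perm_mem ps) !mem_iota => i5 j5 ij; rewrite /nt nth_uniq ?s5.
have mem5 i : (i \in [:: h; p; q; r; t]) = [|| i == h, i == p, i == q, i == r | i == t].
  by rewrite !inE.
have [[hW xh nxh] [pW xp nxp] [qW xq nxq]] := And3 (mW h ltac:(by rewrite mem5 eqxx))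
  (mW p ltac:(by rewrite mem5 eqxx ?orbT)) (mW q ltac:(by rewrite mem5 eqxx ?orbT)).
have [[rW xr nxr] [tW xt nxt]] := conj (mW r ltac:(by rewrite mem5 eqxx ?orbT))
  (mW t ltac:(by rewrite mem5 eqxx ?orbT)).
move: uq; rewrite /= !inE !negb_or => /and5P[/and4P[hp hq hr ht] /and3P[pq pr' pt] /andP[qr qt] rt _].
have {}nneq i j : i != j -> i \in [:: h; p; q; r; t] -> j \in [:: h; p; q; r; t] -> nt i != nt j.
  by move=> *; exact: nneq.
move=> /and5P[ahp ahq ahr aht] /and4P[apq art apqr apqt].
apply: (fin [:: [set x]; [set nt h]; [set nt p; nt q]; [set nt r]; [set nt t]]) => //.
- move=> S; rewrite !inE => /orP[|/or4P[]] /eqP->; try exact: connected_in1.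
  split; first by apply/set0Pn; exists (nt p); rewrite !inE eqxx.
  have pqc : connect [rel u v | [&& u \in [set nt p; nt q], v \in [set nt p; nt q] & adj u v]] (nt p) (nt q).
    by apply: connect1; rewrite /= !inE !eqxx orbT apq.
  have qpc : connect [rel u v | [&& u \in [set nt p; nt q], v \in [set nt p; nt q] & adj u v]] (nt q) (nt p).
    by apply: connect1; rewrite /= !inE !eqxx orbT sym apq.
  by move=> u v; rewrite !inE => /orP[]/eqP-> /orP[]/eqP->.
- pose Q (S S' : {set I}) := [disjoint S & S'] && [exists x in S, exists y in S', adj x y].
  have in5 i : [|| i == h, i == p, i == q, i == r | i == t] -> i \in [:: h; p; q; r; t] by rewrite mem5.
  have NE i j : i != j -> [|| i == h, i == p, i == q, i == r | i == t] ->
    [|| j == h, j == p, j == q, j == r | j == t] -> nt i != nt j by move=> *; apply: nneq; rewrite ?in5.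
  have e1 : Q [set x] [set nt h] by exact: pr1.
  have e2 : Q [set x] [set nt p; nt q].
    by apply: pr; [exists x, (nt p); rewrite !inE !eqxx|rewrite disjoints1 !inE negb_or nxp].
  have e3 : Q [set x] [set nt r] by exact: pr1.
  have e4 : Q [set x] [set nt t] by exact: pr1.
  have e5 : Q [set nt h] [set nt p; nt q].
    apply: pr; [by exists (nt h), (nt p); rewrite !inE !eqxx|].
    by rewrite disjoints1 !inE negb_or !NE// eqxx ?orbT.
  have e6 : Q [set nt h] [set nt r] by apply: pr1 => //; rewrite NE// eqxx ?orbT.
  have e7 : Q [set nt h] [set nt t] by apply: pr1 => //; rewrite NE// eqxx ?orbT.
  have e8 : Q [set nt p; nt q] [set nt r].
    apply: pr; last first.
      by rewrite disjoint_sym disjoints1 !inE negb_or ![nt r == _]eq_sym !NE// eqxx ?orbT.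
    by case/orP: apqr => ?; [exists (nt p), (nt r)|exists (nt q), (nt r)]; rewrite !inE !eqxx ?orbT.
  have e9 : Q [set nt p; nt q] [set nt t].
    apply: pr; last first.
      by rewrite disjoint_sym disjoints1 !inE negb_or ![nt t == _]eq_sym !NE// eqxx ?orbT.
    by case/orP: apqt => ?; [exists (nt p), (nt t)|exists (nt q), (nt t)]; rewrite !inE !eqxx ?orbT.
  have e10 : Q [set nt r] [set nt t] by apply: pr1 => //; rewrite NE// eqxx ?orbT.
  by rewrite -/Q /= e1 e2 e3 e4 e5 e6 e7 e8 e9 e10.
- move=> S; rewrite !inE => /orP[|/or4P[]] /eqP->; rewrite ?sub1set//.
  by apply/subsetP => u; rewrite !inE => /orP[]/eqP->.
Qed.

(** Excess edges are dropped until exactly [3 * #|W| - 2] remain; then some degree is below six.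
    Deleting a vertex of degree at most three, or contracting an edge whose ends have at most two
    common neighbours, loses at most three edges and keeps the bound. Otherwise a vertex of degree
    four or five has the dense neighbourhood of the previous lemma. *)
Theorem dense_minor_K5 (W : {set I}) (adj : rel I) beta :
  symmetric adj -> irreflexive adj -> minor_model W adj beta -> W != set0 ->
  6 * #|W| < arcs_in W adj + 6 -> exists B, K5_model e B.
Proof.
have [m] := ubnP (#|W| + arcs_in W adj).
elim: m W adj beta => // m IH W adj beta hm sym irr mm W0 dense.
have [bc bd ba] := mm.
have [big|small] := ltnP (6 * #|W| + 2) (arcs_in W adj + 6).
  have [x xW] := set0Pn _ W0.
  have /exists_inP[u uW /exists_inP[v vW uv]] : [exists u in W, exists v in W, adj u v].
    apply: contraT => /exists_inPn noadj; move: dense; rewrite /arcs_in big1 => [|u uW].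
      have : 0 < #|W| by rewrite card_gt0.
      by lia.
    rewrite /degree_in big1// => v vW; apply/eqP; rewrite eqb0.
    by have /exists_inPn/(_ v vW) := noadj u uW.
  have nuv : u != v by apply: contraTneq uv => ->; rewrite irr.
  pose adj' := [rel a b | adj a b && ~~ (((a, b) == (u, v)) || ((a, b) == (v, u)))].
  have sym' : symmetric adj'.
    move=> a b; rewrite /adj' /= sym !xpair_eqE orbC.
    by rewrite [(b == u) && _]andbC [(b == v) && _]andbC.
  have irr' : irreflexive adj' by move=> a; rewrite /adj' /= irr.
  have cnt : arcs_in W adj = arcs_in W adj' + 2.
    rewrite (arcs_in_del sym irr uW) (arcs_in_del sym' irr' uW).
    have -> : arcs_in (W :\ u) adj' = arcs_in (W :\ u) adj.
      apply: arcs_in_eq => a b; rewrite !inE => /andP[au _] /andP[bu _].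
      by rewrite /adj' /= !xpair_eqE (negPf au) (negPf bu) andbF andbT.
    have vWu : v \in W :\ u by rewrite !inE eq_sym nuv.
    rewrite /degree_in (big_setD1 v vWu) [X in _ = _ + _ * X + _](big_setD1 v vWu) /=.
    rewrite uv !eqxx /= add0n.
    have -> : \sum_(i in (W :\ u) :\ v) adj' u i = \sum_(i in (W :\ u) :\ v) adj u i.
      apply: eq_bigr => b; rewrite !inE => /and3P[bv bu _]; rewrite /adj' /=.
      by rewrite !xpair_eqE eqxx (negPf bv) (negPf nuv) andbT.
    by rewrite mulnDr muln1 -addnA [2 + _]addnC.
  apply: (IH W adj' beta) => //; [lia| |lia].
  by split=> // w w' wW w'W ww' /andP[+ _]; exact: ba.
have [x xW dx] : exists2 x, x \in W & degree_in W adj x < 6.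
  apply/exists_inP; apply: contraT => /exists_inPn all6.
  have : 6 * #|W| <= arcs_in W adj.
    rewrite mulnC -sum_nat_const; apply: leq_sum => y yW.
    by have := all6 y yW; rewrite -leqNgt.
  by lia.
have cW : #|W| = #|W :\ x|.+1 by rewrite (cardsD1 x) xW.
have [d3|d4] := leqP (degree_in W adj x) 3.
  have cnt := arcs_in_del sym irr xW; rewrite degree_in_del// in cnt.
  have W' : W :\ x != set0.
    apply/eqP => W'; move: cnt dense; rewrite cW W' cards0.
    have -> : arcs_in set0 adj = 0 by rewrite /arcs_in big_set0.
    have -> : degree_in W adj x = 0.
      by rewrite -degree_in_del// W' /degree_in big_set0.
    by lia.
  apply: (IH (W :\ x) adj beta) => //; [lia| |lia].
  split; first by move=> w; rewrite inE => /andP[_]; exact: bc.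
    by move=> w w'; rewrite !inE => /andP[_ ?] /andP[_ ?]; exact: bd.
  by move=> w w'; rewrite !inE => /andP[_ ?] /andP[_ ?]; exact: ba.
have [/exists_inP[y yW /andP[xy com]]|/exists_inPn allc] :=
    boolP [exists y in W, adj x y && (\sum_(v in W) (adj x v && adj y v) <= 2)]; last first.
  have [X [KX XW]] : exists X, K5_model adj X /\ forall i, i < 5 -> X i \subset W.
    apply: (dense_neighbourhood_K5 sym irr xW); first by rewrite d4.
    by move=> y yW xy; have := allc y yW; rewrite xy /= -ltnNge.
  exact: (K5_model_lift irr mm XW KX).
have nxy : x != y by apply: contraTneq xy => ->; rewrite irr.
pose beta' w := if w == x then beta x :|: beta y else beta w.
pose adj' := [rel a b | (a != b) && [|| adj a b, (a == x) && adj y b | (b == x) && adj y a]].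
have sym' : symmetric adj'.
  by move=> a b; rewrite /adj' /= eq_sym sym [((b == x) && _) || _]orbC.
have irr' : irreflexive adj' by move=> a; rewrite /adj' /= eqxx.
have xW' : x \in W :\ y by rewrite !inE nxy.
have cW' : #|W| = #|W :\ y|.+1 by rewrite (cardsD1 y) yW.
(* The contraction loses [xy] and one edge for each common neighbour, hence at most six arcs. The
   first inequality serves the measure of the induction, the second the density. *)
have cnt : arcs_in (W :\ y) adj' <= arcs_in W adj <= arcs_in (W :\ y) adj' + 6.
  rewrite (arcs_in_del sym irr yW) (arcs_in_del sym irr xW') (arcs_in_del sym' irr' xW').
  have -> : arcs_in (W :\ y :\ x) adj' = arcs_in (W :\ y :\ x) adj.
    apply: arcs_in_eq => a b; rewrite !inE => /and3P[ax _ _] /and3P[bx _ _].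
    by rewrite /adj' /= (negPf ax) (negPf bx) !orbF; case: eqVneq => // ->; rewrite irr.
  have -> : degree_in (W :\ y) adj y = (degree_in (W :\ y :\ x) adj y).+1.
    by rewrite /degree_in (big_setD1 x xW') /= sym xy.
  have -> : degree_in (W :\ y :\ x) adj' x = \sum_(v in W :\ y :\ x) (adj x v || adj y v).
    apply: eq_bigr => v; rewrite !inE => /and3P[vx _ _].
    by rewrite /adj' /= eq_sym vx eqxx (negPf vx) orbF.
  have : degree_in (W :\ y :\ x) adj x + degree_in (W :\ y :\ x) adj y =
      \sum_(v in W :\ y :\ x) (adj x v || adj y v) + \sum_(v in W :\ y :\ x) (adj x v && adj y v).
    rewrite /degree_in -!big_split; apply: eq_bigr => v _ /=.
    by case: (adj x v); case: (adj y v).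
  have : \sum_(v in W :\ y :\ x) (adj x v && adj y v) <= 2.
    by move: com; rewrite (big_setD1 y yW) /= irr andbF add0n (big_setD1 x xW') /= irr add0n.
  by lia.
have bx' : beta' x = beta x :|: beta y by rewrite /beta' eqxx.
have bE w : w != x -> beta' w = beta w by rewrite /beta' => /negPf->.
apply: (IH (W :\ y) adj' beta') => //; [lia| | by apply/set0Pn; exists x|lia].
split.
- move=> w; rewrite !inE => /andP[wy wW]; case: (eqVneq w x) => [->|wx]; last by rewrite bE//; exact: bc.
  rewrite bx'.
  have -> : beta x :|: beta y = \bigcup_(w in [set x; y]) beta w.
    by rewrite bigcup_setU !big_set1.
  apply: (connected_in_bigcup irr _ mm); first by apply/subsetP => u; rewrite !inE => /orP[]/eqP->.
  split; first by apply/set0Pn; exists x; rewrite !inE eqxx.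
  have c1 : connect [rel u v | [&& u \in [set x; y], v \in [set x; y] & adj u v]] x y.
    by apply: connect1; rewrite /= !inE !eqxx orbT xy.
  have c2 : connect [rel u v | [&& u \in [set x; y], v \in [set x; y] & adj u v]] y x.
    by apply: connect1; rewrite /= !inE !eqxx orbT sym xy.
  by move=> u v; rewrite !inE => /orP[]/eqP-> /orP[]/eqP->.
- move=> w w'; rewrite !inE => /andP[wy wW] /andP[w'y w'W] ww'.
  have dU u : u \in W -> u != x -> u != y -> [disjoint beta x :|: beta y & beta u].
    move=> uW ux uy; rewrite disjoints_subset subUset -!disjoints_subset.
    by rewrite !bd// eq_sym.
  case: (eqVneq w x) => [wx|wx].
    have w'x : w' != x by rewrite -wx eq_sym.
    by rewrite wx bx' (bE _ w'x) dU.
  rewrite (bE w)//; case: (eqVneq w' x) => [->|w'x]; last by rewrite bE// bd.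
  by rewrite bx' disjoint_sym dU.
- have sub u : u \in W -> u != y -> beta u \subset beta' u.
    by move=> _ uy; rewrite /beta'; case: eqP => // ->; exact: subsetUl.
  have base w w' : w \in W -> w' \in W -> w != y -> w' != y -> w != w' -> adj w w' ->
      exists x0 y0, [/\ x0 \in beta' w, y0 \in beta' w' & e x0 y0].
    move=> wW w'W wy w'y ww' aww'; have [a [b [aw bw ab]]] := ba _ _ wW w'W ww' aww'.
    by exists a, b; split=> //; [apply: (subsetP (sub w wW wy))|apply: (subsetP (sub w' w'W w'y))].
  move=> w w'; rewrite !inE => /andP[wy wW] /andP[w'y w'W] ww' /andP[_ /or3P[]].
  + exact: base.
  + move=> /andP[/eqP wx ayw']; rewrite wx in ww' *.
    have [a [b [aw bw ab]]] := ba y w' yW w'W ltac:(by rewrite eq_sym) ayw'.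
    exists a, b; split=> //; first by rewrite bx' inE aw orbT.
    by rewrite bE// eq_sym.
  + move=> /andP[/eqP wx ayw]; rewrite wx in ww' *.
    have [a [b [aw bw ab]]] := ba w y wW yW wy ltac:(by rewrite sym).
    exists a, b; split=> //; first by rewrite bE.
    by rewrite bx' inE bw orbT.
Qed.
End Mader.

(** * Element connectivity under deletion and contraction *)

Section ElementCuts.
Variables (V : finType) (T : {set V}).
Implicit Types (E : rel V) (A B C D : {set V}).

Definition separates (A B : {set V}) : bool :=
  [&& [disjoint A & B], T \subset A :|: B, T :&: A != set0 & T :&: B != set0].

(* The vertices outside [A :|: B] are the deleted non-terminals. *)
Definition cut_size (E : rel V) (A B : {set V}) : nat :=
  \sum_v ((v \notin A) && (v \notin B)) +
  \sum_(xy : V * V) [&& xy.1 \in A, xy.2 \in B & E xy.1 xy.2].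

Definition elt_connected (E : rel V) (k : nat) : bool :=
  [forall A : {set V}, forall B : {set V}, separates A B ==> (k <= cut_size E A B)].

Lemma elt_connectedP E k :
  reflect (forall A B, separates A B -> k <= cut_size E A B) (elt_connected E k).
Proof.
apply: (iffP forallP) => [h A B sAB|h A]; first by have /forallP/(_ B)/implyP := h A; apply.
by apply/forallP => B; apply/implyP; exact: h.
Qed.

Lemma elt_connectedPn E k : ~~ elt_connected E k ->
  exists A B, separates A B /\ cut_size E A B < k.
Proof.
rewrite negb_forall => /existsP[A]; rewrite negb_forall => /existsP[B].
by rewrite negb_imply -ltnNge => /andP[? ?]; exists A, B.
Qed.

Lemma elt_connected_leq E k k' : k' <= k -> elt_connected E k -> elt_connected E k'.
Proof.
by move=> kk' /elt_connectedP h; apply/elt_connectedP => A B /h; exact: leq_trans.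
Qed.

Lemma separatesC A B : separates A B = separates B A.
Proof. by rewrite /separates disjoint_sym setUC; do !bool_congr. Qed.

Lemma cut_sizeC E A B : symmetric E -> cut_size E A B = cut_size E B A.
Proof.
move=> sym; congr (_ + _); first by apply: eq_bigr => v _; rewrite andbC.
rewrite (reindex_inj (inv_inj (fun xy : V * V => let: (x, y) := xy in erefl : (fun xy => (xy.2, xy.1)) ((fun xy => (xy.2, xy.1)) (x, y)) = (x, y)))) /=.
by apply: eq_bigr => -[x y] _ /=; rewrite sym andbCA.
Qed.

Lemma sum_delta (U : finType) (c : U) : \sum_u (u == c : nat) = 1.
Proof. by rewrite (bigD1 c)//= eqxx big1// => u /negPf->. Qed.

Lemma separates_in A B x : separates A B -> x \in T -> (x \in A) = (x \notin B).
Proof.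
case/and4P => /disjoint_setI0/setP/(_ x) + /subsetP/(_ x) + _ _.
by rewrite !inE => h1 h2 xT; have := h2 xT; move: h1; case: (x \in A); case: (x \in B).
Qed.

Definition delete_edge (E : rel V) p q : rel V :=
  [rel x y | E x y && ~~ ((x == p) && (y == q) || (x == q) && (y == p))].

(** The merged vertex keeps the name [p], and [q] remains as an isolated vertex, so that the vertex
    type never changes. *)
Definition contract_edge (E : rel V) p q : rel V :=
  [rel x y | [&& x != y, x != q, y != q &
     [|| E x y, (x == p) && E q y | (y == p) && E x q]]].

Lemma delete_edge_sym E p q : symmetric E -> symmetric (delete_edge E p q).
Proof.
move=> sym x y; rewrite /delete_edge /= sym orbC.
by rewrite [(x == q) && _]andbC [(x == p) && _]andbC.
Qed.

Lemma contract_edge_sym E p q : symmetric E -> symmetric (contract_edge E p q).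
Proof.
move=> sym x y; rewrite /contract_edge /= (eq_sym y x) (sym y x) (sym y q) (sym q x).
by case: (x == y); case: (x == q); case: (y == q); case: (E x y); case: (x == p);
  case: (y == p); case: (E q y); case: (E x q).
Qed.

(** Both terms of [cut_size] are submodular. The extra one comes from [pq], which crosses from [A]
    to [B]: as [p] is not in [C] and [q] is not in [D], neither of the two new cuts counts it. *)
Lemma cut_size_uncross E A B C D p q :
  [disjoint A & B] -> [disjoint C & D] -> E p q -> p \in A -> q \in B ->
  p \notin C -> p \notin D -> q \notin C -> q \notin D ->
  (cut_size E (A :&: C) (B :|: D) + cut_size E (A :|: C) (B :&: D)).+1 <=
  cut_size E A B + cut_size E C D.
Proof.
move=> /disjoint_setI0/setP AB /disjoint_setI0/setP CD Epq pA qB pC pD qC qD.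
have {}AB x : ~~ ((x \in A) && (x \in B)) by have := AB x; rewrite !inE => ->.
have {}CD x : ~~ ((x \in C) && (x \in D)) by have := CD x; rewrite !inE => ->.
rewrite /cut_size.
have : \sum_v ((v \notin A :&: C) && (v \notin B :|: D)) +
       \sum_v ((v \notin A :|: C) && (v \notin B :&: D)) =
       \sum_v ((v \notin A) && (v \notin B)) + \sum_v ((v \notin C) && (v \notin D)).
  rewrite -!big_split; apply: eq_bigr => v _ /=; rewrite !inE.
  by have := AB v; have := CD v; case: (v \in A); case: (v \in B); case: (v \in C); case: (v \in D).
have : \sum_(xy : V * V) [&& xy.1 \in A :&: C, xy.2 \in B :|: D & E xy.1 xy.2] +
   \sum_(xy : V * V) [&& xy.1 \in A :|: C, xy.2 \in B :&: D & E xy.1 xy.2] +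
   \sum_(xy : V * V) (xy == (p, q)) <=
   \sum_(xy : V * V) [&& xy.1 \in A, xy.2 \in B & E xy.1 xy.2] +
   \sum_(xy : V * V) [&& xy.1 \in C, xy.2 \in D & E xy.1 xy.2].
  rewrite -!big_split; apply: leq_sum => -[x y] _ /=; rewrite !inE.
  case: ((x, y) =P (p, q)) => [[-> ->]|_].
    by rewrite pA qB (negPf pC) (negPf qD) Epq.
  by case: (x \in A); case: (x \in C); case: (y \in B); case: (y \in D); case: (E x y).
by rewrite sum_delta; lia.
Qed.

Lemma separates_setD1 A B q : q \notin T -> separates A B -> separates (A :\ q) (B :\ q).
Proof.
move=> qT /and4P[d c a b]; have nq x : x \in T -> x != q by apply: contraTneq => ->.
apply/and4P; split.
- by apply: disjointWl (subsetDl _ _) _; apply: disjointWr (subsetDl _ _) d.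
- by apply/subsetP => x xT; have := subsetP c x xT; rewrite !inE nq.
- by case/set0Pn: a => x; rewrite inE => /andP[xT xA]; apply/set0Pn; exists x; rewrite !inE xT nq.
- by case/set0Pn: b => x; rewrite inE => /andP[xT xA]; apply/set0Pn; exists x; rewrite !inE xT nq.
Qed.

(** A cut of the contracted graph pulls back to one that deletes both [p] and [q], at an extra cost
    of at most one. If [p] was deleted, [q] is deleted too; if [p] has an edge to the other side,
    deleting both saves that edge. In the remaining case [q] could join the side of [p] for free,
    against the connectivity of [E]. *)
Lemma contracted_cut_lift E p q k A B : symmetric E -> p \notin T -> q \notin T ->
  p != q -> elt_connected E k -> separates A B ->
  cut_size (contract_edge E p q) A B < k ->
  exists C D, [/\ separates C D, cut_size E C D <= k,
    p \notin C, p \notin D & (q \notin C) && (q \notin D)].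
Proof.
move=> sym pT qT npq /elt_connectedP conn; wlog pB : A B / p \notin B => [hw|].
  case: (boolP (p \in B)) => [pB sAB cAB|]; last exact: hw.
  have pA : p \notin A by case/and4P: sAB => /disjoint_setI0/setP/(_ p); rewrite !inE pB andbT => ->.
  apply: (hw B A pA); first by rewrite separatesC.
  by rewrite cut_sizeC//; exact: contract_edge_sym.
move=> sAB; set E' := contract_edge E p q => cAB.
have dAB x : x \in A -> x \notin B.
  by case/and4P: sAB => /disjoint_setI0/setP/(_ x) + _ _ _; rewrite !inE => + xA; rewrite xA /= => ->.
have E'E x y : E x y -> x != y -> x != q -> y != q -> E' x y.
  by move=> xy nxy xq yq; rewrite /E' /contract_edge /= nxy xq yq xy.
have Enn x y : x \in A -> y \in B -> x != y by move=> /dAB xB yB; apply: contraNneq xB => ->.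
pose C := A :\ p :\ q; pose D := B :\ q.
have sCD : separates C D.
  apply: separates_setD1 => //.
  have -> : B = B :\ p by apply/setP => x; rewrite !inE; case: eqP pB => // -> /negPf.
  exact: separates_setD1.
have [pA|pA] := boolP (p \in A); last first.
  exists C, D; split=> //; rewrite ?inE ?eqxx ?(negPf pA) ?(negPf pB) ?andbF//.
  have := cAB; rewrite -ltnS -addn1 /cut_size.
  have : \sum_v ((v \notin C) && (v \notin D)) <=
         \sum_v ((v \notin A) && (v \notin B)) + \sum_v (v == q).
    rewrite -big_split; apply: leq_sum => v _; rewrite !inE.
    case: (eqVneq v q) => [_|vq] /=; first by rewrite addn1.
    by rewrite addn0; case: (eqVneq v p) => [->|_] //=; rewrite pA pB.
  have : \sum_(xy : V * V) [&& xy.1 \in C, xy.2 \in D & E xy.1 xy.2] <=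
         \sum_(xy : V * V) [&& xy.1 \in A, xy.2 \in B & E' xy.1 xy.2].
    apply: leq_sum => -[x y] _; rewrite !inE /=.
    case: andP => //= -[/and3P[xq _ xA] /andP[/andP[yq yB] xy]].
    by rewrite xA yB (E'E _ _ xy (Enn _ _ xA yB) xq yq).
  by rewrite sum_delta; lia.
have [/existsP[y /andP[yB py]]|/existsPn nop] := boolP [exists y, (y \in B) && E' p y].
  exists C, D; split=> //; rewrite ?inE ?eqxx ?(negPf pB) ?andbF//.
  have : \sum_v ((v \notin C) && (v \notin D)) <=
         \sum_v ((v \notin A) && (v \notin B)) + \sum_v (v == q) + \sum_v (v == p).
    rewrite -!big_split; apply: leq_sum => v _; rewrite !inE.
    case: (eqVneq v q) => [_|vq] /=; first by rewrite addn1.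
    by case: (eqVneq v p) => [_|_] /=; case: (v \in A); case: (v \in B).
  have : \sum_(xy : V * V) [&& xy.1 \in C, xy.2 \in D & E xy.1 xy.2] +
         \sum_(xy : V * V) (xy == (p, y)) <=
         \sum_(xy : V * V) [&& xy.1 \in A, xy.2 \in B & E' xy.1 xy.2].
    rewrite -!big_split; apply: leq_sum => -[x z] _; rewrite !inE /=.
    case: ((x, z) =P (p, y)) => [[-> ->]|_]; first by rewrite eqxx andbF /= pA yB py.
    rewrite addn0.
    case: andP => //= -[/and3P[xq _ xA] /andP[/andP[yq zB] xy]].
    by rewrite xA zB (E'E _ _ xy (Enn _ _ xA zB) xq yq).
  by move: cAB; rewrite /cut_size !sum_delta; lia.
(* No edge of the contracted graph leads from [p] to [B], so [q] has no neighbour in [D] either and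
   joining it to [A] adds no crossing edge. *)
have sq : separates (q |: A) D.
  have -> : q |: A = q |: (A :\ q) by apply/setP => x; rewrite !inE; case: eqP.
  case/and4P: (separates_setD1 qT sAB) => d c a b; apply/and4P; split=> //.
  - rewrite disjoints_subset subUset -!disjoints_subset d andbT disjoints1.
    by rewrite !inE eqxx.
  - by apply: subset_trans c _; apply: setSU; exact: subsetUr.
  - case/set0Pn: a => x; rewrite inE => /andP[xT xA]; apply/set0Pn; exists x.
    by rewrite inE xT inE xA orbT.
have := conn _ _ sq; rewrite leqNgt => /negP[]; apply: leq_ltn_trans cAB; rewrite /cut_size.
apply: leq_add.
  apply: leq_sum => v _; rewrite !inE; case: (eqVneq v q) => //= vq.
apply: leq_sum => -[x y] _; rewrite !inE /=.
case: andP => //= -[xA /andP[/andP[yq yB] xy]].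
have nE y' : y' \in B -> E' p y' = false by move=> h; have := nop y'; rewrite h /= => /negbTE.
have py : p != y by apply: contraNneq pB => ->.
have yp := nE y yB.
case/predU1P: xA => [xq|xA].
  by move: yp; rewrite /E' /contract_edge /= py npq yq eqxx -xq xy orbT.
case: (eqVneq x q) => [xq|xq].
  by move: yp; rewrite /E' /contract_edge /= py npq yq eqxx -xq xy orbT.
by rewrite xA yB (E'E _ _ xy (Enn _ _ xA yB) xq yq).
Qed.

(** If both operations failed, there would be a cut with [p] and [q] on opposite sides and a cut
    that deletes both, each of size at most [k] in [E]. Uncrossing them gives two separations of [T]
    of total size below [2 * k]. *)
Theorem delete_or_contract E p q k : symmetric E -> p \notin T -> q \notin T ->
  p != q -> E p q -> elt_connected E k -> ~~ elt_connected (delete_edge E p q) k ->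
  elt_connected (contract_edge E p q) k.
Proof.
move=> sym pT qT npq Epq conn /elt_connectedPn[A [B [sAB cAB]]].
apply: contraT => /elt_connectedPn[A' [B' [sAB' cAB']]].
have [C [D [sCD cCD pC pD /andP[qC qD]]]] := contracted_cut_lift sym pT qT npq conn sAB' cAB'.
(* Restoring [pq] must lift the cut from below [k] to [k], so its ends lie on opposite sides and the
   cut has size at most [k]. *)
have [{}A [{}B [{}sAB {}cAB pA qB]]] : exists A B, [/\ separates A B, cut_size E A B <= k, p \in A & q \in B].
  have kAB := elt_connectedP _ _ conn _ _ sAB.
  have same : cut_size E A B <= cut_size (delete_edge E p q) A B + ((p \in A) && (q \in B)) +
     ((q \in A) && (p \in B)).
    rewrite /cut_size -!addnA leq_add2l.
    have -> : ((p \in A) && (q \in B) : nat) = \sum_(xy : V * V) [&& xy == (p, q), xy.1 \in A & xy.2 \in B].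
      by rewrite (bigD1 (p, q))//= eqxx big1 ?addn0// => xy /negPf->.
    have -> : ((q \in A) && (p \in B) : nat) = \sum_(xy : V * V) [&& xy == (q, p), xy.1 \in A & xy.2 \in B].
      by rewrite (bigD1 (q, p))//= eqxx big1 ?addn0// => xy /negPf->.
    rewrite -!big_split; apply: leq_sum => -[x y] _; rewrite /delete_edge /= !xpair_eqE.
    by case: (x \in A); case: (y \in B); case: (E x y); case: (x == p); case: (y == q);
      case: (x == q); case: (y == p).
  have [/andP[pA qB]|n1] := boolP ((p \in A) && (q \in B)).
    exists A, B; split=> //; apply: (leq_trans same); rewrite pA qB.
    case/and4P: sAB => /disjoint_setI0/setP/(_ p); rewrite !inE pA /= => -> _ _ _.
    by rewrite andbF addn0 addn1.
  have [/andP[qA pB]|n2] := boolP ((q \in A) && (p \in B)).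
    exists B, A; split=> //; first by rewrite separatesC.
    by rewrite cut_sizeC//; apply: (leq_trans same); rewrite (negPf n1) qA pB addn0 addn1.
  move: same; rewrite (negPf n1) (negPf n2) !addn0 => same.
  by have := leq_ltn_trans (leq_trans kAB same) cAB; rewrite ltnn.
have dAB : [disjoint A & B] by case/and4P: sAB.
(* Up to exchanging [C] and [D]: if [A :&: C] has no terminal, the terminals of [A] lie in [D] and
   those of [C] in [B]; likewise for [B :&: D]. *)
wlog [tAC tBD] : C D sCD cCD pC pD qC qD / T :&: (A :&: C) != set0 /\ T :&: (B :&: D) != set0.
  move=> hw.
  have [h1|h1] := boolP ((T :&: (A :&: C) != set0) && (T :&: (B :&: D) != set0)).
    by apply: (hw C D) => //; exact/andP.
  apply: (hw D C) => //; rewrite 1?separatesC 1?cut_sizeC//.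
  have inT := separates_in sAB; have inT' := separates_in sCD.
  case/and4P: (sAB) => _ _ /set0Pn[a] + /set0Pn[b]; rewrite !inE => /andP[aT aA] /andP[bT bB].
  case/and4P: (sCD) => _ _ /set0Pn[c] + /set0Pn[d]; rewrite !inE => /andP[cT cC] /andP[dT dD].
  have none (S : {set V}) x : S = set0 -> x \in S -> False by move=> ->; rewrite inE.
  rewrite negb_and !negbK in h1.
  have mk (S : {set V}) x : x \in S -> S != set0 by move=> xS; apply/set0Pn; exists x.
  have nA x : x \in T -> x \notin A -> x \in B by move=> xT; rewrite inT// negbK.
  have nC x : x \in T -> x \notin C -> x \in D by move=> xT; rewrite inT'// negbK.
  have nB x : x \in T -> x \notin B -> x \in A by move=> xT; rewrite inT.
  have nD x : x \in T -> x \notin D -> x \in C by move=> xT; rewrite inT'.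
  case/orP: h1 => /eqP h1.
    have aC : a \notin C by apply/negP => aC; apply: (none _ a h1); rewrite !inE aT aA.
    have cA : c \notin A by apply/negP => cA; apply: (none _ c h1); rewrite !inE cT cA.
    by split; [apply: (mk _ a)|apply: (mk _ c)]; rewrite !inE ?aT ?aA ?cT ?cC ?andbT ?nC ?nA.
  have bD : b \notin D by apply/negP => bD; apply: (none _ b h1); rewrite !inE bT bB.
  have dB : d \notin B by apply/negP => dB; apply: (none _ d h1); rewrite !inE dT dB.
  by split; [apply: (mk _ d)|apply: (mk _ b)]; rewrite !inE ?bT ?bB ?dT ?dD ?andbT ?nB ?nD.
have dCD : [disjoint C & D] by case/and4P: sCD.
have := cut_size_uncross dAB dCD Epq pA qB pC pD qC qD.
have AB0 x : (x \in A) && (x \in B) = false by move/disjoint_setI0/setP/(_ x): dAB; rewrite !inE.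
have CD0 x : (x \in C) && (x \in D) = false by move/disjoint_setI0/setP/(_ x): dCD; rewrite !inE.
have covAB x : x \in T -> (x \in A) || (x \in B).
  by case/and4P: sAB => _ /subsetP/(_ x) + _ _ => /[apply]; rewrite inE.
have covCD x : x \in T -> (x \in C) || (x \in D).
  by case/and4P: sCD => _ /subsetP/(_ x) + _ _ => /[apply]; rewrite inE.
have ex (P Q : {set V}) : P \subset Q -> P != set0 -> Q != set0.
  by move=> PQ; apply: contraNneq => Q0; rewrite Q0 subset0 in PQ.
have s1 : separates (A :&: C) (B :|: D).
  apply/and4P; split=> //.
  - rewrite -setI_eq0; apply/eqP/setP => x; rewrite !inE; have := AB0 x; have := CD0 x.
    by case: (x \in A); case: (x \in B); case: (x \in C); case: (x \in D).
  - apply/subsetP => x xT; rewrite !inE; have := covAB x xT; have := covCD x xT.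
    by case: (x \in A); case: (x \in B); case: (x \in C); case: (x \in D).
  - by apply: ex tBD; apply: setIS; apply/subsetP => x; rewrite !inE => /andP[->].
have s2 : separates (A :|: C) (B :&: D).
  apply/and4P; split=> //.
  - rewrite -setI_eq0; apply/eqP/setP => x; rewrite !inE; have := AB0 x; have := CD0 x.
    by case: (x \in A); case: (x \in B); case: (x \in C); case: (x \in D).
  - apply/subsetP => x xT; rewrite !inE; have := covAB x xT; have := covCD x xT.
    by case: (x \in A); case: (x \in B); case: (x \in C); case: (x \in D).
  - by apply: ex tAC; apply: setIS; apply/subsetP => x; rewrite !inE => /andP[->].
move=> unc; have := leq_trans unc (leq_add cAB cCD).
by rewrite ltnNge leq_add// (elt_connectedP _ _ conn).
Qed.
End ElementCuts.

(** * Flows and element connectivity *)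

Section EasyMenger.
Variable V : finType.
Implicit Types (E : rel V) (A B : {set V}).

Definition cut_elements E A B : {set V + V * V} :=
  [set z | match z with inl v => (v \notin A) && (v \notin B)
           | inr xy => [&& xy.1 \in A, xy.2 \in B & E xy.1 xy.2] end].

Lemma card_cut_elements E A B : #|cut_elements E A B| = cut_size E A B.
Proof.
rewrite -sum1_card big_mkcond big_sumType /=; congr (_ + _); apply: eq_bigr => z _.
  by rewrite inE; case: ifP.
by rewrite inE; case: ifP.
Qed.

Lemma bigminn_leq (I : finType) (P : pred I) (F : I -> nat) z j :
  P j -> \big[minn/z]_(i | P i) F i <= F j.
Proof.
move=> Pj; have : j \in index_enum I by rewrite mem_index_enum.
elim: (index_enum I) => // a r IH; rewrite inE big_cons => /predU1P[<-|/IH le].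
  by rewrite Pj geq_minl.
by case: ifP => // _; apply: leq_trans (geq_minr _ _) le.
Qed.

Variables (G : sgraph V) (T : {set V}).

Lemma kappa_witness u v k : k <= kappa G T u v ->
  exists2 P : {set #|V|.-bseq V}, disjoint_paths G T u v P & k <= #|P|.
Proof.
move=> hk; apply/exists_inP; apply: contraT => /exists_inPn no.
case: k hk no => [_ /(_ set0)|k hk no].
  rewrite leq0n => h; have /h : disjoint_paths G T u v set0.
    by apply/andP; split; apply/forallP => p; rewrite inE.
  by [].
suff : kappa G T u v <= k by rewrite leqNgt hk.
by apply/bigmax_leqP => P /no; rewrite -ltnNge ltnS.
Qed.

Definition on_path (u : V) (p : seq V) (z : V + V * V) : bool :=
  match z with inl y => y \in p | inr xy => [set xy.1; xy.2] \in path_edges u p end.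

Lemma crossing_element A B u p : [disjoint A & B] -> path G u p -> u \in A ->
  last u p \in B -> exists2 z, z \in cut_elements G A B & on_path u p z.
Proof.
move=> dAB; elim: p u => [|y p IH] u /=.
  by move=> _ uA uB; move/disjoint_setI0/setP/(_ u): dAB; rewrite !inE uA uB.
move=> /andP[uy pp] uA lB; have [yA|yA] := boolP (y \in A).
  have [[z|[x z]] zc zp] := IH y pp yA lB; first by exists (inl z) => //; rewrite /= inE [z \in p]zp orbT.
  by exists (inr (x, z)) => //; rewrite /= inE [_ \in pairmap _ _ _]zp orbT.
have [yB|yB] := boolP (y \in B).
  by exists (inr (u, y)); rewrite /= !inE /= ?uA ?yB ?uy ?eqxx.
by exists (inl y); rewrite /= !inE ?yA ?yB ?eqxx.
Qed.

(** The easy half of Menger's theorem. Each path from [A] to [B] meets an element of the cut, and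
    two paths of the family cannot share one, because a deleted vertex is not a terminal. *)
Theorem kappaT_connected k : k <= kappaT G T -> elt_connected T G k.
Proof.
move=> hk; apply/elt_connectedP => A B sAB.
case/and4P: (sAB) => dAB _ /set0Pn[u] + /set0Pn[v]; rewrite !inE => /andP[uT uA] /andP[vT vB].
have uv : u != v.
  by apply: contraTneq uA => ->; rewrite (separates_in sAB)// vB.
have [P] : exists2 P : {set #|V|.-bseq V}, disjoint_paths G T u v P & k <= #|P|.
  apply: kappa_witness; apply: (leq_trans hk).
  by apply: (@bigminn_leq _ _ (fun uv => kappa G T uv.1 uv.2) _ (u, v)) => /=; rewrite uT vT.
case/andP => /forall_inP Pp /forall_inP Pd kP; apply: (leq_trans kP).
pose R (p : seq V) (z : V + V * V) := (z \in cut_elements G A B) && on_path u p z.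
pose g (p : #|V|.-bseq V) := odflt (inl u) [pick z | R p z].
have gP p : p \in P -> R p (g p).
  move=> pP; rewrite /g; case: pickP => //= no.
  have /and3P[pp /eqP pl _] := Pp p pP.
  have [z z1 z2] := crossing_element dAB pp uA ltac:(by rewrite pl).
  by have := no z; rewrite /R z1 z2.
rewrite -card_cut_elements -(card_in_imset (f := g) (D := P)).
  by apply: subset_leq_card; apply/subsetP => _ /imsetP[p /gP/andP[+ _] ->].
move=> p q pP qP gpq; apply/eqP; apply: contraT => pq.
have /forall_inP/(_ q qP)/implyP/(_ pq)/andP[/hasPn de /forallP dv] := Pd p pP.
have /andP[gc gp] := gP p pP; have /andP[_ gq] := gP q qP; rewrite -gpq in gq.
case: (g p) gc gp gq => [y|[x y]] /=; rewrite inE.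
  move=> /andP[yA yB] yp yq; have := dv y; rewrite !inE yp yq !orbT /= => yT.
  by rewrite (separates_in sAB)// yB in yA.
by move=> _ ep /de; rewrite /= ep.
Qed.

(** The cut around a single terminal consists of its edges only. The bound lets the program
    represent [k] by an initial segment of the vertices. *)
Lemma elt_connected_lt_card E k : irreflexive E -> 1 < #|T| -> elt_connected T E k -> k < #|V|.
Proof.
move=> irr T1 /elt_connectedP conn.
have [u uT] : exists u, u \in T by apply/set0Pn; rewrite -card_gt0 ltnW.
have sep : separates T [set u] (~: [set u]).
  apply/and4P; split.
  - by rewrite disjoints1 !inE eqxx.
  - by rewrite setUCr subsetT.
  - by apply/set0Pn; exists u; rewrite !inE uT eqxx.
  - apply: contraTneq T1 => h; rewrite -leqNgt -(cards1 u); apply: subset_leq_card.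
    apply/subsetP => x xT; move/setP/(_ x): h; rewrite !inE xT /= => /negbT.
    by rewrite negbK.
apply: leq_ltn_trans (conn _ _ sep) _.
rewrite -card_cut_elements.
have -> : #|V| = #|[set~ u]|.+1 by rewrite cardsC1 prednK//; apply/card_gt0P; exists u.
rewrite ltnS; have /card_in_imset <- : {in cut_elements E [set u] (~: [set u]) &,
    injective (fun z : V + V * V => match z with inl v => v | inr xy => xy.2 end)}.
  move=> [v|[x y]] [v'|[x' y']]; rewrite !inE /= ?andbN// => /and3P[/eqP-> _ _] /and3P[/eqP-> _ _].
  by move=> ->.
apply: subset_leq_card; apply/subsetP => _ /imsetP[[v|[x y]] + ->]; rewrite !inE /= ?andbN//.
by case/and3P.
Qed.
End EasyMenger.

Definition indexed_path (N : finType) (nx : rel N) (l : nat) (v : nat -> N) : Prop :=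
  (forall i j, i <= l -> j <= l -> v i = v j -> i = j) /\
  (forall x y, nx x y <-> exists i, [/\ i < l, x = v i & y = v i.+1]).

Section Flow.
Variables (N : finType) (cap : rel N) (s t : N).
Hypothesis st : s != t.

Definition is_flow (F : rel N) (val : nat) : Prop :=
  [/\ forall u v, F u v -> cap u v,
      forall u, u != s -> u != t -> \sum_v F u v = \sum_v F v u &
      \sum_v F s v = \sum_v F v s + val].

Definition residual (F : rel N) : rel N := [rel u v | cap u v && ~~ F u v || F v u].

Lemma flow_across F val (X : {set N}) : is_flow F val -> s \in X -> t \notin X ->
  \sum_(u in X) \sum_(v in ~: X) F u v = \sum_(u in X) \sum_(v in ~: X) F v u + val.
Proof.
move=> [_ bal sval] sX tX.
have tot : \sum_(u in X) \sum_v F u v = \sum_(u in X) \sum_v F v u + val.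
  rewrite (bigD1 s) //= sval [X in _ = X + _](bigD1 s) //= addnAC; congr (_ + _ + _).
  apply: eq_bigr => u /andP[uX us]; apply: bal => //.
  by apply: contraTneq uX => ->.
have splitX (g : N -> N -> nat) : \sum_(u in X) \sum_v g u v =
    \sum_(u in X) \sum_(v in X) g u v + \sum_(u in X) \sum_(v in ~: X) g u v.
  rewrite -big_split; apply: eq_bigr => u _; rewrite (bigID (mem X)) /=; congr (_ + _).
  by apply: eq_bigl => v; rewrite inE.
move: tot; rewrite !splitX.
have -> : \sum_(u in X) \sum_(v in X) F v u = \sum_(u in X) \sum_(v in X) F u v.
  by rewrite exchange_big.
by lia.
Qed.

Definition cut_capacity (X : {set N}) : nat := \sum_(u in X) \sum_(v in ~: X) cap u v.

Lemma flow_le_cut F val (X : {set N}) : is_flow F val -> s \in X -> t \notin X ->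
  val <= cut_capacity X.
Proof.
move=> fl sX tX; have := flow_across fl sX tX.
have : \sum_(u in X) \sum_(v in ~: X) F u v <= cut_capacity X.
  apply: leq_sum => u _; apply: leq_sum => v _; case: fl => h _ _.
  by case Fuv: (F u v) => //; rewrite h.
by lia.
Qed.

(** The optimality half of max-flow min-cut: the arcs leaving a residually closed set are saturated
    and those entering it are empty. *)
Lemma flow_saturated F val (X : {set N}) : is_flow F val -> s \in X -> t \notin X ->
  (forall u v, u \in X -> residual F u v -> v \in X) -> cut_capacity X = val.
Proof.
move=> fl sX tX clo; have := flow_across fl sX tX.
have res u v : u \in X -> v \in ~: X -> F u v = cap u v /\ F v u = false.
  move=> uX; rewrite inE => vX; have : ~~ residual F u v.
    by apply: contra vX; exact: clo.
  rewrite /residual /= negb_or negb_and negbK => /andP[h1 /negbTE h2]; split=> //.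
  by case: fl => /(_ u v) h _ _; case Fuv: (F u v) h h1 => //= h h1; [rewrite h|apply/esym/negbTE; case/orP: h1].
have -> : \sum_(u in X) \sum_(v in ~: X) F v u = 0.
  by apply: big1 => u uX; apply: big1 => v vX; rewrite (res u v uX vX).2.
rewrite add0n => <-; apply: eq_bigr => u uX; apply: eq_bigr => v vX.
by rewrite (res u v uX vX).1.
Qed.

Definition augment (F nx : rel N) : rel N :=
  [rel u v | F u v && ~~ nx v u || nx u v && ~~ F v u].

Lemma flow_augment F val nx l v : is_flow F val -> indexed_path nx l v ->
  v 0 = s -> v l = t -> (forall x y, nx x y -> residual F x y) ->
  is_flow (augment F nx) val.+1.
Proof.
move=> [Fcap bal sval] [vinj nxP] v0 vl res.
have l0 : 0 < l by case: l v0 vl {nxP vinj} => // v0 vl; move: st; rewrite -v0 -vl eqxx.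
have asym x y : nx x y -> ~~ nx y x.
  move=> /nxP[i [il -> ->]]; apply/negP => /nxP[j [jl e1 e2]].
  have := vinj _ _ _ _ e1; have := vinj _ _ _ _ e2; lia.
(* The net flow along [xy] changes by [nx x y - nx y x]. The identity is additive because it lives
   in the natural numbers; it is then summed over [y]. *)
have pt x y : augment F nx x y + F y x + nx y x = F x y + augment F nx y x + nx x y.
  have := res x y; have := res y x; have := asym x y; rewrite /augment /residual /=.
  case: (nx x y); case: (nx y x); case: (F x y); case: (F y x); case: (cap x y); case: (cap y x) => //=;
  by move=> h1 h2 h3; (try by have := h1 isT); (try by have := h2 isT); (try by have := h3 isT).
have sumE x : \sum_y augment F nx x y + \sum_y F y x + \sum_y nx y x =
    \sum_y F x y + \sum_y augment F nx y x + \sum_y nx x y.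
  by rewrite -!big_split; apply: eq_bigr => y _ /=; exact: pt.
have outE i : i <= l -> \sum_y nx (v i) y = (i < l).
  move=> il; case: (ltnP i l) => [il'|].
    rewrite (bigD1 (v i.+1)) //= big1 ?addn0 => [|y yv].
      by have -> : nx (v i) (v i.+1) by apply/nxP; exists i.
    apply/eqP; rewrite eqb0; apply/negP => /nxP[j [jl e1 e2]].
    have ij : i = j by apply: vinj => //; lia.
    by rewrite e2 ij eqxx in yv.
  move=> li; rewrite big1// => y _; apply/eqP; rewrite eqb0; apply/negP => /nxP[j [jl e1 _]].
  by have : i = j; [apply: vinj => //; lia|lia].
have inE' i : i <= l -> \sum_y nx y (v i) = (0 < i).
  move=> il; case: i il => [|i] il.
    rewrite big1// => y _; apply/eqP; rewrite eqb0; apply/negP => /nxP[j [jl _ e1]].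
    by have := vinj _ _ _ _ e1; lia.
  rewrite (bigD1 (v i)) //= big1 ?addn0 => [|y yv].
    by have -> : nx (v i) (v i.+1) by apply/nxP; exists i.
  apply/eqP; rewrite eqb0; apply/negP => /nxP[j [jl e1 e2]].
  have [ij] : i.+1 = j.+1 by apply: vinj => //; lia.
  by rewrite ij e1 eqxx in yv.
split.
- move=> x y; rewrite /augment /= => /orP[/andP[/Fcap//]|/andP[/res + nF]].
  by rewrite /residual /= (negPf nF) orbF => /andP[].
- move=> x xs xt; have := sumE x; have := bal x xs xt.
  have -> : \sum_y nx y x = \sum_y nx x y; last by lia.
  have [/existsP[i /eqP ei]|/existsPn noi] := boolP [exists i : 'I_l.+1, x == v i].
    have il : i <= l by rewrite -ltnS.
    rewrite ei outE// inE'//; congr nat_of_bool.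
    have i0 : i != 0 :> nat by apply: contraNneq xs => iz; rewrite ei iz v0.
    have il' : i != l :> nat by apply: contraNneq xt => iz; rewrite ei iz vl.
    by lia.
  have no j : j <= l -> x <> v j.
    by move=> jl xv; have := noi (Ordinal (jl : j < l.+1)); rewrite xv eqxx.
  rewrite !big1// => y _; apply/eqP; rewrite eqb0; apply/negP => /nxP[j [jl e1 e2]].
    by apply: (no j) => //; lia.
  by apply: (no j.+1).
- have := sumE s; rewrite sval -v0 outE// inE'// l0; lia.
Qed.
End Flow.

(** * The flow network of a pair of terminals *)

Section ElementNetwork.
Variables (V : finType) (T : {set V}) (B : rel V) (o0 o1 : V).
Hypothesis o01 : o0 != o1.
Notation N := (V * V)%type.

(* A non-terminal [x] is split into [(x, o0)] and [(x, o1)], joined by an arc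
   of capacity one; a terminal only has the copy [(x, o0)]. *)
Definition out_copy x : V := if x \in T then o0 else o1.

Definition network : rel N := [rel u v |
  [&& u.1 == v.1, u.1 \notin T, u.2 == o0 & v.2 == o1] ||
  [&& B u.1 v.1, u.2 == out_copy u.1 & v.2 == o0]].

Definition network_cut (X : {set N}) : {set N * N} :=
  [set uv | [&& uv.1 \in X, uv.2 \notin X & network uv.1 uv.2]].

Lemma card_network_cut X : #|network_cut X| = cut_capacity network X.
Proof.
rewrite /cut_capacity pair_big /= -sum1_card big_mkcond [RHS]big_mkcond /=.
by apply: eq_bigr => -[u v] _; rewrite !inE /=; case: (u \in X); case: (v \in X); case: network.
Qed.

(** A network cut is read as a separation in which a vertex is deleted when its entry is in [X] and
    its exit is not; a terminal has a single copy and is never deleted. Elements of the separation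
    then inject into arcs of the cut. *)
Lemma network_cut_ge k (X : {set N}) r t : elt_connected T B k ->
  r \in T -> t \in T -> (r, o0) \in X -> (t, o0) \notin X -> k <= cut_capacity network X.
Proof.
move=> /elt_connectedP conn rT tT rX tX.
pose A := [set x | ((x, o0) \in X) && ((x, out_copy x) \in X)].
pose D := [set x | (x, o0) \notin X].
have sep : separates T A D.
  apply/and4P; split.
  - by rewrite -setI_eq0; apply/eqP/setP => x; rewrite !inE andbAC andbN.
  - by apply/subsetP => x xT; rewrite !inE /out_copy xT andbb orbN.
  - by apply/set0Pn; exists r; rewrite !inE /out_copy rT rX.
  - by apply/set0Pn; exists t; rewrite !inE tT.
apply: (leq_trans (conn _ _ sep)); rewrite -card_cut_elements -card_network_cut.
pose f (z : V + V * V) : N * N := match z with inl v => ((v, o0), (v, o1))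
  | inr xy => ((xy.1, out_copy xy.1), (xy.2, o0)) end.
have finj : injective f.
  move=> [v|[x y]] [v'|[x' y']] //=; first by case=> ->.
  - by case=> _ _ _ e; move: o01; rewrite e eqxx.
  - by case=> _ _ _ e; move: o01; rewrite e eqxx.
  - by case=> -> _ ->.
rewrite -(card_imset _ finj); apply: subset_leq_card; apply/subsetP => _ /imsetP[[v|[x y]] + ->].
  rewrite !inE /= negbK negb_and => /andP[h1 h2]; rewrite h2 in h1 *.
  have vT : v \notin T by move: h1; rewrite /out_copy; case: ifP => //; rewrite h2.
  by move: h1; rewrite /out_copy (negPf vT) /= => ->; rewrite /network /= !eqxx vT.
by rewrite !inE /= => /and3P[/andP[_ ->] -> b]; rewrite /network /= b !eqxx orbT.
Qed.

(** Weak duality applied to the set containing both copies of the vertices of [A] and the entries of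
    the deleted vertices. The arcs that leave it inject into the elements of the separation. *)
Lemma flows_elt_connected k :
  (forall r t, r \in T -> t \in T -> r != t -> exists F, is_flow network (r, o0) (t, o0) F k) ->
  elt_connected T B k.
Proof.
move=> flows; apply/elt_connectedP => A D sep.
case/and4P: (sep) => dAD cov /set0Pn[r] + /set0Pn[t]; rewrite !inE => /andP[rT rA] /andP[tT tD].
have tA : t \notin A by rewrite (separates_in sep)// tD.
have rt : r != t by apply: contraTneq rA => ->.
have [F fl] := flows r t rT tT rt.
pose X : {set N} := [set u | (u.1 \in A) || (u.1 \notin D) && (u.2 == o0)].
have rtN : ((r, o0) : N) != (t, o0) by rewrite xpair_eqE negb_and rt.
have := flow_le_cut rtN fl (X := X); rewrite !inE /= rA tD (negPf tA) => /(_ isT isT) h.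
apply: (leq_trans h); rewrite -card_cut_elements -card_network_cut.
pose f (uv : N * N) : V + V * V := if uv.2.2 == o1 then inl uv.1.1 else inr (uv.1.1, uv.2.1).
have key u v : (u, v) \in network_cut X ->
   [/\ u.1 == v.1, u.1 \notin T, u.2 == o0, v.2 == o1 & (u.1 \notin A) && (u.1 \notin D)] \/
   [/\ B u.1 v.1, u.2 == out_copy u.1, v.2 == o0, u.1 \in A & v.1 \in D].
  rewrite !inE /network /= => /and3P[uX vX /orP[/and4P[/eqP uv uT uo vo]|/and3P[b uo vo]]]; [left|right].
    split=> //; first by rewrite uv.
    move: vX; rewrite -uv negb_or (eqP vo) eq_sym (negPf o01) andbF /= andbT => uA.
    by move: uX; rewrite (negPf uA) /= => /andP[->].
  move: vX; rewrite negb_or negb_and negbK vo /= orbF => /andP[vA vD]; split=> //.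
  case/orP: uX => // /andP[uD uo0]; apply: contraT => uA.
  have : u.1 \in T by move: uo0; rewrite (eqP uo) /out_copy; case: ifP => //; rewrite eq_sym (negPf o01).
  by move=> uT; have := subsetP cov _ uT; rewrite inE (negPf uA) (negPf uD).
rewrite -(card_in_imset (f := f) (D := network_cut X)).
  apply: subset_leq_card; apply/subsetP => _ /imsetP[[u v] /key h' ->]; rewrite /f /=.
  case: h' => [[_ _ _ -> h']|[b _ /eqP-> uA vD]]; first by rewrite inE.
  by rewrite (negPf o01) inE /= uA vD b.
move=> [u v] [u' v'] /key h1 /key h2; rewrite /f /=.
case: u v u' v' h1 h2 => [u1 u2] [v1 v2] [u1' u2'] [v1' v2'] /=.
case=> -[]; [move=> /eqP-> _ /eqP-> /eqP-> _|move=> _ /eqP-> /eqP-> _ _];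
case=> -[]; [move=> /eqP-> _ /eqP-> /eqP-> _|move=> _ /eqP-> /eqP-> _ _|
  move=> /eqP-> _ /eqP-> /eqP-> _|move=> _ /eqP-> /eqP-> _ _]; rewrite ?eqxx ?(negPf o01) //.
  by case=> ->.
by case=> -> ->.
Qed.
End ElementNetwork.

(** * Exchanges in forests with labelled edges *)

Lemma connect_remove (U : finType) (r r' : rel U) a b x y :
  symmetric r' ->
  (forall u v, r u v -> [\/ r' u v, (u, v) = (a, b) | (u, v) = (b, a)]) ->
  connect r x y ->
  [\/ connect r' x y, connect r' x a /\ connect r' b y | connect r' x b /\ connect r' a y].
Proof.
move=> sym rr' /connectP[p pp ->]; elim: p x pp => [|z p IH] x /=; first by constructor 1.
move=> /andP[xz /IH IHz].
case: (rr' _ _ xz) => [xz'|[? ?]|[? ?]]; [|subst a b|subst a b].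
- have c := connect1 xz'.
  case: IHz => [h|[h1 h2]|[h1 h2]]; [constructor 1|constructor 2; split=> //|constructor 3; split=> //];
  exact: connect_trans c _.
- case: IHz => [h|[h1 h2]|[h1 h2]]; [constructor 2|constructor 2|constructor 1] => //.
- case: IHz => [h|[h1 h2]|[h1 h2]]; [constructor 3|constructor 1|constructor 3] => //.
Qed.

Section LabelledForests.
Variables (U L : finType).
Implicit Types (M : L -> rel U) (D : {set L}).

(** The labels in [D] are switched off. Bridges, single exchanges and the effect of switching off a
    whole set are thus all statements about one relation. *)
Definition label_adj M D : rel U :=
  [rel u v | [exists e, (e \notin D) && (M e u v || M e v u)]].

Definition joined M D : rel U := connect (label_adj M D).

Definition one_edge M : Prop :=
  forall e u v u' v', M e u v -> M e u' v' -> (u, v) = (u', v').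

Definition forest M : Prop := forall e u v, M e u v -> ~~ joined M [set e] u v.

Lemma label_adj_sym M D : symmetric (label_adj M D).
Proof. by move=> u v; apply: eq_existsb => e; rewrite orbC. Qed.

Lemma joined_sym M D : symmetric (joined M D).
Proof. exact: sym_connect_sym (label_adj_sym M D). Qed.

Lemma joined_trans M D : transitive (joined M D).
Proof. exact: connect_trans. Qed.

Lemma joined_edge M D e u v : e \notin D -> M e u v -> joined M D u v.
Proof. by move=> eD uv; apply: connect1; apply/existsP; exists e; rewrite eD uv. Qed.

Lemma joined_remove M D f a b x y : one_edge M -> M f a b -> joined M D x y ->
  [\/ joined M (f |: D) x y, joined M (f |: D) x a /\ joined M (f |: D) b y |
      joined M (f |: D) x b /\ joined M (f |: D) a y].
Proof.
move=> one fab; apply: connect_remove; first exact: label_adj_sym.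
move=> u v /existsP[e /andP[eD /orP[euv|evu]]].
  case: (eqVneq e f) => [ef|ef]; first by rewrite ef in euv; constructor 2; exact: one euv fab.
  by constructor 1; apply/existsP; exists e; rewrite !inE negb_or ef eD euv.
case: (eqVneq e f) => [ef|ef]; first by rewrite ef in evu; case: (one _ _ _ _ _ evu fab) => -> ->; constructor 3.
by constructor 1; apply/existsP; exists e; rewrite !inE negb_or ef eD evu orbT.
Qed.

(** Paths in a forest are unique, so a connection that survives each label of [D] alone avoids them
    all. Were [f] the first to break it, the ends of the edge of [f] would be rejoined without [f],
    through [x] and [y]. *)
Lemma joined_survives M D x y : one_edge M -> forest M -> joined M set0 x y ->
  (forall f, f \in D -> joined M [set f] x y) -> joined M D x y.
Proof.
move=> one for_ xy hD.
suff H (s : seq L) : {subset s <= D} -> joined M [set f in s] x y.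
  by rewrite -[D]set_enum; apply: H => f; rewrite mem_enum.
elim: s => [|f s IH] sD.
  by have -> : [set f in [::]] = set0 :> {set L} by apply/setP => f; rewrite !inE.
rewrite set_cons; have {}IH := IH (fun g gs => sD g (mem_behead (s := f :: s) gs)).
have [/existsP[a /existsP[b fab]]|/existsPn no] := boolP [exists a, exists b, M f a b]; last first.
  have -> : joined M (f |: [set f in s]) x y = joined M [set f in s] x y; last by [].
  apply: eq_connect => u v; apply: eq_existsb => e; rewrite !inE negb_or.
  case: (eqVneq e f) => //= ->.
  by have /existsPn nof := no u; have /existsPn nof' := no v; rewrite (negPf (nof v)) (negPf (nof' u)) !andbF.
have sub u v : joined M (f |: [set f in s]) u v -> joined M [set f] u v.
  apply: connect_sub => u' v' /existsP[e /andP[eD h]]; apply: connect1; apply/existsP; exists e.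
  by rewrite h andbT; apply: contra eD; rewrite !inE => ->.
have fxy := hD f (sD f (mem_head _ _)); have := for_ f a b fab.
case: (joined_remove one fab IH) => // -[/sub h1 /sub h2].
  by rewrite (joined_trans (y := x)) ?(joined_sym _ _ a)// (joined_trans fxy)// joined_sym.
rewrite joined_sym (joined_trans (y := x)) ?(joined_sym _ _ b)//.
by rewrite (joined_trans fxy)// joined_sym.
Qed.

End LabelledForests.

Lemma joined_mono (U L L' : finType) (M : L -> rel U) (M' : L' -> rel U)
  (D : {set L}) (D' : {set L'}) x y :
  (forall e u v, M e u v -> e \notin D -> exists2 e', e' \notin D' & M' e' u v) ->
  joined M D x y -> joined M' D' x y.
Proof.
move=> h; apply: connect_sub => u v /existsP[e /andP[eD /orP[] /h/(_ eD)[e' eD' h']]];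
  apply: connect1; apply/existsP; exists e'; by rewrite eD' h' ?orbT.
Qed.


Lemma forest_embed (U L L' : finType) (M : L -> rel U) (M' : L' -> rel U) (phi : L -> L') :
  injective phi -> (forall e u v, M e u v -> M' (phi e) u v) -> forest M' -> forest M.
Proof.
move=> inj h for' e u v /[dup] euv /h /for'; apply: contra; apply: joined_mono => f u' v' /h fuv.
by rewrite !inE => fe; exists (phi f) => //; rewrite inE (inj_eq inj).
Qed.

Section ForestAdd.
Variables (U L : finType).
Implicit Types (M : L -> rel U).

Definition add_edge M e a b : L -> rel U :=
  fun f => [rel u v | if f == e then (u, v) == (a, b) else M f u v].

Lemma one_edge_add M e a b : one_edge M -> one_edge (add_edge M e a b).
Proof.
move=> one f u v u' v'; rewrite /add_edge /=; case: eqP => _; last exact: one.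
by move=> /eqP-> /eqP->.
Qed.

Lemma forest_add M e a b : one_edge M -> (forall u v, ~~ M e u v) -> forest M ->
  ~~ joined M set0 a b -> forest (add_edge M e a b).
Proof.
move=> one ne for_ nab f u v; rewrite /add_edge /=; case: eqVneq => [->|fe].
  move=> /eqP[-> ->]; apply: contra nab; apply: joined_mono => g u' v' /=; rewrite inE.
  by case: ifP => // _ h _; exists g => //; rewrite inE.
move=> fuv; have one' : one_edge (add_edge M e a b) := one_edge_add one.
have eab : add_edge M e a b e a b by rewrite /add_edge /= eqxx.
have sub x y : joined (add_edge M e a b) (e |: [set f]) x y -> joined M [set f] x y.
  apply: joined_mono => g u' v'; rewrite /add_edge /= !inE negb_or => + /andP[ge gf].
  by rewrite (negPf ge) => h; exists g => //; rewrite inE.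
have sub0 x y : joined M [set f] x y -> joined M set0 x y.
  by apply: joined_mono => g u' v' h _; exists g => //; rewrite inE.
have nuv := for_ f u v fuv; have uv0 : joined M set0 u v by apply: joined_edge fuv; rewrite inE.
apply/negP => c; case: (joined_remove one' eab c) => [/sub|[/sub h1 /sub h2]|[/sub h1 /sub h2]].
- exact/negP.
- move/negP: nab; apply; rewrite joined_sym in h1; apply: (joined_trans (sub0 _ _ h1)).
  by apply: (joined_trans uv0); rewrite joined_sym; exact: sub0.
- move/negP: nab; apply; apply: (joined_trans (sub0 _ _ h2)).
  by rewrite joined_sym in uv0; apply: (joined_trans uv0); exact: sub0.
Qed.
End ForestAdd.

Section Exchange.
Variables (U L : finType) (F : L -> rel U).
Hypotheses (one : one_edge F) (for_ : forest F).
Variables (l : nat) (v : nat -> L) (nw : nat -> U * U).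
Hypothesis vinj : forall i j, i <= l -> j <= l -> v i = v j -> i = j.
Hypothesis swap_on : forall i, i < l -> joined F set0 (nw i).1 (nw i).2.
Hypothesis swap_off : forall i, i < l -> ~~ joined F [set v i.+1] (nw i).1 (nw i).2.
Hypothesis no_shortcut : forall i j, i.+1 < j -> j <= l -> joined F [set v j] (nw i).1 (nw i).2.
Hypothesis last_off : ~~ joined F set0 (nw l).1 (nw l).2.

(* Stage [s] of the exchange, performed from the end of the path backwards:
   label [(e, false)] is the old edge of [e] and [(e, true)] its new one. *)
Definition stage s : L * bool -> rel U := fun eb => [rel x y | if eb.2
  then [exists t : 'I_l.+1, [&& s <= t, eb.1 == v t & (x, y) == nw t]]
  else F eb.1 x y && ~~ [exists t : 'I_l.+1, (s < t) && (eb.1 == v t)]].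

Lemma one_edge_stage s : one_edge (stage s).
Proof.
move=> [e []] x y x' y'; rewrite /stage /=; last by move=> /andP[h _] /andP[h' _]; exact: one h h'.
move=> /existsP[t /and3P[_ /eqP et /eqP->]] /existsP[t' /and3P[_ /eqP et' /eqP->]].
by rewrite (vinj (i := t) (j := t')) ?leq_ord// -et -et'.
Qed.

Lemma stage_oldP s e x y : reflect (F e x y /\ forall t, s < t -> t <= l -> e <> v t)
  (stage s (e, false) x y).
Proof.
apply: (iffP andP) => /= -[h1 h2]; split=> //.
  move=> t st tl et; move/negP: h2; apply; apply/existsP.
  by exists (Ordinal (tl : t < l.+1)); rewrite /= st et eqxx.
by apply/existsPn => t; apply/negP => /andP[st /eqP]; apply: h2 => //; rewrite leq_ord.
Qed.

Lemma stage_newP s e x y : reflect (exists t, [/\ s <= t, t <= l, e = v t & (x, y) = nw t])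
  (stage s (e, true) x y).
Proof.
apply: (iffP existsP) => /= [[t /and3P[st /eqP-> /eqP->]]|[t [st tl -> ->]]].
  by exists t; split=> //; rewrite leq_ord.
by exists (Ordinal (tl : t < l.+1)); rewrite /= st !eqxx.
Qed.

(** Working backwards, each swap closes a cycle untouched by the swaps already made. By
    [no_shortcut], the path of [F] between the ends of [nw s] avoids every label beyond [v s.+1]; by
    [swap_off] it uses the old edge of [v s.+1], whose removal opens the cycle. *)
Lemma forest_stage s : s <= l -> forest (stage s).
Proof.
move=> sl; rewrite -(subKn sl); elim: (l - s) {sl} (leq_subr s l) => [_|d IH dl].
  rewrite subn0.
  pose M0 : L * bool -> rel U := fun eb => [rel x y | ~~ eb.2 && F eb.1 x y].
  have one0 : one_edge M0 by move=> [e b] x y x' y' /andP[_ h] /andP[_ h']; exact: one h h'.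
  have for0 : forest M0.
    move=> [e b] x y /andP[/= nb exy]; apply: contra (for_ exy); apply: joined_mono.
    move=> [f b'] u w /andP[/= nb' fuw]; rewrite inE => h; exists f => //.
    rewrite inE; apply: contra h => /eqP->; rewrite xpair_eqE eqxx.
    by move: nb nb' => /negPf-> /negPf->.
  have := @forest_add _ _ M0 (v l, true) (nw l).1 (nw l).2 one0 (fun _ _ => isT) for0.
  have -> : joined M0 set0 (nw l).1 (nw l).2 = false.
    apply/negbTE; apply: contra last_off; apply: joined_mono => [[e b] u w /andP[_ h] _].
    by exists e => //; rewrite inE.
  move=> /(_ isT); apply: (@forest_embed _ _ _ _ _ id) => // -[e []] x y.
    move=> /stage_newP[t [lt tl -> exy]]; have tE : t = l by lia.
    by rewrite /add_edge /= exy tE eqxx -surjective_pairing.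
  by move=> /stage_oldP[h _]; rewrite /add_edge /= xpair_eqE andbF /M0 /= h.
set s' := l - d.+1; have s'l : s' < l by lia.
have e1 : s'.+1 = l - d by rewrite /s' subnSK.
have {}IH : forest (stage s'.+1) by rewrite e1; apply: IH; exact: ltnW.
have [a [b fab]] : exists a b, F (v s'.+1) a b.
  have [/existsP[a /existsP[b h]]|/existsPn no] := boolP [exists a, exists b, F (v s'.+1) a b].
    by exists a, b.
  have := swap_off s'l; rewrite (_ : joined _ _ _ _) //.
  apply: joined_mono (swap_on s'l) => e x y exy _; exists e => //; rewrite inE.
  by apply: contraTneq exy => ->; have /existsPn := no x; apply.
pose M' : L * bool -> rel U := fun eb => [rel x y | (eb != (v s'.+1, false)) && stage s'.+1 eb x y].
have one' : one_edge M'.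
  by move=> eb x y x' y' /andP[_ h] /andP[_ h']; exact: one_edge_stage h h'.
have for' : forest M'.
  by apply: (@forest_embed _ _ _ _ _ id) IH => // e x y /andP[].
(* If the ends of [nw s'] were joined without the old edge [ab], the path of [F] through [ab] would
   give a second connection between [a] and [b], but [ab] is a bridge of the current stage. *)
have nw_off : ~~ joined M' set0 (nw s').1 (nw s').2.
  apply/negP => c.
  pose D := [set v (nat_of_ord t) | t : 'I_l.+1 & s'.+1 < t].
  have D_on : joined F D (nw s').1 (nw s').2.
    apply: joined_survives => //; first exact: swap_on.
    by move=> f /imsetP[t]; rewrite inE => st ->; apply: no_shortcut => //; rewrite leq_ord.
  have sub x y : joined F (v s'.+1 |: D) x y -> joined M' set0 x y.
    apply: joined_mono => e u w euw; rewrite !inE negb_or => /andP[ne eD].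
    exists (e, false); rewrite ?inE// /M' /= xpair_eqE negb_and ne /=; apply/stage_oldP; split=> //.
    move=> t st tl et; move/negP: eD; apply; apply/imsetP.
    by exists (Ordinal (tl : t < l.+1)); rewrite ?inE.
  have bridge : ~~ joined M' set0 a b.
    have : stage s'.+1 (v s'.+1, false) a b.
      apply/stage_oldP; split=> // t st tl /vinj; lia.
    move=> /IH; apply: contra; apply: joined_mono => e x y /andP[ne h] _.
    by exists e => //; rewrite inE.
  have off : ~~ joined F (v s'.+1 |: D) (nw s').1 (nw s').2.
    apply: contra (swap_off s'l); apply: joined_mono => e x y exy; rewrite !inE negb_or => /andP[h _].
    by exists e => //; rewrite inE.
  case: (joined_remove one fab D_on) => [h|[/sub h1 /sub h2]|[/sub h1 /sub h2]].
  - by rewrite h in off.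
  - move/negP: bridge; apply; rewrite joined_sym in h1; apply: (joined_trans h1).
    by apply: (joined_trans c); rewrite joined_sym.
  - move/negP: bridge; apply; apply: (joined_trans h2).
    by rewrite joined_sym in c; apply: (joined_trans c).
have nolab x y : ~~ M' (v s', true) x y.
  by apply/negP => /andP[_ /stage_newP[t [st tl /vinj h _]]]; lia.
have := forest_add one' nolab for' nw_off.
apply: (@forest_embed _ _ _ _ _ id) => // -[e []] x y.
  move=> /stage_newP[t [st tl -> exy]]; rewrite /add_edge /=.
  case: (eqVneq t s') => [ts|ts]; first by rewrite exy ts eqxx -surjective_pairing.
  rewrite xpair_eqE andbT; case: eqP => [/vinj h|_]; first by lia.
  apply/andP; split; first by rewrite xpair_eqE andbF.
  by apply/stage_newP; exists t; split=> //; lia.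
move=> /stage_oldP[h ne]; rewrite /add_edge /= xpair_eqE andbF; apply/andP; split.
  by rewrite xpair_eqE andbT; apply/eqP; apply: ne => //; lia.
by apply/stage_oldP; split=> // t st tl; apply: ne => //; lia.
Qed.

(** Stage 0 with the doubling of labels forgotten: a label on the path takes its new edge, any other
    keeps its old one. *)
Lemma forest_exchange (F' : L -> rel U) :
  (forall e x y, F' e x y -> (F e x y /\ forall t, t <= l -> e <> v t) \/
     exists t, [/\ t <= l, e = v t & (x, y) = nw t]) -> forest F'.
Proof.
move=> hF'; pose phi e := (e, [exists t : 'I_l.+1, e == v t]).
have inj : injective phi by move=> e e' [].
apply: (@forest_embed _ _ _ _ _ phi inj _ (forest_stage (leq0n l))) => e x y /hF'[[h ne]|[t [tl -> e2]]].
  rewrite /phi (_ : [exists _, _] = false); last first.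
    by apply/existsPn => t; apply/eqP; apply: ne; rewrite leq_ord.
  by apply/stage_oldP; split=> // t _; exact: ne.
rewrite /phi (_ : [exists _, _] = true); last first.
  by apply/existsP; exists (Ordinal (tl : t < l.+1)) => /=.
by apply/stage_newP; exists t.
Qed.
End Exchange.

Section ForestClasses.
Variables (U L : finType) (M : L -> rel U) (Z : {set U}).
Hypotheses (one : one_edge M) (for_ : forest M).
Hypothesis inZ : forall e x y, M e x y -> x \in Z /\ y \in Z.

Definition classes_of (D : {set L}) : {set {set U}} :=
  [set [set y | joined M D x y] | x in Z].

Lemma class_eq D x y : joined M D x y -> [set z | joined M D x z] = [set z | joined M D y z].
Proof.
move=> xy; apply/setP => z; rewrite !inE; apply/idP/idP; last exact: joined_trans.
by apply: joined_trans; rewrite joined_sym.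
Qed.

Lemma classes_of_remove (D : {set L}) f : f \in D -> (exists x y, M f x y) ->
  #|classes_of (D :\ f)| < #|classes_of D|.
Proof.
move=> fD [a [b fab]].
have [aZ bZ] := inZ fab.
have coarse x y : joined M D x y -> joined M (D :\ f) x y.
  by apply: joined_mono => e u v h eD; exists e => //; rewrite !inE (negPf eD) andbF.
pose g (C : {set U}) := \bigcup_(x in C) [set z | joined M (D :\ f) x z].
have gE x : g [set z | joined M D x z] = [set z | joined M (D :\ f) x z].
  apply/setP => z; apply/bigcupP/idP => [[y]|]; rewrite !inE.
    by move=> /coarse xy yz; exact: joined_trans yz.
  by move=> xz; exists x; rewrite !inE //; exact: connect0.
have -> : classes_of (D :\ f) = g @: classes_of D.
  by rewrite -imset_comp; apply: eq_imset => x /=; rewrite gE.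
rewrite ltn_neqAle leq_imset_card andbT; apply/negP => /imset_injP inj.
have ab : [set z | joined M D a z] = [set z | joined M D b z].
  apply: inj; [exact: imset_f|exact: imset_f|].
  by rewrite !gE; apply: class_eq; apply: joined_edge fab; rewrite !inE eqxx.
have : b \in [set z | joined M D a z] by rewrite ab inE; exact: connect0.
rewrite inE => jab; move/negP: (for_ fab); apply; apply: joined_mono jab => e u v h eD.
by exists e => //; rewrite inE; apply: contra eD => /eqP->.
Qed.

(** Every edge of a forest is a bridge, so each label in use splits a component when it is switched
    off. *)
Lemma classes_of_removes (D : {set L}) :
  #|classes_of set0| + #|[set f in D | [exists x, exists y, M f x y]]| <= #|classes_of D|.
Proof.
have [m] := ubnP #|D|; elim: m D => // m IH D hm.
have [|/set0Pn[f fD]] := eqVneq [set f in D | [exists x, exists y, M f x y]] set0.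
  move=> h; rewrite h cards0 addn0; apply/eq_leq; congr #|pred_of_set _|.
  apply: eq_imset => x; apply/setP => y; rewrite !inE; apply/idP/idP; apply: joined_mono => e u w euw _;
    exists e => //; rewrite ?inE//.
  apply/negP => eD; move/setP/(_ e): h; rewrite !inE eD /= => /negbT/existsPn/(_ u)/existsPn/(_ w).
  by rewrite euw.
move: fD; rewrite inE => /andP[fD /existsP[a /existsP[b fab]]].
have lt := classes_of_remove fD (ex_intro _ a (ex_intro _ b fab)).
have c1 : #|D :\ f| < m by move: hm; rewrite (cardsD1 f D) fD.
have := IH _ c1.
have -> : #|[set f in D | [exists x, exists y, M f x y]]| =
    #|[set g in D :\ f | [exists x, exists y, M g x y]]|.+1.
  rewrite (cardsD1 f) inE fD (_ : [exists x, _] = true) /=; last first.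
    by apply/existsP; exists a; apply/existsP; exists b.
  by rewrite add1n; congr _.+1; apply: eq_card => g; rewrite !inE andbA.
by move=> h; rewrite addnS; exact: leq_ltn_trans h lt.
Qed.
End ForestClasses.

(** * Maximal packings *)

Section StuckPacking.
Variables (n : nat) (T : {set 'I_n}) (A : rel 'I_n) (J : {set 'I_n}).
Notation V := 'I_n.
Notation L := (V * V)%type.
Notation U := (V * V)%type.

(* The element [(w, w)] is the non-terminal [w]; the element [(a, b)] with
   [a < b] is the edge between the terminals [a] and [b]. *)
Definition elt_inc (e : L) (x : V) : bool :=
  (x \in T) && (if e.1 == e.2 then (e.1 \notin T) && A e.1 x
   else [&& e.1 < e.2, e.1 \in T, e.2 \in T, A e.1 e.2 & (x == e.1) || (x == e.2)]).

(* Copy [i] of the terminal [x] is the vertex [(i, x)]. *)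
Definition elt_edge (e : L) : rel U := [rel u v |
  [&& u.1 == v.1, u.1 \in J, elt_inc e u.2, elt_inc e v.2 & u.2 != v.2]].

Variables (F : L -> rel U) (Q : {set L}).
Hypothesis Asym : symmetric A.
Hypothesis stable : forall p q, p \notin T -> q \notin T -> ~~ A p q.
Hypotheses (Fone : one_edge F) (Ffor : forest F).
Hypothesis Fedge : forall e u v, F e u v -> elt_edge e u v.
Hypothesis Qfree : forall e, (forall u v, ~~ F e u v) -> e \in Q.
Hypothesis Qon : forall e u v, e \in Q -> elt_edge e u v -> joined F set0 u v.
Hypothesis Qclosed : forall e f u v, e \in Q -> elt_edge e u v -> ~~ joined F [set f] u v -> f \in Q.

Definition shares : rel V := [rel x y | [exists e in Q, elt_inc e x && elt_inc e y]].

Lemma shares_sym : symmetric shares.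
Proof. by move=> x y; apply: eq_existsb => e; rewrite [elt_inc e x && _]andbC. Qed.

Definition part x := root shares x.
Definition parts : {set V} := [set part x | x in T].

Lemma partE x y : (part x == part y) = connect shares x y.
Proof. exact: root_connect (sym_connect_sym shares_sym) x y. Qed.

Lemma part_part x : part (part x) = part x.
Proof. exact: root_root (sym_connect_sym shares_sym) x. Qed.

Lemma shares_part e x y : e \in Q -> elt_inc e x -> elt_inc e y -> part x = part y.
Proof.
move=> eQ ex ey; apply/eqP; rewrite partE; apply: connect1; apply/existsP; exists e.
by rewrite eQ ex ey.
Qed.

(** A reached element has its terminals joined in [F], and every label on which this connection
    depends is reached as well. By [joined_survives] the connection remains when all labels outside
    [Q] are switched off together. *)
Lemma part_joined i x y : i \in J -> part x = part y -> joined F (~: Q) (i, x) (i, y).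
Proof.
move=> iJ /eqP; rewrite partE; apply: (@connect_homo _ _ _ _ (pair i)) => {}x {}y.
move=> /existsP[e /and3P[eQ ex ey]].
case: (eqVneq x y) => [->|xy]; first exact: connect0.
have exy : elt_edge e (i, x) (i, y) by rewrite /elt_edge /= eqxx iJ ex ey xy.
apply: joined_survives => //; first exact: Qon eQ exy.
move=> f; rewrite inE => fQ; apply: contraR fQ; exact: Qclosed eQ exy.
Qed.

Lemma joined_copy D u v : joined F D u v -> u.1 = v.1.
Proof.
move=> /connectP[p + ->]; elim: p u => //= w p IH u /andP[/existsP[e /andP[_ h]] /IH <-].
by case/orP: h => /Fedge/and5P[/eqP].
Qed.

Definition copies : {set U} := [set u | (u.1 \in J) && (u.2 \in T)].

(** Counts the components of the copies of [T] after switching off the labels outside [Q].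
    Beforehand there are at least [#|J| + 1], one copy being split; every label outside [Q] is in
    use and adds one; yet each part stays connected in each copy. *)
Lemma unassigned_bound i0 x0 y0 : i0 \in J -> x0 \in T -> y0 \in T ->
  ~~ joined F set0 (i0, x0) (i0, y0) -> #|~: Q| + #|J| + 1 <= #|J| * #|parts|.
Proof.
move=> i0J x0T y0T nj.
have inZ e u v : F e u v -> u \in copies /\ v \in copies.
  move=> /Fedge/and5P[/eqP uv uJ /andP[uT _] /andP[vT _] _]; rewrite !inE uJ uT vT -uv uJ.
  by [].
have := classes_of_removes Ffor inZ (~: Q).
have -> : [set f in ~: Q | [exists x, exists y, F f x y]] = ~: Q.
  apply/setP => f; rewrite !inE; case: (boolP (f \in Q)) => //= fQ; apply/existsP.
  have /existsP[u /existsP[v h]] : [exists u, exists v, F f u v]; last first.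
    by exists u; apply/existsP; exists v.
  apply: contraNT fQ => /existsPn no; apply: Qfree => u v.
  by have /existsPn := no u; apply.
have : #|classes_of F copies (~: Q)| <= #|J| * #|parts|.
  rewrite -cardsX; apply: leq_trans (leq_imset_card (fun u => [set v | joined F (~: Q) u v]) _).
  apply: subset_leq_card; apply/subsetP => _ /imsetP[[i x] + ->]; rewrite inE /= => /andP[iJ xT].
  apply/imsetP; exists (i, part x); first by rewrite in_setX iJ; exact: imset_f.
  by apply: class_eq; apply: part_joined; rewrite ?part_part.
have : #|J| + 1 <= #|classes_of F copies set0|.
  pose c (u : U) := [set v | joined F set0 u v].
  have cin u : u \in c u by rewrite inE; exact: connect0.
  have cJ i : i \in J -> c (i, x0) \in classes_of F copies set0.
    by move=> iJ; apply/imsetP; exists (i, x0); rewrite ?inE ?iJ.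
  have inj : injective (fun i => c (i, x0)).
    by move=> i i' h; have := cin (i', x0); rewrite -h inE => /joined_copy.
  have c0 : c (i0, y0) \notin [set c (i, x0) | i in J].
    apply/negP => /imsetP[i iJ h]; have := cin (i0, y0); rewrite h inE.
    by move=> /[dup] /joined_copy /= ->; rewrite (negPf nj).
  have <- : #|c (i0, y0) |: [set c (i, x0) | i in J]| = #|J| + 1.
    by rewrite cardsU1 c0 card_imset// addnC.
  apply: subset_leq_card; rewrite subUset sub1set; apply/andP; split.
    by apply/imsetP; exists (i0, y0); rewrite ?inE ?i0J.
  by apply/subsetP => _ /imsetP[i iJ ->]; exact: cJ.
move=> h1 h2 h3; apply: leq_trans (leq_trans _ h3) h2.
by rewrite -addnA addnC leq_add2r.
Qed.

Definition crossing : {set L} :=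
  [set e | [exists x, exists y, [&& elt_inc e x, elt_inc e y & part x != part y]]].

Lemma crossing_notin e : e \in crossing -> e \notin Q.
Proof.
rewrite inE => /existsP[x /existsP[y /and3P[ex ey xy]]]; apply: contra xy => eQ.
by rewrite (shares_part eQ ex ey).
Qed.

Definition touches (p : V) (e : L) : bool := [exists x, elt_inc e x && (part x == p)].

(** The bound is the connectivity across a cut around the part. Non-terminals that see terminals of
    the part and terminals outside are deleted, and every other one is placed so that no edge of its
    own crosses. The elements of this cut are crossing and touch [p]. *)
Lemma part_degree k p : elt_connected T A k -> 1 < #|parts| -> p \in parts ->
  k <= \sum_(e in crossing) touches p e.
Proof.
move=> /elt_connectedP conn r2 pp; have /imsetP[x0 x0T px0] := pp.
have [y0 y0T py0] : exists2 y, y \in T & part y != p.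
  apply/exists_inP; apply: contraTT r2 => /exists_inPn no; rewrite -leqNgt -(cards1 p).
  apply: subset_leq_card; apply/subsetP => _ /imsetP[y yT ->]; rewrite inE.
  by have := no y yT; rewrite negbK.
pose inn w := [exists x in T, A w x && (part x == p)].
pose out w := [exists x in T, A w x && (part x != p)].
pose X := [set x | if x \in T then part x == p else ~~ out x].
pose Y := [set x | if x \in T then part x != p else out x && ~~ inn x].
have sep : separates T X Y.
  apply/and4P; split.
  - rewrite -setI_eq0; apply/eqP/setP => x; rewrite !inE; case: (x \in T); first by rewrite andbN.
    by case: (out x).
  - by apply/subsetP => x xT; rewrite !inE xT orbN.
  - by apply/set0Pn; exists x0; rewrite !inE x0T px0 eqxx.
  - by apply/set0Pn; exists y0; rewrite !inE y0T py0.
apply: (leq_trans (conn _ _ sep)); rewrite -card_cut_elements.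
have -> : \sum_(e in crossing) touches p e = #|[set e in crossing | touches p e]|.
  by rewrite -sum1_card big_mkcond [RHS]big_mkcond; apply: eq_bigr => e _; rewrite inE; case: (e \in _); case: touches.
have XY x y : x \in X -> y \in Y -> A x y -> [/\ x \in T, y \in T, part x = p & part y != p].
  rewrite !inE => hx hy xy.
  case: (boolP (x \in T)) hx => xT hx; case: (boolP (y \in T)) hy => yT hy.
  - by split=> //; exact/eqP.
  - case/andP: hy => _ /existsPn/(_ x); rewrite xT Asym xy hx.
    by [].
  - by move/existsPn/(_ y): hx; rewrite yT xy hy.
  - by move: (stable xT yT); rewrite xy.
(* An edge between terminals is named with its smaller end first. Names of distinct elements of the
   cut differ because one end lies in the part and the other does not. *)
pose f (z : V + V * V) : L := match z with inl w => (w, w)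
  | inr xy => if xy.1 < xy.2 then xy else (xy.2, xy.1) end.
have fP z : z \in cut_elements A X Y -> f z \in [set e in crossing | touches p e].
  case: z => [w|[x y]]; rewrite inE /=.
    rewrite !inE; case: (boolP (w \in T)) => wT; first by case: eqP.
    rewrite negbK negb_and negbK => /andP[wo]; rewrite wo /= => /existsP[x /and3P[xT wx px]].
    have /existsP[y /and3P[yT wy py]] := wo.
    have ix : elt_inc (w, w) x by rewrite /elt_inc /= eqxx xT wT.
    have iy : elt_inc (w, w) y by rewrite /elt_inc /= eqxx yT wT.
    apply/andP; split; last by apply/existsP; exists x; rewrite ix.
    by apply/existsP; exists x; apply/existsP; exists y; rewrite ix iy (eqP px) eq_sym.
  move=> /and3P[xX yY xy]; have [xT yT px py] := XY x y xX yY xy.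
  have nxy : x != y by apply: contraNneq py => <-; rewrite px.
  have [e [-> ix iy]] : exists e, [/\ (if x < y then (x, y) else (y, x)) = e, elt_inc e x & elt_inc e y].
    case: ltnP => lt; [exists (x, y)|exists (y, x)]; split=> //; rewrite /elt_inc /= ?xT ?yT.
    - by rewrite (negPf nxy) lt xy eqxx.
    - by rewrite (negPf nxy) lt xy eqxx orbT.
    - by rewrite eq_sym (negPf nxy) ltn_neqAle lt Asym xy eqxx orbT eq_sym (inj_eq val_inj) nxy.
    - by rewrite eq_sym (negPf nxy) ltn_neqAle lt Asym xy eqxx eq_sym (inj_eq val_inj) nxy.
  rewrite !inE; apply/andP; split; last by apply/existsP; exists x; rewrite ix px eqxx.
  by apply/existsP; exists x; apply/existsP; exists y; rewrite ix iy px eq_sym.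
rewrite -(card_in_imset (f := f) (D := cut_elements A X Y)).
  by apply: subset_leq_card; apply/subsetP => _ /imsetP[z zc ->]; exact: fP.
have two z x y : z = inr (x, y) -> z \in cut_elements A X Y -> [/\ part x = p, part y != p & x != y].
  move=> ->; rewrite inE /= => /and3P[xX yY xy]; have [xT yT px py] := XY x y xX yY xy.
  by split=> //; apply: contraNneq py => <-; rewrite px.
have fsplit x y : f (inr (x, y)) = (x, y) \/ f (inr (x, y)) = (y, x).
  by rewrite /f /=; case: ifP; [left|right].
move=> [w|[x y]] [w'|[x' y']] h1 h2.
- by case=> ->.
- have [_ _ nxy] := two _ _ _ erefl h2.
  by case: (fsplit x' y') => -> [e1 e2]; rewrite -e1 -e2 eqxx in nxy.
- have [_ _ nxy] := two _ _ _ erefl h1.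
  by case: (fsplit x y) => -> [e1 e2]; rewrite e1 e2 eqxx in nxy.
- have [px py _] := two _ _ _ erefl h1; have [px' py' _] := two _ _ _ erefl h2.
  case: (fsplit x y) => ->; case: (fsplit x' y') => -> [e1 e2]; subst => //.
  + by rewrite px' eqxx in py.
  + by rewrite px eqxx in py'.
Qed.

Variables (N : finType) (inc : rel N) (tm : V -> N) (beta : L -> {set N}).
Hypothesis inc_sym : symmetric inc.
Hypothesis tm_inj : injective tm.
Hypothesis beta_conn : forall e x, elt_inc e x -> connected_in inc (beta e).
Hypothesis beta_disj : forall e f x y, elt_inc e x -> elt_inc f y -> e != f -> [disjoint beta e & beta f].
Hypothesis beta_adj : forall e x, elt_inc e x -> exists2 z, z \in beta e & inc (tm x) z.
Hypothesis beta_tm : forall e x, x \in T -> tm x \notin beta e.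

Definition branch (z : V + L) : {set N} := match z with
  | inl p => [set tm x | x in T & part x == p] :|:
             \bigcup_(e in Q | touches p e) beta e
  | inr e => beta e end.

Definition branch_index : {set V + L} :=
  [set z | match z with inl p => p \in parts | inr e => e \in crossing end].

Definition branch_adj : rel (V + L)%type := fun z z' => match z, z' with
  | inl p, inr e | inr e, inl p => touches p e | _, _ => false end.

Lemma sum_branch_index (g : V + L -> nat) :
  \sum_(z in branch_index) g z = \sum_(p in parts) g (inl p) + \sum_(e in crossing) g (inr e).
Proof.
rewrite big_mkcond big_sumType /=; congr (_ + _); rewrite [RHS]big_mkcond;
by apply: eq_bigr => z _; rewrite inE.
Qed.

(** The branch sets are disjoint because an element of [Q] touches only one part and a crossing
    element is not in [Q]. *)
Lemma branch_model : minor_model inc branch_index branch_adj branch.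
Proof.
have tmB x : x \in T -> tm x \in branch (inl (part x)).
  by move=> xT; rewrite inE; apply/orP; left; apply: imset_f; rewrite inE xT eqxx.
have betaB e p : e \in Q -> touches p e -> beta e \subset branch (inl p).
  by move=> eQ te; apply: subset_trans (subsetUr _ _); apply: bigcup_sup; rewrite eQ.
split.
- move=> [p|e]; rewrite inE; last by rewrite inE => /existsP[x /existsP[y /and3P[ex _ _]]]; exact: beta_conn ex.
  case/imsetP => x0 x0T ->; set p' := part x0.
  set B := branch (inl p').
  pose R := [rel u v | [&& u \in B, v \in B & inc u v]].
  have Rsym : symmetric R by move=> u v; rewrite /R /= inc_sym andbCA.
  have step e x : e \in Q -> elt_inc e x -> part x = p' -> forall z, z \in beta e -> connect R (tm x) z.
    move=> eQ ex px z ze; have [z0 z0e xz0] := beta_adj ex.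
    have te : touches p' e by apply/existsP; exists x; rewrite ex px eqxx.
    have xT : x \in T by case/andP: ex.
    apply: (@connect_trans _ _ z0).
      apply: connect1; have := tmB x xT; rewrite px /R /= xz0 => ->.
      by rewrite (subsetP (betaB _ _ eQ te)).
    have [_ /(_ z0 z z0e ze)] := beta_conn ex; apply: connect_sub => u v /and3P[ue ve uv].
    by apply: connect1; rewrite /R /= uv !(subsetP (betaB _ _ eQ te)).
  have link x y : shares x y -> part x = p' -> connect R (tm x) (tm y).
    move=> /existsP[e /and3P[eQ ex ey]] px; have [z ze _] := beta_adj ex.
    have py : part y = p' by rewrite -px; apply: shares_part eQ ey ex.
    apply: connect_trans (step e x eQ ex px z ze) _.
    by rewrite (sym_connect_sym Rsym); exact: step py _ ze.
  have toroot x : x \in T -> part x = p' -> connect R (tm x) (tm x0).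
    move=> xT px; have /connectP[q qp ->] : connect shares x x0 by rewrite -partE px.
    elim: q x px qp {xT} => [|y q IH] x px /=; first by move=> _; exact: connect0.
    move=> /andP[xy qp]; apply: connect_trans (link _ _ xy px) (IH y _ qp).
    by rewrite -px; apply/eqP; rewrite eq_sym partE; exact: connect1.
  have all0 z : z \in B -> connect R z (tm x0).
    rewrite inE => /orP[/imsetP[x]|/bigcupP[e /andP[eQ /existsP[x /andP[ex /eqP px]]] ze]].
      by rewrite inE => /andP[xT /eqP px] ->; exact: toroot.
    apply: (@connect_trans _ _ (tm x)); last by apply: toroot => //; case/andP: ex.
    by rewrite (sym_connect_sym Rsym); exact: step px _ ze.
  split; first by apply/set0Pn; exists (tm x0); exact: tmB.
  move=> u v uB vB; apply: connect_trans (all0 u uB) _.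
  by rewrite (sym_connect_sym Rsym); exact: all0.
- have Bdis p e f y : e \in Q -> touches p e -> elt_inc f y -> e != f -> [disjoint beta e & beta f].
    by move=> eQ /existsP[x /andP[ex _]] fy; exact: beta_disj ex fy.
  have tmdis x e z : x \in T -> z = tm x -> z \in beta e -> False.
    by move=> xT ->; rewrite (negPf (beta_tm e xT)).
  have pe p e y : elt_inc e y -> e \in crossing -> [disjoint branch (inl p) & beta e].
    move=> ey ec; rewrite -setI_eq0; apply/eqP/setP => z; rewrite !inE; apply/negbTE/negP.
    case/andP => /orP[/imsetP[x + zx]|/bigcupP[f /andP[fQ fp] zf]].
      by rewrite inE => /andP[xT _] ze; exact: tmdis zx ze.
    move=> ze.
    have fe : f != e by apply: contraTneq fQ => ->; exact: crossing_notin.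
    by have := Bdis _ _ _ _ fQ fp ey fe => /disjoint_setI0/setP/(_ z); rewrite !inE zf ze.
  move=> [p|e] [p'|e']; rewrite !inE => h h' nzz'.
  + rewrite -setI_eq0; apply/eqP/setP => z; rewrite !inE; apply/negbTE/negP.
    have npp' : p != p' by apply: contraNneq nzz' => ->.
    case/andP => /orP[/imsetP[x xin zx]|/bigcupP[f /andP[fQ fp] zf]] /orP[/imsetP[x' x'in zx']|/bigcupP[f' /andP[fQ' fp'] zf']].
    * move: xin x'in; rewrite !inE => /andP[xT /eqP px] /andP[x'T /eqP px'].
      have xx' : x = x' by apply: tm_inj; rewrite -zx.
      by rewrite -px -px' xx' eqxx in npp'.
    * by move: xin; rewrite inE => /andP[xT _]; exact: tmdis zx zf'.
    * by move: x'in; rewrite inE => /andP[xT _]; exact: tmdis zx' zf.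
    * case: (eqVneq f f') => [ff'|ff'].
        case/existsP: fp => x /andP[fx /eqP px]; case/existsP: fp' => x' /andP[fx' /eqP px'].
        by move: npp'; rewrite -px -px' (shares_part fQ fx (y := x')) ?ff'// eqxx.
      case/existsP: (fp') => y /andP[fy _].
      by have := Bdis _ _ _ _ fQ fp fy ff' => /disjoint_setI0/setP/(_ z); rewrite !inE zf zf'.
  + by case/existsP: (h') => y /existsP[? /and3P[ey _ _]]; apply: pe ey _; rewrite inE.
  + by case/existsP: (h) => y /existsP[? /and3P[ey _ _]]; rewrite disjoint_sym; apply: pe ey _; rewrite inE.
  + case/existsP: h => x /existsP[? /and3P[ex _ _]]; case/existsP: h' => y /existsP[? /and3P[ey _ _]].
    by apply: beta_disj ex ey _; apply: contraNneq nzz' => ->.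
- have link p e : touches p e -> exists x y, [/\ x \in branch (inl p), y \in beta e & inc x y].
    case/existsP => x /andP[ex /eqP <-]; have [z ze xz] := beta_adj ex.
    by exists (tm x), z; split=> //; apply: tmB; case/andP: ex.
  move=> [p|e] [p'|e'] _ _ _ //= /link// [x [y [xb yb xy]]].
  by exists y, x; rewrite inc_sym.
Qed.

(** With [r] parts and [c] crossing elements, [unassigned_bound] gives [c <= #|J| * (r - 1) - 1] and
    [part_degree] gives at least [r * (5 * #|J| + 1)] edges. As [r] is at least two, this exceeds
    [3 * (r + c - 1)], the bound of [dense_minor_K5]. *)
Theorem stuck_packing_K5 i0 x0 y0 : elt_connected T A (5 * #|J| + 1) ->
  i0 \in J -> x0 \in T -> y0 \in T -> ~~ joined F set0 (i0, x0) (i0, y0) ->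
  exists B, K5_model inc B.
Proof.
move=> conn i0J x0T y0T nj.
have bound := unassigned_bound i0J x0T y0T nj.
have j0 : 0 < #|J| by apply/card_gt0P; exists i0.
have r2 : 1 < #|parts| by move: bound; nia.
have cQ : #|crossing| <= #|~: Q|.
  by apply: subset_leq_card; apply/subsetP => e /crossing_notin; rewrite inE.
apply: (@dense_minor_K5 N _ inc branch_index branch_adj branch).
- by move=> [p|e] [p'|e'].
- by move=> [p|e].
- exact: branch_model.
- have /card_gt0P[p pp] := ltnW r2; apply/set0Pn; exists (inl p); rewrite inE; exact: pp.
have -> : #|branch_index| = #|parts| + #|crossing|.
  by rewrite -!sum1_card sum_branch_index.
have -> : arcs_in branch_index branch_adj = 2 * \sum_(p in parts) \sum_(e in crossing) touches p e.
  rewrite /arcs_in sum_branch_index mul2n -addnn; congr (_ + _).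
    by apply: eq_bigr => p _; rewrite /degree_in sum_branch_index /= big1 ?add0n.
  rewrite [RHS]exchange_big; apply: eq_bigr => e _; rewrite /degree_in sum_branch_index /=.
  by rewrite [X in _ + X]big1 ?addn0.
have : #|parts| * (5 * #|J| + 1) <= \sum_(p in parts) \sum_(e in crossing) touches p e.
  rewrite -sum_nat_const; apply: leq_sum => p pp; exact: part_degree.
by move: bound cQ j0 r2; nia.
Qed.
End StuckPacking.

(** * Trees made of routes *)

Lemma edgesP (V : finType) (G : sgraph V) (B : {set V}) :
  reflect (exists a b, G a b /\ B = [set a; b]) (B \in edges G).
Proof.
apply: (iffP imsetP) => [[[a b]]|[a [b [Gab ->]]]]; first by rewrite inE /= => Gab ->; exists a, b.
by exists (a, b); rewrite ?inE.
Qed.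

Lemma pair_in_edges (V : finType) (G : sgraph V) a b : G a b -> [set a; b] \in edges G.
Proof. by move=> Gab; apply/edgesP; exists a, b. Qed.

Lemma set2_eq (V : finType) (a b c d : V) : [set a; b] = [set c; d] ->
  (a = c /\ b = d) \/ (a = d /\ b = c).
Proof.
move=> E; have /set2P ha : a \in [set c; d] by rewrite -E set21.
have /set2P hb : b \in [set c; d] by rewrite -E set22.
have /set2P hc : c \in [set a; b] by rewrite E set21.
have /set2P hd : d \in [set a; b] by rewrite E set22.
by case: ha => ?; case: hb => ?; case: hc => ?; case: hd => ?;
  first [by left; split; congruence | by right; split; congruence].
Qed.

Section Routes.
Variables (V I L : finType) (G : sgraph V) (T : {set V}).
(** A label [e] in use is realized in copy [cp e] by a simple path of [G], with vertices [f e 0] to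
    [f e (l e)]. It joins two terminals, and its inner vertices are non-terminals that lie on no
    other route. *)
Variables (on : pred L) (cp : L -> I) (l : L -> nat) (f : L -> nat -> V).
Variables (F : L -> rel (I * V)) (BE : I -> rel V) (i : I).
Hypothesis ends : forall e, on e -> [/\ 0 < l e, f e 0 \in T & f e (l e) \in T].
Hypothesis finj : forall e j k, on e -> j <= l e -> k <= l e -> f e j = f e k -> j = k.
Hypothesis fadj : forall e j, on e -> j < l e -> G (f e j) (f e j.+1).
Hypothesis inner : forall e j, on e -> 0 < j < l e -> f e j \notin T.
Hypothesis inner_uniq : forall e e' j j', on e -> on e' -> 0 < j < l e -> 0 < j' < l e' ->
  f e j = f e' j' -> e = e'.
Hypothesis FP : forall e u v, F e u v <-> [/\ on e, u = (cp e, f e 0) & v = (cp e, f e (l e))].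
Hypothesis Ffor : forest F.
Hypothesis BEP : forall i a b, BE i a b <-> exists e j, [/\ on e, cp e = i, j < l e &
  (a, b) = (f e j, f e j.+1) \/ (a, b) = (f e j.+1, f e j)].

Definition route_tree i : subgraph V :=
  (T :|: [set x | [exists y, BE i x y]], [set [set u.1; u.2] | u : V * V & BE i u.1 u.2]).

Lemma BE_sym j : symmetric (BE j).
Proof.
move=> a b; apply/idP/idP => /BEP[e [k [h1 h2 h3 h4]]]; apply/BEP; exists e, k; split=> //;
by case: h4 => -[-> ->]; [right|left].
Qed.

Lemma BE_irr j x : ~~ BE j x x.
Proof.
apply/negP => /BEP[e [k [oe _ kl h]]]; have E : f e k = f e k.+1 by case: h => -[<- <-].
have := fadj oe kl; by rewrite E adj_irr.
Qed.

Lemma route_edgeP j (B : {set V}) : reflect (exists e k, [/\ on e, cp e = j, k < l e & B = [set f e k; f e k.+1]])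
  (B \in sub_edges (route_tree j)).
Proof.
apply: (iffP imsetP) => [[[a b]]|[e [k [oe ce kl ->]]]].
  rewrite inE /= => /BEP[e [k [oe ce kl h]]] ->; exists e, k; split=> //.
  by case: h => -[-> ->]//; rewrite setUC.
exists (f e k, f e k.+1) => //; rewrite inE /=; apply/BEP; exists e, k; split=> //; by left.
Qed.

Lemma sub_adj_route j : sub_adj (route_tree j) =2 BE j.
Proof.
move=> x y; rewrite /sub_adj; apply/idP/idP => [/andP[xy /imsetP[[a b]]]|xy].
  by rewrite inE /= => ab /set2_eq[[-> ->]//|[-> ->]]; rewrite BE_sym.
apply/andP; split; first by apply: contraTneq xy => ->; exact: BE_irr.
by apply/imsetP; exists (x, y); rewrite ?inE.
Qed.

Lemma nonterminal_inner e j : on e -> j <= l e -> f e j \notin T -> 0 < j < l e.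
Proof.
move=> oe jl nT; have [l0 t0 tl] := ends oe.
case: j jl nT => [|j] jl nT; first by rewrite t0 in nT.
by rewrite /= ltn_neqAle jl andbT; apply: contraNneq nT => ->.
Qed.

Lemma terminal_end e j : on e -> j <= l e -> f e j \in T -> j = 0 \/ j = l e.
Proof.
move=> oe jl jT; case: (posnP j) => [|j0]; [by left|right]; apply/eqP; rewrite eqn_leq jl /= leqNgt.
by apply: contraL jT => jl'; apply: inner; rewrite // j0.
Qed.

Lemma route_verts j x : x \in sub_verts (route_tree j) <->
  x \in T \/ exists e k, [/\ on e, cp e = j, k <= l e & x = f e k].
Proof.
rewrite inE [_ \in [set _ | _]]inE; split.
  case/orP => [|/existsP[y /BEP[e [k [oe ce kl h]]]]]; [by left|right].
  by case: h => -[-> _]; exists e; [exists k|exists k.+1]; split=> //; exact: ltnW.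
case=> [->//|[e [k [oe ce kl ->]]]]; apply/orP; right; apply/existsP.
have [l0 _ _] := ends oe.
case: k kl => [|k] kl; first by exists (f e 1); apply/BEP; exists e, 0; split=> //; left.
by exists (f e k); apply/BEP; exists e, k; split=> //; right.
Qed.

Section Bridge.
Variables (e : L) (j : nat).
Hypotheses (oe : on e) (ce : cp e = i) (jl : j < l e).

(** The vertices that stay with [f e 0] when edge [j] of route [e] is removed. On terminals this is
    connectivity in the forest without [e]; every other route lies on one side as a whole. *)
Definition side (z : V) : Prop :=
  (z \in T /\ joined F [set e] (i, f e 0) (i, z)) \/
  (z \notin T /\ ((exists2 k, k <= j & z = f e k) \/
    exists e' k, [/\ e' <> e, on e', cp e' = i, 0 < k < l e' & z = f e' k /\
      joined F [set e] (i, f e 0) (i, f e' 0)])).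

Lemma not_joined_ends : ~~ joined F [set e] (i, f e 0) (i, f e (l e)).
Proof. by apply: Ffor; apply/FP; rewrite ce. Qed.

Lemma side_on k : k <= l e -> side (f e k) <-> k <= j.
Proof.
move=> kl; have [l0 t0 tl] := ends oe.
have [tk|ntk] := boolP (f e k \in T).
  have [k0|kL] := terminal_end oe kl tk.
  - by rewrite k0 leq0n; split=> // _; left; rewrite t0; split=> //; exact: connect0.
  - rewrite kL leqNgt jl; split=> // -[[_ h]|[+ _]]; last by rewrite tl.
    by rewrite (negPf not_joined_ends) in h.
have kin := nonterminal_inner oe kl ntk.
split=> [[[h _]|[_ [[k' k'j E]|[e' [k' [ne oe' _ k'l [E _]]]]]]]|kj].
- by rewrite h in ntk.
- by rewrite (finj oe kl _ E)//; exact: leq_trans k'j (ltnW jl).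
- by case: ne; apply/esym; exact: (inner_uniq oe oe' kin k'l E).
- by right; split=> //; left; exists k.
Qed.

Lemma side_off e' k : e' <> e -> on e' -> cp e' = i -> k <= l e' ->
  side (f e' k) <-> joined F [set e] (i, f e 0) (i, f e' 0).
Proof.
move=> ne oe' ce' kl; have [l0 t0 tl] := ends oe'.
have jj : joined F [set e] (i, f e' 0) (i, f e' (l e')).
  by apply: (@joined_edge _ _ _ _ e'); [rewrite inE; apply/eqP|apply/FP; rewrite ce'].
have [tk|ntk] := boolP (f e' k \in T).
  have tE (z : V) : z \in T -> side z <-> joined F [set e] (i, f e 0) (i, z).
    by move=> zT; split=> [[[]//|[]]|h]; [rewrite zT|left].
  have [->|->] := terminal_end oe' kl tk; first exact: tE.
  split=> [/(tE _ tl) h|h]; [|apply/(tE _ tl)]; apply: joined_trans h _ => //; by rewrite joined_sym.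
have kin := nonterminal_inner oe' kl ntk.
split=> [[[h _]|[_ [[k' k'j E]|[e2 [k' [ne2 oe2 _ k'l [E h]]]]]]]|h].
- by rewrite h in ntk.
- case: ne; apply: (inner_uniq oe' oe kin _ E).
  by apply: (nonterminal_inner oe); [exact: leq_trans k'j (ltnW jl)|rewrite -E].
- by rewrite (inner_uniq oe' oe2 kin k'l E).
- by right; split=> //; right; exists e', k.
Qed.

Lemma bridge x y : [set x; y] = [set f e j; f e j.+1] ->
  ~ connect [rel u v | BE i u v && ([set u; v] != [set x; y])] x y.
Proof.
move=> E; have inv u v : connect [rel u v | BE i u v && ([set u; v] != [set x; y])] u v -> side u <-> side v.
  case/connectP => p + ->; elim: p u => //= w p IH u /andP[/andP[/BEP[e' [k [oe' ce' kl h]]] ne] /IH <-].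
  have EE : [set u; w] = [set f e' k; f e' k.+1] by case: h => -[-> ->] //; rewrite setUC.
  suff ss : side (f e' k) <-> side (f e' k.+1) by case: h => -[-> ->]; [|symmetry].
  have [ee|nee] := eqVneq e' e.
    subst e'; have : k != j by apply: contraNneq ne => kj; rewrite EE E kj.
    have h1 := side_on (ltnW kl); have h2 := side_on kl.
    by move=> kj; split=> [/h1 k1|/h2 k2]; [apply/h2|apply/h1]; lia.
  have nee' : e' <> e by exact/eqP.
  have h1 := side_off nee' oe' ce' (ltnW kl); have h2 := side_off nee' oe' ce' kl.
  by split=> [/h1 k1|/h2 k2]; [apply/h2|apply/h1].
move=> /inv; have s1 := (side_on (ltnW jl)).2 (leqnn j).
have s2 : ~ side (f e j.+1) by move=> /(side_on jl); rewrite ltnn.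
by case: (set2_eq E) => -[-> ->]; tauto.
Qed.
End Bridge.

Lemma route_segment e k : on e -> cp e = i -> k <= l e -> connect (BE i) (f e 0) (f e k).
Proof.
move=> oe ce; elim: k => [_|k IH kl]; first exact: connect0.
apply: connect_trans (IH (ltnW kl)) _; apply: connect1; apply/BEP; exists e, k; split=> //; by left.
Qed.

(** A cycle would join the ends of one of its edges without that edge, but [bridge] makes every edge
    of the tree a bridge. *)
Lemma route_acyclic : is_acyclic (route_tree i).
Proof.
move=> c; rewrite /ucycle; case: c => [|x [|y [|z c]]]// _ /andP[cyc un].
have {}cyc : cycle (BE i) [:: x, y, z & c] by rewrite -(eq_cycle (sub_adj_route i)).
have /andP[xy pth] : BE i x y && path (BE i) y (rcons (z :: c) x) := cyc.
have /BEP[e [j [oe ce jl h]]] := xy.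
have E : [set x; y] = [set f e j; f e j.+1] by case: h => -[-> ->]//; rewrite setUC.
apply: (bridge oe ce jl E); set R := (X in connect X).
have Rsym : symmetric R by move=> u v; rewrite /R /= BE_sym [[set v; u]]setUC.
have neq u v : (u != x) && (u != y) -> [set u; v] != [set x; y].
  move=> /andP[ux uy]; apply/eqP => /setP/(_ u); by rewrite !inE eqxx (negPf ux) (negPf uy).
have step q u : path (BE i) u (rcons q x) -> all (fun w => (w != x) && (w != y)) q ->
    (q != [::]) || (u != x) && (u != y) -> path R u (rcons q x).
  elim: q u => [|w q IH] u /=; first by rewrite /R /= !andbT => -> _ hu; rewrite neq.
  move=> /andP[uw pw] /andP[hw hq] _; rewrite {1}/R /= uw setUC neq//=.
  by apply: IH => //; rewrite hw orbT.
have {}pth := step _ _ pth _ isT.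
rewrite (sym_connect_sym Rsym); apply/connectP; exists (rcons (z :: c) x); last by rewrite last_rcons.
apply: pth; apply/allP => w wc; move: un; rewrite [uniq _]/= in_cons negb_or => /and3P[/andP[xy' xc] yc _].
by apply/andP; split; [apply: contraNneq xc => <-|apply: contraNneq yc => <-].
Qed.

Lemma route_connected t0 : t0 \in T -> (forall x, x \in T -> joined F set0 (i, x) (i, t0)) ->
  is_connected (route_tree i).
Proof.
move=> t0T conn; split; first by apply/set0Pn; exists t0; apply/route_verts; left.
have BEc x y : connect (sub_adj (route_tree i)) x y = connect (BE i) x y.
  exact: eq_connect (sub_adj_route i) x y.
have seg u v : joined F set0 u v -> u.1 = i -> connect (BE i) u.2 v.2.
  case/connectP => p + ->; elim: p u => [|w p IH] u /=; first by move=> _ _; exact: connect0.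
  move=> /andP[/existsP[e /andP[_ h]] pw] ui.
  suff [h1 h2] : w.1 = i /\ connect (BE i) u.2 w.2 by apply: connect_trans h2 (IH _ pw h1).
  case/orP: h => /FP[oe uE wE].
    have ce : cp e = i by rewrite -ui uE.
    by rewrite wE uE; split=> //=; exact: route_segment.
  have ce : cp e = i by rewrite -ui wE.
  rewrite uE wE; split=> //=; rewrite (sym_connect_sym (@BE_sym i)); exact: route_segment.
have hub x : x \in sub_verts (route_tree i) -> connect (BE i) x t0.
  case/route_verts => [xT|[e [k [oe ce kl ->]]]]; first exact: (seg (i, x) (i, t0) (conn x xT)).
  have [_ t0' _] := ends oe.
  apply: (connect_trans _ (seg (i, f e 0) (i, t0) (conn _ t0') erefl)).
  rewrite (sym_connect_sym (@BE_sym i)); exact: route_segment.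
move=> x y /hub xt /hub yt; rewrite BEc; apply: connect_trans xt _.
by rewrite (sym_connect_sym (@BE_sym i)).
Qed.

Lemma route_subgraph : is_subgraph G (route_tree i).
Proof.
apply/andP; split.
  apply/subsetP => B /route_edgeP[e [k [oe _ kl ->]]]; apply: pair_in_edges; exact: fadj.
apply/forallP => B; apply/implyP => /route_edgeP[e [k [oe ce kl ->]]].
by apply/subsetP => x /set2P[]->; apply/route_verts; right; exists e; [exists k|exists k.+1]; split=> //; exact: ltnW.
Qed.

Lemma inner_vertex x : x \in sub_verts (route_tree i) -> x \notin T ->
  exists e k, [/\ on e, cp e = i, 0 < k < l e & x = f e k].
Proof.
case/route_verts => [->//|[e [k [oe ce kl ->]]]] nT; exists e, k; split=> //.
exact: nonterminal_inner.
Qed.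

Lemma route_degree x : x \in sub_verts (route_tree i) -> x \notin T -> sub_degree (route_tree i) x = 2.
Proof.
move=> xv xT; have [e [k [oe ce kl xE]]] := inner_vertex xv xT; subst x.
case: k kl xv xT => [//|k] /= kl _ xT.
rewrite /sub_degree; have -> : [set A in sub_edges (route_tree i) | f e k.+1 \in A] =
    [set [set f e k; f e k.+1]; [set f e k.+1; f e k.+2]].
  apply/setP => A; rewrite inE; apply/andP/set2P => [[/route_edgeP[e' [m [oe' ce' ml ->]]]]|].
    move=> /set2P[E|E].
      have m_in : 0 < m < l e' by apply: nonterminal_inner; rewrite -?E// ltnW.
      have ee := (@inner_uniq e e' k.+1 _ oe oe' kl m_in E); subst e'.
      by have <- := finj oe (ltnW kl) (ltnW ml) E; right.
    have m_in : 0 < m.+1 < l e' by apply: nonterminal_inner; rewrite -?E.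
    have ee := (@inner_uniq e e' k.+1 _ oe oe' kl m_in E); subst e'.
    by have [<-] := finj oe (ltnW kl) ml E; left.
  case=> ->; rewrite ?set21 ?set22; split=> //; apply/route_edgeP.
    by exists e, k; split=> //; exact: ltnW.
  by exists e, k.+1.
rewrite cards2; case: eqP => // /set2_eq[[E1 E2]|[E1 _]].
  by have := finj oe (ltnW (ltnW kl)) (ltnW kl) E1; lia.
by have := finj oe (ltnW (ltnW kl)) kl E1; lia.
Qed.

Lemma steiner_route t0 : t0 \in T -> (forall x, x \in T -> joined F set0 (i, x) (i, t0)) ->
  steiner_tree G T (route_tree i).
Proof.
move=> t0T conn; split; [exact: route_subgraph|exact: route_connected conn|exact: route_acyclic|].
by apply/subsetP => x xT; apply/route_verts; left.
Qed.
End Routes.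

Section RoutesDisjoint.
Variables (V I L : finType) (T : {set V}).
Variables (on : pred L) (cp : L -> I) (l : L -> nat) (f : L -> nat -> V) (BE : I -> rel V).
Hypothesis ends : forall e, on e -> [/\ 0 < l e, f e 0 \in T & f e (l e) \in T].
Hypothesis inner : forall e j, on e -> 0 < j < l e -> f e j \notin T.
Hypothesis inner_uniq : forall e e' j j', on e -> on e' -> 0 < j < l e -> 0 < j' < l e' ->
  f e j = f e' j' -> e = e'.
Hypothesis short_uniq : forall e e', on e -> on e' -> l e = 1 -> l e' = 1 ->
  [set f e 0; f e 1] = [set f e' 0; f e' 1] -> e = e'.
Hypothesis BEP : forall i a b, BE i a b <-> exists e j, [/\ on e, cp e = i, j < l e &
  (a, b) = (f e j, f e j.+1) \/ (a, b) = (f e j.+1, f e j)].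

(** A non-terminal end of the edge determines the route. An edge between two terminals is a whole
    route of length one, and there [short_uniq] decides. *)
Lemma route_edge_uniq e e' k k' : on e -> on e' -> k < l e -> k' < l e' ->
  [set f e k; f e k.+1] = [set f e' k'; f e' k'.+1] -> e = e'.
Proof.
move=> oe oe' kl kl' E.
have common x : x \notin T -> x \in [set f e k; f e k.+1] -> e = e'.
  move=> xT xA; have xA' := xA; rewrite E in xA'.
  have [m [ml xm]] : exists m, m <= l e /\ x = f e m.
    by case/set2P: xA => ->; [exists k|exists k.+1]; split=> //; exact: ltnW.
  have [m' [ml' xm']] : exists m, m <= l e' /\ x = f e' m.
    by case/set2P: xA' => ->; [exists k'|exists k'.+1]; split=> //; exact: ltnW.
  apply: (@inner_uniq e e' m m') => //; last by rewrite -xm.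
    by apply: (nonterminal_inner ends oe ml); rewrite -xm.
  by apply: (nonterminal_inner ends oe' ml'); rewrite -xm'.
have [aT|/common] := boolP (f e k \in T); last by apply; rewrite set21.
have [bT|/common] := boolP (f e k.+1 \in T); last by apply; rewrite set22.
have [cT dT] : f e' k' \in T /\ f e' k'.+1 \in T by case: (set2_eq E) => -[<- <-].
have short e2 k2 : on e2 -> k2 < l e2 -> f e2 k2 \in T -> f e2 k2.+1 \in T -> k2 = 0 /\ l e2 = 1.
  move=> o2 kl2 t1 t2; have := terminal_end (l := l) inner o2 (ltnW kl2) t1.
  by have := terminal_end (l := l) inner o2 kl2 t2; lia.
have [k0 l1] := short e k oe kl aT bT; have [k0' l1'] := short e' k' oe' kl' cT dT.
by apply: short_uniq => //; rewrite k0 k0' in E.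
Qed.

Lemma routes_disjoint i j : i != j -> element_disjoint T (route_tree T BE i) (route_tree T BE j).
Proof.
move=> ij; apply/andP; split.
  rewrite disjoint_subset; apply/subsetP => A /(route_edgeP T BEP)[e [k [oe ce kl AE]]]; rewrite inE.
  apply/negP => /(route_edgeP T BEP)[e' [k' [oe' ce' kl' AE']]].
  have ee : e = e' by apply: (@route_edge_uniq e e' k k') => //; rewrite -AE -AE'.
  by move/eqP: ij; apply; rewrite -ce -ce' ee.
apply/subsetP => x /setIP[xi xj]; apply: contraT => xT.
have [e [k [oe ce kl xE]]] := inner_vertex ends BEP xi xT.
have [e' [k' [oe' ce' kl' xE']]] := inner_vertex ends BEP xj xT.
have ee : e = e' by apply: (inner_uniq oe oe' kl kl'); rewrite -xE -xE'.
by move/eqP: ij; case; rewrite -ce -ce' ee.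
Qed.
End RoutesDisjoint.

From mathcomp Require Import boolp.

(** * A relational programming language and its compilation *)

Record data := Data { dreg : nat -> nat; din : seq nat; dout : seq nat }.

Definition cfg (l : nat) (d : data) : config := Config l (dreg d) (din d) (dout d).

Definition dexec (d : data) (a : instr) : data :=
  let c := exec_instr a (cfg 0 d) in Data (regs c) (input c) (output c).

Definition basic (a : instr) : bool := if a is IJump _ _ then false else true.

Inductive asm :=
  | ABlk of seq instr
  | ASeq of asm & asm
  | AUnless of nat & asm
  | ARep of asm & nat.

Fixpoint asize (s : asm) : nat := match s with
  | ABlk b => size b
  | ASeq s s' => asize s + asize s'
  | AUnless _ s => (asize s).+1
  | ARep s _ => (asize s).+1
  end.

(** Jump targets are absolute, so the code of a block depends on its offset. *)
Fixpoint acode (s : asm) (off : nat) : seq instr := match s with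
  | ABlk b => b
  | ASeq s s' => acode s off ++ acode s' (off + asize s)
  | AUnless j s => IJump j (off.+1 + asize s) :: acode s off.+1
  | ARep s j => rcons (acode s off) (IJump j off)
  end.

Lemma size_acode s off : size (acode s off) = asize s.
Proof.
elim: s off => [b|s IH s' IH'|j s IH|s IH j] off //=; rewrite ?size_cat ?size_rcons ?IH ?IH' //.
Qed.

(* [AUnless j s] runs [s] if register [j] is zero; [ARep s j] repeats [s] at
   least once, until register [j] is zero. *)
Inductive aex : asm -> data -> nat -> data -> Prop :=
  | aex_blk b d : all basic b -> aex (ABlk b) d (size b) (foldl dexec d b)
  | aex_seq s s' d t d1 t' d2 : aex s d t d1 -> aex s' d1 t' d2 -> aex (ASeq s s') d (t + t') d2
  | aex_skip j s d : 0 < dreg d j -> aex (AUnless j s) d 1 d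
  | aex_run j s d t d' : dreg d j = 0 -> aex s d t d' -> aex (AUnless j s) d t.+1 d'
  | aex_rep0 s j d t d' : aex s d t d' -> dreg d' j = 0 -> aex (ARep s j) d t.+1 d'
  | aex_repS s j d t d' t' d'' : aex s d t d' -> 0 < dreg d' j -> aex (ARep s j) d' t' d'' ->
      aex (ARep s j) d (t.+1 + t') d''.

Definition code_at (p : program) (off : nat) (c : seq instr) : Prop :=
  forall i, i < size c -> onth p (off + i) = onth c i.

Lemma onth_cat_l (T : Type) (s s' : seq T) i : i < size s -> onth (s ++ s') i = onth s i.
Proof. by elim: s i => //= x s IH [|i] //=; exact: IH. Qed.

Lemma onth_cat_r (T : Type) (s s' : seq T) i : onth (s ++ s') (size s + i) = onth s' i.
Proof. by elim: s. Qed.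

Lemma code_at_catl p off c c' : code_at p off (c ++ c') -> code_at p off c.
Proof. by move=> h i ic; rewrite h ?size_cat ?onth_cat_l// ltn_addr. Qed.

Lemma code_at_catr p off c c' : code_at p off (c ++ c') -> code_at p (off + size c) c'.
Proof. by move=> h i ic; rewrite -addnA h ?size_cat ?ltn_add2l// onth_cat_r. Qed.

Definition steps (p : program) (t : nat) (c c' : config) : Prop :=
  iter t (obind (step p)) (Some c) = Some c'.

Lemma steps_add p t t' c c' c'' : steps p t c c' -> steps p t' c' c'' -> steps p (t + t') c c''.
Proof. by rewrite /steps addnC iterD => -> ->. Qed.

Lemma steps1 p a l d : onth p l = Some a -> steps p 1 (cfg l d) (exec_instr a (cfg l d)).
Proof. by rewrite /steps /= /step => ->. Qed.

Lemma acode_steps s d t d' : aex s d t d' -> forall p off, code_at p off (acode s off) ->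
  steps p t (cfg off d) (cfg (off + asize s) d').
Proof.
elim=> {s d t d'}.
- move=> b d bb p off; elim: b d off bb => [|a b IH] d off /=; first by rewrite addn0.
  move=> /andP[ba bb] h.
  have h0 := h 0 isT; rewrite addn0 in h0.
  rewrite -add1n; apply: (steps_add (steps1 d h0)).
  have -> : exec_instr a (cfg off d) = cfg off.+1 (dexec d a) by case: a ba {h h0}.
  rewrite -addSnnS; apply: IH => // i ib; rewrite addSnnS.
  exact: h i.+1 ib.
- move=> s s' d t d1 t' d2 _ IH _ IH' p off /= h.
  have h1 := code_at_catl h; have h2 := code_at_catr h; rewrite size_acode in h2.
  by apply: steps_add (IH _ _ h1) _; rewrite addnA; exact: IH'.
- move=> j s d dj p off /= h; have h0 := h 0 isT; rewrite addn0 in h0.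
  by have := steps1 d h0; rewrite /= dj addSnnS.
- move=> j s d t d' dj _ IH p off /= h; have h0 := h 0 isT; rewrite addn0 in h0.
  rewrite -add1n; apply: steps_add (steps1 d h0) _; rewrite /= dj /= -addSnnS; apply: IH.
  by move=> i ic; rewrite addSnnS; exact: h i.+1 ic.
- move=> s j d t d' _ IH dj p off /=; rewrite -cats1 => h.
  have h1 := code_at_catl h; have := code_at_catr h (i := 0) isT; rewrite size_acode addn0 => h2.
  rewrite -addn1; apply: steps_add (IH _ _ h1) _.
  by have := steps1 d' h2; rewrite /= dj /= addnS.
- move=> s j d t d' t' d'' _ IH dj _ IH' p off /=; rewrite -cats1 => h.
  have h1 := code_at_catl h; have := code_at_catr h (i := 0) isT; rewrite size_acode addn0 => h2.
  rewrite -[t.+1]addn1; apply: steps_add (IH' _ _ _) => //; last by rewrite /= -cats1.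
  apply: steps_add (IH _ _ h1) _.
  by have := steps1 d' h2; rewrite /= dj.
Qed.

Lemma aex_computes s x t d : aex s (Data (fun=> 0) x [::]) t d ->
  computes_in (acode s 0) x t (dout d).
Proof.
move=> ex; exists (cfg (asize s) d); split=> //.
  by apply: (acode_steps ex) => i _; rewrite add0n.
rewrite /step /= (_ : onth _ _ = None) // -(size_acode s 0).
by elim: (acode s 0).
Qed.

(** * First-order formulas and programs over finite relations *)

Inductive fm :=
  | FRel of nat & seq nat
  | FLt of nat & nat
  | FCst of nat & nat
  | FNot of fm
  | FAnd of fm & fm
  | FEx of nat & fm.

(** There are no numeric variables: loops run over the [n] vertices, so every program takes
    polynomial time by construction. Numbers are represented by sets of vertices, and [PrintC] turns
    a set into its cardinal. *)
Inductive prog :=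
  | Put of nat & seq nat & fm
  | Seq of prog & prog
  | For of nat & prog
  | If of fm & prog
  | Read of nat & seq nat
  | PrintC of nat & fm.

Section Semantics.
Variable n : nat.
Definition env := nat -> 'I_n.
Definition rels := nat -> seq 'I_n -> bool.
Record state := State { rl : rels; ip : seq nat; op : seq nat }.

Definition upde (e : env) (x : nat) (a : 'I_n) : env := fun y => if eqn y x then a else e y.

Fixpoint eval (R : rels) (e : env) (f : fm) : bool := match f with
  | FRel r xs => R r (map e xs)
  | FLt x y => e x < e y
  | FCst x c => e x == c :> nat
  | FNot f => ~~ eval R e f
  | FAnd f g => eval R e f && eval R e g
  | FEx x f => [exists a : 'I_n, eval R (upde e x a) f]
  end.

Definition put (R : rels) r (a : seq 'I_n) (b : bool) : rels :=
  fun r' a' => if eqn r' r && (a' == a) then b else R r' a'.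

Fixpoint exec (p : prog) (e : env) (s : state) : state := match p with
  | Put r xs f => State (put (rl s) r (map e xs) (eval (rl s) e f)) (ip s) (op s)
  | Seq p q => exec q e (exec p e s)
  | For x p => foldl (fun s a => exec p (upde e x a) s) s (enum 'I_n)
  | If f p => if eval (rl s) e f then exec p e s else s
  | Read r xs => State (put (rl s) r (map e xs) (0 < head 0 (ip s))) (behead (ip s)) (op s)
  | PrintC x f => State (rl s) (ip s)
      (rcons (op s) #|[set a : 'I_n | eval (rl s) (upde e x a) f]|)
  end.
End Semantics.

(** * Compilation to the machine with a polynomial time bound *)

Section Compilation.
Variable ar : nat -> nat.

(** A variable [x < 40] owns the registers [2 * x + 8] and [2 * x + 9], the second being the counter
    of the quantifier that binds it. All of them are below [base], where the relations are
    stored. *)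
Definition vreg (x : nat) : nat := x.*2 + 8.
Definition areg (x : nat) : nat := x.*2 + 9.
Definition base : nat := 100.

Fixpoint wf_fm (l : seq nat) (f : fm) : bool := match f with
  | FRel r xs => [&& r < 32, size xs == ar r & all (mem l) xs]
  | FLt x y => (x \in l) && (y \in l)
  | FCst x _ => x \in l
  | FNot f => wf_fm l f
  | FAnd f g => wf_fm l f && wf_fm l g
  | FEx x f => [&& x < 40, x \notin l & wf_fm (x :: l) f]
  end.

Fixpoint wf_prog (l : seq nat) (p : prog) : bool := match p with
  | Put r xs f => [&& r < 32, size xs == ar r, all (mem l) xs & wf_fm l f]
  | Seq p q => wf_prog l p && wf_prog l q
  | For x p => [&& x < 40, x \notin l & wf_prog (x :: l) p]
  | If f p => wf_fm l f && wf_prog l p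
  | Read r xs => [&& r < 32, size xs == ar r & all (mem l) xs]
  | PrintC x f => [&& x < 40, x \notin l & wf_fm (x :: l) f]
  end.

(* Registers: 0 holds [n], 1 the value of a formula, 3 an address; 2, 4, 5
   and 6 are scratch. *)
Definition afor (c : nat) (s : asm) : asm :=
  ASeq (ABlk [:: IConst c 0])
       (ARep (ASeq s (ABlk [:: IConst 6 1; IAdd c c 6; ISub 2 0 c])) 2).

(** Horner evaluation of the tuple in base [n]. The machine cannot multiply, so register 3 is added
    [n] times into register 4. *)
Fixpoint cdigits (xs : seq nat) : asm := match xs with
  | [::] => ABlk [::]
  | x :: xs => ASeq (ASeq (ABlk [:: IConst 4 0]) (ASeq (afor 5 (ABlk [:: IAdd 4 4 3]))
      (ABlk [:: IAdd 3 4 (vreg x)]))) (cdigits xs)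
  end.

(** The five doublings multiply by 32: the tables of the 32 relations are interleaved, so an address
    gives the relation modulo 32 and the code of the tuple. Codes are unambiguous because each
    relation has a fixed arity. *)
Definition caddr (r : nat) (xs : seq nat) : asm :=
  ASeq (ABlk [:: IConst 3 0]) (ASeq (cdigits xs)
    (ABlk [:: IAdd 3 3 3; IAdd 3 3 3; IAdd 3 3 3; IAdd 3 3 3; IAdd 3 3 3;
              IConst 2 (base + r); IAdd 3 3 2])).

Definition ccount (x : nat) (s : asm) : asm :=
  ASeq (ABlk [:: IConst (areg x) 0])
       (afor (vreg x) (ASeq s (ABlk [:: IAdd (areg x) (areg x) 1]))).

Fixpoint cfm (f : fm) : asm := match f with
  | FRel r xs => ASeq (caddr r xs) (ABlk [:: ILoad 1 3])
  | FLt x y => ABlk [:: ISub 1 (vreg y) (vreg x); IConst 6 1; ISub 2 6 1; ISub 1 6 2]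
  | FCst x c => ABlk [:: IConst 2 c; ISub 4 2 (vreg x); ISub 5 (vreg x) 2; IAdd 4 4 5;
                         IConst 6 1; ISub 1 6 4]
  | FNot f => ASeq (cfm f) (ABlk [:: IConst 6 1; ISub 1 6 1])
  | FAnd f g => ASeq (cfm f) (ASeq (ABlk [:: IConst 6 1; ISub 2 6 1]) (AUnless 2 (cfm g)))
  | FEx x f => ASeq (ccount x (cfm f)) (ABlk [:: IConst 6 1; ISub 2 6 (areg x); ISub 1 6 2])
  end.

Fixpoint cprog (p : prog) : asm := match p with
  | Put r xs f => ASeq (cfm f) (ASeq (caddr r xs) (ABlk [:: IStore 3 1]))
  | Seq p q => ASeq (cprog p) (cprog q)
  | For x p => afor (vreg x) (cprog p)
  | If f p => ASeq (cfm f) (ASeq (ABlk [:: IConst 6 1; ISub 2 6 1]) (AUnless 2 (cprog p)))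
  | Read r xs => ASeq (caddr r xs)
      (ABlk [:: IRead 1; IConst 6 1; ISub 2 6 1; ISub 1 6 2; IStore 3 1])
  | PrintC x f => ASeq (ccount x (cfm f)) (ABlk [:: IPrint (areg x)])
  end.

Definition cost_for (n c : nat) : nat := n * (c + 4) + 1.

Fixpoint cost_digits (n : nat) (xs : seq nat) : nat :=
  if xs is x :: xs then cost_for n 1 + 2 + cost_digits n xs else 0.

Definition cost_addr n xs : nat := cost_digits n xs + 8.

Fixpoint cost_fm (n : nat) (f : fm) : nat := match f with
  | FRel r xs => cost_addr n xs + 1
  | FLt _ _ => 4
  | FCst _ _ => 6
  | FNot f => cost_fm n f + 2
  | FAnd f g => cost_fm n f + cost_fm n g + 3
  | FEx _ f => cost_for n (cost_fm n f + 1) + 4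
  end.

Fixpoint cost_prog (n : nat) (p : prog) : nat := match p with
  | Put r xs f => cost_fm n f + cost_addr n xs + 1
  | Seq p q => cost_prog n p + cost_prog n q
  | For _ p => cost_for n (cost_prog n p)
  | If f p => cost_fm n f + cost_prog n p + 3
  | Read r xs => cost_addr n xs + 5
  | PrintC _ f => cost_for n (cost_fm n f + 1) + 2
  end.

Definition poly_bounded (f : nat -> nat) : Prop :=
  exists c d, forall n, 0 < n -> f n <= c * n ^ d.

Lemma poly_bounded_const k : poly_bounded (fun=> k).
Proof. by exists k, 0 => n _; rewrite expn0 muln1. Qed.

Lemma poly_boundedD f g : poly_bounded f -> poly_bounded g -> poly_bounded (fun n => f n + g n).
Proof.
move=> [c [d hf]] [c' [d' hg]]; exists (c + c'), (d + d') => n n0; rewrite mulnDl.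
apply: leq_add; [apply: leq_trans (hf n n0) _|apply: leq_trans (hg n n0) _];
by rewrite leq_mul2l leq_pexp2l ?orbT// ?leq_addr ?leq_addl.
Qed.

Lemma poly_bounded_cost_for f : poly_bounded f -> poly_bounded (fun n => cost_for n (f n)).
Proof.
move=> hf; apply: poly_boundedD (poly_bounded_const 1).
have [c [d h]] := poly_boundedD hf (poly_bounded_const 4).
exists c, d.+1 => n n0; rewrite expnS mulnCA leq_mul2l; apply/orP; right; exact: h.
Qed.

Lemma poly_bounded_addr xs : poly_bounded (fun n => cost_addr n xs).
Proof.
apply: poly_boundedD (poly_bounded_const 8); elim: xs => [|x xs IH] /=; first exact: poly_bounded_const.
by apply: poly_boundedD IH; apply: poly_boundedD (poly_bounded_const 2);
  apply: poly_bounded_cost_for (poly_bounded_const 1).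
Qed.

Lemma poly_bounded_fm f : poly_bounded (fun n => cost_fm n f).
Proof.
elim: f => [r xs|x y|x c|f IH|f IH g IH'|x f IH] /=; try exact: poly_bounded_const.
- exact: poly_boundedD (poly_bounded_addr xs) (poly_bounded_const 1).
- exact: poly_boundedD IH (poly_bounded_const 2).
- exact: poly_boundedD (poly_boundedD IH IH') (poly_bounded_const 3).
- apply: poly_boundedD (poly_bounded_const 4).
  exact: poly_bounded_cost_for (poly_boundedD IH (poly_bounded_const 1)).
Qed.

Lemma poly_bounded_prog p : poly_bounded (fun n => cost_prog n p).
Proof.
elim: p => [r xs f|p IH q IH'|x p IH|f p IH|r xs|x f] /=.
- apply: poly_boundedD (poly_bounded_const 1).
  exact: poly_boundedD (poly_bounded_fm f) (poly_bounded_addr xs).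
- exact: poly_boundedD IH IH'.
- exact: poly_bounded_cost_for.
- exact: poly_boundedD (poly_boundedD (poly_bounded_fm f) IH) (poly_bounded_const 3).
- exact: poly_boundedD (poly_bounded_addr xs) (poly_bounded_const 5).
- apply: poly_boundedD (poly_bounded_const 2).
  exact: poly_bounded_cost_for (poly_boundedD (poly_bounded_fm f) (poly_bounded_const 1)).
Qed.

Lemma upd_eq m i v : upd m i v i = v.
Proof. by rewrite /upd eqxx. Qed.

Lemma upd_neq m i v j : j != i -> upd m i v j = m j.
Proof. by rewrite /upd => /negPf->. Qed.

Variable n : nat.
Hypothesis n0 : 0 < n.

(** The loop rule. The body runs before the first test, which is why [0 < n] is assumed; the
    invariant is required after the three instructions that advance the counter and compute the exit
    test. *)
Lemma aex_cost_for c s (B : nat) (I : nat -> data -> Prop) d0 :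
  c != 0 -> c != 2 -> c != 6 ->
  I 0 (Data (upd (dreg d0) c 0) (din d0) (dout d0)) ->
  (forall i d, i < n -> I i d -> dreg d c = i -> exists t d', [/\ aex s d t d', t <= B,
     dreg d' 0 = n, dreg d' c = i &
     I i.+1 (Data (upd (upd (upd (dreg d') 6 1) c i.+1) 2 (n - i.+1)) (din d') (dout d'))]) ->
  exists t d', [/\ aex (afor c s) d0 t d', t <= cost_for n B & I n d'].
Proof.
move=> c0 c2 c6 I0 step.
pose d1 := Data (upd (dreg d0) c 0) (din d0) (dout d0).
pose body := ASeq s (ABlk [:: IConst 6 1; IAdd c c 6; ISub 2 0 c]).
have one i d : i < n -> I i d -> dreg d c = i -> exists t d', [/\ aex body d t d', t <= B + 3,
    I i.+1 d', dreg d' c = i.+1 & dreg d' 2 = n - i.+1].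
  move=> lin Ii dc; have [t [d' [ex tB d'0 d'c Ii']]] := step i d lin Ii dc.
  exists (t + 3); eexists; split.
  - by apply: aex_seq ex _; apply: aex_blk.
  - by rewrite leq_add2r.
  - rewrite /= /dexec /= upd_eq (upd_neq _ _ c6) (upd_neq _ _ (_ : 0 != c)) 1?eq_sym//.
    rewrite (upd_neq _ _ (_ : 0 != 6))// d'0 d'c addn1 upd_eq; exact: Ii'.
  - by rewrite /= /dexec /= (upd_neq _ _ c2) upd_eq upd_eq (upd_neq _ _ c6) d'c addn1.
  - rewrite /= /dexec /= upd_eq (upd_neq _ _ (_ : 0 != c)) 1?eq_sym// (upd_neq _ _ (_ : 0 != 6))//.
    by rewrite d'0 upd_eq upd_eq (upd_neq _ _ c6) d'c addn1.
have loop k i d : i + k.+1 = n -> I i d -> dreg d c = i -> exists t d',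
    [/\ aex (ARep body 2) d t d', t <= k.+1 * (B + 4) & I n d'].
  elim: k i d => [|k IH] i d ik Ii dc.
    have [|t [d' [ex tB Ii' d'c d'2]]] := one i d _ Ii dc; first by lia.
    exists t.+1, d'; split; last by rewrite -ik addn1.
      by apply: aex_rep0 ex _; rewrite d'2; lia.
    by rewrite mul1n addnS ltnS.
  have [|t [d' [ex tB Ii' d'c d'2]]] := one i d _ Ii dc; first by lia.
  have [|t' [d'' [ex' tB' In]]] := IH i.+1 d' _ Ii' d'c; first by lia.
  exists (t.+1 + t'), d''; split=> //.
    by apply: aex_repS ex _ ex'; rewrite d'2; lia.
  by rewrite mulSn; apply: leq_add => //; rewrite addnS ltnS.
have [||t [d' [ex tB In]]] := loop n.-1 0 d1 _ I0; rewrite ?prednK// ?add0n//.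
  by rewrite /d1 /= upd_eq.
exists (1 + t), d'; split=> //.
  by apply: aex_seq ex; exact: (@aex_blk [:: IConst c 0]).
by rewrite /cost_for addnC leq_add2r -[X in X * _](prednK n0).
Qed.


Definition clean (m m' : nat -> nat) : Prop := forall a, (a < 2) || (6 < a) -> m' a = m a.

Lemma clean_trans m1 m2 m3 : clean m1 m2 -> clean m2 m3 -> clean m1 m3.
Proof. by move=> h1 h2 a ha; rewrite h2// h1. Qed.

Lemma clean_upd m m' i v : 1 < i < 7 -> clean m m' -> clean m (upd m' i v).
Proof. by move=> hi h a ha; rewrite upd_neq ?h//; lia. Qed.

Definition horner_digits (acc : nat) (ds : seq nat) : nat := foldl (fun a x => a * n + x) acc ds.

Lemma cdigits_ok (e : nat -> nat) xs m i o :
  m 0 = n -> {in xs, forall x, m (vreg x) = e x} -> exists t m',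
  [/\ aex (cdigits xs) (Data m i o) t (Data m' i o), t <= cost_digits n xs,
      m' 3 = horner_digits (m 3) (map e xs) & clean m m'].
Proof.
elim: xs m => [|x xs IH] m m0 mx.
  by exists 0, m; split=> //; exact: (@aex_blk [::]).
pose I (k : nat) (d : data) := [/\ din d = i, dout d = o, dreg d 4 = k * m 3, dreg d 3 = m 3 &
  clean m (dreg d)].
have [||||| t [[m1 i1 o1] [ex tB [/= ? ? m14 m13 cl]]]] :=
  @aex_cost_for 5 (ABlk [:: IAdd 4 4 3]) 1 I (Data (upd m 4 0) i o) => //.
- by split=> //=; rewrite ?upd_eq //; apply: clean_upd => //; apply: clean_upd.
- move=> k [m1 i1 o1] kn [/= -> -> m14 m13 cl] m15; exists 1; eexists; split.
  + exact: (@aex_blk [:: IAdd 4 4 3]).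
  + by [].
  + by rewrite /= upd_neq// cl.
  + by rewrite /= upd_neq.
  + split=> //=; rewrite ?(upd_neq _ _ (_ : 4 != 2)) ?(upd_neq _ _ (_ : 4 != 5)) ?(upd_neq _ _ (_ : 4 != 6)) //.
    * by rewrite upd_eq m14 m13 mulSn addnC.
    * by do 4!(apply: clean_upd => //).
subst i1 o1.
pose m2 := upd m1 3 (m1 4 + m1 (vreg x)).
have clm2 : clean m m2 by apply: clean_upd.
have [||t' [m' [ex' tB' m'3 cl']]] := IH m2.
- by rewrite clm2.
- by move=> y yxs; rewrite clm2 ?mx ?inE ?yxs ?orbT// /vreg; lia.
exists (1 + (t + 1) + t'), m'; split.
- apply: aex_seq ex'; apply: aex_seq; first exact: (@aex_blk [:: IConst 4 0]).
  by apply: aex_seq ex _; exact: (@aex_blk [:: IAdd 3 4 (vreg x)]).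
- by move: tB tB'; rewrite /= /cost_for; lia.
- rewrite m'3 /m2 upd_eq m14 (cl (vreg x)) ?mx ?mem_head//; last by rewrite /vreg; lia.
  by rewrite /= mulnC.
- exact: clean_trans clm2 cl'.
Qed.

Definition addr (r code : nat) : nat := base + r + 32 * code.

Lemma caddr_ok (e : nat -> nat) r xs m i o :
  m 0 = n -> {in xs, forall x, m (vreg x) = e x} -> exists t m',
  [/\ aex (caddr r xs) (Data m i o) t (Data m' i o), t <= cost_addr n xs,
      m' 3 = addr r (horner_digits 0 (map e xs)) & clean m m'].
Proof.
move=> m0 mx; have [||t [m1 [ex tB m13 cl]]] := @cdigits_ok e xs (upd m 3 0) i o.
- by rewrite upd_neq.
- by move=> x xxs; rewrite upd_neq ?mx// /vreg; lia.
rewrite upd_eq in m13.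
exists (1 + (t + 7)); eexists; split.
- apply: aex_seq; first exact: (@aex_blk [:: IConst 3 0]).
  by apply: aex_seq ex _; exact: aex_blk.
- by rewrite /cost_addr; lia.
- rewrite /= !upd_eq.
  do 6![rewrite ?upd_eq ?(upd_neq _ _ (_ : 3 != 2))//].
  by rewrite m13 /addr; lia.
- do 7!(apply: clean_upd => //).
  by apply: clean_trans cl; apply: clean_upd.
Qed.

Definition ord_code (a : seq 'I_n) : nat := horner_digits 0 (map val a).

Lemma horner_digits_inj (a b : seq 'I_n) c c' : size a = size b ->
  horner_digits c (map val a) = horner_digits c' (map val b) -> c = c' /\ a = b.
Proof.
elim: a b c c' => [|x a IH] [|y b] c c' //= [sab] /(IH _ _ _ sab)[h ->].
have xn := ltn_ord x; have yn := ltn_ord y.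
have c_eq : c = c'.
  by have := congr1 (divn^~ n) h; rewrite !divnMDl// !divn_small// !addn0.
by split=> //; congr (_ :: _); apply: val_inj; move: h; rewrite c_eq => /addnI.
Qed.

Lemma addr_inj r r' (a b : seq 'I_n) : r < 32 -> r' < 32 -> (r = r' -> size a = size b) ->
  addr r (ord_code a) = addr r' (ord_code b) -> r = r' /\ a = b.
Proof.
move=> r32 r'32 sab h; have rr' : r = r' by move: h; rewrite /addr; lia.
split=> //; have /(horner_digits_inj (sab rr'))[] // : horner_digits 0 (map val a) = horner_digits 0 (map val b).
by move: h; rewrite /addr /ord_code; lia.
Qed.

Definition mem_ok (l : seq nat) (e : env n) (R : rels n) (m : nat -> nat) : Prop :=
  [/\ m 0 = n, {in l, forall x, m (vreg x) = e x} &
      forall r (a : seq 'I_n), r < 32 -> size a = ar r -> m (addr r (ord_code a)) = R r a].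

(** Registers of variables outside [l] may change: they belong to the binders inside the compiled
    formula. *)
Definition keeps (l : seq nat) (m m' : nat -> nat) : Prop :=
  [/\ m' 0 = m 0, {in l, forall x, m' (vreg x) = m (vreg x) /\ m' (areg x) = m (areg x)} &
      forall a, base <= a -> m' a = m a].

Lemma mem_ok_keeps l e R m m' : keeps l m m' -> mem_ok l e R m -> mem_ok l e R m'.
Proof.
move=> [k0 kv ka] [m0 mv ma]; split; first by rewrite k0.
  by move=> x xl; rewrite (kv x xl).1 mv.
by move=> r a r32 sa; rewrite ka ?ma// /addr -addnA leq_addr.
Qed.

Lemma keeps_refl l m : keeps l m m. Proof. by split. Qed.

Lemma keeps_trans l m m' m'' : keeps l m m' -> keeps l m' m'' -> keeps l m m''.
Proof.
move=> [k0 kv ka] [k0' kv' ka']; split; first by rewrite k0'.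
  by move=> x xl; rewrite (kv' x xl).1 (kv' x xl).2; exact: kv.
by move=> a ha; rewrite ka'// ka.
Qed.

Lemma keeps_cons x l m m' : keeps (x :: l) m m' -> keeps l m m'.
Proof. by move=> [k0 kv ka]; split=> // y yl; apply: kv; rewrite inE yl orbT. Qed.

Lemma clean_keeps l m m' : clean m m' -> keeps l m m'.
Proof.
move=> h; split; first exact: h.
  by move=> x _; rewrite !h// /vreg /areg; lia.
by move=> a; rewrite /base => ha; apply: h; lia.
Qed.

Lemma keeps_upd l m m' i v : 0 < i < 8 -> keeps l m m' -> keeps l m (upd m' i v).
Proof.
move=> hi [k0 kv ka]; split; first by rewrite upd_neq ?k0//; lia.
  by move=> x /kv[h1 h2]; rewrite !upd_neq ?h1 ?h2// /vreg /areg; lia.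
by move=> a; rewrite /base => ha; rewrite upd_neq ?ka// /base; lia.
Qed.

Lemma keeps_updx l m m' x v : x < 40 -> x \notin l -> keeps l m m' ->
  keeps l m (upd m' (vreg x) v) /\ keeps l m (upd m' (areg x) v).
Proof.
move=> x40 xl [k0 kv ka].
have H c : c = vreg x \/ c = areg x -> keeps l m (upd m' c v).
  move=> hc; have c0 : 0 != c by case: hc => ->; rewrite /vreg /areg; lia.
  have cb a : base <= a -> a != c by case: hc => ->; rewrite /vreg /areg /base; lia.
  split; first by rewrite upd_neq.
    move=> y yl; have yx : y != x by apply: contraNneq xl => <-.
    have [h1 h2] := kv y yl.
    by rewrite !upd_neq ?h1 ?h2//; case: hc => ->; rewrite /vreg /areg; lia.
  by move=> a ha; rewrite upd_neq ?ka// cb.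
by split; apply: H; [left|right].
Qed.

Definition fm_ok (f : fm) : Prop := forall l e R m i o, wf_fm l f -> mem_ok l e R m ->
  exists t m', [/\ aex (cfm f) (Data m i o) t (Data m' i o), t <= cost_fm n f,
    keeps l m m' & m' 1 = eval R e f].

Lemma ccount_ok f x l (e : env n) R m i o : fm_ok f -> x < 40 -> x \notin l -> wf_fm (x :: l) f ->
  mem_ok l e R m -> exists t m', [/\ aex (ccount x (cfm f)) (Data m i o) t (Data m' i o),
    t <= cost_for n (cost_fm n f + 1) + 1, keeps l m m' &
    m' (areg x) = #|[set a : 'I_n | eval R (upde e x a) f]|].
Proof.
move=> IH x40 xl wf mok.
pose I (k : nat) (d : data) := [/\ din d = i, dout d = o, keeps l m (dreg d) &
  dreg d (areg x) = \sum_(a : 'I_n | a < k) eval R (upde e x a) f].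
have va : areg x != vreg x by rewrite /areg /vreg; lia.
have [|||||t [[m1 i1 o1] [ex tB [/= ? ? kp cnt]]]] := @aex_cost_for (vreg x)
  (ASeq (cfm f) (ABlk [:: IAdd (areg x) (areg x) 1])) (cost_fm n f + 1) I
  (Data (upd m (areg x) 0) i o).
- by rewrite /vreg; lia.
- by rewrite /vreg; lia.
- by rewrite /vreg; lia.
- split=> //=; last by rewrite upd_neq// upd_eq big_pred0.
  by apply: (keeps_updx _ x40 xl _).1; apply: (keeps_updx _ x40 xl _).2; exact: keeps_refl.
- move=> k [m1 i1 o1] kn [/= -> -> kp cnt] vk.
  have mok1 : mem_ok (x :: l) (upde e x (Ordinal kn)) R m1.
    have [h1 h2 h3] := mem_ok_keeps kp mok; split=> // y; rewrite inE /upde.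
    case: (@eqnP y x) => [-> _|yx /predU1P[//|yl]]; first by rewrite vk.
    exact: h2.
  have [t [m2 [ex tB kp2 r2]]] := IH _ _ _ _ i o wf mok1.
  have [k20 k2v k2a] := kp2; have [v2 a2] := k2v x (mem_head _ _).
  exists (t + 1); eexists; split.
  + by apply: aex_seq ex _; exact: (@aex_blk [:: IAdd (areg x) (areg x) 1]).
  + by rewrite leq_add2r.
  + have [m10 _ _] := mem_ok_keeps kp mok.
    by rewrite /= upd_neq ?k20 ?m10//; rewrite /areg; lia.
  + by rewrite /= upd_neq 1?eq_sym// v2.
  + split=> //=.
      apply: keeps_upd => //; apply: (keeps_updx _ x40 xl _).1; apply: keeps_upd => //.
      by apply: (keeps_updx _ x40 xl _).2; apply: keeps_trans kp (keeps_cons kp2).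
    rewrite upd_neq ?(upd_neq _ _ va) ?(upd_neq _ _ (_ : areg x != 6)) ?upd_eq; try (by rewrite /areg; lia).
    rewrite a2 cnt r2 [RHS](bigD1 (Ordinal kn)) //= addnC; congr (_ + _).
    by apply: eq_bigl => a; rewrite ltnS leq_eqVlt -(inj_eq val_inj) /=; lia.
subst i1 o1; exists (1 + t), m1; split=> //.
- by apply: aex_seq ex; exact: (@aex_blk [:: IConst (areg x) 0]).
- by rewrite addnC leq_add2r.
- rewrite cnt -sum1_card big_mkcond [RHS]big_mkcond /=; apply: eq_bigr => a _.
  by rewrite inE ltn_ord; case: eval.
Qed.

Lemma cfm_ok f : fm_ok f.
Proof.
elim: f => [r xs|x y|x c|f IH|f IH g IH'|x f IH] l e R m i o /=.
- move=> /and3P[r32 /eqP sx /allP xl] mok; have [m0 mv ma] := mok.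
  have [||t [m' [ex tB m'3 cl]]] := @caddr_ok (fun x => e x) r xs m i o => //.
    by move=> x /xl; exact: mv.
  exists (t + 1), (upd m' 1 (m' (m' 3))); split.
  + by apply: aex_seq ex _; exact: (@aex_blk [:: ILoad 1 3]).
  + by rewrite leq_add2r.
  + by apply: keeps_upd => //; exact: clean_keeps.
  + rewrite upd_eq m'3 cl; last by rewrite /addr /base; lia.
    rewrite -(ma r (map e xs)) ?size_map// /ord_code -map_comp.
    by [].
- move=> /andP[xl yl] [m0 mv ma]; exists 4; eexists; split.
  + exact: aex_blk.
  + by [].
  + by do 4!(apply: keeps_upd => //); exact: keeps_refl.
  + rewrite /= upd_eq; do 4![rewrite ?upd_eq ?(upd_neq _ _ (_ : 6 != 2)) ?(upd_neq _ _ (_ : 1 != 6))//].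
    rewrite mv// mv//; case: ltnP; lia.
- move=> xl [m0 mv ma]; exists 6; eexists; split.
  + exact: aex_blk.
  + by [].
  + by do 6!(apply: keeps_upd => //); exact: keeps_refl.
  + have v8 k : k < 8 -> vreg x != k by rewrite /vreg; lia.
    rewrite /= upd_eq; do 6![rewrite ?upd_eq ?(upd_neq _ _ (_ : 4 != 6)) ?(upd_neq _ _ (_ : 4 != 5))
      ?(upd_neq _ _ (_ : 2 != 4)) ?(upd_neq _ _ (v8 _ _))//].
    by rewrite mv//; case: eqP; lia.
- move=> wf mok; have [t [m' [ex tB kp r1]]] := IH l e R m i o wf mok.
  exists (t + 2); eexists; split.
  + by apply: aex_seq ex _; exact: aex_blk.
  + by rewrite leq_add2r.
  + by do 2!(apply: keeps_upd => //).
  + by rewrite /= upd_eq upd_eq upd_neq// r1; case: eval.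
- move=> /andP[wf wg] mok; have [t [m' [ex tB kp r1]]] := IH l e R m i o wf mok.
  have kp2 : keeps l m (upd (upd m' 6 1) 2 (1 - m' 1)) by do 2!(apply: keeps_upd => //).
  have ex2 : aex (ABlk [:: IConst 6 1; ISub 2 6 1]) (Data m' i o) 2 (Data (upd (upd m' 6 1) 2 (1 - m' 1)) i o).
    have := @aex_blk [:: IConst 6 1; ISub 2 6 1] (Data m' i o) isT.
    by rewrite /= /dexec /= upd_eq upd_neq.
  case ef: (eval R e f) r1 => /= r1.
    have [t' [m'' [ex' tB' kp' r1']]] := IH' l e R _ i o wg (mem_ok_keeps kp2 mok).
    exists (t + (2 + t'.+1)), m''; split.
    * apply: aex_seq ex _; apply: aex_seq ex2 _; apply: aex_run ex'.
      by rewrite /= upd_eq r1.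
    * by lia.
    * exact: keeps_trans kp2 kp'.
    * by rewrite r1'.
  exists (t + (2 + 1)); eexists; split.
  * apply: aex_seq ex _; apply: aex_seq ex2 _; apply: aex_skip.
    by rewrite /= upd_eq r1.
  * by lia.
  * exact: kp2.
  * by rewrite !upd_neq.
- move=> /and3P[x40 xl wf] mok; have [t [m' [ex tB kp cnt]]] := ccount_ok i o IH x40 xl wf mok.
  have a8 k : k < 8 -> areg x != k by rewrite /areg; lia.
  exists (t + 3); eexists; split.
  + by apply: aex_seq ex _; exact: aex_blk.
  + by lia.
  + by do 3!(apply: keeps_upd => //).
  + rewrite /= upd_eq; do 3![rewrite ?upd_eq ?(upd_neq _ _ (_ : 6 != 2)) ?(upd_neq _ _ (a8 _ _))//].
    rewrite cnt; case: existsP => [[a ha]|no].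
      have : 0 < #|[set a : 'I_n | eval R (upde e x a) f]| by apply/card_gt0P; exists a; rewrite inE.
      by case: #|_|.
    rewrite (_ : [set _ | _] = set0) ?cards0//; apply/setP => a; rewrite !inE.
    by apply/negbTE/negP => ha; apply: no; exists a.
Qed.

Lemma mem_ok_put l e R m r (a : seq 'I_n) (b : bool) : {in l, forall x, x < 40} -> r < 32 ->
  size a = ar r -> mem_ok l e R m -> mem_ok l e (put R r a b) (upd m (addr r (ord_code a)) b).
Proof.
move=> l40 r32 sa [m0 mv ma]; split.
- by rewrite upd_neq// /addr /base; lia.
- by move=> x xl; rewrite upd_neq ?mv//; have := l40 x xl; rewrite /vreg /addr /base; lia.
- move=> r' a' r'32 sa'; rewrite /put; case: (@eqnP r' r) => [rr|nrr] /=.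
    case: eqP => [->|na]; first by rewrite rr upd_eq.
    rewrite upd_neq ?ma//; apply/eqP => /addr_inj h; apply: na.
    by case: h => // _; rewrite sa' sa rr.
  by rewrite upd_neq ?ma//; apply/eqP => /addr_inj h; case: h.
Qed.

Lemma mem_ok_unbind l x (e : env n) R m k v w : x < 40 -> x \notin l ->
  mem_ok (x :: l) (upde e x k) R m -> mem_ok l e R (upd (upd (upd m 6 1) (vreg x) v) 2 w).
Proof.
move=> x40 xl [m0 mv ma].
have mok : mem_ok l e R m.
  split=> // y yl; rewrite mv ?inE ?yl ?orbT// /upde; case: (@eqnP y x) => // yx.
  by rewrite -yx yl in xl.
apply: mem_ok_keeps mok; apply: keeps_upd => //; apply: (keeps_updx _ x40 xl _).1.
by apply: keeps_upd => //; exact: keeps_refl.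
Qed.

Lemma cprog_ok p l e s m : {in l, forall x, x < 40} -> wf_prog l p -> mem_ok l e (rl s) m ->
  exists t m', [/\ aex (cprog p) (Data m (ip s) (op s)) t
      (Data m' (ip (exec p e s)) (op (exec p e s))), t <= cost_prog n p &
    mem_ok l e (rl (exec p e s)) m'].
Proof.
elim: p l e s m => [r xs f|p IH q IH'|x p IH|f p IH|r xs|x f] l e s m l40 /=.
- move=> /and4P[r32 /eqP sx /allP xl wf] mok.
  have [t [m1 [ex tB kp r1]]] := cfm_ok (ip s) (op s) wf mok.
  have [m10 m1v m1a] := mem_ok_keeps kp mok.
  have [||t' [m2 [ex' tB' m23 cl]]] := @caddr_ok (fun x => e x) r xs m1 (ip s) (op s) => //.
    by move=> x /xl; exact: m1v.
  have mok2 := mem_ok_keeps (clean_keeps l cl) (mem_ok_keeps kp mok).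
  exists (t + (t' + 1)), (upd m2 (m2 3) (m2 1)); split.
  + apply: aex_seq ex _; apply: aex_seq ex' _; exact: (@aex_blk [:: IStore 3 1]).
  + by lia.
  + rewrite m23 (cl 1)// r1.
    have -> : horner_digits 0 [seq nat_of_ord (e x) | x <- xs] = ord_code (map e xs).
      by rewrite /ord_code -map_comp.
    by apply: mem_ok_put => //; rewrite size_map.
- move=> /andP[wp wq] mok; have [t [m' [ex tB mok']]] := IH l e s m l40 wp mok.
  have [t' [m'' [ex' tB' mok'']]] := IH' l e _ m' l40 wq mok'.
  by exists (t + t'), m''; split=> //; [apply: aex_seq ex ex'|apply: leq_add].
- move=> /and3P[x40 xl wp] mok.
  pose S k := foldl (fun s a => exec p (upde e x a) s) s (take k (enum 'I_n)).
  pose I (k : nat) (d : data) := [/\ din d = ip (S k), dout d = op (S k) & mem_ok l e (rl (S k)) (dreg d)].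
  have [|||||t [[m1 i1 o1] [ex tB [/= ei eo mok1]]]] := @aex_cost_for (vreg x) (cprog p) (cost_prog n p) I
    (Data m (ip s) (op s)).
  + by rewrite /vreg; lia.
  + by rewrite /vreg; lia.
  + by rewrite /vreg; lia.
  + split; rewrite /S ?take0//=; apply: mem_ok_keeps mok.
    by apply: (keeps_updx _ x40 xl _).1; exact: keeps_refl.
  + move=> k [m1 i1 o1] kn [/= -> -> mok1] vk.
    have mok1' : mem_ok (x :: l) (upde e x (Ordinal kn)) (rl (S k)) m1.
      have [h1 h2 h3] := mok1; split=> // y; rewrite inE /upde.
      case: (@eqnP y x) => [-> _|yx /predU1P[//|yl]]; first by rewrite vk.
      exact: h2.
    have l40' : {in x :: l, forall y, y < 40} by move=> y; rewrite inE => /predU1P[->//|]; exact: l40.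
    have [t [m2 [ex tB mok2]]] := IH _ _ _ _ l40' wp mok1'.
    have Sk : S k.+1 = exec p (upde e x (Ordinal kn)) (S k).
      rewrite /S (take_nth (Ordinal kn)) ?size_enum_ord// -cats1 foldl_cat /=.
      by congr (exec p (upde e x _) _); apply: val_inj; rewrite /= nth_enum_ord.
    have [m20 m2v _] := mok2.
    exists t; eexists; split; [exact: ex|exact: tB|exact: m20| |].
      by rewrite /= m2v ?mem_head// /upde; case: (@eqnP x x).
    by split; rewrite Sk //=; apply: mem_ok_unbind mok2.
  + have Sn : S n = foldl (fun s a => exec p (upde e x a) s) s (enum 'I_n).
      by rewrite /S take_oversize// size_enum_ord.
    by exists t, m1; rewrite -Sn; split=> //; rewrite -ei -eo.
- move=> /andP[wf wp] mok.
  have [t [m1 [ex tB kp r1]]] := cfm_ok (ip s) (op s) wf mok.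
  have kp2 : keeps l m (upd (upd m1 6 1) 2 (1 - m1 1)) by do 2!(apply: keeps_upd => //).
  have ex2 : aex (ABlk [:: IConst 6 1; ISub 2 6 1]) (Data m1 (ip s) (op s)) 2
      (Data (upd (upd m1 6 1) 2 (1 - m1 1)) (ip s) (op s)).
    have := @aex_blk [:: IConst 6 1; ISub 2 6 1] (Data m1 (ip s) (op s)) isT.
    by rewrite /= /dexec /= upd_eq upd_neq.
  case ef: (eval (rl s) e f) r1 => r1.
    have [t' [m2 [ex' tB' mok']]] := IH l e s _ l40 wp (mem_ok_keeps kp2 mok).
    exists (t + (2 + t'.+1)), m2; split=> //; last by lia.
    apply: aex_seq ex _; apply: aex_seq ex2 _; apply: aex_run ex'.
    by rewrite /= upd_eq r1.
  exists (t + (2 + 1)); eexists; split; last exact: mem_ok_keeps kp2 mok.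
    apply: aex_seq ex _; apply: aex_seq ex2 _; apply: aex_skip.
    by rewrite /= upd_eq r1.
  by lia.
- move=> /and3P[r32 /eqP sx /allP xl] mok; have [m0 mv ma] := mok.
  have [||t [m2 [ex tB m23 cl]]] := @caddr_ok (fun x => e x) r xs m (ip s) (op s) => //.
    by move=> x /xl; exact: mv.
  exists (t + 5); eexists; split.
  + by apply: aex_seq ex _; exact: aex_blk.
  + by rewrite leq_add2r.
  + rewrite /= /dexec /=.
    do 5![rewrite ?upd_eq ?(upd_neq _ _ (_ : 3 != 1)) ?(upd_neq _ _ (_ : 3 != 2)) ?(upd_neq _ _ (_ : 3 != 6))
      ?(upd_neq _ _ (_ : 6 != 2)) ?(upd_neq _ _ (_ : 1 != 6))//].
    rewrite m23.
    have -> : horner_digits 0 [seq nat_of_ord (e x) | x <- xs] = ord_code (map e xs).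
      by rewrite /ord_code -map_comp.
    have -> : 1 - (1 - head 0 (ip s)) = (0 < head 0 (ip s)) :> nat by case: (head 0 _).
    apply: mem_ok_put => //; first by rewrite size_map.
    apply: mem_ok_keeps mok; do 4!(apply: keeps_upd => //); exact: clean_keeps.
- move=> /and3P[x40 xl wf] mok.
  have [t [m1 [ex tB kp cnt]]] := ccount_ok (ip s) (op s) (@cfm_ok f) x40 xl wf mok.
  exists (t + 1), m1; split; last exact: mem_ok_keeps kp mok.
    apply: aex_seq ex _; have := @aex_blk [:: IPrint (areg x)] (Data m1 (ip s) (op s)) isT.
    by rewrite /= /dexec /= cnt.
  by lia.
Qed.
End Compilation.

(** One code serves all [n]: the size is read from the input into register 0, and [c] and [d] depend
    on the program only. *)
Theorem prog_computes (ar : nat -> nat) (p : prog) : wf_prog ar [::] p ->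
  exists c d, forall n (e : env n) (x : seq nat), 0 < n -> exists t,
    t <= c * n ^ d /\
    computes_in (acode (ASeq (ABlk [:: IRead 0]) (cprog p)) 0) (n :: x) t
      (op (exec p e (State (fun _ _ => false) x [::]))).
Proof.
move=> wf; have [c [d hc]] := poly_boundedD (poly_bounded_const 1) (poly_bounded_prog p).
exists c, d => n e x n0.
have mok : mem_ok ar [::] e (fun _ _ => false) (upd (fun=> 0) 0 n).
  by split=> // r a _ _; rewrite upd_neq// /addr /base; lia.
have [//|t [m' [ex tB _]]] := @cprog_ok ar n n0 p [::] e (State (fun _ _ => false) x [::]) _ _ wf mok.
exists (1 + t); split; first by apply: leq_trans (hc n n0); rewrite leq_add2l.
have ex1 := aex_seq (@aex_blk [:: IRead 0] (Data (fun=> 0) (n :: x) [::]) isT) ex.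
exact: (aex_computes ex1).
Qed.

(** * Derived formulas and simultaneous assignment *)

Definition fOr f g := FNot (FAnd (FNot f) (FNot g)).
Definition fAll x f := FNot (FEx x (FNot f)).
Definition fImp f g := FNot (FAnd f (FNot g)).
Definition fEq x y := FAnd (FNot (FLt x y)) (FNot (FLt y x)).

(** The reflexive lexicographic order. It singles out a least tuple wherever a search or an exchange
    must choose, which makes the choice unique and definable. *)
Fixpoint fLex (xs ys : seq nat) : fm := match xs, ys with
  | x :: xs, y :: ys => fOr (FLt x y) (FAnd (fEq x y) (fLex xs ys))
  | _, _ => FNot (FLt 0 0)
  end.


Arguments fLex : simpl never.

Definition nest (xs : seq nat) (p : prog) : prog := foldr For p xs.

(* Simultaneous assignment through the scratch relation [24 + size xs]. *)
Definition setp (r : nat) (xs : seq nat) (f : fm) : prog :=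
  Seq (nest xs (Put (24 + size xs) xs f)) (nest xs (Put r xs (FRel (24 + size xs) xs))).

Arguments setp : simpl never.

Fixpoint reads (q : nat) (f : fm) : bool := match f with
  | FRel r _ => eqn r q
  | FNot f | FEx _ f => reads q f
  | FAnd f g => reads q f || reads q g
  | _ => false
  end.

Fixpoint mods (p : prog) : seq nat := match p with
  | Put r _ _ | Read r _ => [:: r]
  | Seq p q => mods p ++ mods q
  | For _ p | If _ p => mods p
  | PrintC _ _ => [::]
  end.

Fixpoint pure (p : prog) : bool := match p with
  | Put _ _ _ => true
  | Seq p q => pure p && pure q
  | For _ p | If _ p => pure p
  | _ => false
  end.

Section Lemmas.
Variable n : nat.
Implicit Types (e : env n) (s : state n) (R : rels n).

Lemma evalOr R e f g : eval R e (fOr f g) = eval R e f || eval R e g.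
Proof. by rewrite /fOr /= negb_and !negbK. Qed.

Lemma evalAll R e x f : eval R e (fAll x f) = [forall a, eval R (upde e x a) f].
Proof. by rewrite /fAll /= negb_exists; apply: eq_forallb => a; rewrite negbK. Qed.

Lemma evalImp R e f g : eval R e (fImp f g) = (eval R e f ==> eval R e g).
Proof. by rewrite /fImp /= negb_and negbK implybE. Qed.

Lemma evalEq R e x y : eval R e (fEq x y) = (e x == e y).
Proof. by rewrite /fEq /= -!leqNgt -eqn_leq eq_sym. Qed.

Fixpoint lexle (a b : seq 'I_n) : bool := match a, b with
  | x :: a, y :: b => (x < y) || (x == y) && lexle a b
  | _, _ => true
  end.

Lemma evalLex R e xs ys : eval R e (fLex xs ys) = lexle (map e xs) (map e ys).
Proof.
elim: xs ys => [|x xs IH] [|y ys] //; try by rewrite /fLex /= ltnn.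
by rewrite /= negb_and !negbK IH -!leqNgt -eqn_leq eq_sym.
Qed.

Lemma evalAnd R e f g : eval R e (FAnd f g) = eval R e f && eval R e g. Proof. by []. Qed.
Lemma evalNot R e f : eval R e (FNot f) = ~~ eval R e f. Proof. by []. Qed.
Lemma evalRel R e r xs : eval R e (FRel r xs) = R r (map e xs). Proof. by []. Qed.
Lemma evalEx R e x f : eval R e (FEx x f) = [exists a, eval R (upde e x a) f]. Proof. by []. Qed.
Lemma evalLt R e x y : eval R e (FLt x y) = (e x < e y). Proof. by []. Qed.
Lemma evalCst R e x c : eval R e (FCst x c) = (e x == c :> nat). Proof. by []. Qed.

Lemma evalEx2 R e x y f : eval R e (FEx x (FEx y f)) =
  [exists u : 'I_n * 'I_n, eval R (upde (upde e x u.1) y u.2) f].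
Proof.
apply/existsP/existsP => [[a /existsP[b h]]|[[a b] h]]; first by exists (a, b).
by exists a; apply/existsP; exists b.
Qed.

Lemma evalEx4 R e x y z t f : eval R e (FEx x (FEx y (FEx z (FEx t f)))) =
  [exists uv : ('I_n * 'I_n) * ('I_n * 'I_n),
     eval R (upde (upde (upde (upde e x uv.1.1) y uv.1.2) z uv.2.1) t uv.2.2) f].
Proof.
rewrite evalEx2; apply/existsP/existsP => [[u]|[[u v] h]].
  by rewrite evalEx2 => /existsP[v h]; exists (u, v).
by exists u; rewrite evalEx2; apply/existsP; exists v.
Qed.

Lemma evalAll2 R e x y f : eval R e (fAll x (fAll y f)) =
  [forall u : 'I_n * 'I_n, eval R (upde (upde e x u.1) y u.2) f].
Proof.
rewrite evalAll; apply/forallP/forallP => [h [a b]|h a].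
  by have := h a; rewrite evalAll => /forallP; apply.
by rewrite evalAll; apply/forallP => b; exact: h (a, b).
Qed.

(* The order of the rules keeps the derived connectives folded. *)
Definition evalE := (evalLex, evalEq, evalOr, evalImp, evalAll2, evalAll, evalAnd,
  evalNot, evalRel, evalEx4, evalEx2, evalEx, evalLt, evalCst).

Lemma lexle_code (a b : seq 'I_n) c : size a = size b ->
  lexle a b = (horner_digits n c (map val a) <= horner_digits n c (map val b)).
Proof.
have mono (s : seq 'I_n) u v : u < v -> horner_digits n u (map val s) < horner_digits n v (map val s).
  elim: s u v => //= x s IH u v uv; apply: IH; have := ltn_ord x; nia.
have mono2 (s s' : seq 'I_n) u v : size s = size s' -> u < v ->
    horner_digits n u (map val s) < horner_digits n v (map val s').
  elim: s s' u v => [|x s IH] [|y s'] //= u v [ss] uv; apply: IH => //.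
  have := ltn_ord x; have := ltn_ord y; nia.
elim: a b c => [|x a IH] [|y b] c //=; first by rewrite leqnn.
case=> sab.
case: (ltngtP x y) => [xy|xy|xy] /=.
- by apply/esym/ltnW/mono2; rewrite // ltn_add2l.
- have -> : (x == y) = false by apply/eqP => h; rewrite h ltnn in xy.
  by apply/esym/negbTE; rewrite -ltnNge; apply: mono2; rewrite ?ltn_add2l.
- by rewrite (val_inj xy) eqxx; exact: IH.
Qed.

Fixpoint setenv e (xs : seq nat) (a : seq 'I_n) : env n := match xs, a with
  | x :: xs, v :: a => setenv (upde e x v) xs a
  | _, _ => e
  end.

Fixpoint tuples (k : nat) : seq (seq 'I_n) :=
  if k is k'.+1 then [seq x :: t | x <- enum 'I_n, t <- tuples k'] else [:: [::]].

Lemma mem_tuples k a : (a \in tuples k) = (size a == k).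
Proof.
elim: k a => [|k IH] a /=; first by rewrite inE size_eq0.
apply/allpairsP/idP => [[[x t] /= [_ ht ->]]|]; first by rewrite /= eqSS -IH.
case: a => // x t; rewrite /= eqSS -IH => ht; exists (x, t); split=> //.
by rewrite mem_enum.
Qed.

Lemma exec_nest p xs e s :
  exec (nest xs p) e s = foldl (fun s a => exec p (setenv e xs a) s) s (tuples (size xs)).
Proof.
elim: xs e s => //= x xs IH e s.
elim: (enum 'I_n) s => //= a l IHl s; rewrite foldl_cat -IHl; congr foldl.
rewrite IH; elim: (tuples _) (s) => //= t ts IHt s'; exact: IHt.
Qed.

Lemma eval_eq R R' e f : (forall r, reads r f -> R r = R' r) -> eval R e f = eval R' e f.
Proof.
elim: f e => [r xs|x y|x c|f IH|f IH g IH'|x f IH] e h //=.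
- by rewrite (h r) //=; case: (@eqnP r r).
- by rewrite IH.
- by rewrite IH ?IH'// => r hr; apply: h; rewrite /= hr ?orbT.
- by apply: eq_existsb => a; apply: IH.
Qed.

Lemma setenv_notin e xs a y : y \notin xs -> setenv e xs a y = e y.
Proof.
elim: xs a e => [|x xs IH] [|v a] e //; rewrite inE negb_or => /andP[yx yxs] /=.
by rewrite IH// /upde; case: (@eqnP y x) yx => // ->; rewrite eqxx.
Qed.

Lemma map_setenv e xs a : uniq xs -> size a = size xs -> map (setenv e xs a) xs = a.
Proof.
elim: xs a e => [|x xs IH] [|v a] e //= /andP[nx ux] [sa].
rewrite setenv_notin// /upde; case: (@eqnP x x) => // _; congr (_ :: _).
exact: IH.
Qed.

(** The loop writes in place, so its result is the simultaneous one only because [f] does not read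
    [q]. *)
Lemma exec_nest_put q xs f e s : uniq xs -> ~~ reads q f ->
  exec (nest xs (Put q xs f)) e s = State (fun r a => if eqn r q && eqn (size a) (size xs)
     then eval (rl s) (setenv e xs a) f else rl s r a) (ip s) (op s).
Proof.
move=> ux nq; rewrite exec_nest.
have H l s' : (forall r, ~~ eqn r q -> rl s' r = rl s r) -> {in l, forall a, size a = size xs} ->
  foldl (fun s a => exec (Put q xs f) (setenv e xs a) s) s' l =
  State (fun r a => if eqn r q && (a \in l) then eval (rl s) (setenv e xs a) f else rl s' r a)
    (ip s') (op s').
  elim: l s' => [|a l IH] s' hs hl.
    by case: s' {hs} => R i o /=; congr State; apply/funext => r; apply/funext => a; rewrite andbF.
  rewrite /= IH; last 2 first.
  - by move=> r nr; apply/funext => a'; rewrite /= /put (negPf nr) /= hs.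
  - by move=> a' h; apply: hl; rewrite inE h orbT.
  rewrite /= map_setenv//; last by apply: hl; exact: mem_head.
  congr State; apply/funext => r; apply/funext => a'; rewrite inE /put.
  case: (@eqnP r q) => //= rq; case: (a' \in l); rewrite ?orbT// orbF; case: eqP => // ->.
  apply: eval_eq => r' hr'; apply: hs; apply: contra nq => /eqnP <-; exact: hr'.
rewrite H //; last by move=> a; rewrite mem_tuples => /eqP.
congr State; apply/funext => r; apply/funext => a; rewrite mem_tuples.
by have -> : (size a == size xs) = eqn (size a) (size xs) by [].
Qed.

Lemma exec_setp r xs f e s : uniq xs -> r < 24 -> ~~ reads (24 + size xs) f ->
  exec (setp r xs f) e s = State (fun r' a =>
    if (eqn r' r || eqn r' (24 + size xs)) && eqn (size a) (size xs)
    then eval (rl s) (setenv e xs a) f else rl s r' a) (ip s) (op s).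
Proof.
move=> ux r24 nr; rewrite /setp; set q := 24 + size xs.
rewrite -[exec (Seq _ _) e s]/(exec (nest xs (Put r xs (FRel q xs))) e (exec (nest xs (Put q xs f)) e s)).
rewrite (@exec_nest_put q xs f e s ux nr) (@exec_nest_put r xs (FRel q xs) e _ ux) /=; last first.
  by apply/negP => /eqnP h; move: r24; rewrite -h /q; lia.
congr State; apply/funext => r'; apply/funext => a.
case: (@eqnP (size a) (size xs)) => sa; last by rewrite !andbF.
have E m : eqn m m = true by apply/eqnP.
by rewrite !andbT map_setenv// sa !E; case: (eqn r' r).
Qed.

Lemma exec_frame p e s r : r \notin mods p -> rl (exec p e s) r = rl s r.
Proof.
elim: p e s => [q xs f|p IH q IH'|x p IH|f p IH|q xs|x f] e s //=.
- by rewrite inE => rq; apply/funext => a; rewrite /put; case: (@eqnP r q) rq => // ->; rewrite eqxx.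
- by rewrite mem_cat negb_or => /andP[hp hq]; rewrite IH'// IH.
- by move=> h; elim: (enum 'I_n) s => //= a l IHl s; rewrite IHl IH.
- by move=> h; case: ifP => // _; rewrite IH.
- by rewrite inE => rq; apply/funext => a; rewrite /put; case: (@eqnP r q) rq => // ->; rewrite eqxx.
Qed.

Lemma exec_pure p e s : pure p -> ip (exec p e s) = ip s /\ op (exec p e s) = op s.
Proof.
elim: p e s => [q xs f|p IH q IH'|x p IH|f p IH|q xs|x f] e s //=.
- by move=> /andP[hp hq]; have [-> ->] := IH' e (exec p e s) hq; exact: IH.
- by move=> h; elim: (enum 'I_n) s => //= a l IHl s; have [-> ->] := IHl (exec p (upde e x a) s); exact: IH.
- by move=> h; case: ifP => // _; exact: IH.
Qed.

Lemma uniq_tuples k : uniq (tuples k).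
Proof.
elim: k => //= k IH; apply: allpairs_uniq => //; first exact: enum_uniq.
by move=> [x t] [y u] _ _ /= [-> ->].
Qed.

(** A loop rule whose invariant speaks of the tuples visited so far; each tuple comes exactly once,
    and the order is left open. *)
Lemma exec_nest_visit (Inv : seq (seq 'I_n) -> state n -> Prop) p xs e s : Inv [::] s ->
  (forall D a s', size a = size xs -> a \notin D -> Inv D s' -> Inv (a :: D) (exec p (setenv e xs a) s')) ->
  exists D, (forall a, size a = size xs -> a \in D) /\ Inv D (exec (nest xs p) e s).
Proof.
move=> I0 step; rewrite exec_nest.
have H (l D : seq (seq 'I_n)) s' : uniq (l ++ D) -> {in l, forall a, size a = size xs} -> Inv D s' ->
    exists D' : seq (seq 'I_n), {subset l <= D'} /\ {subset D <= D'} /\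
      Inv D' (foldl (fun s a => exec p (setenv e xs a) s) s' l).
  elim: l D s' => [|a l IH] D s' un hl ID; first by exists D; split; [|split].
  move: un; rewrite /= mem_cat negb_or => /andP[/andP[al aD] un].
  have [||D' [h1 [h2 h3]]] := IH (a :: D) _ _ _ (step D a s' (hl a (mem_head _ _)) aD ID).
  - by rewrite -cat1s uniq_catCA /= mem_cat negb_or al aD.
  - by move=> b bl; apply: hl; rewrite inE bl orbT.
  exists D'; split; [|split=> //].
    by move=> b; rewrite inE => /orP[/eqP->|/h1//]; apply: h2; exact: mem_head.
  by move=> b bD; apply: h2; rewrite inE bD orbT.
have [||D [h1 [_ h3]]] := H (tuples (size xs)) [::] s _ _ I0.
- by rewrite cats0 uniq_tuples.
- by move=> a; rewrite mem_tuples => /eqP.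
by exists D; split=> // a sa; apply: h1; rewrite mem_tuples sa.
Qed.

Lemma exec_For_ind (Inv : nat -> state n -> Prop) p x e s : Inv 0 s ->
  (forall (a : 'I_n) s', Inv a s' -> Inv a.+1 (exec p (upde e x a) s')) ->
  Inv n (exec (For x p) e s).
Proof.
move=> I0 step /=.
suff H k : k <= n -> Inv k (foldl (fun s a => exec p (upde e x a) s) s (take k (enum 'I_n))).
  by have := H n (leqnn n); rewrite take_oversize// size_enum_ord.
elim: k => [|k IH] kn; first by rewrite take0.
rewrite (take_nth (Ordinal kn)) ?size_enum_ord// -cats1 foldl_cat /=.
have -> : nth (Ordinal kn) (enum 'I_n) k = Ordinal kn by apply: val_inj; rewrite /= nth_enum_ord.
exact: step (Ordinal kn) _ (IH (ltnW kn)).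
Qed.

(** Two nested loops used as a counter up to [n * n], the number of pairs, which bounds every
    iteration of the algorithm. *)
Lemma exec_For2_ind (Inv : nat -> state n -> Prop) p x y e s : Inv 0 s ->
  (forall k s' (a b : 'I_n), Inv k s' -> Inv k.+1 (exec p (upde (upde e x a) y b) s')) ->
  Inv (n * n) (exec (For x (For y p)) e s).
Proof.
move=> I0 step; apply: (@exec_For_ind (fun k => Inv (k * n))) => // a s' Ia.
have := @exec_For_ind (fun k => Inv (a * n + k)) p y (upde e x a) s'; rewrite addn0 => /(_ Ia).
move=> h; have := h _; rewrite mulSn addnC; apply=> b s'' Ib; rewrite addnS; exact: step.
Qed.
End Lemmas.
Arguments eval {n} R e f : simpl never.

(** * Breadth-first search *)

Section BreadthFirst.
Variables (N : finType) (arc : rel N) (src : pred N) (key : N -> nat).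
Hypothesis key_inj : injective key.

Definition least (P : pred N) : pred N := fun u => P u && [forall w, P w ==> (key u <= key w)].

Lemma least_ex (P : pred N) u : P u -> exists v, least P v.
Proof.
move=> Pu; exists [arg min_(v < u | P v) key v]; case: arg_minnP => // v Pv vmin.
by rewrite /least Pv; apply/forallP => w; apply/implyP; exact: vmin.
Qed.

Lemma least_uniq (P : pred N) u v : least P u -> least P v -> u = v.
Proof.
move=> /andP[Pu /forallP hu] /andP[Pv /forallP hv]; apply: key_inj; apply/eqP.
by rewrite eqn_leq (implyP (hu v) Pv) (implyP (hv u) Pu).
Qed.

(** The state after [k] rounds: [d] plays the distance from the sources, [P] is the parent relation,
    and closure under arcs is claimed only for vertices at distance below [k]. *)
Definition bfs_inv (k : nat) (R : pred N) (P : rel N) : Prop := exists d : N -> nat,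
  [/\ forall v, R v -> d v <= k, forall v, src v = R v && (d v == 0),
      forall u v, P u v -> [/\ R u, R v, arc u v & d v = (d u).+1],
      forall v, R v -> ~~ src v -> exists u, P u v &
      (forall u u' v, P u v -> P u' v -> u = u') /\
      (forall u v, R u -> arc u v -> d u < k -> R v /\ d v <= (d u).+1)].

(** A newly reached vertex takes its least reached predecessor as parent, so that parents are
    unique. *)
Definition bfs_par (R : pred N) (P : rel N) : rel N := fun u v =>
  P u v || ~~ R v && least (fun u => R u && arc u v) u.

Lemma bfs_inv0 : bfs_inv 0 src (fun _ _ => false).
Proof. by exists (fun=> 0); split=> // [v|v ->//]; rewrite andbT. Qed.

Lemma bfs_invS k R P : bfs_inv k R P ->
  bfs_inv k.+1 (fun v => R v || [exists u, bfs_par R P u v]) (bfs_par R P).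
Proof.
move=> [d [dk srcE PP Rpar [Puniq clo]]].
pose d' v := if R v then d v else k.+1.
have newP u v : bfs_par R P u v -> R v = false -> [/\ R u, arc u v & d u = k].
  move=> /orP[/PP[_ -> //]|/andP[nRv /andP[/andP[Ru uv] _]]] Rv; split=> //.
  apply/eqP; rewrite eqn_leq dk//= leqNgt; apply/negP => /(clo _ _ Ru uv)[].
  by rewrite Rv.
have parR u v : bfs_par R P u v -> R u.
  by move=> /orP[/PP[]|/andP[_ /andP[/andP[]]]].
exists d'; split.
- by move=> v _; rewrite /d'; case: ifP => // /dk /leqW.
- move=> v; rewrite srcE /d'; case: (R v) => //=; by rewrite andbF.
- move=> u v h; have Ru := parR _ _ h; rewrite /d' Ru /=.
  case Rv: (R v) => /=; first by case/orP: h => [/PP[_ _ -> ->]|/andP[]] //; rewrite Rv.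
  have [_ uv duk] := newP _ _ h Rv; split=> //; last by rewrite duk.
  by apply/existsP; exists u.
- move=> v /orP[Rv ns|/existsP[u h] _]; last by exists u.
  by have [u h] := Rpar v Rv ns; exists u; rewrite /bfs_par h.
- split.
    move=> u u' v h h'; case Rv: (R v).
      by case/orP: h => [h|]; [case/orP: h' => [h'|]; [exact: Puniq h h'|]|]; rewrite Rv.
    case/orP: h => [/PP[_]|/andP[_ h]]; first by rewrite Rv.
    case/orP: h' => [/PP[_]|/andP[_ h']]; first by rewrite Rv.
    exact: least_uniq h h'.
  move=> u v hu uv duk; have Ru : R u by move: duk; rewrite /d'; case: ifP => //; rewrite ltnn.
  have d'u : d' u = d u by rewrite /d' Ru.
  rewrite d'u in duk *; rewrite /d'.
  case Rv: (R v) => /=.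
    split=> //; case: (ltnP (d u) k) => [/(clo _ _ Ru uv)[]//|ku].
    by apply: leq_trans (dk v Rv) _; rewrite leqW.
  have [w lw] := @least_ex (fun u => R u && arc u v) u ltac:(by rewrite /= Ru uv).
  have h : bfs_par R P w v by rewrite /bfs_par Rv lw orbT.
  split; first by apply/existsP; exists w.
  case: (ltnP (d u) k) => [/(clo _ _ Ru uv)[]|ku]; first by rewrite Rv.
  by rewrite ltnS.
Qed.

(** The third clause excludes shortcuts; exchanging along the path keeps a forest because of it. *)
Definition bfs_path (tgt : pred N) (nx : rel N) (pth last : pred N) (l : nat) (v : nat -> N) : Prop :=
  [/\ [/\ src (v 0), tgt (v l) & indexed_path nx l v],
      forall i, i < l -> arc (v i) (v i.+1),
      forall i j, i <= l -> j <= l -> arc (v i) (v j) -> j <= i.+1,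
      forall i, 0 < i -> i <= l -> ~~ src (v i) &
      (forall x, pth x <-> exists2 i, i <= l & x = v i) /\ (forall x, last x = (x == v l))].

Lemma bfs_chain k R P d : (forall v, src v = R v && (d v == 0)) ->
  (forall u v, P u v -> [/\ R u, R v, arc u v & d v = (d u).+1]) ->
  (forall v, R v -> ~~ src v -> exists u, P u v) -> forall v, R v -> d v = k ->
  exists f : nat -> N, f k = v /\ forall i, i <= k -> [/\ R (f i), d (f i) = i & i < k -> P (f i) (f i.+1)].
Proof.
move=> srcE PP Rpar; elim: k => [|k IH] v Rv dv.
  by exists (fun=> v); split=> // i; rewrite leqn0 => /eqP->.
have [|u uv] := Rpar v Rv; first by rewrite srcE Rv dv.
have [Ru _ _ du] := PP _ _ uv; have [|f [fk hf]] := IH u Ru; first by rewrite dv in du; case: du.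
exists (fun i => if i <= k then f i else v); split; first by rewrite ltnn.
move=> i ik; case: (leqP i k) => ik'.
  have [h1 h2 h3] := hf i ik'; split=> // _; case: (ltnP i k) => [/h3//|ki].
  by have -> : i = k by [lia]; rewrite fk.
by have -> : i = k.+1 by [lia]; rewrite Rv dv ltnn.
Qed.

Definition bfs_closed (R : pred N) : Prop := (forall v, src v -> R v) /\ (forall u v, R u -> arc u v -> R v).

(** The distances along a chain of parents are distinct, hence below [#|N|], so after [#|N|] rounds
    every reached vertex has been expanded. *)
Lemma bfs_inv_closed k R P : #|N| <= k -> bfs_inv k R P -> bfs_closed R.
Proof.
move=> Nk [d [dk srcE PP Rpar [Puniq clo]]]; split; first by move=> v; rewrite srcE => /andP[].
move=> u v Ru uv; have [f [fu hf]] := bfs_chain srcE PP Rpar Ru (erefl (d u)).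
have [] // := clo u v Ru uv; apply: leq_trans Nk.
have inj : injective (fun i : 'I_(d u).+1 => f i).
  move=> i j h; apply: val_inj; have [_ di _] := hf i (leq_ord i).
  by have [_ dj _] := hf j (leq_ord j); rewrite /= -di -dj h.
by have := leq_card _ inj; rewrite card_ord.
Qed.

(** The set [pth] is obtained from the target by going back to parents. Parents are unique, so this
    set is a single path and [P] restricted to it is the successor relation. *)
Lemma bfs_result k R P (tgt : pred N) (t : N) (pth last : pred N) : bfs_inv k R P -> tgt t -> R t ->
  (forall x, last x = (x == t)) ->
  (exists m, #|N| <= m /\ pth =1 iter m (fun Q x => Q x || [exists y, P x y && Q y]) last) ->
  exists l v, bfs_path tgt (fun u v => P u v && pth v) pth last l v.
Proof.
move=> [d [dk srcE PP Rpar [Puniq clo]]] tt Rt lastE [m [Nm pthE]].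
have [f [ft hf]] := bfs_chain srcE PP Rpar Rt (erefl (d t)); set l := d t in ft hf *.
have finj i j : i <= l -> j <= l -> f i = f j -> i = j.
  by move=> il jl h; have [_ di _] := hf i il; have [_ dj _] := hf j jl; rewrite -di -dj h.
have lN : l < #|N|.
  have inj : injective (fun i : 'I_l.+1 => f i).
    by move=> i j h; apply: val_inj; apply: finj h; rewrite leq_ord.
  by have := leq_card _ inj; rewrite card_ord.
have itE q x : iter q (fun Q x => Q x || [exists y, P x y && Q y]) last x <->
    exists i, [/\ i <= l, l <= i + q & x = f i].
  elim: q x => [|q IH] x.
    rewrite /= lastE; split=> [/eqP->|[i [il li ->]]]; first by exists l; rewrite addn0 ft.
    by have -> : i = l by [lia]; rewrite ft.
  rewrite iterS; split.
    case/orP => [/IH[i [il li ->]]|/existsP[y /andP[xy /IH[i [il li yE]]]]].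
      by exists i; split=> //; lia.
    subst y; case: i il li xy => [|i] il li xy.
      have [R0 d0 _] := hf 0 il; have [_ _ _] := PP _ _ xy; by rewrite d0.
    have [_ _ h] := hf i (ltnW il).
    by exists i; split; [lia|lia|exact: Puniq xy (h il)].
  move=> [i [il li ->]]; case: (ltnP (i + q) l) => [iq|iq]; last first.
    by apply/orP; left; apply/IH; exists i.
  apply/orP; right; apply/existsP; exists (f i.+1).
  have [_ _ h] := hf i il; rewrite h ?ltn_neqAle; last by lia.
  by apply/IH; exists i.+1; split=> //; lia.
have pthP x : pth x <-> exists2 i, i <= l & x = f i.
  rewrite pthE itE; split=> [[i [il _ ->]]|[i il ->]]; first by exists i.
  by exists i; split=> //; lia.
exists l, f; split.
- split; [by have [R0 d0 _] := hf 0 isT; rewrite srcE R0 d0|by rewrite ft|].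
  split=> // x y; split.
    case/andP => xy /pthP[i il yE]; subst y; case: i il xy => [|i] il xy.
      have [R0 d0 _] := hf 0 il; have [_ _ _] := PP _ _ xy; by rewrite d0.
    have [_ _ h] := hf i (ltnW il); by exists i; split=> //; exact: Puniq xy (h il).
  move=> [i [il -> ->]]; have [_ _ h] := hf i (ltnW il); rewrite h//=.
  by apply/pthP; exists i.+1.
- by move=> i il; have [_ _ /(_ il)/PP[]] := hf i (ltnW il).
- move=> i j il jl aij; have [Ri di _] := hf i il; have [Rj dj _] := hf j jl.
  case: (ltnP (d (f i)) k) => [/(clo _ _ Ri aij)[_]|ki]; first by rewrite di dj.
  have := dk _ Rj; rewrite dj => jk; rewrite di in ki; lia.
- by move=> i i0 il; have [Ri di _] := hf i il; rewrite srcE Ri di -lt0n i0.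
- by split=> // x; rewrite lastE ft.
Qed.
End BreadthFirst.

Arguments exec {n} p e s : simpl never.
Arguments upde {n} e x a y /.

(** Input: [rG], [rT]. Bound on the connectivity, as an initial segment: [rK]. Reduced graph and its
    owners: [rA], [rOwn]. Graph under test and verdict: [rB], [rOk]. Flow: [rFl]. Search: [rArc],
    [rSrc], [rTgt], [rRch], [rPar], [rTg], [rPth]. Allowed edges and forest: [rAl], [rF].
    Connectivity with one label off or none: [rC], [rC0]. Trees under construction: [rTr]; trees
    kept: [rBJ], [rBE]. Tree indices: [rJ]. Incidence of elements: [rInc]. *)
Notation rG := 0 (only parsing).
Notation rT := 1 (only parsing).
Notation rK := 2 (only parsing).
Notation rA := 3 (only parsing).
Notation rOwn := 4 (only parsing).
Notation rB := 5 (only parsing).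
Notation rOk := 6 (only parsing).
Notation rFl := 7 (only parsing).
Notation rArc := 8 (only parsing).
Notation rSrc := 9 (only parsing).
Notation rTgt := 10 (only parsing).
Notation rRch := 11 (only parsing).
Notation rPar := 12 (only parsing).
Notation rTg := 13 (only parsing).
Notation rPth := 14 (only parsing).
Notation rAl := 15 (only parsing).
Notation rF := 16 (only parsing).
Notation rC := 17 (only parsing).
Notation rC0 := 18 (only parsing).
Notation rTr := 19 (only parsing).
Notation rBJ := 20 (only parsing).
Notation rBE := 21 (only parsing).
Notation rJ := 22 (only parsing).
Notation rInc := 23 (only parsing).

(** Symbols 24 to 30 are the scratch relations of [setp], of arities 0 to 6. *)
Definition arities : seq nat :=
  [:: 2; 1; 1; 2; 2; 2; 0; 4; 4; 2; 2; 2; 4; 2; 2; 6; 6; 6; 4; 3; 1; 3; 1; 3;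
      0; 1; 2; 3; 4; 5; 6; 0].

Definition fFalse := FLt 0 0.

(** * Breadth-first search as a program *)

Definition bfs_step : prog := Seq
  (setp rPar [:: 0; 1; 2; 3] (fOr (FRel rPar [:: 0; 1; 2; 3])
     (FAnd (FNot (FRel rRch [:: 2; 3]))
       (FAnd (FAnd (FRel rRch [:: 0; 1]) (FRel rArc [:: 0; 1; 2; 3]))
         (fAll 4 (fAll 5 (fImp (FAnd (FRel rRch [:: 4; 5]) (FRel rArc [:: 4; 5; 2; 3]))
           (fLex [:: 0; 1] [:: 4; 5]))))))))
  (setp rRch [:: 2; 3] (fOr (FRel rRch [:: 2; 3]) (FEx 0 (FEx 1 (FRel rPar [:: 0; 1; 2; 3]))))).

Definition bfs_search : prog := Seq (setp rRch [:: 0; 1] (FRel rSrc [:: 0; 1]))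
  (Seq (setp rPar [:: 0; 1; 2; 3] fFalse) (For 10 (For 11 bfs_step))).

Definition path_step : prog :=
  setp rPth [:: 0; 1] (fOr (FRel rPth [:: 0; 1])
    (FEx 2 (FEx 3 (FAnd (FRel rPar [:: 0; 1; 2; 3]) (FRel rPth [:: 2; 3]))))).

Definition path_trace : prog := Seq
  (setp rTg [:: 0; 1] (FAnd (FAnd (FRel rTgt [:: 0; 1]) (FRel rRch [:: 0; 1]))
     (fAll 4 (fAll 5 (fImp (FAnd (FRel rTgt [:: 4; 5]) (FRel rRch [:: 4; 5]))
        (fLex [:: 0; 1] [:: 4; 5]))))))
  (Seq (setp rPth [:: 0; 1] (FRel rTg [:: 0; 1])) (For 10 (For 11 path_step))).

(** Nodes are pairs of vertices. One search thus serves the split vertices of a network, the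
    elements and, with a constant second entry, the vertices themselves. *)
Definition bfs : prog := Seq bfs_search path_trace.

Definition fNx a b c d := FAnd (FRel rPar [:: a; b; c; d]) (FRel rPth [:: c; d]).

Section Readers.
Variable n : nat.
Notation N := ('I_n * 'I_n)%type.
Implicit Types (s : state n) (e : env n) (u v : N).

Definition rd1 s r (x : 'I_n) : bool := rl s r [:: x].
Definition rdg s r : rel 'I_n := fun x y => rl s r [:: x; y].
Definition rd2 s r : pred N := fun u => rl s r [:: u.1; u.2].
Definition rd4 s r : rel N := fun u v => rl s r [:: u.1; u.2; v.1; v.2].
Definition rd6 s r : N -> rel N := fun w u v => rl s r [:: w.1; w.2; u.1; u.2; v.1; v.2].
Definition sett s r : {set 'I_n} := [set x | rd1 s r x].

Lemma exec_Seq p q e s : exec (Seq p q) e s = exec q e (exec p e s).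
Proof. by []. Qed.

Lemma exec_If f p e s : exec (If f p) e s = if eval (rl s) e f then exec p e s else s.
Proof. by []. Qed.

Lemma rl_setp r xs f e s a : uniq xs -> r < 24 -> ~~ reads (24 + size xs) f ->
  size a = size xs -> rl (exec (setp r xs f) e s) r a = eval (rl s) (setenv e xs a) f.
Proof.
move=> ux r24 nr sa; rewrite exec_setp// [rl _]/=.
have E m : eqn m m = true by apply/eqnP.
by rewrite sa !E.
Qed.

Arguments rl {n} _ : simpl never.

Definition key u : nat := u.1 * n + u.2.

Lemma key_inj : injective key.
Proof.
move=> [a b] [c d]; rewrite /key /= => h.
have := @horner_digits_inj n (leq_ltn_trans (leq0n _) (ltn_ord a)) [:: a; b] [:: c; d] 0 0 erefl.
by rewrite /= !mul0n !add0n => /(_ h)[_ [-> ->]].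
Qed.

Lemma lexle2 u v : lexle [:: u.1; u.2] [:: v.1; v.2] = (key u <= key v).
Proof. by rewrite (lexle_code (n := n) (a := [:: u.1; u.2]) 0) //= !mul0n !add0n. Qed.

Lemma rd4_bfs_step e s u v : rd4 (exec bfs_step e s) rPar u v =
  bfs_par (rd4 s rArc) key (rd2 s rRch) (rd4 s rPar) u v.
Proof.
rewrite /bfs_step /rd4 exec_Seq exec_frame// rl_setp//.
rewrite !evalE /= /bfs_par /least; congr (_ || (_ && (_ && _))).
apply: eq_forallb => w; rewrite !evalE /=.
by rewrite -lexle2.
Qed.

Lemma rd2_bfs_step e s v : rd2 (exec bfs_step e s) rRch v =
  rd2 s rRch v || [exists u, bfs_par (rd4 s rArc) key (rd2 s rRch) (rd4 s rPar) u v].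
Proof.
under eq_existsb do rewrite -(rd4_bfs_step e).
rewrite /bfs_step /rd2 exec_Seq rl_setp// !evalE /=.
congr (_ || _); first by rewrite exec_frame.
apply: eq_existsb => u; rewrite ?evalE /rd4 /bfs_step exec_Seq.
by rewrite (@exec_frame _ (setp rRch _ _)).
Qed.

Lemma exec_bfs_search e s (s' := exec bfs_search e s) :
  bfs_inv (rd4 s rArc) (rd2 s rSrc) (n * n) (rd2 s' rRch) (rd4 s' rPar).
Proof.
rewrite /s' /bfs_search 2!exec_Seq.
set s1 := exec _ e (exec _ e s).
have A1 : rd4 s1 rArc = rd4 s rArc by rewrite /rd4 /s1 !exec_frame.
have Inv0 : bfs_inv (rd4 s rArc) (rd2 s rSrc) 0 (rd2 s1 rRch) (rd4 s1 rPar).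
  have -> : rd2 s1 rRch = rd2 s rSrc.
    by apply/funext => u; rewrite /rd2 /s1 exec_frame// rl_setp.
  have -> : rd4 s1 rPar = fun _ _ => false.
    by apply/funext => u; apply/funext => v; rewrite /rd4 /s1 rl_setp// !evalE ltnn.
  exact: bfs_inv0.
pose Inv k s2 := rd4 s2 rArc = rd4 s rArc /\ bfs_inv (rd4 s rArc) (rd2 s rSrc) k (rd2 s2 rRch) (rd4 s2 rPar).
have [] // : Inv (n * n) (exec (For 10 (For 11 bfs_step)) e s1).
apply: exec_For2_ind => // k s2 a b [h1 h2]; split; first by rewrite /rd4 exec_frame.
set e' := upde _ _ _.
have -> : rd2 (exec bfs_step e' s2) rRch = fun v => rd2 s2 rRch v ||
    [exists u, bfs_par (rd4 s rArc) key (rd2 s2 rRch) (rd4 s2 rPar) u v].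
  by apply/funext => v; rewrite rd2_bfs_step h1.
have -> : rd4 (exec bfs_step e' s2) rPar = bfs_par (rd4 s rArc) key (rd2 s2 rRch) (rd4 s2 rPar).
  by apply/funext => u; apply/funext => v; rewrite rd4_bfs_step h1.
exact: bfs_invS key_inj _ _ _ h2.
Qed.

Definition nx_of s : rel N := fun u v => rd4 s rPar u v && rd2 s rPth v.

Lemma exec_path_trace e s (s' := exec path_trace e s) :
  (forall x, rd2 s' rTg x = least key (fun x => rd2 s rTgt x && rd2 s rRch x) x) /\
  rd2 s' rPth =1 iter (n * n) (fun Q x => Q x || [exists y, rd4 s rPar x y && Q y]) (rd2 s' rTg).
Proof.
have TgE : forall x, rd2 s' rTg x = least key (fun x => rd2 s rTgt x && rd2 s rRch x) x.
  move=> x; rewrite /s' /path_trace 2!exec_Seq.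
  rewrite /rd2 2?exec_frame// rl_setp// !evalE /= /least; congr (_ && _).
  apply: eq_forallb => w; rewrite !evalE /=.
by rewrite -lexle2.
split=> // x; rewrite /s' /path_trace 2!exec_Seq.
set s1 := exec _ e (exec _ e s).
have P1 : rd4 s1 rPar = rd4 s rPar by rewrite /rd4 /s1 !exec_frame.
pose Inv k s2 := rd4 s2 rPar = rd4 s rPar /\
  rd2 s2 rPth =1 iter k (fun Q x => Q x || [exists y, rd4 s rPar x y && Q y]) (rd2 s' rTg).
have [_ ->] // : Inv (n * n) (exec (For 10 (For 11 path_step)) e s1).
apply: exec_For2_ind.
  split=> // u; rewrite /rd2 /s1 rl_setp// !evalE /= /s' /path_trace.
  by rewrite 2!exec_Seq (@exec_frame _ (For _ _))// (@exec_frame _ (setp rPth _ _)).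
move=> k s2 a b [h1 h2]; split; first by rewrite /rd4 exec_frame.
move=> u; rewrite iterS -h2 /rd2 rl_setp// !evalE /=.
 congr (_ || _).
by apply: eq_existsb => w; rewrite !evalE; congr (_ && _); [rewrite -h1|exact: h2].
Qed.

Theorem exec_bfs e s (s' := exec bfs e s) (arc := rd4 s rArc) (src := rd2 s rSrc) (tgt := rd2 s rTgt) :
  (forall x, ~~ rd2 s' rPth x) /\ (exists R, bfs_closed arc src R /\ forall x, R x -> ~~ tgt x) \/
  exists l (f : nat -> N), bfs_path arc src tgt (nx_of s') (rd2 s' rPth) (rd2 s' rTg) l f.
Proof.
rewrite /s' /bfs exec_Seq.
set s1 := exec bfs_search e s; have inv : bfs_inv arc src (n * n) (rd2 s1 rRch) (rd4 s1 rPar) := exec_bfs_search e s.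
have [TgE PthE] := exec_path_trace e s1; set s2 := exec path_trace e s1.
have tgtE : rd2 s1 rTgt = tgt by rewrite /rd2 /s1 exec_frame.
have cN : #|{: N}| = n * n by rewrite card_prod card_ord.
have [/existsP[t ht]|/existsPn no] := boolP [exists t, tgt t && rd2 s1 rRch t].
  right; have [t' lt'] := @least_ex _ key (fun x => tgt x && rd2 s1 rRch x) t ht.
  have /andP[/andP[tt' Rt'] _] := lt'.
  have lastE x : rd2 s2 rTg x = (x == t').
    rewrite TgE tgtE; apply/idP/eqP => [h|->//]; exact: least_uniq key_inj _ _ _ h lt'.
  have -> : nx_of s2 = fun u v => rd4 s1 rPar u v && rd2 s2 rPth v.
    by apply/funext => u; apply/funext => v; rewrite /nx_of /rd4 /s2 exec_frame.
  apply: bfs_result inv tt' Rt' lastE _; exists (n * n); split; first by rewrite cN.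
  by move=> x; rewrite PthE.
left; have noTg x : rd2 s2 rTg x = false.
  by rewrite TgE tgtE; apply/negbTE/negP => /andP[h _]; have := no x; rewrite h.
split.
  move=> x; rewrite PthE; elim: (n * n) x => [|k IH] x; first by rewrite /= noTg.
  rewrite iterS negb_or IH; apply/existsPn => y; by rewrite negb_and IH orbT.
exists (rd2 s1 rRch); split; first by apply: bfs_inv_closed inv; rewrite cN.
by move=> x Rx; have := no x; rewrite Rx andbT.
Qed.
End Readers.
Arguments rl {n} _ : simpl never.

(** * Testing element connectivity *)

(** The formula of [network]; the vertices 0 and 1 serve as the marks [o0] and [o1] of the two
    copies. *)
Definition fCap x b y c := fOr
  (FAnd (fEq x y) (FAnd (FNot (FRel rT [:: x])) (FAnd (FCst b 0) (FCst c 1))))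
  (FAnd (FRel rB [:: x; y]) (FAnd (fOr (FAnd (FRel rT [:: x]) (FCst b 0))
     (FAnd (FNot (FRel rT [:: x])) (FCst b 1))) (FCst c 0))).

Definition augment_flow : prog :=
  Seq (setp rArc [:: 0; 1; 2; 3] (fOr (FAnd (fCap 0 1 2 3) (FNot (FRel rFl [:: 0; 1; 2; 3])))
     (FRel rFl [:: 2; 3; 0; 1])))
  (Seq (setp rSrc [:: 0; 1] (FAnd (fEq 0 34) (FCst 1 0)))
  (Seq (setp rTgt [:: 0; 1] (FAnd (fEq 0 33) (FCst 1 0)))
  (Seq bfs
  (Seq (setp rOk [::] (FAnd (FRel rOk [::]) (FEx 0 (FEx 1 (FRel rPth [:: 0; 1])))))
       (setp rFl [:: 0; 1; 2; 3] (fOr (FAnd (FRel rFl [:: 0; 1; 2; 3]) (FNot (fNx 2 3 0 1)))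
          (FAnd (fNx 0 1 2 3) (FNot (FRel rFl [:: 2; 3; 0; 1])))))))))  .

(** One augmentation for each member of [rK]: this is how the program counts to [k]. *)
Definition pair_flow : prog :=
  Seq (setp rFl [:: 0; 1; 2; 3] fFalse) (For 32 (If (FRel rK [:: 32]) augment_flow)).

Definition flow_test : prog := Seq (setp rOk [::] (FNot (FLt 36 36)))
  (nest [:: 34; 33] (If (FAnd (FRel rT [:: 34]) (FAnd (FRel rT [:: 33]) (FNot (fEq 34 33)))) pair_flow)).

Section FlowTest.
Variables (n : nat) (o0 o1 : 'I_n).
Hypotheses (o0E : o0 = 0 :> nat) (o1E : o1 = 1 :> nat).
Notation N := ('I_n * 'I_n)%type.
Implicit Types (s : state n) (e : env n).

Let o01 : o0 != o1. Proof. by rewrite -val_eqE /= o0E o1E. Qed.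

Let eqo0 (x : 'I_n) : (x == o0) = (x == 0 :> nat). Proof. by rewrite -val_eqE /= o0E. Qed.
Let eqo1 (x : 'I_n) : (x == o1) = (x == 1 :> nat). Proof. by rewrite -val_eqE /= o1E. Qed.

Definition net s : rel N := network (sett s rT) (rdg s rB) o0 o1.

Lemma exec_augment_flow e s (s' := exec augment_flow e s) (r := e 34) (t := e 33) (F := rd4 s rFl) :
  (rl s' rOk [::] = false /\ exists X : {set N}, [/\ (r, o0) \in X, (t, o0) \notin X &
     forall u v, u \in X -> residual (net s) F u v -> v \in X]) \/
  (rl s' rOk [::] = rl s rOk [::] /\ exists nx l f, [/\ indexed_path nx l f, f 0 = (r, o0),
     f l = (t, o0), forall x y, nx x y -> residual (net s) F x y & rd4 s' rFl = augment F nx]).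
Proof.
rewrite /s' /augment_flow 5!exec_Seq.
set s1 := exec (setp rArc _ _) e s; set s2 := exec (setp rSrc _ _) e s1.
set s3 := exec (setp rTgt _ _) e s2; set s4 := exec bfs e s3.
set s5 := exec (setp rOk _ _) e s4; set s6 := exec _ e s5.
have arcE : rd4 s3 rArc = residual (net s) F.
  apply/funext => u; apply/funext => v.
  rewrite /rd4 /s3 exec_frame// /s2 exec_frame// /s1 rl_setp// !evalE /=.
  rewrite /residual /net /network /out_copy /= !inE /F /rd4 /rd1 /rdg !eqo0 !eqo1.
  by case: (rl s 1 [:: u.1]); rewrite /= ?andbF ?orbF ?eqo0 ?eqo1.
have srcE u : rd2 s3 rSrc u = (u == (r, o0)).
  by rewrite /rd2 /s3 exec_frame// /s2 rl_setp// !evalE /= -pair_eqE /= /pair_eq /= eqo0.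
have tgtE u : rd2 s3 rTgt u = (u == (t, o0)).
  by rewrite /rd2 /s3 rl_setp// !evalE /= -pair_eqE /= /pair_eq /= eqo0.
have Fl5 : rl s5 rFl = rl s rFl.
  by rewrite /s5 exec_frame// /s4 exec_frame// /s3 exec_frame// /s2 exec_frame// /s1 exec_frame.
have Ok4 : rl s4 rOk = rl s rOk.
  by rewrite /s4 exec_frame// /s3 exec_frame// /s2 exec_frame// /s1 exec_frame.
have Ok6 : rl s6 rOk [::] = rl s rOk [::] && [exists u, rd2 s4 rPth u].
  by rewrite /s6 exec_frame// /s5 rl_setp// !evalE /= Ok4.
have Fl6 : rd4 s6 rFl = augment F (nx_of s4).
  apply/funext => u; apply/funext => v; rewrite /rd4 /s6 rl_setp// !evalE /= /augment /=.
  rewrite /nx_of /F /rd4 /rd2 Fl5 /s5 !(@exec_frame _ (setp rOk _ _))//.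
have [[noP [X [[X0 Xclo] XT]]]|[l [f [[f0 fl path] farc _ _ [pthE _]]]]] := exec_bfs e s3.
  left; rewrite Ok6; split; first by apply/negbTE; rewrite negb_and orbC; apply/orP; left; apply/existsPn.
  exists [set u | X u]; split; rewrite ?inE.
  - by apply: X0; rewrite srcE.
  - by apply: contraT => /negPn/XT; rewrite tgtE eqxx.
  - by move=> u v; rewrite !inE -arcE; exact: Xclo.
right; rewrite Ok6; split.
  have -> : [exists u, rd2 s4 rPth u] by apply/existsP; exists (f 0); apply/pthE; exists 0.
  by rewrite andbT.
exists (nx_of s4), l, f; split=> //.
- by apply/eqP; rewrite -srcE.
- by apply/eqP; rewrite -tgtE.
- by move=> x y /(path.2 x y).1[i [il -> ->]]; rewrite -arcE; exact: farc.
Qed.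

Definition same_input s s2 : Prop := [/\ rl s2 rT = rl s rT, rl s2 rB = rl s rB & rl s2 rK = rl s rK].

(** A failed augmentation leaves a residually closed set, hence a cut whose capacity is the current
    value of the flow, still below [k]; this contradicts [network_cut_ge] when [T] is
    [k]-connected. *)
Lemma exec_pair_flow e s (s' := exec pair_flow e s) (r := e 34) (t := e 33)
    (T := sett s rT) (B := rdg s rB) (k := #|sett s rK|) : r \in T -> t \in T -> r != t ->
  (rl s' rOk [::] -> rl s rOk [::] /\ exists F, is_flow (network T B o0 o1) (r, o0) (t, o0) F k) /\
  (elt_connected T B k -> rl s' rOk [::] = rl s rOk [::]).
Proof.
move=> rT' tT' rt; rewrite /s' /pair_flow exec_Seq; set s1 := exec _ e s.
have st : (r, o0) != (t, o0) by rewrite xpair_eqE negb_and rt.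
pose K j := [set i in sett s rK | i < j].
pose Inv j s2 := [/\ same_input s s2,
  rl s2 rOk [::] -> rl s rOk [::] /\ is_flow (net s) (r, o0) (t, o0) (rd4 s2 rFl) #|K j| &
  elt_connected T B k -> rl s2 rOk [::] = rl s rOk [::]].
have Inv0 : Inv 0 s1.
  split; first by split; rewrite /s1 exec_frame.
    rewrite {1}/s1 exec_frame// => ok; split=> //.
    have -> : rd4 s1 rFl = fun _ _ => false.
      by apply/funext => u; apply/funext => v; rewrite /rd4 /s1 rl_setp// !evalE ltnn.
    have -> : #|K 0| = 0 by apply: eq_card0 => i; rewrite !inE andbF.
    by split=> //; rewrite ?addn0.
  by rewrite /s1 exec_frame.
have K_n : K n = sett s rK by apply/setP => i; rewrite !inE ltn_ord andbT.
have [_ h1 h2] : Inv n (exec (For 32 (If (FRel rK [:: 32]) augment_flow)) e s1).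
  apply: exec_For_ind => // a s2 [[T2 B2 K2] fl2 ok2]; rewrite exec_If !evalE /=.
  have netE : net s2 = net s by rewrite /net /sett /rd1 /rdg T2 B2.
  case: ifP => Ka; rewrite K2 in Ka; last first.
    have KS : K a.+1 = K a.
      apply/setP => i; rewrite !inE ltnS leq_eqVlt; case: eqP => // /val_inj->.
      by rewrite /rd1 Ka.
    by split=> //; rewrite KS.
  have KS : #|K a.+1| = #|K a|.+1.
    have -> : K a.+1 = a |: K a.
      apply/setP => i; rewrite !inE ltnS leq_eqVlt val_eqE.
      by case: eqP => //= ->; rewrite /rd1 Ka.
    by rewrite cardsU1 !inE ltnn andbF.
  have frm : same_input s (exec augment_flow (upde e 32 a) s2) by split; rewrite exec_frame.
  have [[no [X [rX tX Xclo]]]|[okE [nx [l [f [path f0 fl res FlE]]]]]] := exec_augment_flow (upde e 32 a) s2.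
    split=> //; rewrite no// => conn; rewrite -ok2//; apply/esym/negbTE/negP => /fl2[_ flow].
    have := flow_saturated st flow rX tX; rewrite -netE => /(_ Xclo) satur.
    have := network_cut_ge o01 conn rT' tT' rX tX; rewrite -/(net s) -netE satur.
    rewrite leqNgt -KS subset_leq_card//; by apply/subsetP => i; rewrite inE => /andP[].
  split=> //; rewrite okE// => ok; have [? flow] := fl2 ok; split=> //.
  rewrite KS FlE; apply: (flow_augment st flow path f0 fl); rewrite -netE; exact: res.
split=> // ok; have [ok' flow] := h1 ok; split=> //.
by exists (rd4 (exec (For 32 (If (FRel rK [:: 32]) augment_flow)) e s1) rFl); rewrite /k -K_n.
Qed.

Theorem exec_flow_test e s : rl (exec flow_test e s) rOk [::] =
  elt_connected (sett s rT) (rdg s rB) #|sett s rK|.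
Proof.
rewrite /flow_test exec_Seq; set s1 := exec _ e s.
set T := sett s rT; set B := rdg s rB; set k := #|_|.
pose Inv (D : seq (seq 'I_n)) s2 := [/\ same_input s s2,
  rl s2 rOk [::] -> forall r t, r \in T -> t \in T -> r != t -> [:: r; t] \in D ->
    exists F, is_flow (network T B o0 o1) (r, o0) (t, o0) F k &
  elt_connected T B k -> rl s2 rOk [::]].
have [|D a s2 sa _ [[T2 B2 K2] h1 h2]|D [Dall [_ h1 h2]]] := @exec_nest_visit _ Inv
    (If (FAnd (FRel rT [:: 34]) (FAnd (FRel rT [:: 33]) (FNot (fEq 34 33)))) pair_flow) [:: 34; 33] e s1.
- by split=> [||_]; [split; rewrite /s1 exec_frame| |rewrite /s1 rl_setp// !evalE ltnn].
- case: a sa => [|r [|t []]]// _; rewrite exec_If !evalE /= T2; case: ifP => [/and3P[rT' tT' rt]|no]; last first.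
    split=> // ok r' t' r'T t'T rt'; rewrite inE => /orP[/eqP[rE tE]|]; last exact: h1.
    by move: no; rewrite -rE -tE rt'; move: r'T t'T; rewrite /T !inE /rd1 => -> ->.
  have fr : same_input s (exec pair_flow (upde (upde e 34 r) 33 t) s2) by split; rewrite exec_frame.
  have TE : sett s2 rT = T by rewrite /sett /rd1 T2.
  have BE : rdg s2 rB = B by rewrite /rdg B2.
  have KE : #|sett s2 rK| = k by rewrite /sett /rd1 K2.
  have := @exec_pair_flow (upde (upde e 34 r) 33 t) s2; rewrite /= TE BE KE !inE => /(_ rT' tT' rt)[p1 p2].
  split=> //; last by move=> conn; rewrite p2//; exact: h2.
  move=> /p1[/h1 ok ex] r' t' r'T t'T rt'; rewrite inE => /orP[/eqP[-> ->]//|]; exact: ok.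
apply/idP/idP => [ok|/h2//]; apply: (flows_elt_connected o01) => r t rT' tT' rt.
by apply: h1 => //; exact: (Dall [:: r; t]).
Qed.
End FlowTest.

(** * Reducing to a bipartite instance *)

Section Reduced.
Variables (V : finType) (G : rel V) (T : {set V}).
Implicit Types (A O : rel V).

(* [O w] is the set of vertices of [G] contracted to the non-terminal [w] of
   [A]; it is empty if [w] was contracted to another vertex. *)
Definition reduced A O : Prop :=
  [/\ [/\ symmetric A, irreflexive A & {in T &, forall x y, A x y = G x y}],
      (forall w z, O w z -> w \notin T /\ z \notin T),
      (forall w w' z, O w z -> O w' z -> w = w'),
      (forall w a b, O w a -> O w b -> connect [rel c d | [&& O w c, O w d & G c d]] a b) &
      (forall w x, w \notin T -> A w x -> exists z z', [/\ O w z, G z z' & if x \in T then z' = x else O x z'])].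

Definition merge_owner O p q : rel V := [rel x y | O x y && (x != q) || (x == p) && O q y].

(** The termination measure of the reduction. *)
Definition inner_pairs A : {set V * V} := [set u | [&& A u.1 u.2, u.1 \notin T & u.2 \notin T]].

Hypothesis Gsym : symmetric G.

Lemma reduced_delete A O p q : p \notin T -> q \notin T -> reduced A O -> reduced (delete_edge A p q) O.
Proof.
move=> pT qT [[sym irr AT] h1 h2 h3 h4]; split=> //; last by move=> w x wT /andP[wx _]; exact: h4.
split; [exact: delete_edge_sym|by move=> x; rewrite /delete_edge /= irr|].
move=> x y xT yT; rewrite /delete_edge /= AT//.
have -> : (x == p) = false by apply: contraNF pT => /eqP<-.
have -> : (x == q) = false by apply: contraNF qT => /eqP<-.
by rewrite andbT.
Qed.

Lemma reduced_contract A O p q : p \notin T -> q \notin T -> A p q -> reduced A O ->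
  reduced (contract_edge A p q) (merge_owner O p q).
Proof.
move=> pT qT Apq [[sym irr AT] h1 h2 h3 h4].
have pq : p != q by apply: contraTneq Apq => ->; rewrite irr.
have neT x z : z \notin T -> x \in T -> (x == z) = false by move=> zT xT; apply: contraNF zT => /eqP<-.
split.
- split; [exact: contract_edge_sym|by move=> x; rewrite /contract_edge /= eqxx|].
  move=> x y xT yT; rewrite /contract_edge /= (neT x q)// (neT y q)// (neT x p)// (neT y p)//= orbF -AT//.
  by case: eqP => //= ->; rewrite irr.
- move=> w z /orP[/andP[/h1//]|/andP[/eqP-> /h1[]//]].
- move=> w w' z /orP[/andP[Ow wq]|/andP[/eqP-> Oq]] /orP[/andP[Ow' wq']|/andP[/eqP-> Oq']] //.
  + exact: h2 Ow Ow'.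
  + by rewrite (h2 _ _ _ Ow Oq') eqxx in wq.
  + by rewrite (h2 _ _ _ Ow' Oq) eqxx in wq'.
- move=> w a b; have [->|wp] := eqVneq w p; last first.
    rewrite /merge_owner /= (negPf wp) !orbF => /andP[wa wq] /andP[wb _].
    apply: connect_sub (h3 _ _ _ wa wb) => c d /and3P[Oc Od cd]; apply: connect1.
    by rewrite /= ?orbF Oc Od wq cd.
  set e' := (X in connect X).
  have e'sym : symmetric e' by move=> c d; rewrite /e' /= Gsym andbCA.
  (* The edge of [G] that realizes [pq] links the two connected sets that are merged. *)
  have [z [z' [Oz zz']]] := h4 p q pT Apq; rewrite (negPf qT) => Oz'.
  have hub c : merge_owner O p q p c -> connect e' c z.
    rewrite /merge_owner /= eqxx pq andbT => /orP[Oc|Oc].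
      apply: connect_sub (h3 _ _ _ Oc Oz) => x y /and3P[Ox Oy xy]; apply: connect1.
      by rewrite /e' /merge_owner /= eqxx pq Ox Oy xy.
    apply: (@connect_trans _ _ z').
      apply: connect_sub (h3 _ _ _ Oc Oz') => x y /and3P[Ox Oy xy]; apply: connect1.
      by rewrite /e' /merge_owner /= eqxx Ox Oy xy !orbT.
    by apply: connect1; rewrite /e' /merge_owner /= eqxx pq Oz' Oz Gsym zz' !orbT.
  by move=> /hub az /hub bz; apply: connect_trans az _; rewrite (sym_connect_sym e'sym).
- move=> w x wT /and4P[wx wq xq] /or3P[wx'|/andP[/eqP wp qx]|/andP[/eqP xp wq']].
  + have [z [z' [Oz zz' hz]]] := h4 w x wT wx'; exists z, z'; split=> //.
      by rewrite /merge_owner /= Oz wq.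
    by case: ifP hz => // _ h; rewrite /merge_owner /= h xq.
  + have [z [z' [Oz zz' hz]]] := h4 q x qT qx; exists z, z'; split=> //.
      by rewrite /merge_owner /= wp eqxx Oz orbT.
    by case: ifP hz => // _ h; rewrite /merge_owner /= h xq.
  + have [z [z' [Oz zz' hz]]] := h4 w q wT wq'; exists z, z'; split=> //.
      by rewrite /merge_owner /= Oz wq.
    by move: hz; rewrite xp (negPf pT) (negPf qT) /merge_owner /= eqxx => ->; rewrite orbT.
Qed.

Lemma inner_pairs_delete A p q : p \notin T -> q \notin T -> A p q ->
  #|inner_pairs (delete_edge A p q)| < #|inner_pairs A|.
Proof.
move=> pT qT Apq; apply/proper_card/properP; split.
  by apply/subsetP => u; rewrite !inE /= => /and3P[/andP[-> _] -> ->].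
by exists (p, q); rewrite !inE /delete_edge /= ?Apq ?pT ?qT // !eqxx andbF.
Qed.

(** A pair of the contracted graph that was not adjacent in [A] comes from a pair with [q] in place
    of [p]. This charging is injective, and [(p, q)] itself is never charged. *)
Lemma inner_pairs_contract A p q : symmetric A -> p \notin T -> q \notin T -> A p q ->
  #|inner_pairs (contract_edge A p q)| < #|inner_pairs A|.
Proof.
move=> sym pT qT Apq.
pose f (u : V * V) := if A u.1 u.2 then u else if (u.1 == p) && A q u.2 then (q, u.2) else (u.1, q).
have pqA : (p, q) \in inner_pairs A by rewrite inE Apq pT qT.
rewrite [X in _ < X](cardsD1 (p, q)) pqA add1n ltnS.
suff inj : {in inner_pairs (contract_edge A p q) &, injective f}.
  rewrite -(card_in_imset inj).
  apply: subset_leq_card; apply/subsetP => _ /imsetP[[x y] + ->]; rewrite /f !inE /=.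
  move=> /and3P[/and4P[xy xq yq h] xT yT].
  case: ifP h => /= [Axy _|_ h].
    by rewrite Axy xT yT xpair_eqE (negPf yq) andbF.
  case: ifP h => /= [/andP[/eqP xp qy] _|_ /andP[/eqP yp xq']].
    by rewrite xpair_eqE qy qT yT -xp (eq_sym q) (negPf xq).
  by rewrite xpair_eqE xq' xT qT -yp (negPf xy).
move=> [x y] [x' y']; rewrite !inE /f /=.
move=> /and3P[/and4P[xy xq yq h] xT yT] /and3P[/and4P[xy' xq' yq' h'] xT' yT'].
have [qx qx'] : q <> x /\ q <> x' by split=> E; [rewrite E eqxx in xq|rewrite E eqxx in xq'].
have [qy qy'] : q <> y /\ q <> y' by split=> E; [rewrite E eqxx in yq|rewrite E eqxx in yq'].
case: ifP h => /= [_ _|_ h].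
  by case: ifP h' => //= _; case: ifP => //= _ _ [? ?]; congruence.
case: ifP h => /= [/andP[/eqP xp _] _|_ /andP[/eqP yp _]].
  case: ifP h' => /= [_ _ [? ?]|_ h']; first by congruence.
  by case: ifP h' => /= [/andP[/eqP x'p _] _ [->]|_ _ [? ?]]; congruence.
case: ifP h' => /= [_ _ [? ?]|_ h']; first by congruence.
by case: ifP h' => /= [_ _ [? ?]|_ /andP[/eqP y'p _] [->]]; congruence.
Qed.
End Reduced.

Definition fContract : fm := FAnd (FNot (fEq 0 1)) (FAnd (FNot (fEq 0 35)) (FAnd (FNot (fEq 1 35))
  (fOr (FRel rA [:: 0; 1]) (fOr (FAnd (fEq 0 36) (FRel rA [:: 35; 1]))
    (FAnd (fEq 1 36) (FRel rA [:: 0; 35])))))).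

(** One test decides: if the graph without [pq] loses the connectivity, then [delete_or_contract]
    guarantees that the contraction keeps it. *)
Definition reduce_edge : prog :=
  Seq (setp rB [:: 0; 1] (FAnd (FRel rA [:: 0; 1])
     (FNot (fOr (FAnd (fEq 0 36) (fEq 1 35)) (FAnd (fEq 0 35) (fEq 1 36))))))
  (Seq flow_test
  (Seq (setp rOwn [:: 0; 1] (fOr (FAnd (FRel rOk [::]) (FRel rOwn [:: 0; 1]))
     (FAnd (FNot (FRel rOk [::])) (fOr (FAnd (FRel rOwn [:: 0; 1]) (FNot (fEq 0 35)))
        (FAnd (fEq 0 36) (FRel rOwn [:: 35; 1]))))))
       (setp rA [:: 0; 1] (fOr (FAnd (FRel rOk [::]) (FRel rB [:: 0; 1]))
     (FAnd (FNot (FRel rOk [::])) fContract))))).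

Definition reduce_step : prog :=
  If (FAnd (FRel rA [:: 36; 35]) (FAnd (FNot (FRel rT [:: 36])) (FNot (FRel rT [:: 35])))) reduce_edge.

(** A sweep over all pairs decreases [inner_pairs] unless none is left, so [n * n] sweeps
    suffice. *)
Definition reduce : prog := Seq (setp rA [:: 0; 1] (FRel rG [:: 0; 1]))
  (Seq (setp rOwn [:: 0; 1] (FAnd (fEq 0 1) (FNot (FRel rT [:: 0]))))
       (For 38 (For 37 (nest [:: 36; 35] reduce_step)))).

Section Reduce.
Variables (n : nat) (o0 o1 : 'I_n).
Hypotheses (o0E : o0 = 0 :> nat) (o1E : o1 = 1 :> nat).
Implicit Types (s : state n) (e : env n).

Lemma exec_reduce_edge e s (s' := exec reduce_edge e s) (p := e 36) (q := e 35)
    (A := rdg s rA) (T := sett s rT) (k := #|sett s rK|) :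
  if elt_connected T (delete_edge A p q) k
  then rdg s' rA = delete_edge A p q /\ rdg s' rOwn = rdg s rOwn
  else rdg s' rA = contract_edge A p q /\ rdg s' rOwn = merge_owner (rdg s rOwn) p q.
Proof.
rewrite /s' /reduce_edge 3!exec_Seq; set s1 := exec (setp rB _ _) e s.
set s2 := exec flow_test e s1; set s3 := exec (setp rOwn _ _) e s2; set s4 := exec _ e s3.
have B1 : rdg s1 rB = delete_edge A p q.
  by apply/funext => x; apply/funext => y; rewrite /rdg /s1 rl_setp// !evalE.
have fr : [/\ rl s3 rA = rl s rA, rl s2 rOwn = rl s rOwn & rl s3 rB = rl s1 rB].
  by split; rewrite /s3 ?(@exec_frame _ (setp rOwn _ _))// /s2 exec_frame// /s1 exec_frame.
have Ok2 : rl s2 rOk [::] = elt_connected T (delete_edge A p q) k.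
  have TE : sett s1 rT = T by apply/setP => x; rewrite !inE /rd1 /s1 exec_frame.
  have KE : sett s1 rK = sett s rK by apply/setP => x; rewrite !inE /rd1 /s1 exec_frame.
  by rewrite /s2 (exec_flow_test o0E o1E) B1 TE KE.
have Ok3 : rl s3 rOk = rl s2 rOk by rewrite /s3 exec_frame.
have [f1 f2 f3] := fr.
have AE x y : rdg s4 rA x y = if rl s2 rOk [::] then delete_edge A p q x y else contract_edge A p q x y.
  rewrite /rdg /s4 rl_setp// !evalE /= Ok3 f1 f3 -B1 /rdg /contract_edge /=.
  by case: (rl s2 6 [::]); rewrite ?orbF.
have OE x y : rdg s4 rOwn x y = if rl s2 rOk [::] then rdg s rOwn x y else merge_owner (rdg s rOwn) p q x y.
  rewrite /rdg /s4 exec_frame// /s3 rl_setp// !evalE /= f2.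
  by case: (rl s2 6 [::]); rewrite ?orbF.
by rewrite -Ok2; case: ifP => ok; split; apply/funext => x; apply/funext => y; rewrite ?AE ?OE ok.
Qed.

Definition reduce_ok s s2 : Prop :=
  [/\ [/\ rl s2 rG = rl s rG, rl s2 rT = rl s rT & rl s2 rK = rl s rK],
      reduced (rdg s rG) (sett s rT) (rdg s2 rA) (rdg s2 rOwn) &
      elt_connected (sett s rT) (rdg s rG) #|sett s rK| ->
      elt_connected (sett s rT) (rdg s2 rA) #|sett s rK|].

Lemma exec_reduce_step e s s2 (s' := exec reduce_step e s2) (p := e 36) (q := e 35) :
  symmetric (rdg s rG) -> reduce_ok s s2 -> reduce_ok s s' /\
  (if (p, q) \in inner_pairs (sett s rT) (rdg s2 rA)
   then (#|inner_pairs (sett s rT) (rdg s' rA)| < #|inner_pairs (sett s rT) (rdg s2 rA)| : Prop) else s' = s2).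
Proof.
move=> Gsym [[G2 T2 K2] red conn]; rewrite inE /s' /reduce_step exec_If !evalE /= T2 !inE -/(rd1 s rT (e 36)) -/(rd1 s rT (e 35)).
rewrite -/(rdg s2 rA p q); case: ifP => [/and3P[Apq pT qT]|//].
have TE : sett s2 rT = sett s rT by rewrite /sett /rd1 T2.
have KE : sett s2 rK = sett s rK by rewrite /sett /rd1 K2.
have := exec_reduce_edge e s2; rewrite TE KE -/p -/q /=.
have pT' : p \notin sett s rT by rewrite inE.
have qT' : q \notin sett s rT by rewrite inE.
have [[Asym Airr _] _ _ _ _] := red.
have pq : p != q by apply: contraTneq Apq => ->; rewrite Airr.
have fr : [/\ rl (exec reduce_edge e s2) rG = rl s rG, rl (exec reduce_edge e s2) rT = rl s rT &
  rl (exec reduce_edge e s2) rK = rl s rK] by split; rewrite exec_frame.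
case: ifP => [del|/negbT del] [AE OE]; rewrite /reduce_ok AE OE; split.
- by split=> //; exact: reduced_delete.
- exact: inner_pairs_delete.
- by split=> //; [exact: reduced_contract|move=> /conn c; exact: (delete_or_contract Asym pT' qT' pq Apq c del)].
- exact: inner_pairs_contract.
Qed.

Theorem exec_reduce e s (s' := exec reduce e s) : symmetric (rdg s rG) -> irreflexive (rdg s rG) ->
  reduce_ok s s' /\ forall p q, p \notin sett s rT -> q \notin sett s rT -> ~~ rdg s' rA p q.
Proof.
move=> Gsym Girr; rewrite /s' /reduce 2!exec_Seq; set s1 := exec _ e (exec _ e s).
pose m s2 := #|inner_pairs (sett s rT) (rdg s2 rA)|.
have ok1 : reduce_ok s s1.
  have A1 : rdg s1 rA = rdg s rG.
    by apply/funext => x; apply/funext => y; rewrite /rdg /s1 exec_frame// rl_setp// !evalE.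
  have O1 x y : rdg s1 rOwn x y = (x == y) && (x \notin sett s rT).
    by rewrite /rdg /s1 rl_setp// !evalE /= inE /rd1 exec_frame.
  split; first by split; rewrite /s1 exec_frame// exec_frame.
    split; rewrite ?A1//.
    - by move=> w z; rewrite O1 => /andP[/eqP<-].
    - by move=> w w' z; rewrite !O1 => /andP[/eqP-> _] /andP[/eqP-> _].
    - by move=> w a b; rewrite !O1 => /andP[/eqP<- _] /andP[/eqP<- _]; exact: connect0.
    - move=> w x wT wx; exists w, x; split=> //; first by rewrite O1 eqxx.
      by case: ifP => // /negbT xT; rewrite O1 eqxx.
  by rewrite A1.
have [ok' m'] : reduce_ok s (exec (For 38 (For 37 (nest [:: 36; 35] reduce_step))) e s1) /\
    m (exec (For 38 (For 37 (nest [:: 36; 35] reduce_step))) e s1) <= n * n - n * n.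
  apply: (@exec_For2_ind _ (fun k s2 => reduce_ok s s2 /\ m s2 <= n * n - k)).
    split=> //; rewrite subn0; apply: leq_trans (max_card _) _.
    by rewrite card_prod card_ord.
  move=> k s2 a b [ok2 m2]; set e' := upde _ _ _.
  pose Inv (D : seq (seq 'I_n)) s3 := reduce_ok s s3 /\ (m s3 < m s2 \/ s3 = s2 /\
    forall p q, [:: p; q] \in D -> (p, q) \notin inner_pairs (sett s rT) (rdg s2 rA)).
  have [|D c s3 sc _ [ok3 h3]|D [Dall [ok3 h3]]] := @exec_nest_visit _ Inv reduce_step [:: 36; 35] e' s2.
  - by split=> //; right.
  - case: c sc => [|p [|q []]]// _; set e2 := setenv _ _ _.
    have [ok4] := @exec_reduce_step e2 s s3 Gsym ok3; case: ifP => pq.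
      move=> lt; split=> //; left; case: h3 => [h3|[h3 _]]; first exact: ltn_trans lt h3.
      by rewrite -[in X in _ < X]h3.
    move=> ->; split=> //; case: h3 => [|[E h3]]; [by left|right]; split=> // p' q'.
    rewrite inE => /orP[/eqP[-> ->]|/h3//]; by rewrite -E -[X in (X, _)]/(e2 36) -[X in (_, X)]/(e2 35) pq.
  split=> //; case: h3 => [|[-> h3]]; first by lia.
  have -> : m s2 = 0; last by lia.
  by apply: eq_card0 => -[p q]; apply/negbTE/h3/Dall.
split=> // p q pT qT; apply/negP => Apq; move: m'; rewrite subnn leqn0 cards_eq0 => /eqP/setP/(_ (p, q)).
by rewrite !inE /= Apq; move: pT qT; rewrite !inE => -> ->.
Qed.
End Reduce.

(** * Packing by augmentation *)

Lemma iter_closure (U : finType) (r : rel U) k u v : #|U| <= k ->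
  iter k (fun (Q : pred U) v => Q v || [exists w, Q w && r w v]) (pred1 u) v = connect r u v.
Proof.
move=> Uk; set f := fun Q : pred U => _.
have mono j m (x : U) : j <= m -> iter j f (pred1 u) x -> iter m f (pred1 u) x.
  by move=> jm; rewrite -(subnK jm); elim: (m - j) => // i IH /IH h; rewrite addSn iterS /f h.
apply/idP/idP.
  elim: k v {Uk} => [|k IH] v /=; first by move=> /eqP->; exact: connect0.
  case/orP => [/IH//|/existsP[w /andP[/IH uw wv]]]; exact: connect_trans uw (connect1 wv).
case/connectP => p0 /shortenP[p pth up _] ->.
have szp : size p <= k by apply: ltnW; apply: leq_trans Uk; rewrite -[(size p).+1]/(size (u :: p)) -(card_uniqP up) max_card.
apply: mono szp _; elim/last_ind: p pth {up} => [|p x IH] /=; first by rewrite eqxx.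
rewrite rcons_path last_rcons size_rcons => /andP[/IH h px] /=; apply/orP; right.
by apply/existsP; exists (last u p); rewrite h.
Qed.

(** * Augmentation along exchange paths *)

Section Exchange.
Variables (U L : finType) (E F : L -> rel U) (pkey : U * U -> nat).
Hypothesis pkey_inj : injective pkey.

Definition packing (M : L -> rel U) : Prop :=
  [/\ one_edge M, forest M & forall e u v, M e u v -> E e u v].

(** The optimality certificate of the matroid intersection: what the set of labels reached by a
    search satisfies when no augmenting path exists. *)
Definition exhausted (M : L -> rel U) (Q : {set L}) : Prop :=
  [/\ forall e, (forall u v, ~~ M e u v) -> e \in Q,
      forall e u v, e \in Q -> E e u v -> joined M set0 u v &
      forall e f u v, e \in Q -> E e u v -> ~~ joined M [set f] u v -> f \in Q].

Definition assigned (M : L -> rel U) : {set L} := [set e | [exists uv : U * U, M e uv.1 uv.2]].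

Definition free_label : pred L := fun e => e \notin assigned F.
(** An arc leads from [e] to [f] when [e] has an edge whose cycle in the forest passes through the
    edge of [f], so that [e] can take over from [f]. *)
Definition swap_arc : rel L := fun e f =>
  [exists uv : U * U, [&& E e uv.1 uv.2, joined F set0 uv.1 uv.2 & ~~ joined F [set f] uv.1 uv.2]].
Definition addable : pred L := fun e => [exists uv : U * U, E e uv.1 uv.2 && ~~ joined F set0 uv.1 uv.2].

(** Candidates for the new edge of [e]: it closes a cycle through the edge of the next label or, at
    the end of the path, joins two components. *)
Definition new_pair (nx : rel L) (last : pred L) (e : L) : pred (U * U) := fun uv =>
  [exists f, [&& nx e f, E e uv.1 uv.2, joined F set0 uv.1 uv.2 & ~~ joined F [set f] uv.1 uv.2]] ||
  [&& last e, E e uv.1 uv.2 & ~~ joined F set0 uv.1 uv.2].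

Definition exchanged (nx : rel L) (pth last : pred L) : L -> rel U := fun e u v =>
  F e u v && ~~ pth e || pth e && least pkey (new_pair nx last e) (u, v).

Lemma exhausted_closed R : bfs_closed swap_arc free_label R -> (forall x, R x -> ~~ addable x) ->
  exhausted F [set e | R e].
Proof.
move=> [R0 Rclo] RT.
have on e u v : e \in [set e | R e] -> E e u v -> joined F set0 u v.
  rewrite inE => /RT/existsPn/(_ (u, v)) /= h Ee; move: h; rewrite Ee negbK; exact.
split=> //.
  by move=> e he; rewrite inE; apply: R0; rewrite /free_label inE; apply/existsPn => uv; exact: he.
move=> e f u v eQ Ee nj; have j := on _ _ _ eQ Ee; move: eQ; rewrite !inE => Re.
by apply: Rclo Re _; apply/existsP; exists (u, v); rewrite /= Ee j nj.
Qed.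

Section Path.
Variables (nx : rel L) (pth last : pred L) (l : nat) (v : nat -> L).
Hypothesis path : bfs_path swap_arc free_label addable nx pth last l v.

(** A certificate would propagate along the path up to its end, where an edge can still be added.
    Hence a packing once exhausted is left unchanged by the remaining rounds. *)
Lemma exhausted_no_path Q : ~ exhausted F Q.
Proof.
case: path => [[s0 tl _] arcs _ _ _] [h1 h2 h3].
have inQ i : i <= l -> v i \in Q.
  elim: i => [_|i IH il].
    apply: h1 => x y; apply: contraNN s0 => Fxy; rewrite inE; apply/existsP.
    by exists (x, y).
  have /existsP[uv /and3P[Ee _ nj]] := arcs i il; exact: h3 (IH (ltnW il)) Ee nj.
have /existsP[uv /andP[Ee]] := tl; by rewrite (h2 _ _ _ (inQ l (leqnn l)) Ee).
Qed.

Hypothesis pack : packing F.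

(** The shortest path satisfies the hypotheses of [forest_exchange]. The free label at its start
    becomes assigned, and every label on it has a new edge, so none is lost. *)
Lemma packing_exchanged : packing (exchanged nx pth last) /\
  #|assigned F| < #|assigned (exchanged nx pth last)|.
Proof.
case: path => [[s0 tl [vinj nxP]] arcs short _ [pthP lastE]]; have [one for_ FE] := pack.
have np i uv : i <= l -> new_pair nx last (v i) uv -> [/\ E (v i) uv.1 uv.2,
    i < l -> joined F set0 uv.1 uv.2 /\ ~~ joined F [set v i.+1] uv.1 uv.2 &
    i = l -> ~~ joined F set0 uv.1 uv.2].
  move=> il /orP[/existsP[f /and4P[/nxP[j [jl vij fE]] Ee j0 nj]]|/and3P[+ Ee nj]].
    have ij : i = j by apply: vinj vij => //; exact: ltnW.
    by subst j; split=> // [_|il']; [rewrite -fE|rewrite il' ltnn in jl].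
  rewrite lastE => /eqP/vinj il'; split=> // lt; by rewrite il' ?ltnn in lt.
have [nw nwP] : exists nw : nat -> U * U, forall i, i <= l -> least pkey (new_pair nx last (v i)) (nw i).
  suff H i : exists uv, i <= l -> least pkey (new_pair nx last (v i)) uv.
    by have [nw h] := boolp.choice H; exists nw.
  have [il|li] := leqP i l; last first.
    by have /existsP[uv _] := tl; exists uv.
  suff [uv] : exists uv, new_pair nx last (v i) uv by move=> /(least_ex pkey)[uv']; exists uv'.
  have [lt|ge] := ltnP i l.
    have /existsP[uv h] := arcs i lt; exists uv; apply/orP; left; apply/existsP; exists (v i.+1).
    by rewrite h andbT; apply/nxP; exists i.
  have -> : i = l by lia.
  by have /existsP[uv h] := tl; exists uv; apply/orP; right; rewrite lastE eqxx h.
have nwE i : i <= l -> new_pair nx last (v i) (nw i) by move=> /nwP/andP[].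
have exP e x y : exchanged nx pth last e x y <->
    (F e x y /\ forall t, t <= l -> e <> v t) \/ exists t, [/\ t <= l, e = v t & (x, y) = nw t].
  split=> [/orP[/andP[Fe npt]|/andP[/pthP[i il ->] h]]|[[Fe npt]|[t [tl' -> xyE]]]].
  - by left; split=> // t tl' et; move/negP: npt; apply; apply/pthP; exists t.
  - right; exists i; split=> //; exact: least_uniq pkey_inj _ _ _ h (nwP i il).
  - apply/orP; left; rewrite Fe; apply/negP => /pthP[i il]; exact: npt.
  - by apply/orP; right; rewrite xyE nwP// andbT; apply/pthP; exists t.
have pk : packing (exchanged nx pth last).
  split.
  - move=> e x y x' y' /exP[[Fe nt]|[t [tl' et xyE]]] /exP[[Fe' nt']|[t' [tl'' et' xyE']]].
    + exact: one Fe Fe'.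
    + by case: (nt t').
    + by case: (nt' t).
    + by rewrite xyE xyE' (vinj t t')// -et -et'.
  - apply: (@forest_exchange U L F one for_ l v nw vinj).
    + by move=> i il; have [_ /(_ il)[]] := np i _ (ltnW il) (nwE i (ltnW il)).
    + by move=> i il; have [_ /(_ il)[]] := np i _ (ltnW il) (nwE i (ltnW il)).
    + move=> i j ij jl; have il : i < l by lia.
      have [Ee /(_ il)[j0 _] _] := np i _ (ltnW il) (nwE i (ltnW il)).
      apply: contraT => nj; have := short i j (ltnW il) jl; rewrite leqNgt ij /=; apply.
      by apply/existsP; exists (nw i); rewrite Ee j0.
    + by have [_ _] := np l _ (leqnn l) (nwE l (leqnn l)); apply.
    + by move=> e x y /exP.
  - move=> e x y /exP[[/FE//]|[t [tl' -> xyE]]].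
    by have [] := np t _ tl' (nwE t tl'); rewrite -xyE.
split=> //; apply/proper_card/properP; split.
  apply/subsetP => e; rewrite !inE => /existsP[uv Fe]; apply/existsP.
  have [/existsP[i /eqP ei]|/existsPn ne] := boolP [exists i : 'I_l.+1, e == v i].
    by exists (nw i); apply/exP; right; exists i; rewrite leq_ord; split=> //; case: (nw i).
  exists uv; apply/exP; left; split=> // t tl' et.
  by have := ne (Ordinal (tl' : t < l.+1)); rewrite /= et eqxx.
exists (v 0); last by [].
by rewrite inE; apply/existsP; exists (nw 0); apply/exP; right; exists 0; split=> //; case: (nw 0).
Qed.
End Path.
End Exchange.

(** * The packing algorithm as a program *)

Definition fInc e1 e2 x := FAnd (FRel rT [:: x]) (fOr
  (FAnd (fEq e1 e2) (FAnd (FNot (FRel rT [:: e1])) (FRel rA [:: e1; x])))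
  (FAnd (FLt e1 e2) (FAnd (FRel rT [:: e1]) (FAnd (FRel rT [:: e2]) (FAnd (FRel rA [:: e1; e2])
     (fOr (fEq x e1) (fEq x e2))))))).

Definition tc_label_step : prog := setp rC [:: 0; 1; 2; 3; 4; 5] (fOr (FRel rC [:: 0; 1; 2; 3; 4; 5])
    (FEx 6 (FEx 7 (FAnd (FRel rC [:: 0; 1; 2; 3; 6; 7])
      (FEx 8 (FEx 9 (FAnd (FNot (FAnd (fEq 8 0) (fEq 9 1)))
        (fOr (FRel rF [:: 8; 9; 6; 7; 4; 5]) (FRel rF [:: 8; 9; 4; 5; 6; 7]))))))))).

Definition tc_label : prog := Seq (setp rC [:: 0; 1; 2; 3; 4; 5] (FAnd (fEq 4 2) (fEq 5 3)))
  (For 12 (For 13 tc_label_step)).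

Definition tc_all_step : prog := setp rC0 [:: 0; 1; 2; 3] (fOr (FRel rC0 [:: 0; 1; 2; 3])
    (FEx 6 (FEx 7 (FAnd (FRel rC0 [:: 0; 1; 6; 7])
      (FEx 8 (FEx 9 (fOr (FRel rF [:: 8; 9; 6; 7; 2; 3]) (FRel rF [:: 8; 9; 2; 3; 6; 7])))))))).

Definition tc_all : prog := Seq (setp rC0 [:: 0; 1; 2; 3] (FAnd (fEq 2 0) (fEq 3 1)))
  (For 12 (For 13 tc_all_step)).

(** The variables 6 and 7 are bound inside, so the parameters must avoid them; hence the high
    numbers in the minimality test of [pack_step]. *)
Definition fPair a b c d := fOr
  (FEx 6 (FEx 7 (FAnd (fNx 0 1 6 7) (FAnd (FRel rAl [:: 0; 1; a; b; c; d])
     (FAnd (FRel rC0 [:: a; b; c; d]) (FNot (FRel rC [:: 6; 7; a; b; c; d])))))))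
  (FAnd (FRel rTg [:: 0; 1]) (FAnd (FRel rAl [:: 0; 1; a; b; c; d]) (FNot (FRel rC0 [:: a; b; c; d])))).

Definition pack_step : prog := Seq tc_label (Seq tc_all
  (Seq (setp rSrc [:: 0; 1] (FNot (FEx 2 (FEx 3 (FEx 4 (FEx 5 (FRel rF [:: 0; 1; 2; 3; 4; 5])))))))
  (Seq (setp rTgt [:: 0; 1] (FEx 2 (FEx 3 (FEx 4 (FEx 5 (FAnd (FRel rAl [:: 0; 1; 2; 3; 4; 5])
     (FNot (FRel rC0 [:: 2; 3; 4; 5]))))))))
  (Seq (setp rArc [:: 0; 1; 2; 3] (FEx 4 (FEx 5 (FEx 6 (FEx 7 (FAnd (FRel rAl [:: 0; 1; 4; 5; 6; 7])
     (FAnd (FRel rC0 [:: 4; 5; 6; 7]) (FNot (FRel rC [:: 2; 3; 4; 5; 6; 7])))))))))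
  (Seq bfs
  (setp rF [:: 0; 1; 2; 3; 4; 5] (fOr (FAnd (FRel rF [:: 0; 1; 2; 3; 4; 5]) (FNot (FRel rPth [:: 0; 1])))
     (FAnd (FRel rPth [:: 0; 1]) (FAnd (fPair 2 3 4 5)
       (fAll 20 (fAll 21 (fAll 22 (fAll 23 (fImp (fPair 20 21 22 23)
          (fLex [:: 2; 3; 4; 5] [:: 20; 21; 22; 23]))))))))))))))).

(** Variable 39 is the number of trees aimed at; it is bound by the outer loop of [main]. *)
Definition pack : prog :=
  Seq (setp rInc [:: 0; 1; 2] (fInc 0 1 2))
  (Seq (setp rJ [:: 0] (FLt 0 39))
  (Seq (setp rAl [:: 0; 1; 2; 3; 4; 5] (FAnd (fEq 2 4) (FAnd (FRel rJ [:: 2]) (FAnd (FRel rInc [:: 0; 1; 3])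
     (FAnd (FRel rInc [:: 0; 1; 5]) (FNot (fEq 3 5)))))))
  (Seq (setp rF [:: 0; 1; 2; 3; 4; 5] fFalse)
  (Seq (For 38 (For 37 pack_step))
  (Seq tc_all
  (setp rOk [::] (fAll 0 (fImp (FRel rJ [:: 0]) (fAll 1 (fAll 2
     (fImp (FAnd (FRel rT [:: 1]) (FRel rT [:: 2])) (FRel rC0 [:: 0; 1; 0; 2]))))))))))))  .

Section Pack.
Variable n : nat.
Notation N := ('I_n * 'I_n)%type.
Implicit Types (s : state n) (e : env n) (u v w : N).

Definition pkey (w : N * N) : nat := horner_digits n 0 (map val [:: w.1.1; w.1.2; w.2.1; w.2.2]).

Lemma pkey_inj : injective pkey.
Proof.
move=> [[a b] [c d]] [[a' b'] [c' d']] h.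
have n0 : 0 < n := leq_ltn_trans (leq0n _) (ltn_ord a).
by have [_ [-> -> -> ->]] := @horner_digits_inj n n0 [:: a; b; c; d] [:: a'; b'; c'; d'] 0 0 erefl h.
Qed.

Lemma pair_surj (u v : N) : ((u.1 == v.1) && (u.2 == v.2)) = (u == v).
Proof. by rewrite -pair_eqE. Qed.

Lemma card_N : #|{: N}| <= n * n. Proof. by rewrite card_prod card_ord. Qed.

Lemma exec_tc_label e s x u v : rd6 (exec tc_label e s) rC x u v = joined (rd6 s rF) [set x] u v.
Proof.
rewrite /joined -(@iter_closure _ _ (n * n))//; last exact: card_N.
rewrite /tc_label exec_Seq; set s1 := exec _ e s; set r := label_adj _ _.
pose Inv k s2 := rl s2 rF = rl s rF /\ forall v, rd6 s2 rC x u v =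
  iter k (fun (Q : pred N) v => Q v || [exists w, Q w && r w v]) (pred1 u) v.
have [_ H] : Inv (n * n) (exec (For 12 (For 13 tc_label_step)) e s1); last exact: H.
apply: exec_For2_ind.
  split=> [|w]; first by rewrite /s1 exec_frame.
  by rewrite /rd6 /s1 rl_setp// !evalE /= pair_surj.
move=> k s2 a b [F2 C2]; split=> [|w]; first by rewrite exec_frame.
rewrite iterS -C2 /rd6 rl_setp// !evalE /=; congr (_ || _); apply: eq_existsb => z.
rewrite !evalE /= -C2; congr (_ && _); apply: eq_existsb => f.
by rewrite !evalE /= pair_surj inE F2.
Qed.

Lemma exec_tc_all e s u v : rd4 (exec tc_all e s) rC0 u v = joined (rd6 s rF) set0 u v.
Proof.
rewrite /joined -(@iter_closure _ _ (n * n))//; last exact: card_N.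
rewrite /tc_all exec_Seq; set s1 := exec _ e s; set r := label_adj _ _.
pose Inv k s2 := rl s2 rF = rl s rF /\ forall v, rd4 s2 rC0 u v =
  iter k (fun (Q : pred N) v => Q v || [exists w, Q w && r w v]) (pred1 u) v.
have [_ H] : Inv (n * n) (exec (For 12 (For 13 tc_all_step)) e s1); last exact: H.
apply: exec_For2_ind.
  split=> [|w]; first by rewrite /s1 exec_frame.
  by rewrite /rd4 /s1 rl_setp// !evalE /= pair_surj.
move=> k s2 a b [F2 C2]; split=> [|w]; first by rewrite exec_frame.
rewrite iterS -C2 /rd4 rl_setp// !evalE /=; congr (_ || _); apply: eq_existsb => z.
rewrite !evalE /= -C2; congr (_ && _); apply: eq_existsb => f.
by rewrite !evalE /= inE F2.
Qed.

Lemma exec_pack_step e s (s' := exec pack_step e s) (E := rd6 s rAl) (F := rd6 s rF) :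
  packing E F -> packing E (rd6 s' rF) /\
  (rd6 s' rF = F /\ (exists Q, exhausted E F Q) \/
   #|assigned F| < #|assigned (rd6 s' rF)| /\ forall Q, ~ exhausted E F Q).
Proof.
move=> pk; rewrite /s' /pack_step 6!exec_Seq.
set s1 := exec tc_label e s; set s2 := exec tc_all e s1; set s3 := exec (setp rSrc _ _) e s2.
set s4 := exec (setp rTgt _ _) e s3; set s5 := exec (setp rArc _ _) e s4.
set s6 := exec bfs e s5; set s7 := exec _ e s6.
have F1 : rl s1 rF = rl s rF by rewrite /s1 exec_frame.
have C1 x u v : rl s1 rC [:: x.1; x.2; u.1; u.2; v.1; v.2] = joined F [set x] u v by exact: exec_tc_label.
have C2 u v : rl s2 rC0 [:: u.1; u.2; v.1; v.2] = joined F set0 u v.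
  by have := exec_tc_all e s1 u v; rewrite /rd6 F1.
have Al2 : rl s2 rAl = rl s rAl by rewrite /s2 exec_frame// /s1 exec_frame.
have F2 : rl s2 rF = rl s rF by rewrite /s2 exec_frame.
have Cl2 : rl s2 rC = rl s1 rC by rewrite /s2 exec_frame.
have src5 : rd2 s5 rSrc = free_label F.
  apply/funext => x; rewrite /rd2 /s5 exec_frame// /s4 exec_frame// /s3 rl_setp// !evalE /free_label inE /=.
  by congr (~~ _); apply: eq_existsb => uv; rewrite !evalE F2.
have al4 : rl s4 rAl = rl s rAl by rewrite /s4 exec_frame// /s3 exec_frame.
have C04 : rl s4 rC0 = rl s2 rC0 by rewrite /s4 exec_frame// /s3 exec_frame.
have Cl4 : rl s4 rC = rl s1 rC by rewrite /s4 exec_frame// /s3 exec_frame.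
have tgt5 : rd2 s5 rTgt = addable E F.
  apply/funext => x; rewrite /rd2 /s5 exec_frame// /s4 rl_setp// !evalE /addable /=.
  apply: eq_existsb => uv; rewrite !evalE /= /s3 !(@exec_frame _ (setp rSrc _ _))// Al2.
  by rewrite C2.
have arc5 : rd4 s5 rArc = swap_arc E F.
  apply/funext => x; apply/funext => y; rewrite /rd4 /s5 rl_setp// !evalE /swap_arc /=.
  apply: eq_existsb => uv; rewrite !evalE /= al4 C04 Cl4.
  by rewrite C2 C1.
have fr6 : [/\ rl s6 rAl = rl s rAl, rl s6 rC0 = rl s2 rC0, rl s6 rC = rl s1 rC & rl s6 rF = rl s rF].
  by split; rewrite /s6 exec_frame// /s5 exec_frame// /s4 exec_frame// /s3 exec_frame.
have [al6 c06 cl6 f6] := fr6.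
have pairE e' x (a b : N) va vb vc vd : e' 0 = x.1 -> e' 1 = x.2 -> e' va = a.1 -> e' vb = a.2 ->
   e' vc = b.1 -> e' vd = b.2 -> va \notin [:: 6; 7] -> vb \notin [:: 6; 7] -> vc \notin [:: 6; 7] -> vd \notin [:: 6; 7] ->
   eval (rl s6) e' (fPair va vb vc vd) = new_pair E F (nx_of s6) (rd2 s6 rTg) x (a, b).
  rewrite !inE !negb_or => x1 x2 a1 a2 b1 b2 /andP[/negPf na6 /negPf na7] /andP[/negPf nb6 /negPf nb7] /andP[/negPf nc6 /negPf nc7] /andP[/negPf nd6 /negPf nd7].
  have eqnE m m' : eqn m m' = (m == m') by [].
  rewrite /fPair !evalE /= x1 x2 a1 a2 b1 b2 al6 c06 C2; congr (_ || _); apply: eq_existsb => f.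
  rewrite !evalE /= x1 x2 !eqnE na6 na7 nb6 nb7 nc6 nc7 nd6 nd7 a1 a2 b1 b2 al6 c06 cl6 C2 C1.
  by rewrite /nx_of /rd4 /rd2 /= !andbA.
have F7 : rd6 s7 rF = exchanged E F pkey (nx_of s6) (rd2 s6 rPth) (rd2 s6 rTg).
  apply/funext => x; apply/funext => u; apply/funext => v; rewrite /rd6 /s7 rl_setp//.
  rewrite evalOr !evalAnd [eval _ _ (FNot (FRel _ _))]evalNot !evalRel evalAll2 /= f6.
  rewrite /exchanged /least; congr (_ || (_ && _)).
  rewrite (pairE _ x u v)//; congr (_ && _).
  have LE (a b : N) : lexle [:: u.1; u.2; v.1; v.2] [:: a.1; a.2; b.1; b.2] = (pkey (u, v) <= pkey (a, b)).
    exact: (lexle_code (n := n) (a := [:: u.1; u.2; v.1; v.2]) (b := [:: a.1; a.2; b.1; b.2]) 0).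
  apply/forallP/forallP => /= [h [a b]|h a].
    have := h a; rewrite evalAll2 => /forallP/(_ b); rewrite evalImp evalLex (pairE _ x a b)//=.
    by rewrite -LE.
  rewrite evalAll2; apply/forallP => b; have := h (a, b); rewrite evalImp evalLex (pairE _ x a b)//=.
  by rewrite -LE.
have := exec_bfs e s5; rewrite -/s6 /= src5 tgt5 arc5 => -[[noP [X [Xclo XT]]]|[l [f path]]].
  have F7' : rd6 s7 rF = F.
    by rewrite F7; apply/funext => x; apply/funext => u; apply/funext => v; rewrite /exchanged noP (negPf (noP x)) andbT orbF.
  by rewrite F7'; split=> //; left; split=> //; exists [set x | X x]; exact: exhausted_closed.
have [pk' lt] := packing_exchanged pkey_inj path pk; rewrite F7; split=> //; right; split=> // Q.
exact: exhausted_no_path path Q.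
Qed.

Definition first_labels (j : nat) : {set 'I_n} := [set x : 'I_n | x < j].

(** Each of the [n * n] rounds assigns one more label or finds the packing exhausted. If every label
    ends up assigned, none is free and the empty set is a certificate. *)
Theorem exec_pack e s (s' := exec pack e s) (J := first_labels (e 39)) (T := sett s rT)
    (E := elt_edge T (rdg s rA) J) (F := rd6 s' rF) :
  [/\ packing E F, exists Q, exhausted E F Q, sett s' rJ = J &
      rl s' rOk [::] = [forall i in J, forall x in T, forall y in T, joined F set0 (i, x) (i, y)]].
Proof.
rewrite /F /s' /pack 6!exec_Seq; set s1 := exec (setp rInc _ _) e s; set s2 := exec (setp rJ _ _) e s1.
set s3 := exec (setp rAl _ _) e s2; set s4 := exec (setp rF _ _) e s3.
set s5 := exec (For 38 _) e s4; set s6 := exec tc_all e s5; set s7 := exec _ e s6.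
have Inc2 x y : rl s2 rInc [:: x.1; x.2; y] = elt_inc T (rdg s rA) x y.
  rewrite /s2 exec_frame// /s1 rl_setp// /fInc !evalE /= /elt_inc !inE /rd1 /rdg; congr (_ && _).
  case: ltngtP => [lt|gt|/val_inj <-]; rewrite ?eqxx ?andbF ?orbF ?orFb //=.
  - by have -> : (x.1 == x.2) = false by apply/eqP => h; rewrite h ltnn in lt.
have J2 x : rl s2 rJ [:: x] = (x \in J) by rewrite /s2 rl_setp// !evalE inE.
have Al3 : rd6 s3 rAl = E.
  apply/funext => x; apply/funext => u; apply/funext => v; rewrite /rd6 /s3 rl_setp// !evalE /= J2.
  by rewrite !Inc2 /E /elt_edge.
have Al4 : rd6 s4 rAl = E by rewrite -Al3 /rd6 /s4 exec_frame.
have F4 x u v : rd6 s4 rF x u v = false by rewrite /rd6 /s4 rl_setp// !evalE ltnn.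
pose Inv k s2 := [/\ rd6 s2 rAl = E, packing E (rd6 s2 rF) &
  k <= #|assigned (rd6 s2 rF)| \/ exists Q, exhausted E (rd6 s2 rF) Q].
have [_ pk5 ex5] : Inv (n * n) s5.
  apply: exec_For2_ind.
    split=> //; last by left.
    by split=> x u v; rewrite F4.
  move=> k t a b [alE pk ex]; set e' := upde _ _ _.
  have := @exec_pack_step e' t; rewrite /= alE => /(_ pk)[pk' h]; split=> //.
    by rewrite -alE /rd6 exec_frame.
  case: h => [[-> h]|[lt h]]; first by right.
  by left; case: ex => [ex|[Q /h//]]; apply: leq_ltn_trans ex lt.
have F7 : rd6 s7 rF = rd6 s5 rF by rewrite /rd6 /s7 exec_frame// /s6 exec_frame.
rewrite F7; split=> //.
- case: ex5 => // full; exists set0; split=> [x hx|x u v|x f u v]; rewrite ?inE//.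
  have : assigned (rd6 s5 rF) = [set: N].
    apply/eqP; rewrite eqEcard subsetT cardsT; apply: leq_trans card_N _; exact: full.
  by move=> /setP/(_ x); rewrite !inE => /existsP[uv h]; have := hx uv.1 uv.2; rewrite h.
- by apply/setP => x; rewrite inE /rd1 /s7 exec_frame// /s6 exec_frame// /s5 exec_frame// /s4 exec_frame// /s3 exec_frame// J2.
have T6 : rl s6 rT = rl s rT.
  by rewrite /s6 exec_frame// /s5 exec_frame// /s4 exec_frame// /s3 exec_frame// /s2 exec_frame// /s1 exec_frame.
have J6 : rl s6 rJ = rl s2 rJ.
  by rewrite /s6 exec_frame// /s5 exec_frame// /s4 exec_frame// /s3 exec_frame.
rewrite /s7 rl_setp// evalAll; apply: eq_forallb => i; rewrite evalImp evalRel /= J6 J2; congr (_ ==> _).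
rewrite evalAll2; apply/forallP/forallP => /= [h x|h [x y]].
  apply/implyP => xT; apply/forallP => y; apply/implyP => yT; have := h (x, y).
  rewrite !evalE /= T6; move: xT yT; rewrite !inE /rd1 => -> -> /=.
  by have := exec_tc_all e s5 (i, x) (i, y); rewrite /rd4 /= => ->.
rewrite !evalE /= T6; apply/implyP => /andP[xT yT].
have := exec_tc_all e s5 (i, x) (i, y); rewrite /rd4 /= => ->.
have := h x; rewrite inE => /implyP/(_ xT)/forallP/(_ y); rewrite inE => /implyP; exact.
Qed.
End Pack.

(** * From an exhausted search to a five-clique model in the incidence graph *)

Section Completeness.
Variables (n : nat) (G : sgraph 'I_n) (T J : {set 'I_n}) (A O : rel 'I_n).
Notation V := 'I_n.
Notation L := (V * V)%type.
Hypothesis red : reduced G T A O.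

(* The part of the incidence graph of [G] contracted to the element [e]. *)
Definition element_branch (e : L) : {set V + {set V}} := if e.1 == e.2
  then [set z | match z with inl z => O e.1 z
    | inr B => [&& B \in edges G, [exists c in B, O e.1 c] & [forall c in B, O e.1 c || (c \in T)]] end]
  else [set inr [set e.1; e.2]].

Lemma element_branch_inl e z : inl z \in element_branch e -> O e.1 z.
Proof. by rewrite /element_branch; case: ifP; rewrite inE. Qed.

Lemma element_branch_adj e x : elt_inc T A e x ->
  exists2 z, z \in element_branch e & incidence G (inl x) z.
Proof.
have [[_ _ AT] _ _ _ real] := red.
case/andP => xT; rewrite /element_branch; case: ifP => [/eqP ee /andP[wT wx]|_ /and5P[_ aT bT ab xab]].
  have [z [z' [Oz zz']]] := real _ _ wT wx; rewrite xT => z'x; subst z'.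
  exists (inr [set z; x]); last by rewrite /= pair_in_edges ?set22.
  rewrite inE pair_in_edges//=; apply/andP; split.
    by apply/existsP; exists z; rewrite set21.
  by apply/forallP => c; apply/implyP => /set2P[]->; rewrite ?Oz ?xT ?orbT.
exists (inr [set e.1; e.2]); first by rewrite inE.
by rewrite /= pair_in_edges ?inE// -AT.
Qed.

Lemma element_branch_connected e x : elt_inc T A e x -> connected_in (incidence G) (element_branch e).
Proof.
move=> ex; have [z0 z0b _] := element_branch_adj ex.
split; first by apply/set0Pn; exists z0.
have [_ _ _ conn real] := red.
case/andP: ex => xT; case: ifP => [/eqP ee /andP[wT wx]|ne _]; last first.
  by rewrite /element_branch ne => u v /set1P-> /set1P->; exact: connect0.
set B := element_branch e; set R := (X in connect X).
have Rsym : symmetric R by move=> u v; rewrite /R /= incidence_sym andbCA.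
have BE z : (z \in B) = match z with inl z => O e.1 z
    | inr B => [&& B \in edges G, [exists c in B, O e.1 c] & [forall c in B, O e.1 c || (c \in T)]] end.
  by rewrite /B /element_branch ee eqxx inE.
have [z [z' [Oz _ _]]] := real _ _ wT wx.
have hub1 a : O e.1 a -> connect R (inl a) (inl z).
  move=> Oa; have := conn _ _ _ Oa Oz; apply: (@connect_homo _ _ _ _ inl) => c d /and3P[Oc Od cd].
  have cdB : inr [set c; d] \in B.
    rewrite BE pair_in_edges//=; apply/andP; split; first by apply/existsP; exists c; rewrite set21.
    by apply/forallP => b; apply/implyP => /set2P[]->; rewrite ?Oc ?Od.
  apply: (@connect_trans _ _ (inr [set c; d])); apply: connect1; rewrite /R /= cdB !BE ?Oc ?Od /= pair_in_edges//=;
  by rewrite ?set21 ?set22.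
have hub u : u \in B -> connect R u (inl z).
  case: u => [a|D] uB; first by apply: hub1; rewrite BE in uB.
  have := uB; rewrite BE => /and3P[De /existsP[c /andP[cD Oc]] _].
  by apply: connect_trans (hub1 _ Oc); apply: connect1; rewrite /R /= uB BE Oc De cD.
by move=> u v /hub uz /hub vz; apply: connect_trans uz _; rewrite (sym_connect_sym Rsym).
Qed.

Lemma element_branch_disjoint e f x y : elt_inc T A e x -> elt_inc T A f y -> e != f ->
  [disjoint element_branch e & element_branch f].
Proof.
move=> ex fy ef; rewrite -setI_eq0; apply/eqP/setP => z; rewrite in_setI in_set0.
apply/negP => /andP[ze zf]; move/negP: ef; apply.
have [_ nT own _ _] := red.
case: z ze zf => [z|B] ze zf.
  have := own _ _ _ (element_branch_inl ze) (element_branch_inl zf).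
  move: ze zf; rewrite /element_branch; case: ifP => [/eqP e12|]; rewrite inE//.
  case: ifP => [/eqP f12|]; rewrite inE// => _ _ E.
  by rewrite -pair_eqE /pair_eq /= -e12 -f12 E eqxx.
case/andP: ex => _; case/andP: fy => _; move: ze zf; rewrite /element_branch.
case: ifP => [/eqP e12|e12]; case: ifP => [/eqP f12|f12]; rewrite !inE.
- move=> /and3P[_ /existsP[c /andP[cB Oc]] _] /and3P[_ _ /forallP/(_ c)]; rewrite cB /= => /orP[Oc'|cT] _ _.
    by rewrite -pair_eqE /pair_eq /= -e12 -f12 (own _ _ _ Oc Oc') eqxx.
  by have [_] := nT _ _ Oc; rewrite cT.
- move=> /and3P[_ /existsP[c /andP[cB Oc]] _] /eqP[BE] /and5P[_ aT bT _ _] _.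
  by have [_] := nT _ _ Oc; move: cB; rewrite BE => /set2P[]->; rewrite ?aT ?bT.
- move=> /eqP[BE] /and3P[_ /existsP[c /andP[cB Oc]] _] _ /and5P[_ aT bT _ _].
  by have [_] := nT _ _ Oc; move: cB; rewrite BE => /set2P[]->; rewrite ?aT ?bT.
- move=> /eqP[->] /eqP[/set2_eq h] /and5P[lf _ _ _ _] /and5P[le _ _ _ _].
  rewrite -pair_eqE /pair_eq /=; case: h => -[E1 E2]; first by rewrite E1 E2 !eqxx.
  by move: le lf; rewrite E1 E2; lia.
Qed.

Lemma exhausted_joined (F : L -> rel L) Q i x y :
  (forall p q, p \notin T -> q \notin T -> ~~ A p q) -> packing (elt_edge T A J) F ->
  exhausted (elt_edge T A J) F Q -> elt_connected T A (5 * #|J| + 1) ->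
  (forall B, ~ K5_model (incidence G) B) -> i \in J -> x \in T -> y \in T -> joined F set0 (i, x) (i, y).
Proof.
move=> stable [one for_ FE] [q1 q2 q3] conn noK5 iJ xT yT; apply: contraT => nj.
have [[Asym _ _] nT _ _ _] := red.
have tminj : injective (@inl V {set V}) by move=> a b [].
have btm e z : z \in T -> inl z \notin element_branch e.
  by move=> zT; apply/negP => /element_branch_inl/nT[_]; rewrite zT.
have [B KB] : exists B, K5_model (incidence G) B.
  exact: (stuck_packing_K5 Asym stable one for_ FE q1 q2 q3 (@incidence_sym _ G) tminj
    element_branch_connected element_branch_disjoint element_branch_adj btm conn iJ xT yT nj).
by case: (noK5 B).
Qed.
End Completeness.

(** * Extracting the trees *)

Section RouteArc.
Variables (n : nat) (G : sgraph 'I_n) (T J : {set 'I_n}) (A O : rel 'I_n).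
Notation V := 'I_n.
Notation L := (V * V)%type.

Definition route_mem (e : L) (z : V) : bool := (e.1 == e.2) && O e.1 z.

(** A route of a non-terminal runs through the vertices of [G] contracted to it; the route of an
    edge between terminals is that edge. *)
Definition route_arc (e : L) (x y : V) : rel V := [rel a b | G a b &&
  [|| ((a == x) || route_mem e a) && route_mem e b, route_mem e a && (b == y) |
      [&& e.1 != e.2, a == x & b == y]]].

Definition routed (e : L) (x y : V) (l : nat) (f : nat -> V) : Prop :=
  [/\ f 0 = x, f l = y, forall j k, j <= l -> k <= l -> f j = f k -> j = k &
      forall j, j < l -> route_arc e x y (f j) (f j.+1)].

Hypothesis red : reduced G T A O.

Lemma route_exists e u v : elt_edge T A J e u v -> connect (route_arc e u.2 v.2) u.2 v.2.
Proof.
have [[Asym Airr AT] nT own conn real] := red.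
move=> /and5P[_ _ /andP[uT eu] /andP[vT ev] uv]; move: eu ev.
case: ifP => [/eqP ee /andP[wT wu] /andP[_ wv]|/negbT ne /and5P[_ aT bT ab uab] /and5P[_ _ _ _ vab]].
  have [z [z1 [Oz zz1]]] := real _ _ wT wu; rewrite uT => E; subst z1.
  have [z' [z1 [Oz' zz1']]] := real _ _ wT wv; rewrite vT => E; subst z1.
  have mE c : O e.1 c -> route_mem e c by move=> Oc; rewrite /route_mem ee eqxx -ee.
  apply: (@connect_trans _ _ z).
    by apply: connect1; rewrite /route_arc /= eqxx (mE z Oz) (@adj_sym _ G) zz1.
  apply: (@connect_trans _ _ z').
    apply: connect_sub (conn _ _ _ Oz Oz') => c d /and3P[Oc Od cd].
    by apply: connect1; rewrite /route_arc /= cd !mE ?orbT.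
  by apply: connect1; rewrite /route_arc /= zz1' (mE z' Oz') eqxx !orbT.
apply: connect1; rewrite /route_arc /= ne !eqxx !orbT andbT.
rewrite AT// in ab.
by case/orP: uab uv => /eqP->; case/orP: vab => /eqP->; rewrite ?eqxx// (@adj_sym _ G).
Qed.

Lemma routed_inner e x y l f j : y \in T -> routed e x y l f -> 0 < j < l ->
  [/\ e.1 = e.2, O e.1 (f j) & f j \notin T].
Proof.
have [_ nT _ _ _] := red.
move=> yT [f0 fl inj arcs] /andP[j0 jl]; have := arcs j.-1; rewrite prednK// => /(_ (ltnW jl)) /andP[_].
have ny : (f j == y) = false.
  by apply/eqP => h; have := inj j l (ltnW jl) (leqnn l); rewrite h fl => /(_ erefl); lia.
rewrite ny !andbF !orbF => /andP[_ /andP[/eqP ee Oj]]; split=> //.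
by have [] := nT _ _ Oj.
Qed.

Section Trees.
Variables (F : L -> rel L) (l : L -> nat) (f : L -> nat -> V) (BE : V -> rel V).
Hypothesis pack : packing (elt_edge T A J) F.
Hypothesis rt : forall e u v, F e u v -> routed e u.2 v.2 (l e) (f e).
Hypothesis BEP : forall i a b, BE i a b <-> exists e u v, [/\ F e u v, u.1 = i & exists2 j, j < l e &
  (a, b) = (f e j, f e j.+1) \/ (a, b) = (f e j.+1, f e j)].

(** Owners are unique, so routes of distinct elements share no inner vertex. A route of length one
    is an edge between terminals, which the increasing order of its ends identifies with its
    element. *)
Theorem routes_steiner :
  (forall i, (forall x y, x \in T -> y \in T -> joined F set0 (i, x) (i, y)) -> T != set0 ->
     steiner_tree G T (route_tree T BE i)) /\
  (forall i x, x \in sub_verts (route_tree T BE i) -> x \notin T -> sub_degree (route_tree T BE i) x = 2) /\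
  (forall i j, i != j -> element_disjoint T (route_tree T BE i) (route_tree T BE j)).
Proof.
have [one for_ FE] := pack; have [[Asym Airr AT] nT own _ _] := red.
pose on : pred L := fun e => e \in assigned F.
have [g gP] : exists g : L -> L * L, forall e, on e -> F e (g e).1 (g e).2.
  suff H (e : L) : exists uv : L * L, on e -> F e uv.1 uv.2 by have [g h] := boolp.choice H; exists g.
  have [oe|no] := boolP (on e); last by exists (e, e) => h; case/negP: no.
  by move: oe; rewrite /on inE => /existsP[uv h]; exists uv.
pose cp e := (g e).1.1.
have gE e : on e -> [/\ (g e).2.1 = cp e, (g e).1.2 \in T, (g e).2.2 \in T & (g e).1.2 != (g e).2.2].
  by move=> /gP/FE/and5P[/eqP<- _ /andP[-> _] /andP[-> _] ->].
have rtE e : on e -> routed e (g e).1.2 (g e).2.2 (l e) (f e) by move=> oe; apply: rt; exact: gP.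
have onP e u v : F e u v -> on e by move=> h; rewrite /on inE; apply/existsP; exists (u, v).
have ends e : on e -> [/\ 0 < l e, f e 0 \in T & f e (l e) \in T].
  move=> oe; have [f0 fl _ _] := rtE _ oe; have [_ xT yT xy] := gE _ oe.
  rewrite f0 fl; split=> //; rewrite lt0n; apply: contraNneq xy => l0; by rewrite -f0 -fl l0.
have finj e j k : on e -> j <= l e -> k <= l e -> f e j = f e k -> j = k.
  by move=> /rtE[_ _ h _]; exact: h.
have fadj e j : on e -> j < l e -> G (f e j) (f e j.+1).
  by move=> /rtE[_ _ _ h] /h/andP[].
have inn e j : on e -> 0 < j < l e -> [/\ e.1 = e.2, O e.1 (f e j) & f e j \notin T].
  by move=> oe; have [_ _ yT _] := gE _ oe; exact: routed_inner yT (rtE _ oe).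
have inner e j : on e -> 0 < j < l e -> f e j \notin T by move=> oe /(inn _ _ oe)[].
have inner_uniq e e' j j' : on e -> on e' -> 0 < j < l e -> 0 < j' < l e' -> f e j = f e' j' -> e = e'.
  move=> oe oe' /(inn _ _ oe)[e12 Oj _] /(inn _ _ oe')[e12' Oj' _] E; rewrite -E in Oj'.
  have := own _ _ _ Oj Oj'; case: (e) (e') e12 e12' => [a b] [c d] /= -> -> ->; by [].
have short_uniq e e' : on e -> on e' -> l e = 1 -> l e' = 1 -> [set f e 0; f e 1] = [set f e' 0; f e' 1] -> e = e'.
  have short e2 : on e2 -> l e2 = 1 -> e2.1 < e2.2 /\ [set f e2 0; f e2 1] = [set e2.1; e2.2].
    move=> o2 l1; have [f0 fl _ /(_ 0)] := rtE _ o2; rewrite l1 in fl * => /(_ isT).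
    have [_ xT yT xy] := gE _ o2; have := FE _ _ _ (gP _ o2).
    rewrite f0 fl => /and5P[_ _ /andP[_ ex] /andP[_ ey] _] /andP[_].
    have nm z : z \in T -> route_mem e2 z = false.
      by move=> zT; apply/negP => /andP[_ /nT[_]]; rewrite zT.
    rewrite !nm// !andbF /= => /andP[ne _]; move: ex ey; rewrite (negPf ne) => /and5P[lt _ _ _ hx] /and5P[_ _ _ _ hy].
    split=> //; case/orP: hx xy => /eqP->; case/orP: hy => /eqP->; rewrite ?eqxx//; by rewrite setUC.
  move=> oe oe' l1 l1'; have [lt ->] := short _ oe l1; have [lt' ->] := short _ oe' l1'.
  move=> /set2_eq[[E1 E2]|[E1 E2]]; last by move: lt lt'; rewrite E1 E2; lia.
  by case: (e) (e') E1 E2 => [a b] [c d] /= -> ->.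
have FP e u v : F e u v <-> [/\ on e, u = (cp e, f e 0) & v = (cp e, f e (l e))].
  have gg : on e -> (cp e, f e 0) = (g e).1 /\ (cp e, f e (l e)) = (g e).2.
    move=> oe; have [f0 fl _ _] := rtE _ oe; have [c2 _ _ _] := gE _ oe.
    by rewrite f0 fl -{2}c2 /cp; case: (g e) => -[? ?] [? ?].
  split=> [h|[oe -> ->]]; last by have [-> ->] := gg oe; exact: gP.
  have oe := onP _ _ _ h; have [-> ->] := gg oe; have [-> ->] := one _ _ _ _ _ h (gP _ oe); by [].
have BEP' i a b : BE i a b <-> exists e j, [/\ on e, cp e = i, j < l e &
    (a, b) = (f e j, f e j.+1) \/ (a, b) = (f e j.+1, f e j)].
  split=> [/BEP[e [u [v [h ui [j jl ab]]]]]|[e [j [oe ce jl ab]]]].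
    by exists e, j; split=> //; [exact: onP h|move/FP: h => [_ uE _]; rewrite -ui uE].
  apply/BEP; exists e, (cp e, f e 0), (cp e, f e (l e)); split=> //; first exact/FP.
  by exists j.
split.
  move=> i conn /set0Pn[t0 t0T].
  exact: (steiner_route ends finj fadj inner inner_uniq FP for_ BEP' t0T (fun x xT => conn x t0 xT t0T)).
split; first by move=> i x; exact: (route_degree ends finj inner_uniq BEP').
by move=> i j; exact: (routes_disjoint ends inner inner_uniq short_uniq BEP').
Qed.
End Trees.
End RouteArc.

Definition fMem z := FAnd (fEq 36 35) (FRel rOwn [:: 36; z]).

Definition fRouteArc := FAnd (FAnd (FCst 1 0) (FCst 3 0)) (FAnd (FRel rG [:: 0; 2])
  (fOr (FAnd (fOr (fEq 0 33) (fMem 0)) (fMem 2)) (fOr (FAnd (fMem 0) (fEq 2 31))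
    (FAnd (FNot (fEq 36 35)) (FAnd (fEq 0 33) (fEq 2 31)))))).

Definition route_edge : prog :=
  Seq (setp rArc [:: 0; 1; 2; 3] fRouteArc)
  (Seq (setp rSrc [:: 0; 1] (FAnd (fEq 0 33) (FCst 1 0)))
  (Seq (setp rTgt [:: 0; 1] (FAnd (fEq 0 31) (FCst 1 0)))
  (Seq bfs
  (setp rTr [:: 0; 1; 2] (fOr (FRel rTr [:: 0; 1; 2]) (FAnd (fEq 0 34) (FEx 3 (FAnd (FCst 3 0)
     (fOr (fNx 1 3 2 3) (fNx 2 3 1 3)))))))))).

Definition extract : prog := Seq (setp rTr [:: 0; 1; 2] fFalse)
  (Seq (nest [:: 36; 35; 34; 33; 32; 31] (If (FRel rF [:: 36; 35; 34; 33; 32; 31]) route_edge))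
  (Seq (setp rBJ [:: 0] (FRel rJ [:: 0])) (setp rBE [:: 0; 1; 2] (FRel rTr [:: 0; 1; 2])))).

Definition rd3 n (s : state n) r (i : 'I_n) : rel 'I_n := fun a b => rl s r [:: i; a; b].

Section Extract.
Variables (n : nat) (o0 : 'I_n).
Hypothesis o0E : o0 = 0 :> nat.
Variable G : sgraph 'I_n.
Notation V := 'I_n.
Notation N := ('I_n * 'I_n)%type.
Implicit Types (s : state n) (e : env n).

Let eqo0 (x : 'I_n) : (x == 0 :> nat) = (x == o0). Proof. by rewrite -val_eqE /= o0E. Qed.

Lemma exec_route_edge e s (s' := exec route_edge e s) (x := e 33) (y := e 31) (lab := (e 36, e 35)) :
  rdg s rG = G -> connect (route_arc G (rdg s rOwn) lab x y) x y ->
  exists l f, routed G (rdg s rOwn) lab x y l f /\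
    forall i a b, rd3 s' rTr i a b <-> rd3 s rTr i a b \/ (i = e 34 /\ exists2 j, j < l &
      (a, b) = (f j, f j.+1) \/ (a, b) = (f j.+1, f j)).
Proof.
move=> GE reach; rewrite /s' /route_edge 4!exec_Seq.
set s1 := exec (setp rArc _ _) e s; set s2 := exec (setp rSrc _ _) e s1.
set s3 := exec (setp rTgt _ _) e s2; set s4 := exec bfs e s3; set s5 := exec _ e s4.
set R := route_arc _ _ _ _ _ in reach *.
have arcE u v : rd4 s3 rArc u v = [&& u.2 == o0, v.2 == o0 & R u.1 v.1].
  rewrite /rd4 /s3 exec_frame// /s2 exec_frame// /s1 rl_setp// /fRouteArc /fMem !evalE /= !eqo0.
  by rewrite /R /route_arc /route_mem /= -GE /rdg /= -!andbA.
have srcE u : rd2 s3 rSrc u = (u == (x, o0)).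
  by rewrite /rd2 /s3 exec_frame// /s2 rl_setp// !evalE /= eqo0 -pair_eqE.
have tgtE u : rd2 s3 rTgt u = (u == (y, o0)).
  by rewrite /rd2 /s3 rl_setp// !evalE /= eqo0 -pair_eqE.
have Tr5 i a b : rd3 s5 rTr i a b = rd3 s rTr i a b || (i == e 34) &&
    (nx_of s4 (a, o0) (b, o0) || nx_of s4 (b, o0) (a, o0)).
  rewrite /rd3 /s5 rl_setp// !evalE /=; congr (_ || (_ && _)).
    by rewrite /s4 exec_frame// /s3 exec_frame// /s2 exec_frame// /s1 exec_frame.
  apply/existsP/idP => [[c]|h]; last by exists o0; rewrite /fNx !evalE /= o0E.
  by rewrite /fNx !evalE /= eqo0 => /andP[/eqP->].
have := exec_bfs e s3; rewrite -/s4 /= => -[[_ [X [[X0 Xclo] XT]]]|[l [v [[v0 vl [vinj nxP]] arcs _ _ _]]]].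
  have : X (y, o0).
    move: reach => /connectP[p pp ->]; have : X (x, o0) by apply: X0; rewrite srcE.
    elim: p (x) pp => //= z p IH x' /andP[xz /IH h] Xx'; apply: h; apply: Xclo Xx' _.
    by rewrite arcE /= !eqxx.
  by move=> /XT; rewrite tgtE eqxx.
have v2 j : j <= l -> v j = ((v j).1, o0).
  case: j => [_|j jl]; first by move: v0; rewrite srcE => /eqP->.
  have := arcs j jl; rewrite arcE => /and3P[_ /eqP h _]; by rewrite -h; case: (v j.+1).
exists l, (fun j => (v j).1); split.
  split.
  - by move: v0; rewrite srcE => /eqP->.
  - by move: vl; rewrite tgtE => /eqP->.
  - by move=> j k jl kl E; apply: vinj => //; rewrite (v2 j)// (v2 k)// E.
  - by move=> j jl; have := arcs j jl; rewrite arcE => /and3P[].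
have nxE a b : nx_of s4 (a, o0) (b, o0) <-> exists2 j, j < l & (a, b) = ((v j).1, (v j.+1).1).
  rewrite nxP; split=> [[j [jl E1 E2]]|[j jl [-> ->]]]; exists j => //; first by rewrite -E1 -E2.
  by split=> //; apply/esym/v2; rewrite // ltnW.
move=> i a b; rewrite Tr5; split.
  case/orP => [|/andP[/eqP-> /orP[]/nxE[j jl E]]]; [by left|right|right]; split=> //; exists j => //; first by left.
  by right; case: E => -> ->.
case=> [->//|[-> [j jl ab]]]; apply/orP; right; rewrite eqxx /=; apply/orP.
by case: ab => -[-> ->]; [left|right]; apply/nxE; exists j.
Qed.

Lemma exec_extract e s (s' := exec extract e s) (T : {set V}) A J (F := rd6 s rF) :
  rdg s rG = G -> reduced G T A (rdg s rOwn) -> packing (elt_edge T A J) F ->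
  (forall i, rl s' rBJ [:: i] = rl s rJ [:: i]) /\
  (forall i, (forall x y, x \in T -> y \in T -> joined F set0 (i, x) (i, y)) -> T != set0 ->
     steiner_tree G T (route_tree T (rd3 s' rBE) i)) /\
  (forall i x, x \in sub_verts (route_tree T (rd3 s' rBE) i) -> x \notin T ->
     sub_degree (route_tree T (rd3 s' rBE) i) x = 2) /\
  (forall i j, i != j -> element_disjoint T (route_tree T (rd3 s' rBE) i) (route_tree T (rd3 s' rBE) j)).
Proof.
move=> GE red pk; rewrite /s' /extract 3!exec_Seq; set s1 := exec (setp rTr _ _) e s.
set s2 := exec (nest _ _) e s1; set s3 := exec (setp rBJ _ _) e s2; set s4 := exec _ e s3.
pose O := rdg s rOwn; have [one _ FE] := pk.
pose tup (lab u v : N) := [:: lab.1; lab.2; u.1; u.2; v.1; v.2].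
pose Inv (D : seq (seq 'I_n)) t := [/\ rl t rF = rl s rF, rl t rG = rl s rG, rl t rOwn = rl s rOwn &
  exists (l : N -> nat) (f : N -> nat -> V),
  (forall lab u v, F lab u v -> tup lab u v \in D -> routed G O lab u.2 v.2 (l lab) (f lab)) /\
  (forall i a b, rd3 t rTr i a b <-> exists lab u v, [/\ F lab u v, tup lab u v \in D, u.1 = i &
     exists2 j, j < l lab & (a, b) = (f lab j, f lab j.+1) \/ (a, b) = (f lab j.+1, f lab j)])].
have [||D [Dall [F2 G2 O2 [l [f [rt TrE]]]]]] := @exec_nest_visit _ Inv
    (If (FRel rF [:: 36; 35; 34; 33; 32; 31]) route_edge) [:: 36; 35; 34; 33; 32; 31] e s1.
- split; try by rewrite /s1 exec_frame.
  exists (fun=> 0), (fun _ _ => o0); split=> // i a b; rewrite /rd3 /s1 rl_setp// !evalE ltnn.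
  by split=> // -[lab [u [v []]]].
- move=> D a t; case: a => [|e1 [|e2 [|i [|x [|i' [|y []]]]]]]// _ aD [Ft Gt Ot [l [f [rt TrE]]]].
  set e' := setenv _ _ _; rewrite exec_If !evalE /= Ft.
  pose lab := (e1, e2); pose u := (i, x); pose v := (i', y).
  have tupE lab' u' v' : tup lab' u' v' = [:: e1; e2; i; x; i'; y] -> [/\ lab' = lab, u' = u & v' = v].
    by case: lab' u' v' => [? ?] [? ?] [? ?] [-> -> -> -> -> ->].
  rewrite -[rl s 16 _]/(F lab u v); case: ifP => [Fuv|nF]; last first.
    have noF lab' u' v' : F lab' u' v' -> tup lab' u' v' <> [:: e1; e2; i; x; i'; y].
      by move=> F' /tupE[E1 E2 E3]; rewrite E1 E2 E3 nF in F'.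
    split=> //; exists l, f; split=> [lab' u' v' F' |i0 a b].
      by rewrite inE => /orP[/eqP/(noF _ _ _ F')//|]; exact: rt.
    rewrite TrE; split=> -[lab' [u' [v' [F' inD h1 h2]]]]; exists lab', u', v'; split=> //; first by rewrite inE inD orbT.
    by move: inD; rewrite inE => /orP[/eqP/(noF _ _ _ F')//|].
  have Gt' : rdg t rG = G by rewrite -GE /rdg Gt.
  have Ot' : rdg t rOwn = O by rewrite /O /rdg Ot.
  have := @exec_route_edge e' t Gt'; rewrite Ot' => /(_ (route_exists red (FE _ _ _ Fuv)))[l1 [f1 [rt1 Tr1]]].
  split; try by rewrite exec_frame.
  exists (fun b => if b == lab then l1 else l b), (fun b => if b == lab then f1 else f b).
  (* A label has a single edge, so it is routed once, and recording the new route does not overwrite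
     an old one. *)
  have old lab' u' v' : F lab' u' v' -> tup lab' u' v' \in D -> (lab' == lab) = false.
    move=> F' inD; apply/eqP => E; subst lab'; have [uE vE] := one _ _ _ _ _ F' Fuv; subst u' v'.
    by rewrite -[_ :: _]/(tup lab u v) inD in aD.
  split.
    move=> lab' u' v' F'; rewrite inE => /orP[/eqP E|inD]; last first.
      by rewrite (old _ _ _ F' inD); exact: rt.
    by have [-> -> ->] := tupE _ _ _ E; rewrite eqxx.
  move=> i0 a b; rewrite Tr1 TrE; split.
    case=> [[lab' [u' [v' [F' inD h1 h2]]]]|[-> h]].
      by exists lab', u', v'; rewrite inE inD orbT (old _ _ _ F' inD).
    by exists lab, u, v; split=> //; [exact: mem_head|rewrite eqxx].
  case=> lab' [u' [v' [F' + h1 h2]]]; rewrite inE => /orP[/eqP E|inD]; last first.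
    by left; exists lab', u', v'; rewrite (old _ _ _ F' inD) in h2.
  have [E1 E2 E3] := tupE _ _ _ E; right; split; first by rewrite -h1 E2.
  by rewrite E1 eqxx in h2.
have BJ4 i : rl s4 rBJ [:: i] = rl s rJ [:: i].
  by rewrite /s4 exec_frame// /s3 rl_setp// !evalE /= /s2 exec_frame// /s1 exec_frame.
have BE4 i a b : rd3 s4 rBE i a b = rd3 s2 rTr i a b.
  by rewrite /rd3 /s4 rl_setp// !evalE /= /s3 exec_frame.
split=> //.
apply: (@routes_steiner n G T J A O red F l f _ pk).
  by move=> lab u v h; apply: (rt _ _ _ h); exact: Dall.
move=> i a b; rewrite BE4 TrE; split=> -[lab [u [v]]].
  by case=> h1 _ h2 h3; exists lab, u, v.
by case=> h1 h2 h3; exists lab, u, v; split=> //; exact: Dall.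
Qed.
End Extract.

(** * The whole program *)

(** Adds the least missing vertex to the initial segment [rK], and changes nothing once the segment
    is full. *)
Definition grow : prog := setp rK [:: 0] (fOr (FRel rK [:: 0]) (fAll 1 (fImp (FLt 1 0) (FRel rK [:: 1])))).

(** Five increments lead from [5 * a + 1] to [5 * (a + 1) + 1]. The kept trees are replaced only on
    success. *)
Definition attempt : prog := Seq reduce (Seq pack (Seq (If (FRel rOk [::]) extract)
  (Seq grow (Seq grow (Seq grow (Seq grow grow)))))).

(** The counted variable is pinned to the vertex 0, so the count is the truth value of [f]. *)
Definition print_bit f : prog := PrintC 0 (FAnd (FCst 0 0) f).

Definition print_tree : prog := Seq
  (For 38 (print_bit (fOr (FRel rT [:: 38]) (FEx 1 (FRel rBE [:: 39; 38; 1])))))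
  (For 38 (For 37 (print_bit (FAnd (FNot (fEq 38 37))
     (fOr (FRel rBE [:: 39; 38; 37]) (FRel rBE [:: 39; 37; 38])))))).

Definition main : prog :=
  Seq (nest [:: 0; 1] (Read rG [:: 0; 1])) (Seq (nest [:: 0] (Read rT [:: 0]))
  (Seq (setp rK [:: 0] (FCst 0 0)) (Seq (For 39 attempt)
  (Seq (PrintC 0 (FRel rBJ [:: 0])) (For 39 (If (FRel rBJ [:: 39]) print_tree)))))).

Lemma wf_main : wf_prog (nth 0 arities) [::] main.
Proof. by vm_compute. Qed.

Lemma card_first_labels n k : k <= n -> #|first_labels n k| = k.
Proof.
move=> kn; have -> : first_labels n k = [set widen_ord kn x | x : 'I_k].
  apply/setP => x; rewrite inE; apply/idP/imsetP => [xk|[y _ ->]]; last exact: ltn_ord y.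
  by exists (Ordinal xk) => //; apply: val_inj.
by rewrite card_imset ?card_ord// => x y /(congr1 val)/= /val_inj.
Qed.

Lemma sub_adj_route_tree (V I : finType) (T : {set V}) (BE : I -> rel V) i x y :
  sub_adj (route_tree T BE i) x y = (x != y) && (BE i x y || BE i y x).
Proof.
congr (_ && _); apply/imsetP/orP => [[[a b]]|].
  by rewrite inE /= => ab /set2_eq[[-> ->]|[-> ->]]; [left|right].
by case=> h; [exists (x, y)|exists (y, x)]; rewrite ?inE//= setUC.
Qed.

Lemma flatten_bits (U : Type) (g : U -> nat) r : [seq g x | x <- r] = flatten [seq [:: g x] | x <- r].
Proof. by elim: r => //= x r ->. Qed.

Lemma size_filter_card n (P : pred 'I_n) : size [seq x <- enum 'I_n | P x] = #|[set x | P x]|.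
Proof.
rewrite size_filter -sum1_count -sum1_card big_enum_cond; apply: eq_bigl => x.
by rewrite !inE.
Qed.

Section Printing.
Variables (n : nat) (R : rels n).
Hypothesis n0 : 0 < n.
Implicit Types (e : env n) (s : state n).

Definition prints p e (w : seq nat) : Prop := forall s, rl s = R ->
  rl (exec p e s) = R /\ op (exec p e s) = op s ++ w.

Lemma prints_Seq p q e w w' : prints p e w -> prints q e w' -> prints (Seq p q) e (w ++ w').
Proof. by move=> h h' s /h[/h'[h1 h2] h3]; rewrite exec_Seq h1 h2 h3 catA. Qed.

Lemma prints_For p x e (w : 'I_n -> seq nat) : (forall a, prints p (upde e x a) (w a)) ->
  prints (For x p) e (flatten [seq w a | a <- enum 'I_n]).
Proof.
move=> h s sR; rewrite /exec -/exec; elim: (enum 'I_n) s sR => [|a r IH] s sR /=; first by rewrite cats0.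
by have [h1 h2] := h a s sR; have [h3 h4] := IH _ h1; rewrite h3 h4 h2 -catA.
Qed.

Lemma prints_If f p e w : prints p e w -> prints (If f p) e (if eval R e f then w else [::]).
Proof. by move=> h s sR; rewrite exec_If sR; case: ifP => _; [exact: h|rewrite cats0]. Qed.

Lemma prints_bit f e (b : bool) : (forall a, eval R (upde e 0 a) f = b) -> prints (print_bit f) e [:: nat_of_bool b].
Proof.
move=> fb s sR; rewrite /print_bit /exec sR; split=> //=; rewrite -cats1; congr (_ ++ [:: _]).
have -> : [set a : 'I_n | eval R (upde e 0 a) (FAnd (FCst 0 0) f)] = if b then [set Ordinal n0] else set0.
  apply/setP => a; rewrite inE !evalE fb /=; case: b {fb}; rewrite !inE ?andbF// andbT.
  by rewrite -val_eqE.
by case: b {fb}; rewrite ?cards1 ?cards0.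
Qed.

Definition tree_of (T : {set 'I_n}) i := route_tree T (fun i a b => R rBE [:: i; a; b]) i.

Lemma prints_tree e i (T : {set 'I_n}) : e 39 = i -> (forall x, R rT [:: x] = (x \in T)) ->
  prints print_tree e (encode_subgraph (tree_of T i)).
Proof.
move=> ei TE; apply: prints_Seq.
  rewrite /encode_set flatten_bits; apply: prints_For => a; apply: prints_bit => b.
  rewrite !evalE /= TE !inE; congr (_ || _); apply: eq_existsb => c.
  by rewrite !evalE /= ei.
apply: prints_For => a; rewrite flatten_bits; apply: prints_For => b; apply: prints_bit => c.
by rewrite !evalE /= ei sub_adj_route_tree.
Qed.

Lemma prints_trees e (T : {set 'I_n}) : (forall x, R rT [:: x] = (x \in T)) ->
  prints (Seq (PrintC 0 (FRel rBJ [:: 0])) (For 39 (If (FRel rBJ [:: 39]) print_tree))) e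
    (encode_subgraphs [seq tree_of T i | i <- enum 'I_n & R rBJ [:: i]]).
Proof.
move=> TE; rewrite /encode_subgraphs -[_ :: flatten _]cat1s; apply: prints_Seq.
  move=> s sR; rewrite /exec sR; split=> //=; rewrite -cats1; congr (_ ++ [:: _]).
  by rewrite size_map size_filter_card; apply: eq_card => x; rewrite !inE !evalE.
have -> : flatten [seq encode_subgraph H | H <- [seq tree_of T i | i <- enum 'I_n & R rBJ [:: i]]] =
    flatten [seq (if R rBJ [:: i] then encode_subgraph (tree_of T i) else [::]) | i <- enum 'I_n].
  by elim: (enum 'I_n) => //= a r IH; case: ifP => //= _; rewrite IH.
apply: prints_For => i; have -> : R rBJ [:: i] = eval R (upde e 39 i) (FRel rBJ [:: 39]) by [].
by apply: prints_If; exact: prints_tree.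
Qed.
End Printing.

Lemma exec_nest_read n (g : seq 'I_n -> bool) r xs e (s : state n) rest : uniq xs ->
  ip s = [seq nat_of_bool (g a) | a <- tuples n (size xs)] ++ rest ->
  exec (nest xs (Read r xs)) e s = State (fun r' a => if eqn r' r && (size a == size xs) then g a else rl s r' a)
    rest (op s).
Proof.
move=> ux; rewrite exec_nest.
have H l (t : state n) : {in l, forall a, size a = size xs} -> ip t = [seq nat_of_bool (g a) | a <- l] ++ rest ->
    foldl (fun s a => exec (Read r xs) (setenv e xs a) s) t l =
    State (fun r' a => if eqn r' r && (a \in l) then g a else rl t r' a) rest (op t).
  elim: l t => [|a l IH] t hl /= it.
    by case: t it => R i o /= ->; congr State; apply/funext => r'; apply/funext => a; rewrite andbF.
  rewrite IH; last by rewrite /exec /= it.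
    rewrite /exec /= it /= map_setenv//; last by apply: hl; exact: mem_head.
    congr State; apply/funext => r'; apply/funext => a'; rewrite inE.
    rewrite -[rl (State _ _ _) r' a']/(put (rl t) r a (0 < nat_of_bool (g a)) r' a') /put.
    case: (@eqnP r' r) => //= _; case: (a' \in l); rewrite ?orbT// orbF; case: eqP => // ->.
    by case: (g a).
  by move=> b bl; apply: hl; rewrite inE bl orbT.
move=> ips; rewrite (H _ s)//; last by move=> a; rewrite mem_tuples => /eqP.
by congr State; apply/funext => r'; apply/funext => a; rewrite mem_tuples.
Qed.

Lemma encode_set_tuples n (S : {set 'I_n}) :
  encode_set S = [seq nat_of_bool (if a is [:: x] then x \in S else false) | a <- tuples n 1].
Proof.
rewrite -[tuples n 1]/[seq x :: t | x <- enum 'I_n, t <- [:: [::]]] /encode_set.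
by elim: (enum 'I_n) => //= x r ->.
Qed.

Lemma encode_rel_tuples n (E : rel 'I_n) :
  encode_rel E = [seq nat_of_bool (if a is [:: x; y] then E x y else false) | a <- tuples n 2].
Proof.
have t1 : tuples n 1 = [seq [:: x] | x <- enum 'I_n].
  rewrite -[tuples n 1]/[seq x :: t | x <- enum 'I_n, t <- [:: [::]]].
  by elim: (enum 'I_n) => //= x r ->.
by rewrite -[tuples n 2]/[seq x :: t | x <- enum 'I_n, t <- tuples n 1] t1 allpairs_mapr map_allpairs.
Qed.

Section Main.
Variables (n : nat) (o0 o1 : 'I_n) (G : sgraph 'I_n) (T : {set 'I_n}).
Hypotheses (o0E : o0 = 0 :> nat) (o1E : o1 = 1 :> nat).
Hypothesis Tne : T != set0.
Hypothesis noK5 : forall B, ~ K5_model (incidence G) B.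
Implicit Types (s : state n) (e : env n).

Definition tree s i := route_tree T (rd3 s rBE) i.

Definition good s : Prop := [/\ rdg s rG = G, sett s rT = T,
  forall i, rd1 s rBJ i -> steiner_tree G T (tree s i) /\
    (forall x, x \in sub_verts (tree s i) -> x \notin T -> sub_degree (tree s i) x = 2) &
  forall i j, i != j -> rd1 s rBJ i -> rd1 s rBJ j -> element_disjoint T (tree s i) (tree s j)].

Lemma good_frame s s' : good s -> [/\ rl s' rG = rl s rG, rl s' rT = rl s rT, rl s' rBJ = rl s rBJ &
  rl s' rBE = rl s rBE] -> good s'.
Proof.
move=> [g1 g2 g3 g4] [h1 h2 h3 h4]; rewrite /good /tree /rd1 /rd3 /rdg /sett /rd1 h1 h2 h3 h4.
by split=> //; rewrite -?g1 -?g2.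
Qed.

Lemma exec_grow e s k : (forall x, rd1 s rK x = (x < k)) -> forall x, rd1 (exec grow e s) rK x = (x < k.+1).
Proof.
move=> KE x; rewrite /rd1 rl_setp// !evalE /= -/(rd1 s rK x) KE.
case: (ltngtP x k) => [xk|kx|xk] /=.
- by rewrite ltnS ltnW.
- rewrite ltnS leqNgt kx; apply/negbTE/negP => /forallP/(_ (Ordinal (ltn_trans kx (ltn_ord x)))).
  by rewrite !evalE /= kx -/(rd1 s rK _) KE /= ltnn.
- rewrite xk ltnSn; apply/forallP => a; rewrite !evalE /=; apply/implyP => ax.
  by rewrite -/(rd1 s rK a) KE -xk.
Qed.

(** A failure refutes the connectivity only while [5 * a + 1 <= n], since [rK] holds at most [n]
    vertices. *)
Lemma exec_attempt e s (a := e 39) : good s -> (forall x, rd1 s rK x = (x < 5 * a + 1)) ->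
  let s' := exec attempt e s in
  [/\ good s', (forall x, rd1 s' rK x = (x < 5 * a.+1 + 1)) &
      (forall i, rd1 s' rBJ i = (i < a)) \/ (rl s' rBJ = rl s rBJ /\
        (5 * a + 1 <= n -> ~ elt_connected T G (5 * a + 1)))].
Proof.
move=> gd KE; rewrite /attempt 7!exec_Seq; set s1 := exec reduce e s; set s2 := exec pack e s1.
set s3 := exec (If _ _) e s2; set s4 := exec grow e _.
have [GE TE t1 t2] := gd.
have [ok1 stable] : reduce_ok s s1 /\ forall p q, p \notin sett s rT -> q \notin sett s rT -> ~~ rdg s1 rA p q.
  by apply: (exec_reduce o0E o1E); rewrite GE; [exact: adj_sym|exact: adj_irr].
have [[G1 T1 K1] red conn] := ok1; rewrite TE in red conn stable; rewrite GE in red conn.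
have T1' : sett s1 rT = T by rewrite -TE /sett /rd1 T1.
have := exec_pack e s1; rewrite -/s2 /= T1' => -[pk [Q exh] JE okE].
have Own2 : rdg s2 rOwn = rdg s1 rOwn by rewrite /rdg /s2 exec_frame.
have G2 : rdg s2 rG = G by rewrite -GE /rdg /s2 exec_frame// G1.
have fr2 : [/\ rl s2 rG = rl s rG, rl s2 rT = rl s rT, rl s2 rBJ = rl s rBJ & rl s2 rBE = rl s rBE].
  by split; rewrite /s2 exec_frame// /s1 exec_frame.
have gd2 := good_frame gd fr2.
have K3 x : rd1 s3 rK x = (x < 5 * a + 1).
  by rewrite -KE /rd1 /s3 exec_frame// /s2 exec_frame// K1.
have fr4 : [/\ rl s4 rG = rl s3 rG, rl s4 rT = rl s3 rT, rl s4 rBJ = rl s3 rBJ & rl s4 rBE = rl s3 rBE].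
  have fg t r : r \in [:: rG; rT; rBJ; rBE] -> rl (exec grow e t) r = rl t r.
    by rewrite !inE => /or4P[]/eqP->; rewrite exec_frame.
  by split; rewrite /s4 !fg.
have K4 x : rd1 s4 rK x = (x < 5 * a.+1 + 1).
  have := exec_grow e (exec_grow e (exec_grow e (exec_grow e (exec_grow e K3)))) x.
  by rewrite -/s4 => ->; congr (_ < _); lia.
have BJ4 : rl s4 rBJ = rl s3 rBJ by case: fr4.
rewrite BJ4 /rd1 BJ4.
have s3E : s3 = if rl s2 rOk [::] then exec extract e s2 else s2 by rewrite /s3 exec_If !evalE.
have [ok|no] := boolP (rl s2 rOk [::]); last first.
  have s32 : s3 = s2 by rewrite s3E (negPf no).
  split=> //; first by apply: good_frame fr4; rewrite s32.
  right; rewrite s32; split; first by case: fr2.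
  move=> an cn; move/negP: no; apply; rewrite okE.
  have kE : #|sett s rK| = 5 * a + 1.
    rewrite -[RHS](card_first_labels an); apply: eq_card => x; by rewrite !inE KE.
  have jE : #|first_labels n a| = a by apply: card_first_labels; exact: ltnW.
  rewrite kE in conn; apply/forallP => i; apply/implyP => iJ; apply/forallP => x; apply/implyP => xT.
  apply/forallP => y; apply/implyP => yT.
  by apply: (exhausted_joined red stable pk exh) => //; rewrite jE; exact: conn.
have s32 : s3 = exec extract e s2 by rewrite s3E ok.
have := @exec_extract n o0 o0E G e s2 T (rdg s1 rA) (first_labels n a) G2; rewrite Own2 => /(_ red pk)[BJ [st [dg dj]]].
have BJ3 i : rl s3 rBJ [:: i] = (i < a).
  by rewrite s32 BJ -[rl s2 22 _]/(rd1 s2 rJ i); have /setP/(_ i) := JE; rewrite !inE.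
split=> //; last by left.
apply: good_frame fr4; rewrite s32; split.
- by rewrite -G2 /rdg exec_frame.
- by rewrite -TE /sett /rd1 exec_frame//; have [_ -> _ _] := fr2.
- move=> i; rewrite -s32 /rd1 BJ3 => ia; rewrite s32; split; last exact: dg.
  apply: st => // x y xT yT; move: ok; rewrite okE => /forallP/(_ i); rewrite inE ia /=.
  by move=> /forallP/(_ x); rewrite xT => /forallP/(_ y); rewrite yT.
- by move=> i j ij _ _; exact: dj.
Qed.

Theorem exec_main e k : k < n -> elt_connected T G k ->
  exists s, op (exec main e (State (fun _ _ => false) (encode_rel G ++ encode_set T) [::])) =
      encode_subgraphs [seq tree s i | i <- enum 'I_n & rd1 s rBJ i] /\
    good s /\ k <= 5 * (size [seq i <- enum 'I_n | rd1 s rBJ i] + 1).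
Proof.
move=> kn conn; rewrite /main 5!exec_Seq; set s0 := State _ _ _.
set s1 := exec (nest _ (Read rG _)) e s0; set s2 := exec (nest _ (Read rT _)) e s1.
set s3 := exec (setp rK _ _) e s2; set s4 := exec (For 39 attempt) e s3.
have s1E : s1 = State (fun r a => if eqn r 0 && (size a == 2) then
    (if a is [:: x; y] then G x y else false) else false) (encode_set T) [::].
  by rewrite /s1 (@exec_nest_read n (fun a => if a is [:: x; y] then G x y else false) _ _ e s0 (encode_set T))//=
    -encode_rel_tuples.
have s2E : s2 = State (fun r a => if eqn r 1 && (size a == 1) then
    (if a is [:: x] then x \in T else false) else rl s1 r a) [::] [::].
  rewrite /s2 (@exec_nest_read n (fun a => if a is [:: x] then x \in T else false) _ _ e s1 [::])//.
    by rewrite s1E.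
  by rewrite s1E cats0 -encode_set_tuples.
have fr3 r : r != rK -> r < 24 -> rl s3 r = rl s2 r.
  by move=> rK' r24; rewrite /s3 exec_frame//= !inE negb_or rK'; lia.
have BJ3 i : rd1 s3 rBJ i = false by rewrite /rd1 fr3// s2E /rl /= s1E.
have gd3 : good s3.
  split.
  - by apply/funext => x; apply/funext => y; rewrite /rdg fr3// s2E /rl /= s1E.
  - by apply/setP => x; rewrite inE /rd1 fr3// s2E.
  - by move=> i; rewrite BJ3.
  - by move=> i j _; rewrite BJ3.
have n0 : 0 < n by apply: leq_ltn_trans kn.
pose j0 := k.-1 %/ 5.
have [gd4 _ [j [jn BJ4 hj]]] : [/\ good s4, (forall x, rd1 s4 rK x = (x < 5 * n + 1)) &
    exists j, [/\ j <= n, forall i, rd1 s4 rBJ i = (i < j) & j0 < n -> j0 <= j \/ k = 0]].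
  pose Inv a t := [/\ good t, (forall x, rd1 t rK x = (x < 5 * a + 1)) &
    exists j, [/\ j <= n, forall i, rd1 t rBJ i = (i < j) & j0 < a -> j0 <= j \/ k = 0]].
  apply: (@exec_For_ind _ Inv).
    split=> //; last by exists 0; split=> // i; rewrite BJ3.
    by move=> x; rewrite /rd1 /s3 rl_setp// !evalE /=; lia.
  move=> a t [gt Kt [j [jn BJt hj]]].
  have [gd' K' h] := exec_attempt (e := upde e 39 a) gt Kt; split=> //.
  case: h => [h|[BJ' no]].
    by exists a; split=> //; [exact: ltnW|rewrite ltnS => ->; left].
  exists j; split=> //; first by move=> i; rewrite /rd1 BJ'; exact: BJt.
  rewrite ltnS leq_eqVlt => /orP[/eqP ja|/hj//]; right; apply/eqP; apply: contraT => k0.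
  have le : 5 * a + 1 <= k by rewrite -ja /j0; lia.
  case: (no (leq_trans le (ltnW kn))); exact: elt_connected_leq conn.
have [_ T4 _ _] := gd4.
have TE x : rl s4 rT [:: x] = (x \in T) by rewrite -T4 inE.
have op4 : op s4 = [::].
  have p1 : op s4 = op s3 by have [_ ->] := @exec_pure n (For 39 attempt) e s3 isT.
  by rewrite p1; have [_ ->] := @exec_pure n (setp rK [:: 0] (FCst 0 0)) e s2 isT; rewrite s2E.
exists s4; split.
  by have [_ ->] := @prints_trees n (rl s4) n0 e T TE s4 erefl; rewrite op4.
split=> //.
have -> : size [seq i <- enum 'I_n | rd1 s4 rBJ i] = j.
  by rewrite size_filter_card -[RHS](card_first_labels jn); apply: eq_card => x; rewrite !inE BJ4.
have j0n : j0 < n by rewrite /j0; lia.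
by case: (hj j0n); rewrite /j0; lia.
Qed.
End Main.

(** * A planar graph has no five-clique minor *)

From mathcomp Require Import all_order all_algebra ring lra.
From mathcomp Require Import classical_sets set_interval reals topology normedtype.
Import Order.TTheory GRing.Theory Num.Theory.
Import numFieldNormedType.Exports.

(** * Uniform estimates for arcs in the plane *)

Section PlaneAnalysis.
Variable R : realType.
Local Open Scope ring_scope.
Local Open Scope classical_set_scope.

Definition close (e : R) (p q : R * R) :=
  (`|p.1 - q.1| < e) && (`|p.2 - q.2| < e).

Lemma close_sym e p q : close e p q = close e q p.
Proof. by rewrite /close distrC [`|p.2 - _|]distrC. Qed.

Lemma close_trans a b p q r : close a p q -> close b q r -> close (a + b) p r.
Proof.
move=> /andP[p1 p2] /andP[q1 q2]; apply/andP; split.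
  by rewrite (le_lt_trans (ler_distD q.1 _ _))// ltrD.
by rewrite (le_lt_trans (ler_distD q.2 _ _))// ltrD.
Qed.

Lemma close_mono a b p q : a <= b -> close a p q -> close b p q.
Proof. by move=> ab /andP[p1 p2]; apply/andP; split; exact: lt_le_trans ab. Qed.

Lemma close_refl e p : 0 < e -> close e p p.
Proof. by move=> e0; rewrite /close !subrr normr0 e0. Qed.

Lemma natSinv_small (d : R) : 0 < d ->
  exists M : nat, forall m : nat, (M <= m)%N -> m.+1%:R^-1 < d.
Proof.
move=> d0; exists (Num.bound d^-1) => m Mm.
rewrite invf_plt ?posrE ?ltr0n//.
have := @archi_boundP R d^-1; rewrite invr_ge0 ltW// => /(_ isT) h.
by apply: (lt_le_trans h); rewrite ler_nat (leq_trans Mm).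
Qed.

Definition continuous01 (f : R -> R * R) : Prop :=
  forall x, x \in `[0, 1]%R -> forall e, 0 < e -> exists2 d, 0 < d &
  forall y, y \in `[0, 1]%R -> `|x - y| < d -> close e (f x) (f y).

Lemma within_continuous01 (f : R -> R * R) :
  {within `[0, 1], continuous f} -> continuous01 f.
Proof.
move=> /subspace_continuousP fc x x01 e e0.
have /cvgrPdist_lt /(_ e e0) := fc x x01.
rewrite /within/= => -[d /= d0 hd]; exists d => // y y01 xy.
have := hd y xy y01; rewrite /Num.norm /= gt_max => /andP[h1 h2].
by apply/andP; split.
Qed.

(** Heine-Cantor. The modulus is an inverse integer and every larger integer works too, so finitely
    many arcs get a common modulus by a maximum. *)
Lemma uniformly_close (f : R -> R * R) :
  continuous01 f -> forall e, 0 < e -> exists M : nat,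
  forall m, (M <= m)%N -> forall x y, x \in `[0, 1]%R -> y \in `[0, 1]%R ->
  `|x - y| < m.+1%:R^-1 -> close e (f x) (f y).
Proof.
move=> fc e e0.
have /compact_near_coveringP := @segment_compact R 0 1.
move=> /(_ nat \oo (fun m x => forall y, x \in `[0, 1]%R -> y \in `[0, 1]%R ->
  `|x - y| < m.+1%:R^-1 -> close e (f x) (f y))) [].
- move=> x x01.
  have e2 : 0 < e / 2 by lra.
  have [d d0 hd] := fc x x01 _ e2.
  have [|M hM] := @natSinv_small (d / 2); first lra.
  exists ([set y | `|x - y| < d / 2], [set m | (M <= m)%N]) => /=.
    split; last by exists M.
    by exists (d / 2) => //=; lra.
  move=> [y m] /= [xy Mm] z y01 z01 yz.
  have yz2 := lt_trans yz (hM m Mm).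
  have -> : e = e / 2 + e / 2 by lra.
  apply: (@close_trans _ _ _ (f x)); last first.
    apply: hd => //; apply: le_lt_trans (ler_distD y _ _) _; lra.
  rewrite close_sym; apply: hd => //; lra.
- move=> M _ hM; exists M => m Mm x y x01 y01 xy.
  by apply: (hM m Mm) => //; rewrite inE.
Qed.

(** Disjoint compact arcs have a positive distance, here again bounded below by an inverse integer
    so that finitely many pairs share one bound. *)
Lemma uniformly_separated (f g : R -> R * R) :
  continuous01 f -> continuous01 g ->
  (forall s t, s \in `[0, 1]%R -> t \in `[0, 1]%R -> f s <> g t) ->
  exists M : nat, forall m, (M <= m)%N -> forall s t,
  s \in `[0, 1]%R -> t \in `[0, 1]%R -> ~~ close m.+1%:R^-1 (f s) (g t).
Proof.
move=> fc gc fg.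
have /compact_near_coveringP := compact_setX (@segment_compact R 0 1) (@segment_compact R 0 1).
move=> /(_ nat \oo (fun m x => x.1 \in `[0, 1]%R -> x.2 \in `[0, 1]%R ->
  ~~ close m.+1%:R^-1 (f x.1) (g x.2))) [].
- move=> [s t] [/= s01 t01].
  have [d d0 hd] : exists2 d, 0 < d & ~~ close d (f s) (g t).
    have /eqP := fg s t s01 t01.
    rewrite [f s]surjective_pairing [g t]surjective_pairing xpair_eqE negb_and.
    case/orP => h.
      exists `|(f s).1 - (g t).1|; first by rewrite normr_gt0 subr_eq0.
      by rewrite /close ltxx.
    exists `|(f s).2 - (g t).2|; first by rewrite normr_gt0 subr_eq0.
    by rewrite /close ltxx andbF.
  have d3 : 0 < d / 3 by lra.
  have [a a0 ha] := fc s s01 _ d3.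
  have [b b0 hb] := gc t t01 _ d3.
  have [M hM] := natSinv_small d3.
  exists ([set y : R * R| `|s - y.1| < a /\ `|t - y.2| < b], [set m | (M <= m)%N]) => /=.
    split; last by exists M.
    exists ([set y | `|s - y| < a], [set y | `|t - y| < b]) => //=.
    by split; [exists a|exists b].
  move=> [[y z] m] /= [[sy tz] Mm] y01 z01.
  apply: contra hd => h.
  have := hM m Mm => /= hm.
  have -> : d = d / 3 + (d / 3 + d / 3) by lra.
  apply: (close_trans (ha _ y01 sy)).
  apply: (close_trans (close_mono (ltW hm) h)).
  by rewrite close_sym; apply: hb.
- move=> M _ hM; exists M => m Mm s t s01 t01.
  by apply: (hM m Mm (s, t)) => //; split; exact: (s01, t01).
Qed.

End PlaneAnalysis.

(** * Orientations of five points and crossings of segments *)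

Section Orientation.
Variable R : realType.
Local Open Scope ring_scope.
Implicit Types a b c d e : R * R.

Definition orient a b c : R :=
  (b.1 - a.1) * (c.2 - a.2) - (b.2 - a.2) * (c.1 - a.1).

Definition ccw a b c : bool := 0 < orient a b c.

Definition segments_cross a b c d : bool :=
  (ccw a b c (+) ccw a b d) && (ccw c d a (+) ccw c d b).

Definition in_triangle a c d e : bool :=
  (ccw c d a == ccw d e a) && (ccw d e a == ccw e c a).

Lemma orient_rot a b c : orient a b c = orient b c a.
Proof. by rewrite /orient; ring. Qed.

Lemma orient_swap a b c : orient b a c = - orient a b c.
Proof. by rewrite /orient; ring. Qed.

Lemma ccw_rot a b c : ccw a b c = ccw b c a.
Proof. by rewrite /ccw orient_rot. Qed.

Lemma ccw_swap a b c : orient a b c != 0 -> ccw b a c = ~~ ccw a b c.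
Proof. by move=> h; rewrite /ccw orient_swap oppr_gt0 -leNgt le_eqVlt (negPf h). Qed.

Lemma ccw_swap2 a b c : orient a b c != 0 -> ccw a c b = ~~ ccw a b c.
Proof. by move=> h; rewrite -ccw_swap// ccw_rot ccw_rot. Qed.

Lemma ccw_aac a c : ccw a a c = false.
Proof. by rewrite /ccw /orient !subrr !mul0r subrr ltxx. Qed.

Lemma pos_mul (x y : R) : x != 0 -> y != 0 ->
  (0 < x * y) = ~~ ((0 < x) (+) (0 < y)).
Proof.
move=> x0 y0; case: (ltgtP 0 x) x0 => // hx _; case: (ltgtP 0 y) y0 => // hy _ /=.
- exact: mulr_gt0.
- by apply/negbTE; rewrite -leNgt mulr_ge0_le0// ltW.
- by apply/negbTE; rewrite -leNgt mulr_le0_ge0// ltW.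
- by rewrite nmulr_rgt0.
Qed.

Lemma sign_sum3 (x y z : R) : x - y + z = 0 -> x != 0 -> y != 0 -> z != 0 ->
  ~~ [&& (0 < x) == ~~ (0 < y) & (0 < z) == (0 < x)].
Proof.
move=> h x0 y0 z0.
by case: (ltgtP 0 x) x0 => // hx _; case: (ltgtP 0 y) y0 => // hy _ /=;
  case: (ltgtP 0 z) z0 => // hz _ /=; exfalso; lra.
Qed.

Lemma sign_sum4 (x y z t : R) :
  x - y + z - t = 0 -> x != 0 -> y != 0 -> z != 0 -> t != 0 ->
  ~~ [&& (0 < x) == ~~ (0 < y), (0 < z) == (0 < x) & (0 < t) == (0 < y)].
Proof.
move=> h x0 y0 z0 t0.
by case: (ltgtP 0 x) x0 => // hx _; case: (ltgtP 0 y) y0 => // hy _ /=;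
  case: (ltgtP 0 z) z0 => // hz _ /=; case: (ltgtP 0 t) t0 => // ht _ /=;
  exfalso; lra.
Qed.

(* The three-term Grassmann-Pluecker relation. *)
Lemma ccw_plucker a b c d e :
  [&& orient a b c != 0, orient a b d != 0, orient a b e != 0,
      orient a c d != 0, orient a c e != 0 & orient a d e != 0] ->
  ~~ [&& (ccw a b c (+) ccw a d e) == ~~ (ccw a b d (+) ccw a c e) &
         (ccw a b e (+) ccw a c d) == (ccw a b c (+) ccw a d e)].
Proof.
case/and5P => h1 h2 h3 h4 /andP[h5 h6].
have := @sign_sum3 (orient a b c * orient a d e) (orient a b d * orient a c e)
  (orient a b e * orient a c d).
rewrite !pos_mul ?mulf_eq0 ?negb_or ?h1 ?h2 ?h3 ?h4 ?h5 ?h6//.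
rewrite /ccw => H.
move: (H ltac:(rewrite /orient; ring) isT isT isT).
by case: (0 < _); case: (0 < _); case: (0 < _); case: (0 < _); case: (0 < _);
  case: (0 < _).
Qed.

(** The signed areas of the four triangles on [a], [b], [c], [d] have alternating sum zero, so the
    four terms cannot all have the same sign. *)
Lemma ccw_sum4 a b c d :
  [&& orient b c d != 0, orient a c d != 0, orient a b d != 0 & orient a b c != 0] ->
  ~~ [&& ccw b c d == ~~ ccw a c d, ccw a b d == ccw b c d &
         ccw a b c == ccw a c d].
Proof.
case/and4P => h1 h2 h3 h4; apply: sign_sum4 => //.
by rewrite /orient; ring.
Qed.

Definition generic5 a b c d e : bool :=
  [&& orient a b c != 0, orient a b d != 0, orient a b e != 0,
      orient a c d != 0, orient a c e != 0, orient a d e != 0,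
      orient b c d != 0, orient b c e != 0, orient b d e != 0
      & orient c d e != 0].

(** Sign patterns that satisfy the Grassmann-Pluecker relations based at [a] and [b] and the area
    relation of each four points. These constraints already imply the parity statements below, which
    are then checked on all patterns. *)
Definition realizable (s : seq bool) : bool :=
  if s is [:: abc; abd; abe; acd; ace; ade; bcd; bce; bde; cde] then
  [&& ~~ [&& (abc (+) ade) == ~~ (abd (+) ace) & (abe (+) acd) == (abc (+) ade)],
    ~~ [&& (~~ abc (+) bde) == ~~ (~~ abd (+) bce) & (~~ abe (+) bcd) == (~~ abc (+) bde)],
    ~~ [&& bcd == ~~ acd, abd == bcd & abc == acd],
    ~~ [&& bce == ~~ ace, abe == bce & abc == ace],
    ~~ [&& bde == ~~ ade, abe == bde & abd == ade],
    ~~ [&& cde == ~~ ade, ace == cde & acd == ade] &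
    ~~ [&& cde == ~~ bde, bce == cde & bcd == bde]] else false.

Lemma ccw_generic5 a b c d e (P : pred (seq bool)) :
  all (fun s => realizable s ==> P s) (bitseqs 10) ->
  generic5 a b c d e ->
  P [:: ccw a b c; ccw a b d; ccw a b e; ccw a c d; ccw a c e; ccw a d e;
        ccw b c d; ccw b c e; ccw b d e; ccw c d e].
Proof.
move=> H /and5P[abc abd abe acd] /and5P[ace ade bcd bce] /andP[bde cde].
have N x y z : orient x y z != 0 -> orient y x z != 0.
  by rewrite orient_swap oppr_eq0.
set s := [:: _; _; _; _; _; _; _; _; _; _].
have := allP H s (mem_bitseqs s) => /implyP; apply; rewrite /s => {s}.
apply/and5P; split; [| | | |apply/and3P; split].
- by apply: ccw_plucker; rewrite abc abd abe acd ace ade.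
- rewrite -!(ccw_swap abc) -!(ccw_swap abd) -!(ccw_swap abe).
  by apply: ccw_plucker; rewrite (N _ _ _ abc) (N _ _ _ abd) (N _ _ _ abe) bcd bce bde.
all: by apply: ccw_sum4; rewrite ?abc ?abd ?abe ?acd ?ace ?ade ?bcd ?bce ?bde ?cde.
Qed.

(** The Jordan curve theorem modulo 2 for a triangle. *)
Lemma segments_cross_triangle a b c d e : generic5 a b c d e ->
  segments_cross a b c d (+) segments_cross a b d e (+) segments_cross a b e c
  = in_triangle a c d e (+) in_triangle b c d e.
Proof.
move=> gen.
pose f s := if s is [:: abc; abd; abe; acd; ace; ade; bcd; bce; bde; cde] then
  ((abc (+) abd) && (acd (+) bcd)) (+) ((abd (+) abe) && (ade (+) bde)) (+)
  ((abe (+) abc) && (~~ ace (+) ~~ bce)) ==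
  ((acd == ade) && (ade == ~~ ace)) (+) ((bcd == bde) && (bde == ~~ bce)) else false.
have : f [:: ccw a b c; ccw a b d; ccw a b e; ccw a c d; ccw a c e; ccw a d e;
        ccw b c d; ccw b c e; ccw b d e; ccw c d e].
  by apply: ccw_generic5 => //; vm_cast_no_check (erefl true).
case/and5P: gen => abc abd abe acd /and5P[ace ade bcd bce /andP[bde cde]].
rewrite /f /segments_cross /in_triangle => /eqP.
have -> : ccw e c a = ~~ ccw a c e by rewrite -ccw_rot ccw_swap2.
have -> : ccw e c b = ~~ ccw b c e by rewrite -ccw_rot ccw_swap2.
by rewrite -(ccw_rot a c d) -(ccw_rot a d e) -(ccw_rot b c d) -(ccw_rot b d e).
Qed.

(** A straight drawing of the complete graph on five points has five, three or one crossings
    according to the size of the convex hull, always an odd number. The proof runs through the sign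
    patterns. *)
Lemma K5_crossing_parity a b c d e : generic5 a b c d e ->
  let X := segments_cross in
  X a b c d (+) X a c b d (+) X a d b c (+)
  (X a b c e (+) X a c b e (+) X a e b c) (+)
  (X a b d e (+) X a d b e (+) X a e b d) (+)
  (X a c d e (+) X a d c e (+) X a e c d) (+)
  (X b c d e (+) X b d c e (+) X b e c d) = true.
Proof.
move=> gen X.
pose f s := if s is [:: abc; abd; abe; acd; ace; ade; bcd; bce; bde; cde] then
  let g abc abd acd bcd := ((abc (+) abd) && (acd (+) bcd)) (+)
     ((~~ abc (+) acd) && (abd (+) ~~ bcd)) (+) ((~~ abd (+) ~~ acd) && (abc (+) bcd)) in
  g abc abd acd bcd (+) g abc abe ace bce (+) g abd abe ade bde (+)
  g acd ace ade cde (+) g bcd bce bde cde else false.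
have : f [:: ccw a b c; ccw a b d; ccw a b e; ccw a c d; ccw a c e; ccw a d e;
        ccw b c d; ccw b c e; ccw b d e; ccw c d e].
  by apply: ccw_generic5 => //; vm_cast_no_check (erefl true).
case/and5P: gen => abc abd abe acd /and5P[ace ade bcd bce /andP[bde cde]].
have G x y z t : orient x y z != 0 -> orient x y t != 0 -> orient x z t != 0 ->
  orient y z t != 0 -> X x y z t (+) X x z y t (+) X x t y z =
  ((ccw x y z (+) ccw x y t) && (ccw x z t (+) ccw y z t)) (+)
  ((~~ ccw x y z (+) ccw x z t) && (ccw x y t (+) ~~ ccw y z t)) (+)
  ((~~ ccw x y t (+) ~~ ccw x z t) && (ccw x y z (+) ccw y z t)).
  move=> h1 h2 h3 h4; rewrite /X /segments_cross.
  rewrite (ccw_swap2 h1) (ccw_swap2 h2) (ccw_swap2 h3).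
  have -> : ccw y t x = ccw x y t by rewrite -ccw_rot.
  have -> : ccw y z x = ccw x y z by rewrite -ccw_rot.
  have -> : ccw z t x = ccw x z t by rewrite -ccw_rot.
  have -> : ccw z t y = ccw y z t by rewrite -ccw_rot.
  by have -> : ccw y t z = ~~ ccw y z t by rewrite ccw_swap2.
by rewrite /f !G.
Qed.

Lemma segments_cross_sym a b c d : segments_cross a b c d = segments_cross c d a b.
Proof. by rewrite /segments_cross andbC. Qed.

Lemma segments_cross_point a b c d : segments_cross a b c d ->
  exists s t, [/\ 0 <= s <= 1, 0 <= t <= 1,
   a.1 + s * (b.1 - a.1) = c.1 + t * (d.1 - c.1) &
   a.2 + s * (b.2 - a.2) = c.2 + t * (d.2 - c.2)].
Proof.
have key (x y : R) : (0 < x) (+) (0 < y) -> x - y != 0 /\ 0 <= x / (x - y) <= 1.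
  move=> h; have xy : x - y != 0.
    by rewrite subr_eq0; apply: contraTneq h => ->; rewrite addbb.
  have hh : (0 < x /\ y <= 0) \/ (x <= 0 /\ 0 < y).
    by move: h; case: (ltP 0 x); case: (ltP 0 y); [| left| right|].
  split=> //; case: (ltP 0 (x - y)) => hxy.
    rewrite ler_pdivlMr// ler_pdivrMr// mul0r mul1r.
    by case: hh => -[? ?]; apply/andP; split; lra.
  have {}hxy : x - y < 0 by rewrite lt_neqAle xy.
  rewrite ler_ndivlMr// ler_ndivrMr// mul0r mul1r.
  by case: hh => -[? ?]; apply/andP; split; lra.
case/andP => /key[h1 H1] /key[h2 H2].
(* The function [orient c d] is affine along [ab] and vanishes at this parameter; likewise
   [orient a b] along [cd]. *)
exists (orient c d a / (orient c d a - orient c d b)).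
exists (orient a b c / (orient a b c - orient a b d)).
split => //.
  by move: h1 h2; rewrite /orient => h1 h2; field; rewrite h1 h2.
by move: h1 h2; rewrite /orient => h1 h2; field; rewrite h1 h2.
Qed.

Lemma far_segments_not_cross (r : R) a b c d :
  close r a b -> close r c d -> ~~ close (r + r) a c -> ~~ segments_cross a b c d.
Proof.
move=> /andP[ab1 ab2] /andP[cd1 cd2]; apply: contra => /segments_cross_point.
case=> s [t [/andP[s0 s1] /andP[t0 t1] e1 e2]].
have K (x y z w : R) : `|x - y| < r -> `|z - w| < r ->
  x + s * (y - x) = z + t * (w - z) -> `|x - z| < r + r.
  move=> h1 h2 h; have -> : x - z = t * (w - z) + s * (x - y) by lra.
  apply: le_lt_trans (ler_normD _ _) _; rewrite !normrM ger0_norm// (ger0_norm s0) distrC.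
  have := normr_ge0 (x - y); have := normr_ge0 (z - w); nra.
by apply/andP; split; [apply: K e1|apply: K e2].
Qed.
End Orientation.

(** * Crossing parities of polygonal lines *)

Section Polylines.
Variables (R : realType) (I : eqType) (P : I -> R * R).
Local Open Scope ring_scope.

Definition general_position : Prop :=
  forall i j k : I, i != j -> i != k -> j != k -> orient (P i) (P j) (P k) != 0.

Hypothesis gen : general_position.

Definition cross (e f : I * I) : bool :=
  segments_cross (P e.1) (P e.2) (P f.1) (P f.2).

Definition polyline (x : I) (p : seq I) : seq (I * I) := zip (x :: p) p.

Definition cross_parity (s t : seq (I * I)) : bool :=
  \big[addb/false]_(e <- s) \big[addb/false]_(f <- t) cross e f.

Lemma cross_parity_consr s f t :
  cross_parity s (f :: t) = cross_parity s [:: f] (+) cross_parity s t.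
Proof.
rewrite /cross_parity -big_split; apply: eq_bigr => e _.
by rewrite big_cons big_seq1.
Qed.

Lemma cross_parity_cat s s' t :
  cross_parity (s ++ s') t = cross_parity s t (+) cross_parity s' t.
Proof. exact: big_cat. Qed.

Lemma cross_sym e f : cross e f = cross f e.
Proof. exact: segments_cross_sym. Qed.

Lemma cross_parityC s t : cross_parity s t = cross_parity t s.
Proof.
rewrite /cross_parity exchange_big; apply: eq_bigr => e _; apply: eq_bigr => f _.
exact: cross_sym.
Qed.

Lemma cross_flip a b c d : c \notin [:: a; b] -> d \notin [:: a; b] ->
  cross (a, b) (c, d) = cross (a, b) (d, c).
Proof.
rewrite !inE !negb_or => /andP[ca cb] /andP[da db]; rewrite /cross /segments_cross /=.
case: (eqVneq c d) => [->//|cd].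
rewrite (@ccw_swap _ (P c) (P d) (P a)) ?gen// (@ccw_swap _ (P c) (P d) (P b)) ?gen//.
by rewrite addNb addbN negbK [X in X && _]addbC.
Qed.

Lemma cross_degenerate e c : cross e (c, c) = false.
Proof. by rewrite /cross /segments_cross !ccw_aac andbF. Qed.

Lemma cross_degeneratel c e : cross (c, c) e = false.
Proof. by rewrite /cross /segments_cross !ccw_aac. Qed.

Lemma cross_triangle a b c d e :
  c \notin [:: a; b] -> d \notin [:: a; b] -> e \notin [:: a; b] ->
  cross (a, b) (c, d) (+) cross (a, b) (d, e) (+) cross (a, b) (e, c) =
  in_triangle (P a) (P c) (P d) (P e) (+) in_triangle (P b) (P c) (P d) (P e).
Proof.
move=> hc hd he.
have flip x y : x \notin [:: a; b] -> y \notin [:: a; b] ->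
  cross (a, b) (x, y) (+) cross (a, b) (y, x) = false.
  by move=> hx hy; rewrite -cross_flip// addbb.
have NI x y z : x != y -> x != z -> y != z -> ccw (P y) (P x) (P z) = ~~ ccw (P x) (P y) (P z).
  by move=> *; apply: ccw_swap; apply: gen.
have neq z : z \notin [:: a; b] -> z != a /\ z != b by rewrite !inE negb_or => /andP.
have [[ca cb] [da db] [ea eb]] := And3 (neq _ hc) (neq _ hd) (neq _ he).
case: (eqVneq c d) => [cd|cd].
  subst d; rewrite cross_degenerate /= flip// /in_triangle !ccw_aac.
  case: (eqVneq c e) => [<-|ce]; first by rewrite !ccw_aac.
  by rewrite (NI c e a)// (NI c e b)//; do 2!case: (ccw _ _ _).
case: (eqVneq d e) => [de|de].
  subst e; rewrite cross_degenerate addbF flip// /in_triangle !ccw_aac.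
  by rewrite (NI c d a)// (NI c d b)//; do 2!case: (ccw _ _ _).
case: (eqVneq e c) => [ec|ec].
  subst e; rewrite cross_degenerate addbF flip// /in_triangle !ccw_aac.
  by rewrite (NI c d a)// (NI c d b)//; do 2!case: (ccw _ _ _).
case: (eqVneq a b) => [<-|ab]; first by rewrite !cross_degeneratel; case: in_triangle.
apply: segments_cross_triangle.
by rewrite /generic5 !gen// eq_sym.
Qed.

Lemma seg_mem x p a b :
  (a, b) \in polyline x p -> (a \in x :: p) && (b \in x :: p).
Proof.
elim: p x => //= y p IH x; rewrite inE => /predU1P[[-> ->]|/IH/andP[ha hb]].
  by rewrite !inE !eqxx orbT.
by rewrite ![_ \in x :: _]in_cons ha hb !orbT.
Qed.

(** Each segment of the line contributes whether its two ends differ in being inside the triangle,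
    so the sum telescopes to zero on a closed line. *)
Lemma cross_parity_triangle x p c d e : last x p = x ->
  c \notin x :: p -> d \notin x :: p -> e \notin x :: p ->
  cross_parity (polyline x p) [:: (c, d); (d, e); (e, c)] = false.
Proof.
move=> xp.
have -> : false = in_triangle (P x) (P c) (P d) (P e) (+)
                  in_triangle (P (last x p)) (P c) (P d) (P e) by rewrite xp addbb.
elim: p x {xp} => [|y p IH] x hc hd he.
  by rewrite /cross_parity big_nil /= addbb.
rewrite /polyline [zip _ _]/= /cross_parity big_cons.
have sub z : z \notin [:: x, y & p] -> z \notin y :: p /\ z \notin [:: x; y].
  by rewrite !inE !negb_or => /and3P[-> -> ->].
have [[hc1 hc2] [hd1 hd2] [he1 he2]] := And3 (sub _ hc) (sub _ hd) (sub _ he).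
have := IH y hc1 hd1 he1; rewrite /cross_parity => -> /=.
have -> : \big[addb/false]_(f <- [:: (c, d); (d, e); (e, c)]) cross (x, y) f =
  in_triangle (P x) (P c) (P d) (P e) (+) in_triangle (P y) (P c) (P d) (P e).
  by rewrite -cross_triangle// !big_cons big_nil addbF addbA.
by rewrite -addbA; congr (_ (+) _); rewrite addbA addbb.
Qed.

(* A polyline may be straightened as far as its crossings with a closed
   polyline are concerned. *)
Lemma cross_parity_straighten x p y q : last x p = x ->
  {in y :: q, forall z, z \notin x :: p} ->
  cross_parity (polyline x p) (polyline y q) =
  cross_parity (polyline x p) [:: (y, last y q)].
Proof.
move=> xp; elim: q y => [|z q IH] y dis.
  by rewrite /cross_parity !big1// => e _; rewrite ?big_seq1 ?cross_degenerate ?big_nil.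
rewrite /polyline [zip (y :: _) _]/= cross_parity_consr.
rewrite -/(polyline z q) IH => [|t tq]; last by apply: dis; rewrite inE tq orbT.
have hy := dis y (mem_head _ _).
have hz : z \notin x :: p by apply: dis; rewrite !inE eqxx orbT.
have hl : last z q \notin x :: p by apply: dis; rewrite inE mem_last orbT.
have := cross_parity_triangle xp hy hz hl.
rewrite cross_parity_consr [X in _ (+) X]cross_parity_consr addbA.
move=> h; rewrite -[LHS]addbF -h; move: (cross_parity _ [:: (y, z)]) (cross_parity _ [:: (z, last z q)]) => u v.
rewrite addbA addbb /=; apply: eq_big_seq => -[a b] /seg_mem/andP[ha hb].
have nin t : t \notin x :: p -> t \notin [:: a; b].
  by move=> ht; rewrite !inE !negb_or; apply/andP; split; apply: contra ht => /eqP->.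
by rewrite !big_seq1 cross_flip ?nin.
Qed.

Lemma cross_parity1l e t : cross_parity [:: e] t = \big[addb/false]_(f <- t) cross e f.
Proof. exact: big_seq1. Qed.

Lemma cross_parity11 e f : cross_parity [:: e] [:: f] = cross e f.
Proof. by rewrite cross_parity1l big_seq1. Qed.

Lemma polyline_rcons x p y :
  polyline x (rcons p y) = rcons (polyline x p) (last x p, y).
Proof. by rewrite /polyline; elim: p x => //= z p IH x; rewrite IH. Qed.

Definition K5_edges : seq (nat * nat) :=
  [:: (0, 1); (0, 2); (0, 3); (0, 4); (1, 2); (1, 3); (1, 4); (2, 3); (2, 4); (3, 4)]%N.

Definition K5_indep (e f : nat * nat) : bool :=
  [&& e.1 != f.1, e.1 != f.2, e.2 != f.1 & e.2 != f.2].

Definition K5_pairs : seq ((nat * nat) * (nat * nat)) :=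
  [seq ef <- [seq (e, f) | e <- K5_edges, f <- K5_edges] |
    K5_indep ef.1 ef.2 && (ef.1.1 < ef.2.1)%N].

(* The van Kampen-Flores argument: modulo 2, the number of crossings between
   independent edges of K5 does not depend on the drawing. *)
Lemma K5_not_drawable (b : nat -> I) (w : nat * nat -> seq I) :
  {in K5_edges, forall e, last (b e.1) (w e) = b e.2} ->
  {in K5_edges &, forall e f, K5_indep e f ->
     {in b f.1 :: w f, forall z, z \notin b e.1 :: w e}} ->
  {in K5_edges &, forall e f, K5_indep e f ->
     cross_parity (polyline (b e.1) (w e)) (polyline (b f.1) (w f)) = false} ->
  False.
Proof.
move=> hlast hdis hcr.
pose W e := polyline (b e.1) (w e).
pose S (e : nat * nat) := [:: (b e.1, b e.2)].
(* The line of [e] closed up by its chord. *)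
pose C e := polyline (b e.1) (rcons (w e) (b e.1)).
have bneq i j : (i < 5)%N -> (j < 5)%N -> i != j -> b i != b j.
  move=> i5 j5 ij.
  have tab : all (fun i => all (fun j => (i == j) ||
      has (fun ef => [&& K5_indep ef.1 ef.2, (i == ef.1.1) || (i == ef.1.2) &
      (j == ef.2.1) || (j == ef.2.2)]) [seq (e, f) | e <- K5_edges, f <- K5_edges])
      (iota 0 5)) (iota 0 5) by [].
  have := allP (allP tab i _) j; rewrite !mem_iota i5 j5 (negPf ij) orFb => /(_ isT isT).
  move=> /hasP[[e f]] /allpairsP[[e' f'] /= [he hf [-> ->]]] /and3P[ind hi hj].
  have mem g k : g \in K5_edges -> (k == g.1) || (k == g.2) -> b k \in b g.1 :: w g.
    move=> hg /orP[/eqP->|/eqP->]; first exact: mem_head.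
    by rewrite -hlast// mem_last.
  have := hdis _ _ he hf ind _ (mem _ _ hf hj); apply: contra => /eqP<-.
  exact: mem.
have Cmem e z : e \in K5_edges -> (z \in b e.1 :: rcons (w e) (b e.1)) = (z \in b e.1 :: w e).
  by move=> he; rewrite !inE mem_rcons inE orbA orbb.
have Wmem g k : g \in K5_edges -> (k == g.1) || (k == g.2) -> b k \in b g.1 :: w g.
  move=> hg /orP[/eqP->|/eqP->]; first exact: mem_head.
  by rewrite -hlast// mem_last.
have flipS e x y : e \in K5_edges -> x \notin b e.1 :: w e -> y \notin b e.1 :: w e ->
    cross (b e.2, b e.1) (x, y) = cross (b e.1, b e.2) (x, y).
  move=> he hx hy; rewrite ![cross _ (x, y)]cross_sym.
  by rewrite cross_flip// !inE negb_or; apply/andP; split;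
    [apply: contra hx|apply: contra hy|apply: contra hx|apply: contra hy] => /eqP<-;
    rewrite Wmem// eqxx ?orbT.
have CE e x p : e \in K5_edges -> {in x :: p, forall z, z \notin b e.1 :: w e} ->
    cross_parity (C e) (polyline x p) =
    cross_parity (W e) (polyline x p) (+) cross_parity (S e) (polyline x p).
  move=> he dis; rewrite /C polyline_rcons -cats1 cross_parity_cat hlast//; congr (_ (+) _).
  rewrite !cross_parity1l; apply: eq_big_seq => -[u v] /seg_mem/andP[hu hv].
  by apply: flipS => //; apply: dis.
have Clast e : last (b e.1) (rcons (w e) (b e.1)) = b e.1 by rewrite last_rcons.
have SE f : S f = polyline (b f.1) [:: b f.2] by [].
have Sdis e f : e \in K5_edges -> f \in K5_edges -> K5_indep e f ->
    {in b f.1 :: [:: b f.2], forall z, z \notin b e.1 :: w e}.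
  move=> he hf ind z; rewrite !inE => /orP[/eqP->|/eqP->]; apply: (hdis _ _ he hf ind);
  by rewrite Wmem// eqxx ?orbT.
(* The closed line [C e] crosses [W f] and the chord [S f] with the same parity, and [W e] does not
   cross [W f]. *)
have eqWS e f : e \in K5_edges -> f \in K5_edges -> K5_indep e f ->
  cross_parity (W e) (S f) (+) cross_parity (W f) (S e) = cross_parity (S e) (S f).
  move=> he hf ind.
  have dC : {in b f.1 :: w f, forall z, z \notin b e.1 :: rcons (w e) (b e.1)}.
    by move=> z /(hdis _ _ he hf ind); rewrite -Cmem.
  have := cross_parity_straighten (Clast e) dC; rewrite hlast// -/(S f) -/(C e).
  rewrite CE//; last exact: hdis.
  rewrite (SE f) (CE e (b f.1) [:: b f.2] he (Sdis _ _ he hf ind)) -(SE f).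
  rewrite hcr// addFb -/(W f) [cross_parity (S e) (W f)]cross_parityC.
  by move=> ->; rewrite addbA addbb addFb.
(* The edges independent of [e] form a triangle, which the closed line [C e] crosses an even number
   of times. *)
have tri e : e \in K5_edges ->
  \big[addb/false]_(f <- K5_edges | K5_indep e f) cross_parity (C e) (S f) = false.
  move=> he.
  have T k l m : {in [:: (k, l); (l, m)], forall f, f \in K5_edges /\ K5_indep e f} ->
     cross_parity (C e) (S (k, l)) (+) (cross_parity (C e) (S (k, m)) (+)
     cross_parity (C e) (S (l, m))) = false.
    move=> hT; have [kl1 kl2] := hT (k, l) (mem_head _ _).
    have [lm1 lm2] : (l, m) \in K5_edges /\ K5_indep e (l, m) by apply: hT; rewrite !inE eqxx orbT.
    have hk : b k \notin b e.1 :: rcons (w e) (b e.1).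
      by rewrite Cmem//; apply: (Sdis e (k, l)) => //; rewrite inE eqxx.
    have hl : b l \notin b e.1 :: rcons (w e) (b e.1).
      by rewrite Cmem//; apply: (Sdis e (k, l)) => //; rewrite !inE eqxx orbT.
    have hm : b m \notin b e.1 :: rcons (w e) (b e.1).
      by rewrite Cmem//; apply: (Sdis e (l, m)) => //; rewrite !inE eqxx orbT.
    have := cross_parity_triangle (Clast e) hk hl hm.
    rewrite -/(C e) cross_parity_consr [X in _ (+) X]cross_parity_consr.
    have -> : cross_parity (C e) [:: (b m, b k)] = cross_parity (C e) (S (k, m)).
      apply: eq_big_seq => -[u v] /seg_mem/andP[hu hv]; rewrite !big_seq1 cross_flip//.
        by rewrite !inE negb_or; apply/andP; split; apply: contra hm => /eqP->.
      by rewrite !inE negb_or; apply/andP; split; apply: contra hk => /eqP->.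
    by move=> <-; rewrite [cross_parity _ [:: (b l, _)] (+) _]addbC.
  have U k l m : {in [:: (k, l); (l, m)], forall f, f \in K5_edges /\ K5_indep e f} ->
      [seq f <- K5_edges | K5_indep e f] = [:: (k, l); (k, m); (l, m)] ->
      \big[addb/false]_(f <- K5_edges | K5_indep e f) cross_parity (C e) (S f) = false.
    by move=> h1 h2; rewrite -big_filter h2 !big_cons big_nil addbF T.
  move: (he); rewrite !inE => h.
  have/hasP [klm _ /andP[/allP h1 /eqP h2]] : has (fun klm => all (fun f => (f \in K5_edges) && K5_indep e f)
     [:: (klm.1.1, klm.1.2); (klm.1.2, klm.2)] && ([seq f <- K5_edges | K5_indep e f] ==
       [:: (klm.1.1, klm.1.2); (klm.1.1, klm.2); (klm.1.2, klm.2)]))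
     [:: (0, 1, 2); (0, 1, 3); (0, 1, 4); (0, 2, 3); (0, 2, 4); (0, 3, 4); (1, 2, 3);
         (1, 2, 4); (1, 3, 4); (2, 3, 4)]%N.
    by case/orP: h => [/eqP->//|]; do !(case/orP => [/eqP->//|]); move=> /eqP->.
  by apply: U h2 => f /h1/andP.
have L2E (g : nat * nat -> nat * nat -> bool) :
    \big[addb/false]_(e <- K5_edges) \big[addb/false]_(f <- K5_edges | K5_indep e f) g e f
    = \big[addb/false]_(ef <- K5_pairs) (g ef.1 ef.2 (+) g ef.2 ef.1).
  under eq_bigr do rewrite -big_filter.
  have := @big_allpairs_dep _ _ addb _ (fun=> _) _ (fun e f => (e, f)) K5_edges
    (fun e => [seq f <- K5_edges | K5_indep e f]) (fun ef => g ef.1 ef.2).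
  move=> /= <-.
  rewrite big_split -(big_map (fun ef => (ef.2, ef.1)) predT (fun ef => g ef.1 ef.2)) -big_cat.
  by apply: perm_big.
have pairsP ef : ef \in K5_pairs -> [/\ ef.1 \in K5_edges, ef.2 \in K5_edges & K5_indep ef.1 ef.2].
  by rewrite mem_filter => /andP[/andP[ind _] /allpairsP[[e f] /= [he hf ?]]]; subst ef.
(* Summing [tri] over all [e] counts the chord crossings of an unordered pair twice, so they cancel;
   the remaining two terms add up to these crossings by [eqWS]. *)
have sumSS : \big[addb/false]_(ef <- K5_pairs) cross_parity (S ef.1) (S ef.2) = false.
  have : \big[addb/false]_(e <- K5_edges) \big[addb/false]_(f <- K5_edges | K5_indep e f)
     cross_parity (C e) (S f) = false.
    by rewrite big_seq big1// => e; exact: tri.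
  have -> : \big[addb/false]_(e <- K5_edges) \big[addb/false]_(f <- K5_edges | K5_indep e f)
     cross_parity (C e) (S f) = \big[addb/false]_(e <- K5_edges)
     \big[addb/false]_(f <- K5_edges | K5_indep e f) (cross_parity (W e) (S f) (+) cross_parity (S e) (S f)).
    apply: eq_big_seq => e he; rewrite big_seq_cond [RHS]big_seq_cond; apply: eq_bigr => f /andP[hf ind].
    by rewrite (SE f) (CE e (b f.1) [:: b f.2] he (Sdis _ _ he hf ind)).
  rewrite L2E => h.
  rewrite -[RHS]h; apply: eq_big_seq => ef /pairsP[he hf ind] /=.
  rewrite [cross_parity (S ef.2) _]cross_parityC -(eqWS _ _ he hf ind).
  by case: (cross_parity (W ef.1) _); case: (cross_parity (W ef.2) _).
have := @K5_crossing_parity R (P (b 0)) (P (b 1)) (P (b 2)) (P (b 3)) (P (b 4)).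
have -> : generic5 (P (b 0)) (P (b 1)) (P (b 2)) (P (b 3)) (P (b 4)).
  by rewrite /generic5 !gen// bneq.
move=> /(_ isT) /=.
have pm : perm_eq [:: ((0, 1), (2, 3)); ((0, 2), (1, 3)); ((0, 3), (1, 2));
  ((0, 1), (2, 4)); ((0, 2), (1, 4)); ((0, 4), (1, 2));
  ((0, 1), (3, 4)); ((0, 3), (1, 4)); ((0, 4), (1, 3));
  ((0, 2), (3, 4)); ((0, 3), (2, 4)); ((0, 4), (2, 3));
  ((1, 2), (3, 4)); ((1, 3), (2, 4)); ((1, 4), (2, 3))]%N K5_pairs by [].
move: sumSS; rewrite -(perm_big _ pm) !big_cons big_nil !cross_parity11 /cross /=.
by rewrite addbF !addbA => ->.
Qed.
End Polylines.

(** * General position by a small perturbation *)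

Section Perturbation.
Variable R : realType.
Local Open Scope ring_scope.

Lemma small_nonroot (p : {poly R}) (e : R) : p != 0 -> 0 < e ->
  exists t, [/\ 0 < t, t < e & ~~ root p t].
Proof.
move=> p0 e0.
(* These are [size p] distinct candidates, more than a nonzero [p] has roots. *)
pose s := [seq e / (m.+2)%:R | m <- iota 0 (size p)].
have us : uniq s.
  rewrite map_inj_uniq ?iota_uniq// => m m' /(mulfI (lt0r_neq0 e0)) /invr_inj /eqP.
  by rewrite eqr_nat => /eqP[].
case: (boolP (all (root p) s)) => [rs|].
  by have := max_poly_roots p0 rs us; rewrite size_map size_iota ltnn.
case/allPn => t /mapP[m _ ->] nr; exists (e / m.+2%:R); split => //.
  by rewrite divr_gt0// ltr0n.
by rewrite ltr_pdivrMr ?ltr0n// ltr_pMr// ltr1n.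
Qed.

(** Points are placed one after another, each moved by [(t, t ^+ 2)] with [t] small and off the
    roots of one polynomial. Distinct first coordinates are maintained, because they make the
    coefficient of [t ^+ 2] in each collinearity condition nonzero. *)
Lemma general_position_close (I : finType) (Q : I -> R * R) (e : R) : 0 < e ->
  exists P : I -> R * R, general_position P /\ forall i, close e (P i) (Q i).
Proof.
move=> e0.
suff [P [dP gP cP]] : exists P : I -> R * R,
  [/\ {in enum I &, forall i j, i != j -> (P i).1 != (P j).1},
   {in enum I & &, forall i j k, i != j -> i != k -> j != k -> orient (P i) (P j) (P k) != 0} &
   forall i, close e (P i) (Q i)].
  by exists P; split=> // i j k; apply: gP; rewrite mem_enum.
elim: (enum I) => [|i s [P [dP gP cP]]].
  by exists Q; split => // i; exact: close_refl.
case: (boolP (i \in s)) => [si|nsi].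
  exists P; split => //.
    by move=> x y; rewrite !inE => /predU1P[->|xs] /predU1P[->|ys]; apply: dP.
  by move=> x y z; rewrite !inE => /predU1P[->|xs] /predU1P[->|ys] /predU1P[->|zs]; apply: gP.
pose p1 j : {poly R} := ('X + (((Q i).1 - (P j).1)%:P)).
pose p2 (jk : I * I) : {poly R} := let: (j, k) := jk in if j == k then 1 else
  ((P k).1 - (P j).1) *: ('X^2 + ((Q i).2 - (P j).2)%:P)
  - ((P k).2 - (P j).2) *: ('X + ((Q i).1 - (P j).1)%:P).
pose p := (\prod_(j <- s) p1 j) * \prod_(jk <- [seq (j, k) | j <- s, k <- s]) p2 jk.
have p0 : p != 0.
  apply: mulf_neq0; rewrite prodf_seq_neq0; apply/allP.
    by move=> j _ /=; rewrite /p1 -size_poly_eq0 size_XaddC.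
  move=> _ /allpairsP[[j k] /= [js ks ->]]; rewrite /p2 /=.
  case: (eqVneq j k) => [_|jk]; first exact: oner_neq0.
  apply/eqP => /(congr1 (fun q : {poly R} => q`_2)) /eqP.
  rewrite coef0 coefB !coefZ !coefD !coefC coefXn coefX /= !addr0 mulr1 mulr0 subr0.
  by rewrite subr_eq0 (negPf (dP _ _ ks js _))// eq_sym.
have [|t [t0 t1 nr]] := @small_nonroot p (Num.min e 1) p0; first by rewrite lt_min e0 ltr01.
move: t1; rewrite lt_min => /andP[te t1].
pose P' j := if j == i then ((Q i).1 + t, (Q i).2 + t ^+ 2) else P j.
have P'i : P' i = ((Q i).1 + t, (Q i).2 + t ^+ 2) by rewrite /P' eqxx.
have P's j : j \in s -> P' j = P j.
  by move=> js; rewrite /P'; case: eqP js nsi => // -> ->.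
move: nr; rewrite rootE hornerM mulf_eq0 negb_or !horner_prod !prodf_seq_neq0 => /andP[nr1 nr2].
have d1 j : j \in s -> (P' i).1 != (P j).1.
  move=> js; have := allP nr1 j js; rewrite /= /p1 hornerD hornerX hornerC P'i /=.
  by apply: contra => /eqP e1; apply/eqP; lra.
have d2 j k : j \in s -> k \in s -> j != k -> orient (P j) (P k) (P' i) != 0.
  move=> js ks jk; have := allP nr2 (j, k); rewrite allpairs_f// => /(_ isT) /=.
  rewrite /p2 (negPf jk) hornerD hornerN !hornerZ !hornerD hornerXn hornerX !hornerC P'i /orient /=.
  by apply: contra => /eqP e1; apply/eqP; lra.
have dI j k : orient (P' i) (P j) (P k) = orient (P j) (P k) (P' i) by rewrite orient_rot.
exists P'; split.
- move=> x y; rewrite !inE => /predU1P[->|xs] /predU1P[->|ys]; first by rewrite eqxx.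
  + by move=> _; rewrite (P's _ ys) d1.
  + by move=> _; rewrite (P's _ xs) eq_sym d1.
  + by rewrite (P's _ xs) (P's _ ys); apply: dP.
- move=> x y z; rewrite !inE => /predU1P[->|xs] /predU1P[->|ys] /predU1P[->|zs];
    rewrite ?eqxx// => xy xz yz.
  + by rewrite (P's _ ys) (P's _ zs) dI d2.
  + by rewrite (P's _ xs) (P's _ zs) orient_rot dI d2// eq_sym.
  + by rewrite (P's _ xs) (P's _ ys) d2.
  + by rewrite (P's _ xs) (P's _ ys) (P's _ zs) gP.
- move=> j; rewrite /P'; case: eqP => [->|_]; last exact: cP.
  rewrite /close /= [X in `|X| < _]addrC addKr [X in _ && (`|X| < _)]addrC addKr.
  rewrite !ger0_norm ?exprn_ge0 ?(ltW t0)// te /=; nra.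
Qed.
End Perturbation.

(** * From a planar drawing to a polygonal drawing of the five-clique *)

Section PlanarIncidence.
Variables (R : realType) (V : finType) (G : sgraph V).
Local Open Scope ring_scope.
Notation N := (V + {set V})%type.

Lemma polyline_path (I : eqType) (r : rel I) x p a b :
  path r x p -> (a, b) \in polyline x p -> r a b.
Proof.
elim: p x => //= y p IH x /andP[rxy pp]; rewrite inE => /predU1P[[-> ->]//|].
exact: IH.
Qed.

(** Paths inside the branch sets are followed along half-arcs, sampled finely and perturbed. For
    independent edges of the clique, segments come from half-arcs at distinct vertices on distinct
    edges; these are a distance [d] apart, so the short segments near them cannot cross. *)
Theorem planar_no_K5_model (B : nat -> {set N}) :
  planar R G -> ~ K5_model (incidence G) B.
Proof.
move=> [pos [arc [posI arcP arcpos arcarc]]] [Bcon Bdis Badj].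
(* Half of the arc of [A], from [x] to the midpoint; [x] may be either end of the
   parametrization. *)
pose h (x : V) (A : {set V}) (s : R) : R * R :=
  if arc A 0 == pos x then arc A (s / 2) else arc A (1 - s / 2).
have hE x A : exists f : R -> R, [/\ forall s, h x A s = arc A (f s),
    forall s, s \in `[0, 1] -> f s \in `[0, 1], forall s, s \in `]0, 1] -> f s \in `]0, 1[,
    f 1 = 2^-1 & forall s t, `|f s - f t| <= `|s - t|].
  case: (boolP (arc A 0 == pos x)) => hx.
    exists (fun s => s / 2); split; first (by move=> s; rewrite /h hx); try by move=> s; rewrite !in_itv /= => /andP[? ?]; apply/andP; split; lra.
      by rewrite mul1r.
    move=> s t; rewrite -mulrBl normrM [X in _ * X]ger0_norm; last lra.
    by have := normr_ge0 (s - t); lra.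
  exists (fun s => 1 - s / 2); split; first (by move=> s; rewrite /h (negPf hx)); try by move=> s; rewrite !in_itv /= => /andP[? ?]; apply/andP; split; lra.
    by lra.
  move=> s t; have -> : 1 - s / 2 - (1 - t / 2) = (t - s) / 2 by lra.
  rewrite normrM [X in _ * X]ger0_norm; last lra.
  by rewrite distrC; have := normr_ge0 (s - t); lra.
have h0 x A : A \in edges G -> x \in A -> h x A 0 = pos x.
  move=> AG xA; have [_ _ [a [b [AE a0 b1]]]] := arcP A AG; rewrite /h mul0r subr0 a0 b1.
  case: eqP => // /eqP; rewrite (inj_eq posI) => ax.
  by move: xA; rewrite AE !inE eq_sym (negPf ax) /= => /eqP->.
have h1 x A : h x A 1 = arc A 2^-1.
  by have [f [fE _ _ f1 _]] := hE x A; rewrite fE f1.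
have hc x A : A \in edges G -> continuous01 (h x A).
  move=> AG s s01 e e0; have [/within_continuous01 ac _ _] := arcP A AG.
  have [f [fE f01 _ _ fl]] := hE x A.
  have [d d0 hd] := ac (f s) (f01 s s01) e e0.
  by exists d => // t t01 st; rewrite !fE; apply: hd; [exact: f01|apply: le_lt_trans (fl _ _) st].
have hdis x A y B' : A \in edges G -> B' \in edges G -> x \in A -> y \in B' ->
    x != y -> A != B' -> forall s t, s \in `[0, 1] -> t \in `[0, 1] -> h x A s <> h y B' t.
  move=> AG BG xA yB xy AB s t s01 t01.
  have [f [fE f01 fo _ _]] := hE x A; have [g [gE g01 go _ _]] := hE y B'.
  case: (eqVneq s 0) => [->|s0].
    rewrite h0//; case: (eqVneq t 0) => [->|t0].
      by rewrite h0// => /posI/eqP; rewrite (negPf xy).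
    rewrite gE => /esym; apply: arcpos => //; apply: go.
    by move: t01 t0; rewrite !in_itv /= lt_def => /andP[-> ->] ->.
  rewrite fE gE; apply: arcarc => //; last exact: g01.
  by apply: fo; move: s01 s0; rewrite !in_itv /= lt_def => /andP[-> ->] ->.
pose J := ((V * {set V}) * (V * {set V}))%type.
pose good (j : J) := [&& j.1.2 \in edges G, j.2.2 \in edges G, j.1.1 \in j.1.2, j.2.1 \in j.2.2,
   j.1.1 != j.2.1 & j.1.2 != j.2.2].
have /choice [M hM] : forall j : J, exists M : nat, forall m, (M <= m)%N -> good j -> forall s t,
    s \in `[0, 1] -> t \in `[0, 1] -> ~~ close m.+1%:R^-1 (h j.1.1 j.1.2 s) (h j.2.1 j.2.2 t).
  move=> [[x A] [y B']] /=; case: (boolP (good ((x, A), (y, B')))) => [|_]; last by exists 0%N.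
  case/and5P => /= AG BG xA yB /andP[xy AB].
  have [M hM] := uniformly_separated (hc x A AG) (hc y B' BG) (hdis _ _ _ _ AG BG xA yB xy AB).
  by exists M => m Mm _; exact: hM.
pose d : R := (\max_j M j).+1%:R^-1.
have d0 : 0 < d by rewrite invr_gt0 ltr0n.
have sep x A y B' : A \in edges G -> B' \in edges G -> x \in A -> y \in B' ->
    x != y -> A != B' -> forall s t, s \in `[0, 1] -> t \in `[0, 1] ->
    ~~ close d (h x A s) (h y B' t).
  move=> AG BG xA yB xy AB; apply: (hM ((x, A), (y, B'))).
    exact: (leq_bigmax ((x, A), (y, B'))).
  by rewrite /good AG BG xA yB xy.
(* The eight parts of [d] are used up at the end: one for each of the two perturbations and three
   for each of the two perturbed segments. *)
pose eps := d / 8.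
have eps0 : 0 < eps by rewrite /eps; lra.
have /choice [M2 hM2] : forall j : V * {set V}, exists M : nat, forall m, (M <= m)%N ->
    j.2 \in edges G -> forall s t, s \in `[0, 1] -> t \in `[0, 1] ->
    `|s - t| < m.+1%:R^-1 -> close eps (h j.1 j.2 s) (h j.1 j.2 t).
  move=> [x A] /=; case: (boolP (A \in edges G)) => [AG|_]; last by exists 0%N.
  by have [M' hM'] := uniformly_close (hc x A AG) eps0; exists M' => m Mm _; exact: hM'.
pose m := \max_j M2 j.
have unif x A : A \in edges G -> forall s t, s \in `[0, 1] -> t \in `[0, 1] ->
    `|s - t| < m.+1%:R^-1 -> close eps (h x A s) (h x A t).
  by move=> AG; apply: (hM2 (x, A)) => //; exact: (leq_bigmax (x, A)).
(* Sample points are handled through indices, so that lines sharing a vertex or a midpoint still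
   share it after the perturbation. *)
pose I := (N + (V * {set V} * 'I_m.+1))%type.
pose Q (i : I) : R * R := match i with
  | inl (inl x) => pos x | inl (inr A) => arc A 2^-1
  | inr (x, A, k) => h x A (k.+1%:R / m.+2%:R) end.
have [P [genP cP]] := general_position_close Q eps0.
(* Sample [k] of a half-arc: the vertex for [k = 0], the midpoint for [k = m.+2], where the two
   halves of [A] meet. *)
pose node x A (k : nat) : I := if k == 0%N then inl (inl x) else
  if (k <= m.+1)%N then inr (x, A, inord k.-1) else inl (inr A).
have Qnode x A (k : nat) : A \in edges G -> x \in A -> (k <= m.+2)%N ->
    Q (node x A k) = h x A (k%:R / m.+2%:R).
  move=> AG xA km; rewrite /node; case: eqP => [->|/eqP k0] /=; first by rewrite mul0r h0.
  case: leqP => mk /=.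
    by rewrite inordK ?prednK// ?lt0n//; case: k k0 mk {km}.
  have -> : k = m.+2 by apply/eqP; rewrite eqn_leq km.
  by rewrite divff ?h1// pnatr_eq0.
have frac01 (k : nat) : (k <= m.+2)%N -> (k%:R / m.+2%:R : R) \in `[0, 1].
  by move=> km; rewrite in_itv /= divr_ge0// ler_pdivrMr ?ltr0n// mul1r ler_nat.
have clnode x A (k : nat) : A \in edges G -> x \in A -> (k < m.+2)%N ->
    close eps (Q (node x A k)) (Q (node x A k.+1)).
  move=> AG xA km; rewrite !Qnode// 1?ltnW//; apply: unif; rewrite ?frac01// 1?ltnW//.
  rewrite -mulrBl -natr1 opprD addrA subrr sub0r mulN1r normrN ger0_norm ?invr_ge0//.
  by rewrite ltf_pV2 ?posrE ?ltr0n// ltr_nat.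
pose r (S : {set N}) : rel I := fun a b => [exists x, exists A, exists k : 'I_m.+2,
  [&& inl x \in S, inr A \in S, incidence G (inl x) (inr A) &
   ((a, b) == (node x A k, node x A k.+1)) || ((b, a) == (node x A k, node x A k.+1))]].
have rP S a b : r S a b -> exists x A s, [/\ inl x \in S, inr A \in S, A \in edges G, x \in A &
   [/\ s \in `[0, 1], Q a = h x A s & close eps (Q a) (Q b)]].
  case/existsP => x /existsP[A /existsP[k /and4P[xS AS /andP[AG xA]]]].
  have km : (k < m.+2)%N by [].
  case/orP => /eqP[-> ->].
    exists x, A, (k%:R / m.+2%:R); split => //; split; first by rewrite frac01// ltnW.
      by rewrite Qnode// ltnW.
    exact: clnode.
  exists x, A, (k.+1%:R / m.+2%:R); split => //; split; first by rewrite frac01.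
    by rewrite Qnode.
  by rewrite close_sym; apply: clnode.
(* Disjoint sets of nodes have disjoint hulls, so the lines of independent edges share no sample
   point. *)
pose hull (S : {set N}) : pred I := fun a => match a with
  | inl n => n \in S | inr (x, A, _) => (inl x \in S) && (inr A \in S) end.
have r_hull S a b : r S a b -> hull S b.
  case/existsP => x /existsP[A /existsP[k /and4P[xS AS _]]].
  have nS i : hull S (node x A i) by rewrite /node; case: ifP => // _; case: ifP => //= _; rewrite xS.
  by case/orP => /eqP[] => [_ ->|-> _].
have path_hull S a p : hull S a -> path (r S) a p -> {in a :: p, forall z, hull S z}.
  elim: p a => [|b p IH] a ha /=; first by move=> _ z; rewrite inE => /eqP->.
  move=> /andP[/r_hull hb pp] z; rewrite inE => /predU1P[->//|]; exact: IH.
have r_sym S : symmetric (r S).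
  move=> a b; rewrite /r; apply: eq_existsb => x; apply: eq_existsb => A.
  by apply: eq_existsb => k; rewrite orbC.
have conn_half (S : {set N}) x A : inl x \in S -> inr A \in S -> incidence G (inl x) (inr A) ->
    connect (r S) (inl (inl x)) (inl (inr A)).
  move=> xS AS inc.
  have H (k : nat) : (k <= m.+2)%N -> connect (r S) (node x A 0) (node x A k).
    elim: k => [|k IH] km; first exact: connect0.
    apply: connect_trans (IH (ltnW km)) (connect1 _).
    apply/existsP; exists x; apply/existsP; exists A; apply/existsP; exists (Ordinal km).
    by rewrite xS AS inc /= eqxx.
  by have := H m.+2 (leqnn _); rewrite /node /= ltnn.
have conn_hull (S : {set N}) n n' : connect [rel u v | [&& u \in S, v \in S & incidence G u v]] n n' ->
    connect (r S) (inl n) (inl n').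
  apply: (@connect_homo _ I _ (r S) inl) => -[x|A] [y|B'] //= /and3P[uS vS inc] //.
    exact: conn_half.
  by rewrite (sym_connect_sym (r_sym S)); exact: conn_half.
have [n0 _] : exists n, n \in B 0 by have [/finset.set0Pn] := Bcon 0%N isT.
have /choice [b hb] : forall i : nat, exists n : N, (i < 5)%N -> n \in B i.
  by move=> i; case: (ltnP i 5) => [/Bcon[/finset.set0Pn[n nB] _]|_]; [exists n|exists n0].
have edge_lt e : e \in K5_edges -> (e.1 < e.2 < 5)%N.
  by have /allP := isT : all (fun e => e.1 < e.2 < 5)%N K5_edges; apply.
have sub_conn (S S' : {set N}) n n' : S \subset S' ->
    connect [rel u v | [&& u \in S, v \in S & incidence G u v]] n n' ->
    connect [rel u v | [&& u \in S', v \in S' & incidence G u v]] n n'.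
  move=> /fintype.subsetP sS; apply: connect_sub => u v /= /and3P[uS vS uv]; apply: connect1.
  by rewrite /= !sS.
have /choice [w hw] : forall e : nat * nat, exists p : seq I, e \in K5_edges ->
    path (r (B e.1 :|: B e.2)) (inl (b e.1)) p /\ last (inl (b e.1)) p = inl (b e.2).
  move=> e; case: (boolP (e \in K5_edges)) => [he|_]; last by exists [::].
  have /andP[e12 e2] := edge_lt e he; have e1 := ltn_trans e12 e2.
  have [|x [y [xB yB xy]]] := Badj e.1 e.2; first by rewrite e12.
  have : connect (r (B e.1 :|: B e.2)) (inl (b e.1)) (inl (b e.2)).
    apply: conn_hull.
    apply: (connect_trans (sub_conn _ _ _ _ (finset.subsetUl _ _) ((Bcon _ e1).2 _ _ (hb _ e1) xB))).
    apply: (connect_trans _ (sub_conn _ _ _ _ (finset.subsetUr _ _) ((Bcon _ e2).2 _ _ yB (hb _ e2)))).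
    by apply: connect1; rewrite /= !finset.in_setU xB yB orbT.
  by case/connectP => p pp pl; exists p.
have BI i j n : (i < 5)%N -> (j < 5)%N -> i != j -> n \in B i -> n \in B j -> False.
  move=> i5 j5; rewrite neq_ltn => /orP[ij|ij] ni nj.
    by have := Bdis i j; rewrite ij j5 => /(_ isT) /finset.disjoint_setI0 /finset.setP /(_ n); rewrite !inE ni nj.
  by have := Bdis j i; rewrite ij i5 => /(_ isT) /finset.disjoint_setI0 /finset.setP /(_ n); rewrite !inE ni nj.
have SI e f n : e \in K5_edges -> f \in K5_edges -> K5_indep e f ->
    n \in B e.1 :|: B e.2 -> n \in B f.1 :|: B f.2 -> False.
  move=> /edge_lt/andP[e12 e2] /edge_lt/andP[f12 f2] /and4P[i1 i2 i3 i4].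
  have [e1 f1] := (ltn_trans e12 e2, ltn_trans f12 f2).
  by rewrite !finset.in_setU => /orP[ne|ne] /orP[nf|nf];
    [apply: BI i1 ne nf|apply: BI i2 ne nf|apply: BI i3 ne nf|apply: BI i4 ne nf].
have whull e : e \in K5_edges -> {in inl (b e.1) :: w e, forall z, hull (B e.1 :|: B e.2) z}.
  move=> he; have [pw _] := hw e he; apply: path_hull pw => /=.
  by have /andP[e12 e2] := edge_lt e he; rewrite finset.in_setU hb// (ltn_trans e12 e2).
apply: (@K5_not_drawable R I P genP (fun i => inl (b i)) w).
- by move=> e /hw[].
- move=> e f he hf ind z zf; apply/negP => ze.
  have := whull e he z ze; have := whull f hf z zf.
  case: z {ze zf} => [n|[[x A] k]] /=; first by move=> nf ne; exact: (SI e f n).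
  by move=> /andP[xf _] /andP[xe _]; exact: (SI e f (inl x)).
- move=> e f he hf ind; rewrite /cross_parity big_seq big1// => -[a a'] ha.
  rewrite big_seq big1// => -[c c'] hc'; apply/negbTE; rewrite /cross /=.
  have [pe _] := hw e he; have [pf _] := hw f hf.
  have [x [A [s [xS AS AG xA [s01 Qa aa']]]]] := rP _ _ _ (polyline_path pe ha).
  have [y [B' [t [yS BS BG yB [t01 Qc cc']]]]] := rP _ _ _ (polyline_path pf hc').
  have xy : x != y by apply/eqP => xy; apply: (SI e f (inl x)) => //; rewrite xy.
  have AB : A != B' by apply/eqP => AB; apply: (SI e f (inr A)) => //; rewrite AB.
  have E3 (i j : I) : close eps (Q i) (Q j) -> close (eps + (eps + eps)) (P i) (P j).
    move=> ij; apply: close_trans (cP i) (close_trans ij _).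
    by rewrite close_sym; exact: cP.
  apply: (far_segments_not_cross (E3 _ _ aa') (E3 _ _ cc')).
  have := sep _ _ _ _ AG BG xA yB xy AB s t s01 t01; rewrite -Qa -Qc; apply: contra => ac.
  have -> : d = eps + ((eps + (eps + eps) + (eps + (eps + eps))) + eps) by rewrite /eps; lra.
  apply: close_trans (close_trans ac (cP c)).
  by rewrite close_sym; exact: cP.
Qed.
End PlanarIncidence.

(** * The theorem *)

Lemma ceil_fifth (k m : nat) : k <= 5 * (m + 1) -> (Num.ceil (k%:R / 5%:R : rat) - 1 <= m%:Z)%R.
Proof.
move=> km; rewrite lerBlDr ceil_le_int ler_pdivrMr ?ltr0n//.
by rewrite intrD mulr1z -pmulrn natr1 -natrM ler_nat; lia.
Qed.

Lemma pairwise_mem (T : eqType) (r : rel T) (s : seq T) : uniq s ->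
  {in s &, forall x y, x != y -> r x y} -> pairwise r s.
Proof.
elim: s => //= x s IH /andP[xs us] h; apply/andP; split.
  apply/allP => y ys; apply: h; rewrite ?mem_head ?inE ?ys ?orbT//.
  by apply: contraNneq xs => ->.
by apply: IH => // y z ys zs; apply: h; rewrite inE ?ys ?zs orbT.
Qed.

Theorem theorem6 (R : realType) :
  exists (p : program) (q : {poly nat}),
  forall (n : nat) (G : sgraph 'I_n) (T : {set 'I_n}) (k : nat),
    planar R G -> 1 < #|T| -> k <= kappaT G T ->
  exists (t : nat) (F : seq (subgraph 'I_n)),
    [/\ t <= (q.[size (encode_instance G T)])%R,
        computes_in p (encode_instance G T) t (encode_subgraphs F),
        (Num.ceil (k%:R / 5%:R : rat) - 1 <= (size F)%:Z)%R,
        {in F, forall H, steiner_tree G T H} /\ pairwise (element_disjoint T) F &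
        {in F, forall H x, x \in sub_verts H -> x \notin T ->
           sub_degree H x = 2}].
Proof.
have [c [d run]] := prog_computes wf_main.
exists (acode (ASeq (ABlk [:: IRead 0]) (cprog main)) 0), (c *: 'X^d)%R.
move=> n G T k pl T2 kT.
(* Two terminals provide the vertices 0 and 1, which mark the two copies of a vertex in the flow
   network. *)
have n1 : 1 < n by apply: leq_trans T2 _; rewrite -[X in _ <= X]card_ord max_card.
have n0 : 0 < n := ltnW n1.
pose e : env n := fun=> Ordinal n0.
have noK5 B : ~ K5_model (incidence G) B by exact: planar_no_K5_model pl.
have Tne : T != finset.set0 by rewrite -card_gt0; exact: ltnW.
have conn := kappaT_connected kT.
have kn : k < n by have := elt_connected_lt_card (@adj_irr _ G) T2 conn; rewrite card_ord.
have [s [opE [[GE TE st dj] ks]]] := @exec_main n (Ordinal n0) (Ordinal n1) G T erefl erefl Tne noK5 e k kn conn.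
have [t [tle comp]] := run n e (encode_rel G ++ encode_set T) n0.
exists t, [seq tree T s i | i <- enum 'I_n & rd1 s rBJ i]; split.
- apply: leq_trans tle _; rewrite hornerZ hornerXn.
  have -> : (c * (size (encode_instance G T)) ^+ d)%R = c * size (encode_instance G T) ^ d.
    by congr (_ * _); elim: d {run tle} => [|d IH]; rewrite ?expr0 ?expn0// exprS expnS IH.
  rewrite leq_mul2l; apply/orP; right.
  have nle : n <= size (encode_instance G T).
    by rewrite /= size_cat [size (encode_set T)]size_map size_enum_ord; lia.
  by case: d {run} => [//|d]; rewrite leq_exp2r.
- by rewrite -opE.
- by apply: ceil_fifth; rewrite size_map.
- split.
    by move=> H /mapP[i]; rewrite mem_filter => /andP[/st[h _] _] ->.
  rewrite pairwise_map; apply: pairwise_mem; first by rewrite filter_uniq// enum_uniq.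
  by move=> i j; rewrite !mem_filter => /andP[hi _] /andP[hj _] ij; exact: dj.
- move=> H /mapP[i]; rewrite mem_filter => /andP[/st[_ h] _] -> x; exact: h.
Qed.
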